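(* Suppose that, for each $n\in\mathbb N$, the recurrence coefficient $a_n(x)$ of the monic orthogonal polynomials of $\sigma(x,ds)$ satisfies $\sup_{x\in\Lambda}a_n(x)<\infty$ for every bounded Borel set $\Lambda\subset\mathbb R^d$. Then the unitary isomorphism $\mathcal K=I\operatorname{Sym}J:\mathcal G\to L^2(\mathcal D',\mu)$ is given, for $f=(f_\alpha)_{\alpha\in\mathbb Z_{+,0}^\infty}\in\mathcal G=\bigoplus_{\alpha\in\mathbb Z_{+,0}^\infty}\mathcal G_\alpha$, by $$\mathcal Kf=\sum_{\alpha\in\mathbb Z_{+,0}^\infty}\int_{(\mathbb R^d)^{|\alpha|}}f_\alpha(x_1,\dots,x_{|\alpha|})\,dZ^{(0)}(x_1)\cdots dZ^{(0)}(x_{\alpha_0})\,dZ^{(1)}(x_{\alpha_0+1})\cdots dZ^{(1)}(x_{\alpha_0+\alpha_1})\,dZ^{(2)}(x_{\alpha_0+\alpha_1+1})\cdots$$ where the integrals are the multiple Wiener--Itô integrals with respect to $Z^{(0)},Z^{(1)},Z^{(2)},\dots$ and the series converges in $L^2(\mathcal D',\mu)$.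
   Context: Conventions. $\mathbb Z_+=\{0,1,2,\dots\}$. All spaces are real. For a Hilbert space $V$ and $c>0$, $V\,c$ denotes the same vector space with squared norm multiplied by $c$. $\odot$ is the symmetric tensor product, $\operatorname{Sym}_n$ is the orthogonal projection of $H^{\otimes n}$ onto $H^{\odot n}$ (so $\operatorname{Sym}_n(f_1\otimes\dots\otimes f_n)=f_1\odot\dots\odot f_n=\frac1{n!}\sum_{\pi\in S_n}f_{\pi(1)}\otimes\dots\otimes f_{\pi(n)}$), and zeroth tensor powers are $\mathbb R$. $\mathcal F(H)=\bigoplus_{n=0}^\infty H^{\odot n}n!$ is the symmetric Fock space with vacuum $\Omega=(1,0,0,\dots)$; $h\in H$ is identified with $(0,h,0,0,\dots)\in\mathcal F(H)$. $\mathbb Z_{+,0}^\infty$ is the set of sequences $\alpha=(\alpha_0,\alpha_1,\dots)$ with $\alpha_i\in\mathbb Z_+$ and $|\alpha|:=\sum_i\alpha_i<\infty$. Setting. For each $x\in\mathbb R^d$, $\sigma(x,ds)$ is a probability measure on $(\mathbb R,\mathcal B(\mathbb R))$, with $x\mapsto\sigma(x,\Delta)$ measurable for each $\Delta\in\mathcal B(\mathbb R)$. For each bounded $\Lambda\in\mathcal B(\mathbb R^d)$ there is $C_\Lambda>0$ with $\int_{\mathbb R}|s|^n\sigma(x,ds)\le C_\Lambda^n n!$ for all $n\in\mathbb N$, $x\in\Lambda$. Put $H=L^2(\mathbb R^d\times\mathbb R,dx\,\sigma(x,ds))$. Let $\mathcal D=C_0^\infty(\mathbb R^d)$ and let $\mathcal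 D'$ be its dual (with respect to $L^2(\mathbb R^d,dx)$), with the cylinder $\sigma$-algebra and dual pairing $\langle\omega,\varphi\rangle$. The measure $\mu$ and the operator $I$ (known facts). Let $\mathfrak D\subset\mathcal F(H)$ be the set of finite vectors $(f^{(0)},\dots,f^{(n)},0,\dots)$ where each $f^{(k)}$ is the symmetrization of a finite sum of functions $\phi(x_1,\dots,x_k)s_1^{i_1}\cdots s_k^{i_k}$ with $\phi\in C_0^\infty((\mathbb R^d)^k)$, $i_j\in\mathbb Z_+$. For $\varphi\in\mathcal D$, let $(\varphi\otimes m_i)(x,s)=\varphi(x)s^i$ and define on $\mathfrak D$ $$A(\varphi)=a^+(\varphi\otimes m_0)+a^-(\varphi\otimes m_0)+a^0(\varphi\otimes m_1),$$ where, for $f^{(k)}\in H^{\odot k}$, $a^+(h)f^{(k)}=f^{(k)}\odot h$, $a^-(h)f^{(k)}=k\int dy\,\sigma(y,du)\,h(y,u)f^{(k)}(y,u,\cdot)$, and $a^0(h)$ is multiplication of $f^{(k)}(x_1,s_1,\dots,x_k,s_k)$ by $h(x_1,s_1)+\dots+h(x_k,s_k)$. It is known that each $A(\varphi)$ is essentially self-adjoint on $\mathfrak D$ and that there is a unique probability measure $\mu$ on $\mathcal D'$ such that the linear operator $I:\mathcal F(H)\to L^2(\mathcal D',\mu)$ given through $I\Omega=1$ and $I(A(\varphi_1)\cdots A(\varphi_n)\Omega)=\langle\omega,\varphi_1\rangle\cdots\langle\omega,\varphi_n\rangle$ is unitary. Its Fourier transform is $$\int_{\mathcal D'}e^{i\langle\omega,\varphi\rangle}\mu(d\omega)=\exp\Big[-\tfrac12\int_{\mathbb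 R^d}dx\,\sigma(x,\{0\})\varphi(x)^2+\int_{\mathbb R^d}dx\int_{\mathbb R\setminus\{0\}}\sigma(x,ds)\tfrac1{s^2}\big(e^{i\varphi(x)s}-i\varphi(x)s-1\big)\Big].$$ Orthogonal polynomials. $(q^{(n)}(x,\cdot))_{n\ge0}$ are the monic orthogonal polynomials of $\sigma(x,ds)$; they satisfy $sq^{(n)}(x,s)=q^{(n+1)}(x,s)+b_n(x)q^{(n)}(x,s)+a_n(x)q^{(n-1)}(x,s)$ for $n\ge1$ and $sq^{(0)}(x,s)=q^{(1)}(x,s)+b_0(x)$, with $b_n(x)\in\mathbb R$, $a_n(x)>0$. If the support of $\sigma(x,\cdot)$ consists of $k<\infty$ points, then for $n\ge k$ one sets $q^{(n)}(x,\cdot)=0$, $a_n(x)=0$, with $b_n(x)$ arbitrary. The spaces and operators. $\rho_n(dx)=\big(\int_{\mathbb R}q^{(n)}(x,s)^2\sigma(x,ds)\big)dx$ on $\mathbb R^d$. $H_n$ is the closure in $H$ of $\{f(x)q^{(n)}(x,s): f\in\mathcal D\}$. $J_n:L^2(\mathbb R^d,\rho_n)\to H_n$ is $(J_nf)(x,s)=f(x)q^{(n)}(x,s)$. For $\alpha\in\mathbb Z_{+,0}^\infty$, $$\mathcal G_\alpha=\big(L^2(\mathbb R^d,\rho_0)^{\odot\alpha_0}\otimes L^2(\mathbb R^d,\rho_1)^{\odot\alpha_1}\otimes\cdots\big)\,\alpha_0!\,\alpha_1!\cdots,$$ $J_\alpha=J_0^{\otimes\alpha_0}\otimes J_1^{\otimes\alpha_1}\otimes\cdots:\mathcal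 G_\alpha\to(H_0^{\odot\alpha_0}\otimes H_1^{\odot\alpha_1}\otimes\cdots)\alpha_0!\alpha_1!\cdots$, and $J=\bigoplus_\alpha J_\alpha$. The operator $$\operatorname{Sym}:\bigoplus_{\alpha\in\mathbb Z_{+,0}^\infty}(H_0^{\odot\alpha_0}\otimes H_1^{\odot\alpha_1}\otimes\cdots)\alpha_0!\alpha_1!\cdots\to\mathcal F(H)$$ is the one whose restriction to the summand indexed by $\alpha$ is $\operatorname{Sym}_{|\alpha|}$. Then $\mathcal K:=I\operatorname{Sym}J$ is a unitary operator from $\mathcal G$ onto $L^2(\mathcal D',\mu)$ under the local boundedness assumption on the $a_n$. Multiple Wiener--Itô integrals. For $k\in\mathbb Z_+$ and a bounded Borel set $\Delta\subset\mathbb R^d$ with indicator function $\chi_\Delta$, put $Z^{(k)}(\Delta):=I(\chi_\Delta q^{(k)})\in L^2(\mathcal D',\mu)$, where $(\chi_\Delta q^{(k)})(x,s)=\chi_\Delta(x)q^{(k)}(x,s)$. For $\alpha\in\mathbb Z_{+,0}^\infty$ with $|\alpha|=n\ge1$ and mutually disjoint bounded Borel sets $\Delta_1,\dots,\Delta_n\subset\mathbb R^d$, the multiple integral $\int\cdot\;dZ^{(0)}(x_1)\cdots dZ^{(0)}(x_{\alpha_0})dZ^{(1)}(x_{\alpha_0+1})\cdots dZ^{(1)}(x_{\alpha_0+\alpha_1})\cdots$ of $\chi_{\Delta_1}(x_1)\cdots\chi_{\Delta_n}(x_n)$, equivalently of its symmetrization within blocks $(\chi_{\Delta_1}\odot\dots\odot\chi_{\Delta_{\alpha_0}})\otimes(\chi_{\Delta_{\alpha_0+1}}\odot\dots\odot\chi_{\Delta_{\alpha_0+\alpha_1}})\otimes\cdots\in\mathcal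 G_\alpha$, is defined as the product $$Z^{(0)}(\Delta_1)\cdots Z^{(0)}(\Delta_{\alpha_0})Z^{(1)}(\Delta_{\alpha_0+1})\cdots Z^{(1)}(\Delta_{\alpha_0+\alpha_1})Z^{(2)}(\Delta_{\alpha_0+\alpha_1+1})\cdots.$$ These block-symmetrized vectors are total in $\mathcal G_\alpha$, and the multiple integral of a general $f_\alpha\in\mathcal G_\alpha$ is defined by extending the assignment $$(\chi_{\Delta_1}\odot\dots\odot\chi_{\Delta_{\alpha_0}})\otimes(\chi_{\Delta_{\alpha_0+1}}\odot\dots\odot\chi_{\Delta_{\alpha_0+\alpha_1}})\otimes\cdots\;\mapsto\; Z^{(0)}(\Delta_1)\cdots Z^{(0)}(\Delta_{\alpha_0})Z^{(1)}(\Delta_{\alpha_0+1})\cdots Z^{(1)}(\Delta_{\alpha_0+\alpha_1})Z^{(2)}(\Delta_{\alpha_0+\alpha_1+1})\cdots$$ (with $\Delta_1,\dots,\Delta_n$ mutually disjoint bounded Borel sets) by linearity and continuity to a map $\mathcal G_\alpha\to L^2(\mathcal D',\mu)$. For $\alpha=(0,0,\dots)$, $\mathcal G_\alpha=\mathbb R$ and the integral of $f_\alpha$ is the constant function $f_\alpha$. *)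

(* Defs.v *)
From HB Require Import structures.
From mathcomp Require Import all_boot all_order all_algebra all_fingroup finmap.
From mathcomp Require Import all_classical all_reals all_analysis.

Set Implicit Arguments.
Unset Strict Implicit.
Unset Printing Implicit Defensive.

Import Order.TTheory GRing.Theory Num.Theory.
Import numFieldNormedType.Exports.

Local Open Scope classical_set_scope.
Local Open Scope ring_scope.

Section tuple_product_measure.
Context dT (T : measurableType dT) (R : realType).
Local Open Scope ereal_scope.

Definition tuple_cons n (x : T * n.-tuple T) : n.+1.-tuple T := [tuple of x.1 :: x.2].
Definition tuple_uncons n (x : n.+1.-tuple T) : T * n.-tuple T :=
  (thead x, [tuple of behead x]).

Lemma measurable_tuple_cons n : measurable_fun [set: T * n.-tuple T] (@tuple_cons n).
Proof. exact: measurable_cons. Qed.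

Lemma measurable_tuple_uncons n : measurable_fun [set: n.+1.-tuple T] (@tuple_uncons n).
Proof.
apply/measurable_fun_pairP; split; first exact: measurable_tnth.
exact: measurable_behead.
Qed.

Lemma tuple_consK n : cancel (@tuple_cons n) (@tuple_uncons n).
Proof.
by move=> [x t]; rewrite /tuple_cons /tuple_uncons /=; congr pair; apply: val_inj.
Qed.

Section step.
Variables (n : nat) (m : {sigma_finite_measure set T -> \bar R}).
Variable p : {sigma_finite_measure set (n.-tuple T) -> \bar R}.

Definition tuple_prod_step : set (n.+1.-tuple T) -> \bar R :=
  pushforward (m \x p) (@tuple_cons n).

Let tuple_prod_step0 : tuple_prod_step set0 = 0.
Proof. by rewrite /tuple_prod_step /pushforward preimage_set0 measure0. Qed.

Let tuple_prod_step_ge0 A : 0 <= tuple_prod_step A.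
Proof. exact: integral_ge0. Qed.

Let tuple_prod_step_sigma_additive : semi_sigma_additive tuple_prod_step.
Proof.
move=> F mF tF mUF; rewrite /tuple_prod_step /pushforward preimage_bigcup.
have mpre A : measurable A -> measurable (@tuple_cons n @^-1` A).
  by move=> mA; rewrite -[X in measurable X]setTI; exact: measurable_tuple_cons.
apply: measure_semi_sigma_additive.
- by move=> k; exact: mpre.
- apply/trivIsetP => /= i j _ _ ij; rewrite -preimage_setI.
  by move/trivIsetP : tF => /(_ _ _ _ _ ij) ->//; rewrite preimage_set0.
- by rewrite -preimage_bigcup; exact: mpre.
Qed.

HB.instance Definition _ := isMeasure.Build _ _ _ tuple_prod_step
  tuple_prod_step0 tuple_prod_step_ge0 tuple_prod_step_sigma_additive.

Let tuple_prod_step_sigma_finite : sigma_finite setT tuple_prod_step.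
Proof.
(* the canonical sigma-finite instance of [m \x p] is shadowed, in the library,
   by the one for products of subprobabilities *)
have [F TF Fp] : sigma_finite setT (m \x p).
  by case: (lebesgue_integral_fubini.measure_function_Measure_isSigmaFinite__to__measure_function_isSigmaFinite m p).
exists (fun k => @tuple_uncons n @^-1` F k).
  by rewrite -preimage_bigcup -TF preimage_setT.
move=> k; have [mF Foo] := Fp k; split.
  by rewrite -[X in measurable X]setTI; exact: measurable_tuple_uncons.
rewrite /tuple_prod_step /pushforward -comp_preimage.
by rewrite (_ : _ \o _ = id) ?preimage_id//; apply/funext => x /=; rewrite tuple_consK.
Qed.

HB.instance Definition _ := Measure_isSigmaFinite.Build _ _ _ tuple_prod_step
  tuple_prod_step_sigma_finite.

End step.

(* the product measure m 0 (x) ... (x) m n.-1 *)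
Fixpoint tuple_prod n (m : nat -> {sigma_finite_measure set T -> \bar R}) :
    {sigma_finite_measure set (n.-tuple T) -> \bar R} :=
  match n with
  | 0 => dirac [tuple]
  | n'.+1 => tuple_prod_step (m 0%N) (tuple_prod n' (m \o S))
  end.

End tuple_product_measure.

Section kernel_product_measure.
Context dT dS (T : measurableType dT) (S : measurableType dS) (R : realType).
Variables (m : {sigma_finite_measure set T -> \bar R}) (k : R.-pker T ~> S).
Local Open Scope ereal_scope.

Definition kprod (A : set (T * S)) : \bar R := \int[m]_x k x (xsection A x).

Let kprod0 : kprod set0 = 0.
Proof. by rewrite /kprod integral0_eq// => x _; rewrite xsection0 measure0. Qed.

Let kprod_ge0 A : 0 <= kprod A.
Proof. exact: integral_ge0. Qed.

Let kprod_sigma_additive : semi_sigma_additive kprod.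
Proof.
move=> F mF tF mUF.
rewrite [X in _ --> X](_ : _ = \sum_(n <oo) kprod (F n)).
  by apply: is_cvg_ereal_nneg_natsum => n _; exact: kprod_ge0.
rewrite /kprod -integral_nneseries//.
- apply: eq_integral => x _; rewrite xsection_bigcup.
  apply/esym/cvg_lim => //; apply: measure_semi_sigma_additive.
  + by move=> n; exact: measurable_xsection.
  + exact: trivIset_xsection.
  + by apply: bigcup_measurable => n _; exact: measurable_xsection.
- by move=> n; apply: measurable_fun_xsection_finite_kernel; rewrite inE.
Qed.

HB.instance Definition _ := isMeasure.Build _ _ _ kprod
  kprod0 kprod_ge0 kprod_sigma_additive.

Let kprod_sigma_finite : sigma_finite setT kprod.
Proof.
have [F TF Fp] := sigma_finiteT m.
exists (fun n => F n `*` setT).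
  rewrite predeqE => -[x y]; split => // _.
  have : [set: T] x by [].
  by rewrite TF => -[n _ Fnx]; exists n.
move=> n; have [mF Foo] := Fp n; split; first exact: measurableX.
suff -> : kprod (F n `*` setT) = m (F n) by [].
have <- : \int[m]_x (\1_(F n) x)%:E = m (F n) by rewrite integral_indic// setIT.
apply: eq_integral => x _; rewrite indicE.
have [xF|xF] := boolP (x \in F n); first by rewrite in_xsectionX// prob_kernel.
by rewrite notin_xsectionX// measure0.
Qed.

HB.instance Definition _ := Measure_isSigmaFinite.Build _ _ _ kprod kprod_sigma_finite.

End kernel_product_measure.

(* [lebesgue_measure] lives on [measurableTypeR R]; this is the same set function
   on the canonical measurable structure of [R], which has the same measurable
   sets but another display. *)
Section lebesgue_on_R.
Variable R : realType.
Local Open Scope ereal_scope.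

Definition leb1 : set R -> \bar R := @lebesgue_measure R.

Let leb1_0 : leb1 set0 = 0. Proof. exact: measure0. Qed.

Let leb1_ge0 A : 0 <= leb1 A. Proof. exact: measure_ge0. Qed.

Let leb1_sigma_additive : semi_sigma_additive leb1.
Proof. exact: (@measure_semi_sigma_additive _ _ _ (@lebesgue_measure R)). Qed.

HB.instance Definition _ := isMeasure.Build _ _ _ leb1
  leb1_0 leb1_ge0 leb1_sigma_additive.

Let leb1_sigma_finite : sigma_finite setT leb1.
Proof. exact: (sigma_finiteT (@lebesgue_measure R)). Qed.

HB.instance Definition _ := Measure_isSigmaFinite.Build _ _ _ leb1 leb1_sigma_finite.

End lebesgue_on_R.

Section test_functions_and_distributions.
Variables (R : realType) (d : nat).

(* R^d is [d.-tuple R], whose sigma-algebra in the library is the product (that is,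
   Borel) one; the normed space structure is only available on row vectors. *)
Definition row_fun (f : d.-tuple R -> R) (v : 'rV[R]_d) : R :=
  f [tuple v ord0 i | i < d].

Definition iter_partial (s : seq 'I_d) (g : 'rV[R]_d -> R) : 'rV[R]_d -> R :=
  foldr (fun i (h : 'rV[R]_d -> R) v => 'D_(delta_mx ord0 i) h v) g s.

Definition smooth (g : 'rV[R]_d -> R) := forall s : seq 'I_d,
  continuous (iter_partial s g) /\
  forall i v, derivable (iter_partial s g) v (delta_mx ord0 i).

Record test_function := TestFunction {
  test_fun :> d.-tuple R -> R ;
  test_smooth : smooth (row_fun test_fun) ;
  test_compact : compact (closure [set v | row_fun test_fun v != 0]) }.

(* Continuity on C_0^oo is expressed by the usual seminorm estimates on the test
   functions supported in a fixed cube. *)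
Record Dprime := MkDprime {
  dist_fun :> test_function -> R ;
  dist_linear : forall (c : R) (f g h : test_function),
    (forall x, h x = c * f x + g x) -> dist_fun h = c * dist_fun f + dist_fun g ;
  dist_continuous : forall M : R, exists (C : R) (N : nat),
    forall f : test_function,
    (forall x, (exists i, M < `|tnth x i|) -> f x = 0) ->
    forall B : R,
    (forall s v, (size s <= N)%N -> `|iter_partial s (row_fun f) v| <= B) ->
    `|dist_fun f| <= C * B }.

Let dist0_linear (c : R) (f g h : test_function) :
  (forall x, h x = c * f x + g x) -> 0 = c * 0 + 0 :> R.
Proof. by rewrite mulr0 addr0. Qed.

Let dist0_continuous (M : R) : exists (C : R) (N : nat),
    forall f : test_function,
    (forall x, (exists i, M < `|tnth x i|) -> f x = 0) ->
    forall B : R,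
    (forall s v, (size s <= N)%N -> `|iter_partial s (row_fun f) v| <= B) ->
    `|0 : R| <= C * B.
Proof. by exists 0, 0%N => f _ B _; rewrite normr0 mul0r. Qed.

HB.instance Definition _ := gen_eqMixin Dprime.
HB.instance Definition _ := gen_choiceMixin Dprime.
HB.instance Definition _ :=
  isPointed.Build Dprime (MkDprime dist0_linear dist0_continuous).

Definition cylinders : set (set Dprime) :=
  [set A | exists f : test_function, exists2 B : set R, measurable B &
     A = [set w : Dprime | B (w f)]].

Definition DprimeType := g_sigma_algebraType cylinders.

End test_functions_and_distributions.

Section generic.
Variable R : realType.

Definition sqint dT (T : measurableType dT) (mu : {measure set T -> \bar R})
    (f : T -> R) : \bar R :=
  (\int[mu]_x ((f x) ^+ 2)%:E)%E.

(* [sqn] is a squared seminorm; the codomain is L^2(mu), whose elements are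
   represented by functions up to almost everywhere equality. *)
Definition unitary_onto (V : lmodType R) (D : set V) (sqn : V -> \bar R)
    dS (S : measurableType dS) (mu : {measure set S -> \bar R})
    (U : V -> S -> R) :=
  [/\ forall v, D v -> U v \in Lfun mu 2%:E /\ sqint mu (U v) = sqn v,
      forall (c : R) u v, D u -> D v ->
        U (c *: u + v) = (fun w => c * U u w + U v w) %[ae mu]
    & forall g : S -> R, g \in Lfun mu 2%:E ->
        exists2 v, D v & U v = g %[ae mu]].

(* unconditional convergence of a series for a squared seminorm *)
Definition sums_to (V : zmodType) (sqn : V -> \bar R) (K : choiceType)
    (u : K -> V) (l : V) :=
  forall e : R, 0 < e -> exists A0 : {fset K}, forall A : {fset K},
    (A0 `<=` A)%fset -> (sqn (l - \sum_(i <- A) u i)%R < e%:E)%E.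

(* A sequence (f^(n))_n, f^(n) being a function of n variables in T, is encoded
   as a single function on the finite sequences of elements of T. *)
Section functions_of_n_variables.
Variable T : Type.

Definition component n (f : seq T -> R^o) : n.-tuple T -> R := fun t => f t.

Definition in_degree n (f : seq T -> R^o) : seq T -> R^o :=
  fun s => if size s == n then f s else 0.

Definition perm_seq (s : seq T) (p : 'S_(size s)) : seq T :=
  [seq tnth (in_tuple s) (p i) | i <- enum 'I_(size s)].

Definition Symn (f : seq T -> R^o) : seq T -> R^o := fun s =>
  (size s)`!%:R^-1 * \sum_(p : 'S_(size s)) f (perm_seq p).

End functions_of_n_variables.

Definition multiindex := {fsfun nat -> nat with 0%N}.

Definition deg (al : multiindex) : nat := (\sum_(k <- finsupp al) al k)%N.

Definition fact_index (al : multiindex) : nat :=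
  (\prod_(k <- finsupp al) (al k)`!)%N.

(* the sequence 0, ..., 0, 1, ..., 1, ... with al_k occurrences of each k *)
Definition blocks (al : multiindex) : seq nat :=
  flatten [seq nseq (al k) k | k <- sort leq (finsupp al)].

Definition block (al : multiindex) (j : nat) : nat := nth 0%N (blocks al) j.

Definition block_sym (T : Type) (al : multiindex) (f : seq T -> R^o) :
    seq T -> R^o := fun s =>
  (fact_index al)%:R^-1 *
  \sum_(p : 'S_(size s) | [forall i, block al (p i) == block al i])
     f (perm_seq p).

End generic.

Arguments component {R T} n f t.

Section setting.
Variables (R : realType) (d : nat).
Local Notation E := (d.-tuple R).
Local Notation X := (d.-tuple R * R)%type.

Definition leb : {sigma_finite_measure set E -> \bar R} :=
  tuple_prod d (fun _ => @leb1 R).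

Definition bounded_borel (L : set E) :=
  measurable L /\ exists M : R, forall x, L x -> forall i, `|tnth x i| <= M.

Variable sigma : R.-pker E ~> R.

Definition moment_bound := forall L : set E, bounded_borel L ->
  exists2 C : R, 0 < C & forall (n : nat) x, L x ->
    (\int[sigma x]_s (`|s| ^+ n)%:E <= (C ^+ n * n`!%:R)%:E)%E.

Definition msupport (P : {measure set R -> \bar R}) : set R :=
  [set s | forall e : R, 0 < e -> (0 < P (ball s e))%E].

(* The condition [S #<= `I_n] says that the support of sigma(x, .) has at most n
   points. The recurrence is only required on the support, since q^(n) is set to 0
   when the support has at most n points; when the support is infinite this is
   the polynomial identity. *)
Definition monic_orthogonal (q : nat -> E -> {poly R}) (a b : nat -> E -> R) :=
  forall x, let S := msupport (sigma x) in
  [/\ forall n, ~ (S #<= `I_n)%card -> q n x \is monic /\ size (q n x) = n.+1,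
      forall n, (S #<= `I_n)%card -> q n x = 0,
      forall n m, n != m ->
        \int[sigma x]_s ((q n x).[s] * (q m x).[s]) = 0 ,
      (forall s, S s -> s * (q 0 x).[s] = (q 1 x).[s] + b 0 x) /\
      (forall n s, (0 < n)%N -> S s -> s * (q n x).[s] =
         (q n.+1 x).[s] + b n x * (q n x).[s] + a n x * (q n.-1 x).[s])
    & forall n, (0 < n)%N ->
        (~ (S #<= `I_n)%card -> 0 < a n x) /\ ((S #<= `I_n)%card -> a n x = 0)].

(* dx sigma(x, ds), the measure defining H = L^2(R^d x R, dx sigma(x, ds)) *)
Definition dx_sigma : {sigma_finite_measure set X -> \bar R} := kprod leb sigma.

Definition dx_sigma_pow n : {sigma_finite_measure set (n.-tuple X) -> \bar R} :=
  tuple_prod n (fun _ => dx_sigma).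

(* F(H): H^{(x)n} is realized as L^2((R^d x R)^n), and the n-fold symmetric tensor
   power as the range of the projection [Symn]. *)
Definition fock_sqnorm (F : seq X -> R^o) : \bar R :=
  (\sum_(0 <= n <oo) (n`!%:R)%:E * sqint (dx_sigma_pow n) (component n F))%E.

Definition fock (F : seq X -> R^o) : Prop :=
  (forall n, component n F \in Lfun (dx_sigma_pow n) 2%:E /\
     component n (Symn F) = component n F %[ae dx_sigma_pow n]) /\
  (fock_sqnorm F < +oo)%E.

Definition vacuum : seq X -> R^o := fun s => if s is [::] then 1 else 0.

Definition one_particle (h : X -> R) : seq X -> R^o :=
  fun s => if s is [:: y] then h y else 0.

Definition creation (h : X -> R) (F : seq X -> R^o) : seq X -> R^o :=
  Symn (fun s => if s is y :: s' then h y * F s' else 0).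

Definition annihilation (h : X -> R) (F : seq X -> R^o) : seq X -> R^o :=
  fun s => (size s).+1%:R * \int[dx_sigma]_y (h y * F (y :: s)).

Definition neutral (h : X -> R) (F : seq X -> R^o) : seq X -> R^o :=
  fun s => (\sum_(y <- s) h y) * F s.

Definition tens_monom (f : test_function R d) (i : nat) : X -> R :=
  fun y => f y.1 * y.2 ^+ i.

Definition field_op (f : test_function R d) (F : seq X -> R^o) : seq X -> R^o :=
  creation (tens_monom f 0) F + annihilation (tens_monom f 0) F
  + neutral (tens_monom f 1) F.

(* A(f_1) ... A(f_n) Omega *)
Definition field_vector (fs : seq (test_function R d)) : seq X -> R^o :=
  foldr field_op vacuum fs.

(* I is the unitary operator given by its values on the vectors
   A(f_1) ... A(f_n) Omega, the linear span of which is dense in F(H). *)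
Definition fock_unitary (mu : probability (DprimeType R d) R)
    (I : (seq X -> R^o) -> Dprime R d -> R^o) :=
  [/\ unitary_onto fock fock_sqnorm mu I,
      forall fs, I (field_vector fs) =
        (fun w : Dprime R d => \prod_(f <- fs) w f) %[ae mu]
    & forall F, fock F -> forall e : R, 0 < e ->
        exists l : seq (R * seq (test_function R d)),
        (fock_sqnorm (F - \sum_(u <- l) u.1 *: field_vector u.2)%R < e%:E)%E].

Variable q : nat -> E -> {poly R}.

Section decomposition.
Variable rho : nat -> {sigma_finite_measure set E -> \bar R}.

Definition rho_spec := forall n A, measurable A ->
  (rho n A = \int[leb]_(x in A) \int[sigma x]_s ((q n x).[s] ^+ 2)%:E)%E.

(* G_al: (L^2(rho_0))^{(.) al_0} (x) (L^2(rho_1))^{(.) al_1} (x) ... is realized as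
   the space of functions of |al| variables in L^2 of the product measure that are
   symmetric within each block. *)
Definition rho_prod (al : multiindex) :
    {sigma_finite_measure set ((deg al).-tuple E) -> \bar R} :=
  tuple_prod (deg al) (fun j => rho (block al j)).

Definition Gcomp (al : multiindex) (g : seq E -> R^o) : Prop :=
  component (deg al) g \in Lfun (rho_prod al) 2%:E /\
  component (deg al) (block_sym al g) = component (deg al) g %[ae rho_prod al].

Definition Gcomp_sqnorm (al : multiindex) (g : seq E -> R^o) : \bar R :=
  ((fact_index al)%:R%:E * sqint (rho_prod al) (component (deg al) g))%E.

Definition Gsqnorm (f : multiindex -> seq E -> R^o) : \bar R :=
  (\esum_(al in [set: multiindex]) Gcomp_sqnorm al (f al))%E.

Definition Gspace (f : multiindex -> seq E -> R^o) : Prop :=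
  (forall al, Gcomp al (f al)) /\ (Gsqnorm f < +oo)%E.

(* J_al = J_0^{(x) al_0} (x) J_1^{(x) al_1} (x) ..., with
   (J_k f)(x, s) = f(x) q^(k)(x, s) *)
Definition J_op (f : multiindex -> seq E -> R^o) : multiindex -> seq X -> R^o :=
  fun al s => f al [seq y.1 | y <- s] *
    \prod_(ky <- zip (blocks al) s) (q ky.1 ky.2.1).[ky.2.2].

(* Sym_{|al|} g_al, as an element of F(H); Sym is the extension by linearity and
   continuity to the Hilbert sum over al, that is, the sum in F(H) of these. *)
Definition Sym_comp (g : multiindex -> seq X -> R^o) (al : multiindex) :
    seq X -> R^o :=
  in_degree (deg al) (Symn (g al)).

Definition Sym_op (g : multiindex -> seq X -> R^o) : seq X -> R^o :=
  xget 0 [set F | fock F /\ sums_to fock_sqnorm (Sym_comp g) F].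

Variables (mu : probability (DprimeType R d) R).
Variable I : (seq X -> R^o) -> Dprime R d -> R^o.

Definition K_op (f : multiindex -> seq E -> R^o) : Dprime R d -> R^o :=
  I (Sym_op (J_op f)).

Definition Zint (k : nat) (D : set E) : Dprime R d -> R^o :=
  I (one_particle (fun y => \1_D y.1 * (q k y.1).[y.2])).

Definition simple_vector (al : multiindex) (D : nat -> set E) : seq E -> R^o :=
  block_sym al (fun s => \prod_(i < size s) \1_(D i) (tnth (in_tuple s) i)).

(* W is the multiple integral on G_al with respect to Z^(0), Z^(1), ...; for
   al = 0 the condition on simple vectors reads: W maps the constant 1 to 1. *)
Definition multiple_integral (al : multiindex)
    (W : (seq E -> R^o) -> Dprime R d -> R^o) :=
  [/\ forall g, Gcomp al g -> W g \in Lfun mu 2%:E,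
      forall (c : R) g h, Gcomp al g -> Gcomp al h ->
        W (c *: g + h) = (fun w => c * W g w + W h w) %[ae mu],
      exists C : R, forall g, Gcomp al g ->
        (sqint mu (W g) <= C%:E * Gcomp_sqnorm al g)%E
    & forall D : nat -> set E,
        (forall i, (i < deg al)%N -> bounded_borel (D i)) ->
        (forall i j, (i < j < deg al)%N -> D i `&` D j = set0) ->
        W (simple_vector al D) =
          (fun w => \prod_(i < deg al) Zint (block al i) (D i) w) %[ae mu]].

End decomposition.
End setting.

(* Main.v *)
(* K preserves norms by the combinatorics of symmetrization and the orthogonality of the
   q^(n), and its range contains the field vectors, since s^k is a combination of
   q^(0)(x, s), ..., q^(k)(x, s); these are dense by hypothesis on I.

   That K is a sum of multiple integrals comes down to
     I(h_1 (.) ... (.) h_n) = I(h_1) ... I(h_n)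
   for one-particle vectors h_i supported over disjoint regions. The identity
   I(A(f_1) ... A(f_n) Omega) = I(A(f_1) Omega) ... I(A(f_n) Omega) extends from test
   functions to bounded measurable f_i with bounded support. If f is supported in D, then
   A(f)(F (.) G) = (A(f)F) (.) G whenever F lives over D and G over its complement, so I is
   multiplicative on products F (.) G of polynomials in the fields over D and over its
   complement; as ||F (.) G|| <= ||F|| ||G||, it is multiplicative on all such F, G, and an
   induction on n gives the claim.

   A multiple integral is determined by its values on simple vectors because the diagonals
   are null sets: off the diagonals, a rectangle is a union of products of disjoint cells. *)
Require Import Defs.
From HB Require Import structures.
From mathcomp Require Import all_boot all_order all_algebra all_fingroup finmap.
From mathcomp Require Import all_classical all_reals all_analysis.
From mathcomp Require Import measurable_realfun.
From mathcomp Require Import ring lra.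

Set Implicit Arguments.
Unset Strict Implicit.
Unset Printing Implicit Defensive.

Import Order.TTheory GRing.Theory Num.Theory.
Import numFieldNormedType.Exports.

Local Open Scope classical_set_scope.
Local Open Scope ring_scope.

(** * Product measures *)

(** L^2 is never formed as a quotient: vectors are functions on finite sequences, and identities
    between them hold up to null vectors of a squared seminorm. Square roots are avoided by using
    N(u + v) <= (1 + e) N(u) + (1 + 1/e) N(v) as triangle inequality; hence the factors 2 and 4 in
    the estimates. Two obstacles shape the middle of the proof. The field operators are unbounded,
    so limits are taken only among vectors dominated by products of weights 1_box(x) (1 + |s|)^k,
    for which the moment bound makes dominated convergence available. And a product of two L^2(mu)
    limits need not be an L^2 limit, so an identity u = v Y is passed to the limit after division by
    1 + |Y|. The bound on F (.) G over disjoint regions rests on n! (k! l! / n!)^2 C(n, k) = k! l!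
    for k + l = n, which turns the norms into a Cauchy product. Local boundedness of the a_n enters
    through ||q^(n)(x, .)||^2 = a_1(x) ... a_n(x): it makes rho_n finite on bounded sets, so that
    their indicators lie in L^2(rho_n). *)

Section nonnegative_functions.
Context d (T : measurableType d) (R : realType).
Local Open Scope ereal_scope.
Import HBNNSimple.

(** A nonnegative measurable function is an increasing limit of simple functions, and these are
    finite combinations of indicators with coefficients >= 0. The formulas [integral_density] and
    [integral_kprod] follow by checking the four closure properties. *)
Lemma ge0_measurable_ind (P : (T -> \bar R) -> Prop) :
  (forall A, measurable A -> P (EFin \o \1_A)) ->
  (forall (c : R) (f : T -> \bar R), (0 <= c)%R -> measurable_fun setT f -> (forall x, 0 <= f x) ->
     P f -> P (fun x => c%:E * f x)) ->
  (forall f g : T -> \bar R, measurable_fun setT f -> measurable_fun setT g ->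
     (forall x, 0 <= f x) -> (forall x, 0 <= g x) ->
     P f -> P g -> P (fun x => f x + g x)) ->
  (forall f_ : nat -> T -> \bar R, (forall n, measurable_fun setT (f_ n)) ->
     (forall n x, 0 <= f_ n x) ->
     (forall x, {homo f_ ^~ x : n m / (n <= m)%N >-> n <= m}) ->
     (forall n, P (f_ n)) -> P (fun x => limn (f_ ^~ x))) ->
  forall f : T -> \bar R, measurable_fun setT f -> (forall x, 0 <= f x) -> P f.
Proof.
move=> P1 PZ PD PL f mf f0.
pose g := nnsfun_approx measurableT mf.
have -> : f = fun x => limn ((fun n x => (g n x)%:E) ^~ x).
  by apply/funext => x; apply/esym/cvg_lim => //; exact: cvg_nnsfun_approx.
apply: PL => [n|n x|x m n mn|n]; first exact/measurable_EFinP.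
- by rewrite lee_fin.
- by rewrite lee_fin; exact/lefP/nd_nnsfun_approx.
have P0 : P (cst 0).
  by have := P1 set0 measurable0; rewrite indic0; congr P; apply/funext.
have -> : (fun x => (g n x)%:E) = fun x => \sum_(r <- fset_set (range (g n)))
    ((r * \1_(g n @^-1` [set r]) x)%:E).
  apply/funext => x; rewrite sumEFin; congr EFin.
  by rewrite [LHS](fimfunE (g n) x) fsbig_finite.
(* Measurability and nonnegativity are carried through the induction on the list of values, since
   closure under sums asks for them. *)
suff [_ []] : measurable_fun setT (fun x => \sum_(r <- fset_set (range (g n)))
    ((r * \1_(g n @^-1` [set r]) x)%:E)) /\
  (forall x, 0 <= \sum_(r <- fset_set (range (g n)))
    ((r * \1_(g n @^-1` [set r]) x)%:E)) /\
   P (fun x => \sum_(r <- fset_set (range (g n)))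
    ((r * \1_(g n @^-1` [set r]) x)%:E)) by [].
elim: (enum_fset (fset_set (range (g n)))); last first.
  move=> r s [ms [s0 Ps]]; under eq_fun do rewrite big_cons.
  have m1 : measurable_fun setT (EFin \o (\1_(g n @^-1` [set r]) : T -> R)).
    exact/measurable_EFinP.
  (* A negative [r] is not a value of the nonnegative [g n], so its level set is empty and its term
     is zero. *)
  have [r0|r0] := leP 0%R r; last first.
    under eq_fun do rewrite preimage_nnfun0// indic0 mulr0 add0e.
    split=> //; split => // x; rewrite big_cons.
    by rewrite preimage_nnfun0// indic0 mulr0 add0e.
  split; [|split].
  - apply: emeasurable_funD => //; apply/measurable_EFinP.
    exact: measurable_funM.
  - by move=> x; rewrite big_cons adde_ge0// lee_fin mulr_ge0.
  - apply: PD => //; [|by move=> x; rewrite lee_fin mulr_ge0|].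
      by apply/measurable_EFinP; exact: measurable_funM.
    under eq_fun do rewrite EFinM.
    by apply: PZ => //; exact: P1.
split; first by under eq_fun do rewrite big_nil; exact: measurable_cst.
split; first by move=> x; rewrite big_nil.
by under eq_fun do rewrite big_nil.
Qed.

End nonnegative_functions.

Section integral_density.
Context d (T : measurableType d) (R : realType).
Variables (m m' : {measure set T -> \bar R}) (w : T -> R).
Hypotheses (mw : measurable_fun setT w) (w0 : forall x, 0 <= w x).
Hypothesis m'E : forall A, measurable A -> (m' A = \int[m]_(x in A) (w x)%:E)%E.
Local Open Scope ereal_scope.

(** Used with m' = rho_n, m the Lebesgue measure and w(x) = ||q^(n)(x, .)||^2; on indicators it is
    the hypothesis on m'. *)
Lemma integral_density (f : T -> \bar R) : measurable_fun setT f ->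
  (forall x, 0 <= f x) -> \int[m']_x f x = \int[m]_x (f x * (w x)%:E).
Proof.
have w0' x : 0 <= (w x)%:E by rewrite lee_fin.
have mw' : measurable_fun setT (EFin \o w) by exact/measurable_EFinP.
move: f; apply: ge0_measurable_ind.
- move=> A mA; rewrite integral_indic// setIT m'E// integral_mkcond.
  apply: eq_integral => x _; rewrite patchE/= indicE.
  by case: ifP => _; rewrite ?mul1e ?mul0e.
- move=> c f c0 mf f0 IH; rewrite ge0_integralZl// IH -ge0_integralZl//.
  + by apply: eq_integral => x _; rewrite muleA.
  + exact: emeasurable_funM.
  + by move=> x _; rewrite mule_ge0.
- move=> f g mf mg f0 g0 If Ig; rewrite ge0_integralD// If Ig -ge0_integralD//.
  + by apply: eq_integral => x _; rewrite ge0_muleDl.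
  + by move=> x _; rewrite mule_ge0.
  + exact: emeasurable_funM.
  + by move=> x _; rewrite mule_ge0.
  + exact: emeasurable_funM.
- move=> f_ mf f0 ndf If; rewrite monotone_convergence//.
  under eq_fun do rewrite If.
  rewrite -monotone_convergence//.
  + apply: eq_integral => x _; apply/cvg_lim => //.
    apply: cvgeZr => //; exact: ereal_nondecreasing_is_cvgn (ndf x).
  + by move=> n; exact: emeasurable_funM.
  + by move=> n x _; rewrite mule_ge0.
  + by move=> x _ a b ab; rewrite lee_wpmul2r// ndf.
Qed.

End integral_density.

Section integral_kernel_product.
Context d d' (T : measurableType d) (S : measurableType d') (R : realType).
Variables (m : {sigma_finite_measure set T -> \bar R}) (k : R.-pker T ~> S).
Local Open Scope ereal_scope.

Lemma measurable_integral_pker (f : T * S -> \bar R) : measurable_fun setT f ->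
  (forall z, 0 <= f z) -> measurable_fun setT (fun x => \int[k x]_s f (x, s)).
Proof. by move=> mf f0; exact: (measurable_fun_integral_finite_kernel f k). Qed.

(** Tonelli's theorem for dx sigma(x, ds); on indicators it is the definition of [kprod]. *)
Lemma integral_kprod (f : T * S -> \bar R) : measurable_fun setT f ->
  (forall z, 0 <= f z) ->
  \int[kprod m k]_z f z = \int[m]_x \int[k x]_s f (x, s).
Proof.
move: f; apply: ge0_measurable_ind.
- move=> A mA; rewrite integral_indic// setIT; apply: eq_integral => x _.
  rewrite (_ : (fun s => _) = EFin \o \1_(xsection A x)).
    by rewrite integral_indic ?setIT//; exact: measurable_xsection.
  apply/funext => s /=; rewrite !indicE; congr (_%:R%:E).
  by rewrite mem_xsection.
- move=> c f c0 mf f0 IH; rewrite ge0_integralZl// IH -ge0_integralZl//.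
  + apply: eq_integral => x _; rewrite ge0_integralZl//.
    exact: measurableT_comp.
  + exact: measurable_integral_pker.
  + by move=> x _; exact: integral_ge0.
- move=> f g mf mg f0 g0 If Ig; rewrite ge0_integralD ?If ?Ig; [|by []..].
  rewrite -ge0_integralD; [|by []|..].
  + apply: eq_integral => x _; rewrite ge0_integralD//; exact: measurableT_comp.
  + by move=> x _; exact: integral_ge0.
  + exact: measurable_integral_pker.
  + by move=> x _; exact: integral_ge0.
  + exact: measurable_integral_pker.
- move=> f_ mf f0 ndf If; rewrite monotone_convergence//.
  under eq_fun do rewrite If.
  rewrite -monotone_convergence//.
  + apply: eq_integral => x _; rewrite monotone_convergence//.
    * by move=> n; exact: measurableT_comp.
  + by move=> n; exact: measurable_integral_pker.
  + by move=> n x _; exact: integral_ge0.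
  + move=> x _ a b ab; apply: ge0_le_integral => //.
    * exact: measurableT_comp.
    * exact: measurableT_comp.
    * by move=> s _; exact: ndf.
Qed.

End integral_kernel_product.

Section tuple_product.
Context d (T : measurableType d) (R : realType).
Local Open Scope ereal_scope.
Implicit Type m : nat -> {sigma_finite_measure set T -> \bar R}.

Lemma integral_tuple_prod0 m (f : 0.-tuple T -> \bar R) :
  measurable_fun setT f -> \int[tuple_prod 0 m]_t f t = f [tuple].
Proof. by move=> mf; rewrite /= integral_dirac// diracT mul1e. Qed.

Lemma measurable_fun_tuple_cons d' (S : measurableType d') n
    (f : n.+1.-tuple T -> S) : measurable_fun setT f ->
  measurable_fun setT (fun z : T * n.-tuple T => f [tuple of z.1 :: z.2]).
Proof.
move=> mf; exact: (measurableT_comp mf (@measurable_tuple_cons _ _ n)).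
Qed.

Lemma integral_tuple_prod_pair n m (f : n.+1.-tuple T -> \bar R) :
  measurable_fun setT f -> (forall t, 0 <= f t) ->
  \int[tuple_prod n.+1 m]_t f t =
  \int[m 0%N \x tuple_prod n (m \o S)]_z f [tuple of z.1 :: z.2].
Proof.
move=> mf f0 /=.
by rewrite (ge0_integral_pushforward (@measurable_tuple_cons _ _ n)).
Qed.

Lemma integral_tuple_prodS n m (f : n.+1.-tuple T -> \bar R) :
  measurable_fun setT f -> (forall t, 0 <= f t) ->
  \int[tuple_prod n.+1 m]_t f t =
  \int[m 0%N]_y \int[tuple_prod n (m \o S)]_t f [tuple of y :: t].
Proof.
move=> mf f0; rewrite integral_tuple_prod_pair// fubini_tonelli1//.
exact: measurable_fun_tuple_cons.
Qed.

End tuple_product.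

(** * Monotone classes and rectangles in product spaces *)

Section functional_monotone_class.
Context d (T : measurableType d) (R : realType).
Import HBNNSimple.

Definition bounded_on (Q : set T) (f : T -> R) :=
  measurable_fun setT f /\ exists M, forall x, `|f x| <= M * \1_Q x.

Lemma bounded_on_ge0 Q f : bounded_on Q f ->
  measurable_fun setT f /\ exists2 M, 0 <= M & forall x, `|f x| <= M * \1_Q x.
Proof.
move=> [mf [M fM]]; split=> //; exists `|M| => // x.
by rewrite (le_trans (fM x))// ler_wpM2r// ler_norm.
Qed.

Lemma bounded_on_lin Q c f g : bounded_on Q f -> bounded_on Q g ->
  bounded_on Q (fun x => c * f x + g x).
Proof.
move=> [mf [M fM]] [mg [N gN]]; split.
  by apply: measurable_funD => //; exact: measurable_funM.
exists (`|c| * M + N) => x; rewrite (le_trans (ler_normD _ _))// normrM mulrDl.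
by rewrite -mulrA lerD// ler_wpM2l.
Qed.

Lemma bounded_on_indic Q A : measurable Q -> measurable A ->
  bounded_on Q \1_(A `&` Q).
Proof.
move=> mQ mA; split; first exact/measurable_indic/measurableI.
exists 1 => x; rewrite mul1r indicI/= ger0_norm ?mulr_ge0//.
by rewrite ler_piMl// indicE lern1 leq_b1.
Qed.

Lemma bounded_on0 Q : bounded_on Q (cst 0).
Proof. by split=> //; exists 0 => x /=; rewrite normr0 mul0r. Qed.

(** Functional monotone class theorem relative to the set [Q]: the sets A for which the indicator of
    A cut down to Q satisfies P form a lambda-system containing the pi-system [G]; simple functions
    and limits dominated by a multiple of 1_Q give the rest. It serves both to pass from boxes to
    bounded fields and to pass from rectangles to L^2 functions. *)
Lemma bounded_measurable_ind (G : set (set T)) (Q : set T) (P : (T -> R) -> Prop) :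
  measurable Q -> setI_closed G -> @measurable _ T = <<s G>> ->
  P \1_Q -> (forall A, G A -> P \1_(A `&` Q)) ->
  (forall c f g, bounded_on Q f -> bounded_on Q g -> P f -> P g ->
     P (fun x => c * f x + g x)) ->
  (forall (f_ : nat -> T -> R) f M, (forall n, measurable_fun setT (f_ n)) ->
     (forall n x, `|f_ n x| <= M * \1_Q x) -> bounded_on Q f ->
     (forall x, f_ ^~ x @ \oo --> f x) ->
     (forall n, P (f_ n)) -> P f) ->
  forall f, bounded_on Q f -> P f.
Proof.
move=> mQ GI GE P1 PG PD PL.
have P0 : P (cst 0).
  rewrite (_ : cst 0 = fun x => -1 * \1_Q x + \1_Q x); last first.
    by apply/funext => x; rewrite mulN1r addNr.
  by apply: PD => //; rewrite -[Q in \1_Q]setTI; exact: bounded_on_indic.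
pose H := [set A | measurable A /\ P \1_(A `&` Q)].
have mH : measurable `<=` H.
  rewrite GE; apply: (lambda_system_subset GI) => //; last first.
    by move=> A GA; split; [rewrite GE; exact: sub_sigma_algebra|exact: PG].
  split=> //.
  - by split=> //; rewrite setTI.
  - move=> A B BA [mA PA] [mB PB]; split; first exact: measurableD.
    rewrite (_ : \1_ _ = (fun x => -1 * \1_(B `&` Q) x + \1_(A `&` Q) x)).
      by apply: PD => //; exact: bounded_on_indic.
    apply/funext => x; rewrite setDE !indicE !in_setI in_setC.
    have [xB|xB] := boolP (x \in B); last by rewrite andbT/= mulr0 add0r.
    have -> : x \in A by rewrite inE; apply: BA; rewrite inE in xB.
    by rewrite andbF/= mulN1r addNr.
  - move=> F ndF HF; have mF n := (HF n).1; have mUF : measurable (\bigcup_n F n).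
      exact: bigcup_measurable.
    split => //; apply: (PL (fun n => \1_(F n `&` Q)) _ 1) => //.
    + by move=> n; exact/measurable_indic/measurableI.
    + move=> n x; rewrite mul1r indicI/= ger0_norm ?mulr_ge0//.
      by rewrite ler_piMl// indicE lern1 leq_b1.
    + exact: bounded_on_indic.
    + move=> x; have [[n _ Fnx]|nF] := pselect ((\bigcup_n F n) x).
        apply: cvg_near_cst; exists n => // m /= nm; rewrite !indicE !in_setI.
        have -> : x \in F m by rewrite inE; move/subsetPset : (ndF _ _ nm); exact.
        by have -> : x \in \bigcup_i F i by rewrite inE; exists n.
      apply: cvg_near_cst; near=> n; rewrite !indicE !in_setI.
      rewrite (memNset nF) (@memNset _ (F n) x)// => Fnx; apply: nF.
      by exists n.
    + by move=> n; have [] := HF n.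
have Pge0 f : bounded_on Q f -> (forall x, 0 <= f x) -> P f.
  move=> Qf f0; have [mf [M fM]] := Qf.
  have mf' : measurable_fun setT (EFin \o f) by exact/measurable_EFinP.
  pose g := nnsfun_approx measurableT mf'.
  have gf n x : g n x <= f x.
    rewrite /g nnsfun_approxE -lee_fin; apply: le_approx => //.
    by move=> ? _; rewrite lee_fin.
  apply: (PL g f M) => //.
  - by move=> n x; rewrite ger0_norm// (le_trans (gf n x))// (le_trans _ (fM x))// ler_norm.
  - move=> x; have := @cvg_nnsfun_approx _ _ _ _ measurableT _ mf' (fun x _ => f0 x) x Logic.I.
    by move/fine_cvgP => -[].
  (* The approximations lie below [f] and hence vanish off [Q], so their level sets may be cut down
     to [Q], the only form in which indicators are known to satisfy [P]. *)
  move=> n; have g0 x : ~ Q x -> g n x = 0.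
    move=> nQx; apply/eqP; rewrite eq_le fun_ge0 andbT (le_trans (gf n x))//.
    have := fM x; rewrite indicE memNset// mulr0 => /(le_trans (ler_norm _)).
    exact.
  have -> : (g n : T -> R) = fun x => \sum_(r <- fset_set (range (g n)))
      (r * \1_(g n @^-1` [set r] `&` Q) x).
    apply/funext => x; have [Qx|nQx] := pselect (Q x).
      rewrite [LHS](fimfunE (g n) x) fsbig_finite//; apply: eq_bigr => r _.
      by rewrite indicI/= [\1_Q x]indicE mem_set// mulr1.
    rewrite g0// big1// => r _; rewrite indicI/= [\1_Q x]indicE memNset//.
    by rewrite !mulr0.
  elim: (enum_fset (fset_set (range (g n)))) => [|r s].
    by under eq_fun do rewrite big_nil.
  have msum : bounded_on Q (fun x : T => \sum_(r <- s) r * \1_(g n @^-1` [set r] `&` Q) x).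
    elim: s => [|r' s IH]; first by under eq_fun do rewrite big_nil; exact: bounded_on0.
    under eq_fun do rewrite big_cons; apply: bounded_on_lin => //.
    exact: bounded_on_indic.
  move=> Ps; under eq_fun do rewrite big_cons.
  apply: PD => //; first exact: bounded_on_indic.
  have /mH[]// : measurable (g n @^-1` [set r]) by [].
move=> f Qf; have [mf [M fM]] := Qf.
have Qp : bounded_on Q f^\+.
  split; first exact: measurable_funrpos.
  exists M => x; rewrite (le_trans _ (fM x))// ger0_norm//.
  by rewrite /funrpos ge_max ler_norm normr_ge0.
have Qn : bounded_on Q f^\-.
  split; first exact: measurable_funrneg.
  exists M => x; rewrite (le_trans _ (fM x))// ger0_norm//.
  by rewrite /funrneg ge_max -normrN ler_norm normr_ge0.
have -> : f = fun x => -1 * f^\- x + f^\+ x.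
  apply/funext => x; rewrite mulN1r addrC.
  rewrite /funrpos /funrneg; have [f0|f0] := leP 0 (f x).
    by rewrite [Num.max (- _) _]max_r ?oppr_le0 ?subr0.
  by rewrite max_l ?oppr_ge0 ?sub0r ?opprK ?ltW.
by apply: PD => //; apply: Pge0.
Unshelve. all: by end_near.
Qed.

End functional_monotone_class.

Section rectangles.
Context d (T : measurableType d) (n : nat).

Definition rect (A : 'I_n -> set T) : set (n.-tuple T) :=
  [set t | forall i, A i (tnth t i)].

Lemma rectI A B : rect A `&` rect B = rect (fun i => A i `&` B i).
Proof.
apply/seteqP; split => t /=; first by move=> [tA tB] i.
by move=> AB; split => i; have [] := AB i.
Qed.

Lemma rect_bigcap A : rect A = \bigcap_(i in [set: 'I_n]) ((@tnth n T ^~ i) @^-1` (A i)).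
Proof. by apply/seteqP; split => t /= h i => [_|]; exact: h. Qed.

Lemma measurable_rect A : (forall i, measurable (A i)) -> measurable (rect A).
Proof.
move=> mA; rewrite rect_bigcap; apply: fin_bigcap_measurable => // i _.
rewrite -[X in measurable X]setTI; exact: measurable_tnth.
Qed.

(** A coordinate cylinder is a rectangle whose other sides are the whole space; this is where
    [G setT] enters. *)
Lemma tuple_measurableE (G : set (set T)) : G setT -> @measurable _ T = <<s G>> ->
  @measurable _ (n.-tuple T) = <<s [set rect A | A in [set A | forall i, G (A i)]]>>.
Proof.
move=> GT GE; apply/seteqP; split; last first.
  apply: smallest_sub; first exact: sigma_algebra_measurable.
  move=> _ [A GA <-]; apply: measurable_rect => i; rewrite GE.
  by apply: sub_sigma_algebra; exact: GA.
apply: smallest_sub; first exact: smallest_sigma_algebra.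
rewrite -bigcup_seq/= => B [i _ [C mC <-]]; rewrite setTI.
pose H := [set C | <<s [set rect A | A in [set A | forall i, G (A i)]]>>
   ((@tnth n T ^~ i) @^-1` C)].
suff : measurable `<=` H by apply.
rewrite GE; apply: smallest_sub.
  split.
  - by rewrite /H/= preimage_set0; exact: sigma_algebra0.
  - move=> A HA; rewrite /H/= setTD preimage_setC; exact: sigma_algebraC.
  - move=> F HF; rewrite /H/= preimage_bigcup; exact: sigma_algebra_bigcup.
move=> A GA; apply: sub_sigma_algebra => /=.
exists (fun j => if j == i then A else setT).
  by move=> j; case: ifP.
apply/seteqP; split => t /=; first by move=> /(_ i); rewrite eqxx.
by move=> At j; case: ifP => // /eqP ->.
Qed.

End rectangles.

Definition permute_tuple (T : Type) n (p : 'S_n) (t : n.-tuple T) : n.-tuple T :=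
  [tuple tnth t (p i) | i < n].

(** * Invariance of product measures under permutations of equal factors *)

Section permutation_invariance.
Context d (T : measurableType d) (R : realType).
Local Open Scope ereal_scope.

Lemma measurable_permute_tuple n (p : 'S_n) :
  measurable_fun [set: n.-tuple T] (permute_tuple p).
Proof.
apply/measurable_fun_tnthP => i.
rewrite (_ : _ \o _ = (@tnth _ T ^~ (p i))); first exact: measurable_tnth.
by apply/funext => t /=; rewrite tnth_mktuple.
Qed.

Lemma tuple_prod_rect n (m' : nat -> {sigma_finite_measure set T -> \bar R})
  (A : 'I_n -> set T) : (forall i, measurable (A i)) ->
  tuple_prod n m' (rect A) = \prod_(i < n) m' i (A i).
Proof.
elim: n m' A => [|n IH] m' A mA.
  by rewrite big_ord0/= diracE mem_set// => -[].
rewrite big_ord_recl/= /tuple_prod_step /pushforward.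
rewrite (_ : _ @^-1` _ = A ord0 `*` rect (fun i => A (lift ord0 i))).
  rewrite lebesgue_integral_fubini.product_measure1E//; last first.
    by apply: measurable_rect.
  by rewrite IH.
apply/seteqP; split => [[x t]/= xt|[x t]/= [Ax At] i].
  split; first exact: (xt ord0).
  by move=> i; have := xt (lift ord0 i); rewrite tnthS.
by case: (unliftP ord0 i) => [j ->|->//]; rewrite tnthS.
Qed.

(** The image measure and the product measure agree on rectangles, a pi-system that contains an
    exhaustion by sets of finite measure. The condition [m' (p i) = m' i] admits the permutations
    within blocks, as required for G_alpha. *)
Lemma tuple_prod_perm n (m' : nat -> {sigma_finite_measure set T -> \bar R})
    (p : 'S_n) (A : set (n.-tuple T)) : (forall i, m' (p i) = m' i) -> measurable A ->
  tuple_prod n m' (permute_tuple p @^-1` A) = tuple_prod n m' A.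
Proof.
move=> m'p mA.
have h (i : 'I_n) : exists G : (set T)^nat, [/\ nondecreasing_seq G,
    \bigcup_k G k = setT & forall k, measurable (G k) /\ m' i (G k) < +oo].
  by have /sigma_finiteP[G [GT ndG Gp]] := sigma_finiteT (m' i); exists G.
have [G Gp] := choice h.
pose mp : {measure set (n.-tuple T) -> \bar R} :=
  pushforward (tuple_prod n m') (permute_tuple p).
apply: (measure_unique [set rect A | A in [set A : 'I_n -> set T | forall i, measurable (A i)]]
  (fun k => rect (fun i => G i k)) _ _ _ _ (mp (measurable_permute_tuple p)) (tuple_prod n m')) => //.
- by apply: tuple_measurableE => //; rewrite sigma_algebra_id//; exact: sigma_algebra_measurable.
- by move=> _ _ [B mB <-] [C mC <-]; rewrite rectI; exists (fun i => B i `&` C i) => // i; exact: measurableI.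
- by move=> k; exists (fun i => G i k) => // i; have [_ _ /(_ k)[]] := Gp i.
- apply/seteqP; split => // t _.
  have H i : exists k, G i k (tnth t i).
    have [_ GT _] := Gp i.
    by have : setT (tnth t i) by []; rewrite -GT => -[k _ ?]; exists k.
  have [k kP] := choice H.
  (* Each coordinate enters its own exhausting sequence at stage [k i]; monotonicity makes the
     maximum a common stage. *)
  exists (\max_(i < n) k i)%N => // i; have [ndG _ _] := Gp i.
  by have /ndG/subsetPset := @leq_bigmax 'I_n k i; apply; exact: kP.
- move=> _ [B mB <-]; transitivity (\prod_(i < n) m' i (B i)); last first.
    exact/esym/tuple_prod_rect.
  rewrite /mp/= /pushforward.
  rewrite (_ : _ @^-1` _ = rect (fun i => B ((p^-1)%g i))).
    rewrite tuple_prod_rect// (reindex_inj (@perm_inj _ p))/=.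
    by apply: eq_bigr => i _; rewrite permK m'p.
  apply/seteqP; split => t /= ht i.
    by have := ht ((p^-1)%g i); rewrite tnth_mktuple permKV.
  by rewrite tnth_mktuple; have := ht (p i); rewrite permK.
- move=> k; rewrite /mp/= /pushforward.
  rewrite (_ : _ @^-1` _ = rect (fun i => G ((p^-1)%g i) k)).
    rewrite tuple_prod_rect; last by move=> i; have [_ _ /(_ k)[]] := Gp ((p^-1)%g i).
    apply: (big_ind (fun x => x < +oo /\ 0 <= x) _ _ _).1 => //.
    + by rewrite ltry lee01.
    + move=> x y [xoo x0] [yoo y0]; rewrite mule_ge0//; split=> //.
      by rewrite lte_mul_pinfty// ge0_fin_numE.
    + move=> i _; split => //; have [_ _ /(_ k)[_]] := Gp ((p^-1)%g i).
      by rewrite -m'p permKV.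
  apply/seteqP; split => t /= ht i.
    by have := ht ((p^-1)%g i); rewrite tnth_mktuple permKV.
  by rewrite tnth_mktuple; have := ht (p i); rewrite permK.
Qed.

Lemma integral_tuple_prod_perm n (m' : nat -> {sigma_finite_measure set T -> \bar R})
    (p : 'S_n) (f : n.-tuple T -> \bar R) : (forall i, m' (p i) = m' i) ->
  measurable_fun setT f -> (forall t, 0 <= f t) ->
  \int[tuple_prod n m']_t f (permute_tuple p t) = \int[tuple_prod n m']_t f t.
Proof.
move=> m'p mf f0.
rewrite -(ge0_integral_pushforward (measurable_permute_tuple p) (tuple_prod n m') measurableT)//.
apply: eq_measure_integral; first exact: measurable_permute_tuple.
by move=> mp A mA _; rewrite -[RHS](tuple_prod_perm m'p mA).
Qed.

(** The integrals of the positive and of the negative part are separately invariant, so the identity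
    also covers functions that are not integrable. *)
Lemma Rintegral_tuple_prod_perm n (m' : nat -> {sigma_finite_measure set T -> \bar R})
    (p : 'S_n) (f : n.-tuple T -> R) : (forall i, m' (p i) = m' i) ->
  measurable_fun setT f ->
  (\int[tuple_prod n m']_t f (permute_tuple p t))%R = (\int[tuple_prod n m']_t f t)%R.
Proof.
move=> m'p mf; rewrite /Rintegral; congr fine.
have mf' : measurable_fun setT (EFin \o f) by exact/measurable_EFinP.
rewrite integralE [RHS]integralE; congr (_ - _).
  rewrite -[RHS](integral_tuple_prod_perm m'p)//; last exact: measurable_funepos.
  by apply: eq_integral => t _; rewrite !funeposE.
rewrite -[RHS](integral_tuple_prod_perm m'p)//; last exact: measurable_funeneg.
by apply: eq_integral => t _; rewrite !funenegE.
Qed.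

End permutation_invariance.

(** * Square integrable functions and Hilbert sums *)

Section square_integrable.
Context d (T : measurableType d) (R : realType).
Variable mu : {measure set T -> \bar R}.
Implicit Types f g : T -> R.

Lemma sqint_ge0 f : (0 <= sqint mu f)%E.
Proof. by apply: integral_ge0 => x _; rewrite lee_fin sqr_ge0. Qed.

Lemma measurable_sqr f : measurable_fun setT f ->
  measurable_fun setT (fun x => ((f x) ^+ 2)%:E).
Proof. by move=> mf; apply/measurable_EFinP; exact: measurable_funX. Qed.

Lemma Lfun2P f : f \in Lfun mu 2%:E <->
  measurable_fun setT f /\ (sqint mu f < +oo)%E.
Proof.
split=> [fL|[mf foo]].
  split; first by move: fL; rewrite inE => /andP[/[!inE]].
  move/Lfun2_integrable_sqr : fL => /integrableP[_]; congr (_ < _)%E.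
  by apply: eq_integral => x _ /=; rewrite ger0_norm// sqr_ge0.
rewrite inE; apply/andP; split; rewrite !inE//= /finite_norm.
have : ('N[mu]_(2%:E)[EFin \o f] `^ 2 < +oo)%E.
  rewrite poweR_Lnorm//; congr (_ < _)%E : foo; apply: eq_integral => x _ /=.
  by rewrite powR_mulrn// real_normK// num_real.
by apply: lty_poweRy; rewrite pnatr_eq0.
Qed.

Lemma sqint_lt_pinfty f : f \in Lfun mu 2%:E -> (sqint mu f < +oo)%E.
Proof. by move/Lfun2P => []. Qed.

Lemma Lfun2_measurable f : f \in Lfun mu 2%:E -> measurable_fun setT f.
Proof. by move/Lfun2P => []. Qed.

Lemma le_sqint f g : measurable_fun setT f -> measurable_fun setT g ->
  (forall x, `|f x| <= `|g x|) -> (sqint mu f <= sqint mu g)%E.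
Proof.
move=> mf mg fg; apply: ge0_le_integral => //.
- by move=> x _; rewrite lee_fin sqr_ge0.
- exact: measurable_sqr.
- exact: measurable_sqr.
- move=> x _; rewrite lee_fin -[leLHS]real_normK ?num_real//.
  by rewrite -[leRHS]real_normK ?num_real// lerXn2r ?nnegrE.
Qed.

Lemma ae_eq_sqint f g : measurable_fun setT f -> measurable_fun setT g ->
  f = g %[ae mu] -> sqint mu f = sqint mu g.
Proof.
move=> mf mg fg; apply: ae_eq_integral => //; try exact: measurable_sqr.
by apply: filterS fg => x fg _; rewrite fg.
Qed.

Lemma sqint_eq0 f : measurable_fun setT f -> sqint mu f = 0%E ->
  f = (fun=> 0) %[ae mu].
Proof.
move=> mf f0; have : (\int[mu]_x `|(f x ^+ 2)%:E| = 0)%E.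
  by rewrite -[RHS]f0; apply: eq_integral => x _ /=; rewrite ger0_norm// sqr_ge0.
move/(ae_eq_integral_abs _ measurableT (measurable_sqr mf)).
apply: filterS => x /(_ Logic.I) /= [] /eqP.
by rewrite sqrf_eq0 => /eqP.
Qed.

Lemma sqintB_eq0 f g : measurable_fun setT f -> measurable_fun setT g ->
  sqint mu (fun x => f x - g x) = 0%E -> f = g %[ae mu].
Proof.
move=> mf mg /sqint_eq0 => /(_ (measurable_funB mf mg)).
by apply: filterS => x fg xT; apply/eqP; rewrite -subr_eq0 fg.
Qed.

Lemma sqintZ c f : measurable_fun setT f ->
  sqint mu (fun x => c * f x) = ((c ^+ 2)%:E * sqint mu f)%E.
Proof.
move=> mf; rewrite /sqint -ge0_integralZl_EFin//; last 3 first.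
- by move=> x _; rewrite lee_fin sqr_ge0.
- exact: measurable_sqr.
- exact: sqr_ge0.
by apply: eq_integral => x _; rewrite exprMn EFinM.
Qed.

(** Young's inequality: the difference of the two sides is e (a - b/e)^2. It stands in for the
    triangle inequality throughout. *)
Lemma sqrD_le (e a b : R) : 0 < e ->
  (a + b) ^+ 2 <= (1 + e) * a ^+ 2 + (1 + e^-1) * b ^+ 2.
Proof.
move=> e0; rewrite -subr_ge0.
rewrite (_ : _ - _ = e * (a - e^-1 * b) ^+ 2); last by field; rewrite gt_eqF.
by rewrite mulr_ge0 ?sqr_ge0// ltW.
Qed.

Lemma sqintD_le e f g : 0 < e -> measurable_fun setT f -> measurable_fun setT g ->
  (sqint mu (fun x => f x + g x)%R
   <= (1 + e)%:E * sqint mu f + (1 + e^-1)%:E * sqint mu g)%E.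
Proof.
move=> e0 mf mg; have e1 : 0 <= 1 + e by rewrite addr_ge0// ltW.
have e2 : 0 <= 1 + e^-1 by rewrite addr_ge0// invr_ge0 ltW.
have s0 (h : T -> R) x : setT x -> (0 <= ((h x) ^+ 2)%:E)%E.
  by move=> _; rewrite lee_fin sqr_ge0.
rewrite /sqint -!ge0_integralZl_EFin//; try exact: measurable_sqr; try exact: s0.
rewrite -ge0_integralD//.
- apply: ge0_le_integral => //.
  + exact: s0.
  + by apply: measurable_sqr; exact: measurable_funD.
  + by apply: emeasurable_funD; apply: measurable_funeM; exact: measurable_sqr.
  + by move=> x _; rewrite -!EFinM -EFinD lee_fin sqrD_le.
- by move=> x _; rewrite mule_ge0 ?lee_fin// sqr_ge0.
- by apply: measurable_funeM; exact: measurable_sqr.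
- by move=> x _; rewrite mule_ge0 ?lee_fin// sqr_ge0.
- by apply: measurable_funeM; exact: measurable_sqr.
Qed.

Lemma Lfun2_lin c f g : f \in Lfun mu 2%:E -> g \in Lfun mu 2%:E ->
  (fun x => c * f x + g x) \in Lfun mu 2%:E.
Proof.
move=> /Lfun2P[mf fy] /Lfun2P[mg gy]; apply/Lfun2P; split.
  by apply: measurable_funD => //; exact: measurable_funM.
have mcf : measurable_fun setT (fun x => c * f x) by exact: measurable_funM.
rewrite (le_lt_trans (sqintD_le ltr01 mcf mg))// sqintZ//.
by rewrite lte_add_pinfty// !lte_mul_pinfty// ?lee_fin ?sqr_ge0// ?addr_ge0 ?invr_ge0.
Qed.

Lemma Lfun2_0 : (fun=> 0) \in Lfun mu 2%:E.
Proof.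
apply/Lfun2P; split => //.
by rewrite /sqint integral0_eq// => x _; rewrite expr0n.
Qed.

End square_integrable.

Section square_integrable_complete.
Context d (T : measurableType d) (R : realType).
Variable mu : {measure set T -> \bar R}.

(** The telescoping series of the increments converges absolutely by comparison with a geometric
    series. *)
Lemma geometric_bound_cvg (u : nat -> R) (K : R) :
  (forall j, `|u j.+1 - u j| <= K * (3 / 4) ^+ j) -> cvgn u.
Proof.
move=> uK; have -> : u = (fun n => u 0%N + series (telescope u) n).
  by apply/funext => n; exact: eq_sum_telescope.
apply: is_cvgD; first exact: is_cvg_cst.
apply: normed_cvg; apply: (@series_le_cvg _ _ (geometric K (3 / 4))) => //.
- by move=> n; exact: normr_ge0.
- by move=> n; rewrite /= (le_trans _ (uK n)).
- apply: is_cvg_geometric_series; rewrite ger0_norm; lra.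
Qed.

(* [16/9 < 2] makes the weighted sum of the increments integrable and
   [3/4 = (9/16)^(1/2) < 1] makes the increments summable where it is finite. *)
Lemma Lfun2_complete (u : nat -> T -> R) :
  (forall j, u j \in Lfun mu 2%:E) ->
  (forall i j, (i <= j)%N -> (sqint mu (fun x => u j x - u i x)%R <= (2^-1 ^+ i)%:E)%E) ->
  exists2 l, l \in Lfun mu 2%:E &
    forall i, (sqint mu (fun x => l x - u i x)%R <= (2^-1 ^+ i)%:E)%E.
Proof.
move=> uL uC; have mu_ j := Lfun2_measurable (uL j).
pose D j x := ((16 / 9) ^+ j * (u j.+1 x - u j x) ^+ 2)%:E.
have mD j : measurable_fun setT (D j).
  apply/measurable_EFinP; apply: measurable_funM => //.
  by apply: measurable_funX; exact: measurable_funB.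
have D0 j x : (0 <= D j x)%E.
  by rewrite lee_fin mulr_ge0// ?sqr_ge0// exprn_ge0// divr_ge0.
pose G x := (\sum_(j <oo) D j x)%E.
have mG : measurable_fun setT G by apply: ge0_emeasurable_sum.
have Goo : (\int[mu]_x G x < +oo)%E.
  rewrite integral_nneseries//.
  (* The weight (16/9)^j against the Cauchy bound 2^-j leaves a geometric series of ratio 8/9. *)
  apply: (@le_lt_trans _ _ (\sum_(j <oo) ((8 / 9) ^+ j)%:E)%E).
    apply: lee_nneseries => [j _ _|j _]; first exact: integral_ge0.
    rewrite /D; under eq_integral do rewrite EFinM.
    rewrite ge0_integralZl_EFin// ?exprn_ge0//.
    - rewrite (_ : (8 / 9) ^+ j = (16 / 9) ^+ j * 2^-1 ^+ j); last first.
        by rewrite -exprMn; congr (_ ^+ _); field.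
      by rewrite EFinM lee_wpmul2l// ?lee_fin ?exprn_ge0//; exact: uC.
    - by move=> x _; rewrite lee_fin sqr_ge0.
    - by apply: measurable_sqr; exact: measurable_funB.
  have := @cvg_geometric_series R 1 (8 / 9).
  rewrite ger0_norm; last lra.
  move=> /(_ ltac:(lra)) cvg.
  rewrite (@cvg_lim _ _ _ _ _ _ (1 * (1 - 8 / 9)^-1)%:E)// ?ltry//.
  rewrite (_ : (fun n => _) = EFin \o series (geometric 1 (8 / 9))).
    by apply: (cvg_EFin _ cvg); near=> n.
  apply/funext => n /=; rewrite sumEFin /series/=; congr EFin.
  by apply: eq_bigr => i _; rewrite mul1r.
pose A := [set x | (G x < +oo)%E].
have mA : measurable A.
  by rewrite -[A]setTI; exact: (measurable_lte measurableT mG (measurable_cst +oo%E)).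
have G0 x : (0 <= G x)%E by apply: nneseries_ge0 => j _ _; exact: D0.
have aeA : {ae mu, forall x, A x}.
  have : mu.-integrable setT G.
    apply/integrableP; split=> //; rewrite (le_lt_trans _ Goo)//.
    by under eq_integral do rewrite gee0_abs//.
  move/(integrable_ae measurableT); apply: filterS => x /(_ Logic.I).
  by rewrite ge0_fin_numE.
(* Cutting down to the set of full measure where [G] is finite makes the sequence converge at every
   point, so that the limit is measurable. *)
pose v j x := \1_A x * u j x.
have mv j : measurable_fun setT (v j).
  by apply: measurable_funM => //; exact: measurable_indic.
have cv x : cvgn (v^~ x).
  have [Ax|nAx] := pselect (A x); last first.
    rewrite /v; under eq_fun do rewrite indicE memNset// mul0r.
    exact: is_cvg_cst.
  rewrite /v; under eq_fun do rewrite indicE mem_set// mul1r.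
  apply: (@geometric_bound_cvg _ (Num.sqrt (fine (G x)))) => j.
  have Gfin : G x = (fine (G x))%:E by rewrite fineK// ge0_fin_numE.
  have g0 : 0 <= fine (G x) by rewrite fine_ge0.
  move: (fine (G x)) g0 Gfin => g g0 Gfin.
  have : (D j x <= G x)%E.
    rewrite /G (@nneseriesD1 _ (D^~ x) j)//.
    rewrite leeDl//; exact: nneseries_ge0.
  rewrite Gfin /D lee_fin => DG.
  rewrite -(@ler_pXn2r _ 2)// ?nnegrE ?normr_ge0// ?mulr_ge0// ?sqrtr_ge0 ?exprn_ge0//.
  rewrite real_normK ?num_real// exprMn sqr_sqrtr//.
  rewrite -exprM mulnC exprM -ler_pdivrMr ?exprn_gt0//.
  by rewrite mulrC -exprVn (_ : (_^-1) = 16 / 9)//; field.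
pose l x := limn (v^~ x).
have vl x : v^~ x @ \oo --> l x by exact: cv.
have ml : measurable_fun setT l by apply: (measurable_fun_cvg mv) => x _; exact: vl.
have main i : (sqint mu (fun x => l x - u i x)%R <= (2^-1 ^+ i)%:E)%E.
  have mli : measurable_fun setT (fun x => l x - v i x) by exact: measurable_funB.
  rewrite (@ae_eq_sqint _ _ _ _ _ (fun x => l x - v i x))//; last 2 first.
  - exact: measurable_funB.
  - by apply: filterS aeA => x Ax _; rewrite /v indicE mem_set ?mul1r.
  have mvi j : measurable_fun setT (fun x => v j x - v i x) by exact: measurable_funB.
  (* Fatou's lemma for (v j - v i)^2 as j grows; the index [maxn n i] stays in the range where the
     Cauchy bound for i applies. *)
  have F := fatou mu measurableT (fun j => measurable_sqr (mvi j)).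
  rewrite /sqint (_ : (\int[mu]_x _)%E = (\int[mu]_x limn_einf (fun j => ((v j x - v i x) ^+ 2)%:E))%E); last first.
    apply: eq_integral => x _; apply/esym; apply: (cvg_limn_einf_sup _).1.
    apply: cvg_EFin; first by near=> n.
    apply: (@cvg_comp _ _ _ _ (fun y : R => y ^+ 2) _ _ _ (cvgB (vl x) (cvg_cst (v i x)))).
    exact: exprn_continuous.
  apply: (le_trans (F _)); first by move=> j x _; rewrite lee_fin sqr_ge0.
  rewrite limn_einf_lim; apply: lime_le; first exact: is_cvg_einfs.
  near=> n; apply: (@le_trans _ _ (\int[mu]_x ((v (maxn n i) x - v i x) ^+ 2)%:E)%E).
    by apply: ereal_inf_lbound; exists (maxn n i) => //=; exact: leq_maxl.
  rewrite -/(sqint mu (fun x => v (maxn n i) x - v i x)).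
  rewrite (@ae_eq_sqint _ _ _ _ _ (fun x => u (maxn n i) x - u i x))//.
  - by apply: uC; exact: leq_maxr.
  - exact: measurable_funB.
  - by apply: filterS aeA => x Ax _; rewrite /v indicE mem_set ?mul1r.
exists l => //; rewrite (_ : l = (fun x => 1 * (l x - u 0%N x) + u 0%N x)).
  apply: Lfun2_lin => //; apply/Lfun2P; split; first exact: measurable_funB.
  by rewrite (le_lt_trans (main 0%N))// ltry.
by apply/funext => x; rewrite mul1r subrK.
Unshelve. all: by end_near.
Qed.

End square_integrable_complete.

Lemma half_pow_small (R : realType) (c e : R) : 0 <= c -> 0 < e ->
  exists j, forall i, (j <= i)%N -> c * 2^-1 ^+ i < e.
Proof.
move=> c0 e0; have h : geometric c (2^-1 : R) @ \oo --> (0 : R).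
  by apply: cvg_geometric; rewrite ger0_norm ?invr_ge0// invf_lt1 ?ltr1n.
move/cvgrPdist_lt : h => /(_ _ e0)[j _ hj]; exists j => i /hj/=.
by rewrite sub0r normrN ger0_norm// mulr_ge0// exprn_ge0 ?invr_ge0.
Qed.

Section esum_lemmas.
Context (R : realType) (K : choiceType).
Local Open Scope ereal_scope.
Implicit Types a b : K -> \bar R.

Lemma esum_le a (M : \bar R) :
  (forall A : {fset K}, \sum_(i <- A) a i <= M) -> \esum_(i in setT) a i <= M.
Proof.
move=> aM; apply: ge_ereal_sup => _ [A [fA _] <-].
by rewrite fsbig_finite//=; exact: aM.
Qed.

Lemma le_esum_fset a (A : {fset K}) : \sum_(i <- A) a i <= \esum_(i in setT) a i.
Proof.
apply: esum_ge; exists [set` A]; first by split => //; exact: finite_fset.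
by rewrite fsbig_finite ?set_fsetK//; exact: finite_fset.
Qed.

Lemma esumZl (c : R) a : (0 <= c)%R -> (forall i, 0 <= a i) ->
  \esum_(i in setT) (c%:E * a i) = c%:E * \esum_(i in setT) a i.
Proof.
move=> c0 a0; have le (c' : R) b : (0 <= c')%R -> (forall i, 0 <= b i) ->
    \esum_(i in setT) (c'%:E * b i) <= c'%:E * \esum_(i in setT) b i.
  move=> c'0 b0; apply: esum_le => A; rewrite -ge0_sume_distrr//.
  by rewrite lee_wpmul2l ?lee_fin// le_esum_fset.
apply/eqP; rewrite eq_le le//=.
have [<-|c0'] := eqVneq 0%R c; last have {}c0 : (0 < c)%R by rewrite lt_def eq_sym c0'.
  by rewrite mul0e esum_ge0// => i _; rewrite mul0e.
have ci : (0 <= c^-1)%R by rewrite invr_ge0 ltW.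
rewrite -lee_pdivlMl// (le_trans _ (le _ _ ci _))//.
  by apply: le_esum => i _; rewrite muleA -EFinM mulVf ?mul1e// gt_eqF.
by move=> i; rewrite mule_ge0// lee_fin ltW.
Qed.

Lemma fset_sum_sub a (A B : {fset K}) : (forall i, 0 <= a i) -> (A `<=` B)%fset ->
  \sum_(i <- A) a i <= \sum_(i <- B) a i.
Proof.
move=> a0 AB; rewrite (big_fsetID _ (mem A) B)/=.
have -> : [fset i in B | i \in A]%fset = A.
  by apply/fsetP => i; rewrite !inE; case: (boolP (i \in A)) => [/(fsubsetP AB) ->|_]; rewrite ?andbF.
by rewrite leeDl// sume_ge0.
Qed.

Lemma esum_approx a (e : R) : (forall i, 0 <= a i) -> \esum_(i in setT) a i < +oo ->
  (0 < e)%R -> exists A0 : {fset K}, forall A : {fset K}, (A0 `<=` A)%fset ->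
    \esum_(i in setT) a i <= \sum_(i <- A) a i + e%:E.
Proof.
move=> a0 aoo e0; have aE : \esum_(i in setT) a i \is a fin_num.
  by rewrite ge0_fin_numE// esum_ge0.
have [A0 hA0] : exists A0 : {fset K}, \esum_(i in setT) a i <= \sum_(i <- A0) a i + e%:E.
  apply: contrapT => /forallNP nA.
  have : \esum_(i in setT) a i <= \esum_(i in setT) a i - e%:E.
    apply: esum_le => A; rewrite leeBrDr//.
    by have /negP := nA A; rewrite -ltNge => /ltW.
  by rewrite leNgt => /negP; apply; rewrite lteBlDr// lteDl// lte_fin.
exists A0 => A /(fset_sum_sub a0) A0A; rewrite (le_trans hA0)//.
by rewrite leeD2r.
Qed.

End esum_lemmas.

(* [N] is the square of a seminorm on [D]; the last clause is the triangle
   inequality, in a form without square roots. *)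
Definition sqnormed (R : realType) (V : lmodType R) (D : set V) (N : V -> \bar R) :=
  [/\ D 0 /\ N 0 = 0%E,
      forall (c : R) u v, D u -> D v -> D (c *: u + v),
      (forall u, (0 <= N u)%E) /\ (forall u, D u -> (N u < +oo)%E),
      forall (c : R) u, D u -> N (c *: u) = ((c ^+ 2)%:E * N u)%E
    & forall (e : R) u v, 0 < e -> D u -> D v ->
        (N (u + v)%R <= (1 + e)%:E * N u + (1 + e^-1)%:E * N v)%E].

(* Stated on fast Cauchy sequences, which is enough for series. *)
Definition sqcomplete (R : realType) (V : lmodType R) (D : set V) (N : V -> \bar R) :=
  forall u : nat -> V, (forall j, D (u j)) ->
    (forall i j, (i <= j)%N -> (N (u j - u i)%R <= (2^-1 ^+ i)%:E)%E) ->
    exists2 l, D l & forall i, (N (l - u i)%R <= (2 * 2^-1 ^+ i)%:E)%E.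

(** * Unconditional sums and completeness for squared seminorms *)

Section sqnormed_spaces.
Context (R : realType) (V : lmodType R) (D : set V) (N : V -> \bar R).
Hypothesis DN : sqnormed D N.
Local Open Scope ereal_scope.

Lemma sqn_ge0 u : 0 <= N u. Proof. by case: DN => _ _ []. Qed.

Lemma sqn_lty u : D u -> N u < +oo.
Proof. by case: DN => _ _ [_ h] _ _; exact: h. Qed.

Lemma sqn_fin u : D u -> N u \is a fin_num.
Proof. by move=> Du; rewrite ge0_fin_numE ?sqn_ge0// sqn_lty. Qed.

Lemma dom_lin c u v : D u -> D v -> D (c *: u + v)%R.
Proof. by case: DN => _ h _ _ _; exact: h. Qed.

Lemma dom0 : D 0%R. Proof. by case: DN => -[]. Qed.

Lemma domD u v : D u -> D v -> D (u + v)%R.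
Proof. by move=> Du Dv; rewrite -[u]scale1r; exact: dom_lin. Qed.

Lemma domZ c u : D u -> D (c *: u)%R.
Proof. by move=> Du; rewrite -[_ *: _]addr0; apply: dom_lin => //; exact: dom0. Qed.

Lemma domB u v : D u -> D v -> D (u - v)%R.
Proof. by move=> Du Dv; rewrite addrC -scaleN1r; exact: dom_lin. Qed.

Lemma dom_sum (I : Type) (r : seq I) (F : I -> V) : (forall i, D (F i)) ->
  D (\sum_(i <- r) F i)%R.
Proof. by move=> DF; elim/big_ind : _ => //; [exact: dom0|exact: domD]. Qed.

Lemma sqn0 : N 0%R = 0. Proof. by case: DN => -[]. Qed.

Lemma sqnN u : D u -> N (- u)%R = N u.
Proof.
by case: DN => _ _ _ NZ _ Du; rewrite -scaleN1r NZ// sqrrN expr1n mul1e.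
Qed.

Lemma sqnBC u v : D u -> D v -> N (u - v)%R = N (v - u)%R.
Proof. by move=> Du Dv; rewrite -opprB sqnN//; exact: domB. Qed.

Lemma sqnD_le e u v : (0 < e)%R -> D u -> D v ->
  N (u + v)%R <= (1 + e)%:E * N u + (1 + e^-1)%:E * N v.
Proof. by case: DN => _ _ _ _; exact. Qed.

Lemma sqnD2 u v : D u -> D v -> N (u + v)%R <= 2%:E * N u + 2%:E * N v.
Proof. by move=> Du Dv; have := sqnD_le (@ltr01 R) Du Dv; rewrite invr1. Qed.

Lemma sqn_tri v u w : D u -> D v -> D w ->
  N (u - w)%R <= 2%:E * N (u - v)%R + 2%:E * N (v - w)%R.
Proof.
move=> Du Dv Dw; have -> : (u - w = (u - v) + (v - w))%R by rewrite addrA subrK.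
by apply: sqnD2; exact: domB.
Qed.

(** The quarters compensate for the factor 2 that the squared triangle inequality puts on each
    term. *)
Lemma sqn_tri_lt v u w (e : R) : D u -> D v -> D w ->
  N (u - v)%R < (e / 4)%:E -> N (v - w)%R < (e / 4)%:E -> N (u - w)%R < e%:E.
Proof.
move=> Du Dv Dw; rewrite (_ : e = 2 * (e / 4) + 2 * (e / 4))%R; last by field.
set f := (e / 4)%R; rewrite (_ : (_ / 4) = f)%R; last by rewrite /f; field.
move=> uv vw; rewrite (le_lt_trans (sqn_tri Du Dv Dw))//.
rewrite [X in _ < X]EFinD ![(2 * f)%:E]EFinM.
by apply: lteD; rewrite lte_pmul2l.
Qed.

Lemma sqn_eq0P u : (forall e : R, (0 < e)%R -> N u < e%:E) -> N u = 0.
Proof.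
move=> ue; apply/eqP; rewrite eq_le sqn_ge0 andbT.
by apply/lee_addgt0Pr => e e0; rewrite add0e ltW// ue.
Qed.

(** When N(u - v) = 0, the term with coefficient 1 + 1/d disappears, so d can be taken small at no
    cost; d = e / (1 + r) makes the excess d r at most e. *)
Lemma sqn_null u v : D u -> D v -> N (u - v)%R = 0 -> N u = N v.
Proof.
suff le u' v' : D u' -> D v' -> N (u' - v')%R = 0 -> N u' <= N v'.
  move=> Du Dv uv; apply/eqP; rewrite eq_le !le//.
  by rewrite sqnBC.
move=> {u v} {}Du Dv uv; rewrite -[u'](subrK v') addrC.
apply/lee_addgt0Pr => e e0.
have Nv : N v' = (fine (N v'))%:E by rewrite fineK// sqn_fin.
have v0 : (0 <= fine (N v'))%R by rewrite fine_ge0// sqn_ge0.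
move: (fine (N v')) v0 Nv => r r0 Nv.
have d0 : (0 < e / (1 + r))%R by rewrite divr_gt0// ltr_wpDr.
rewrite (le_trans (sqnD_le d0 Dv (domB Du Dv)))// uv mule0 adde0 Nv -EFinM lee_fin.
rewrite mulrDl mul1r lerD2l mulrAC ler_pdivrMr ?ltr_wpDr// ler_wpM2l//; first exact: ltW.
by rewrite lerDr.
Qed.

Section sums.
Context (K : choiceType) (u : K -> V).
Hypothesis Du : forall i, D (u i).

Lemma sums_to_uniq l l' : D l -> D l' -> sums_to N u l -> sums_to N u l' ->
  N (l - l')%R = 0.
Proof.
move=> Dl Dl' ul ul'; apply: sqn_eq0P => e e0.
have e4 : (0 < e / 4)%R by rewrite divr_gt0.
have [A hA] := ul _ e4; have [A' hA'] := ul' _ e4.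
apply: (@sqn_tri_lt (\sum_(i <- (A `|` A')%fset) u i)) => //; first exact: dom_sum.
  by apply: hA; exact: fsubsetUl.
by rewrite sqnBC//; [apply: hA'; exact: fsubsetUr|exact: dom_sum].
Qed.

Lemma sums_to_lin (c : R) v w l m : (forall i, D (v i)) -> (forall i, w i = (c *: u i + v i)%R) ->
  D l -> D m -> sums_to N u l -> sums_to N v m ->
  sums_to N w (c *: l + m)%R.
Proof.
move=> Dv wE Dl Dm ul vm e e0.
have c1 : (0 < c ^+ 2 + 1)%R by rewrite ltr_wpDl// sqr_ge0.
(* Dividing by c^2 + 1 rather than by c^2 covers c = 0. *)
have [A hA] := ul (e / 4 / (c ^+ 2 + 1))%R ltac:(rewrite !divr_gt0//).
have [A' hA'] := vm (e / 4)%R ltac:(rewrite divr_gt0//).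
exists (A `|` A')%fset => B; rewrite fsubUset => /andP[AB A'B].
have -> : (c *: l + m - \sum_(i <- B) w i = c *: (l - \sum_(i <- B) u i) + (m - \sum_(i <- B) v i))%R.
  under eq_bigr do rewrite wE; rewrite big_split/= -scaler_sumr scalerBr opprD.
  by rewrite addrACA.
have Dl' : D (l - \sum_(i <- B) u i)%R by apply: domB => //; exact: dom_sum.
have Dm' : D (m - \sum_(i <- B) v i)%R by apply: domB => //; exact: dom_sum.
rewrite (le_lt_trans (sqnD2 (domZ c Dl') Dm'))//.
have /ltW lA := hA _ AB; have mA := hA' _ A'B.
rewrite (_ : e = 2 * (e / 4) + 2 * (e / 4))%R; last by field.
case: DN => _ _ _ NZ _; rewrite NZ// [X in _ < X]EFinD ![(2 * (e / 4))%:E]EFinM.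
apply: lee_ltD; rewrite ?lte_pmul2l//.
  by rewrite fin_numM// fin_numM// sqn_fin.
rewrite lee_pmul2l//.
rewrite (le_trans (lee_wpmul2l _ lA)) ?lee_fin ?sqr_ge0// mulrA ler_pdivrMr// mulrC.
by rewrite ler_wpM2l ?divr_ge0 ?ltW// ltrDl.
Qed.

Hypothesis pyth : forall A : {fset K}, N (\sum_(i <- A) u i)%R = \sum_(i <- A) N (u i).

(** Parseval's identity. In each direction [l] is compared with a finite partial sum: first d is
    taken so small that its share of the main term is at most e/2, then the partial sum so close to
    [l] that the error multiplied by 1 + 1/d is at most e/2. *)
Lemma sums_to_sqn l : D l -> sums_to N u l -> N l = \esum_(i in setT) N (u i).
Proof.
move=> Dl ul; apply/eqP; rewrite eq_le; apply/andP; split; last first.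
  apply: esum_le => A; apply/lee_addgt0Pr => e e0.
  have Nl : N l = (fine (N l))%:E by rewrite fineK// sqn_fin.
  have l0 : (0 <= fine (N l))%R by rewrite fine_ge0// sqn_ge0.
  move: (fine (N l)) l0 Nl => r r0 Nl.
  set d := (e / 2 / (1 + r))%R; have d0 : (0 < d)%R by rewrite !divr_gt0// ltr_wpDr.
  have d1 : (0 < 1 + d^-1)%R by rewrite addr_gt0// invr_gt0.
  have [A0 hA0] := ul (e / 2 / (1 + d^-1))%R ltac:(rewrite !divr_gt0//).
  have /ltW h := hA0 (A `|` A0)%fset (fsubsetUr _ _).
  rewrite (le_trans (fset_sum_sub (fun i => sqn_ge0 (u i)) (fsubsetUl A A0)))//.
  rewrite -pyth; set S := (\sum_(i <- (A `|` A0)%fset) u i)%R in h *.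
  have DS : D S by exact: dom_sum.
  rewrite -[S](subrK l) addrC (le_trans (sqnD_le d0 Dl (domB DS Dl)))//.
  rewrite [X in _ <= X](_ : _ = (r + e / 2)%:E + (e / 2)%:E); last by rewrite Nl -!EFinD; congr EFin; field.
  apply: leeD.
    rewrite Nl -EFinM lee_fin mulrDl mul1r lerD2l /d mulrAC ler_pdivrMr ?ltr_wpDr//.
    by rewrite ler_wpM2l ?divr_ge0 ?ltW// ltrDr.
  rewrite sqnBC// (le_trans (lee_wpmul2l _ h))//; first by rewrite lee_fin ltW.
  by rewrite -EFinM mulrCA mulfV ?mulr1// gt_eqF.
have [Eoo|] := ltP (\esum_(i in setT) N (u i)) +oo; last by move=> /(le_trans _); apply; rewrite leey.
have EF : \esum_(i in setT) N (u i) = (fine (\esum_(i in setT) N (u i)))%:E.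
  by rewrite fineK// ge0_fin_numE// esum_ge0// => i _; exact: sqn_ge0.
have E0 : (0 <= fine (\esum_(i in setT) N (u i)))%R.
  by rewrite fine_ge0// esum_ge0// => i _; exact: sqn_ge0.
apply/lee_addgt0Pr => e e0.
move: (fine _) E0 EF => r r0 EF.
set d := (e / 2 / (1 + r))%R; have d0 : (0 < d)%R by rewrite !divr_gt0// ltr_wpDr.
have d1 : (0 < 1 + d^-1)%R by rewrite addr_gt0// invr_gt0.
have [A0 hA0] := ul (e / 2 / (1 + d^-1))%R ltac:(rewrite !divr_gt0//).
have /ltW h := hA0 A0 (fsubset_refl _).
set S := (\sum_(i <- A0) u i)%R in h *.
have DS : D S by exact: dom_sum.
rewrite -[l](subrK S) addrC (le_trans (sqnD_le d0 DS (domB Dl DS)))//.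
rewrite [X in _ <= X](_ : _ = (r + e / 2)%:E + (e / 2)%:E); last by rewrite EF -!EFinD; congr EFin; field.
apply: leeD.
  apply: (@le_trans _ _ ((1 + d)%:E * r%:E)).
    by rewrite lee_pmul2l ?lte_fin ?addr_gt0// -EF pyth le_esum_fset.
  rewrite -EFinM lee_fin mulrDl mul1r lerD2l /d mulrAC ler_pdivrMr ?ltr_wpDr//.
  by rewrite ler_wpM2l ?divr_ge0 ?ltW// ltrDr.
rewrite (le_trans (lee_wpmul2l _ h))//; first by rewrite lee_fin ltW.
by rewrite -EFinM mulrCA mulfV ?mulr1// gt_eqF.
Qed.

(** By the Pythagorean hypothesis the squared distance between nested partial sums is the sum of the
    added terms, hence bounded by a tail of a convergent series. *)
Lemma sums_to_exists : sqcomplete D N -> \esum_(i in setT) N (u i) < +oo ->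
  exists2 l, D l & sums_to N u l.
Proof.
move=> Nc Eoo; have N0 i := sqn_ge0 (u i).
have h (j : nat) : exists A0 : {fset K}, forall A : {fset K}, (A0 `<=` A)%fset ->
    \esum_(i in setT) N (u i) <= \sum_(i <- A) N (u i) + (2^-1 ^+ j)%:E.
  by apply: esum_approx => //; rewrite exprn_gt0// invr_gt0.
have [A hA] := choice h.
(* Unions make the finite sets increase with j, so that the partial sums over them form a fast
   Cauchy sequence. *)
pose B j := (\bigcup_(i <- iota 0 j.+1) A i)%fset.
have AB j : (A j `<=` B j)%fset.
  by apply: bigfcup_sup => //; rewrite mem_iota/= ltnS leqnn.
have BB i j : (i <= j)%N -> (B i `<=` B j)%fset.
  move=> ij; apply/bigfcupsP => k; rewrite mem_iota/= add0n => ki _.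
  by apply: bigfcup_sup => //; rewrite mem_iota/= add0n (leq_trans ki).
have sumB (C C' : {fset K}) : (C `<=` C')%fset ->
    (\sum_(i <- C') u i - \sum_(i <- C) u i = \sum_(i <- (C' `\` C)%fset) u i)%R.
  move=> CC'; rewrite (big_fsetID _ (mem C) C')/=.
  have -> : [fset i in C' | i \in C]%fset = C.
    by apply/fsetP => i; rewrite !inE; case: (boolP (i \in C)) => [/(fsubsetP CC') ->|_]; rewrite ?andbF.
  rewrite addrAC subrr add0r.
  by congr (\sum_(i <- enum_fset _) _)%R; apply/fsetP => i; rewrite !inE andbC.
have small j (C : {fset K}) : (B j `<=` C)%fset ->
    N (\sum_(i <- C) u i - \sum_(i <- B j) u i)%R <= (2^-1 ^+ j)%:E.
  move=> BC; rewrite sumB// pyth.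
  have Efin : \sum_(i <- B j) N (u i) \is a fin_num.
    by apply/sum_fin_numP => i _ _; exact: sqn_fin.
  have : \sum_(i <- C) N (u i) <= \sum_(i <- B j) N (u i) + (2^-1 ^+ j)%:E.
    rewrite (le_trans (le_esum_fset _ _))//; apply: hA; exact: AB.
  rewrite (big_fsetID _ (mem (B j)) C)/=.
  have -> : [fset i in C | i \in B j]%fset = B j.
    by apply/fsetP => i; rewrite !inE; case: (boolP (i \in B j)) => [/(fsubsetP BC) ->|_]; rewrite ?andbF.
  rewrite leeD2lE// => le; rewrite (le_trans _ le)//.
  rewrite le_eqVlt; apply/orP; left; apply/eqP.
  by congr (\sum_(i <- enum_fset _) _)%R; apply/fsetP => i; rewrite !inE andbC.
have [l Dl hl] := Nc (fun j => \sum_(i <- B j) u i)%R (fun j => dom_sum _ Du)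
  (fun i j ij => small _ _ (BB _ _ ij)).
exists l => // e e0.
have [j hj] : exists j, (2 * 2^-1 ^+ j < e / 4)%R.
  have [j hj] := @half_pow_small R 2 (e / 4) ltac:(done) ltac:(by rewrite divr_gt0).
  by exists j; exact: hj.
exists (B j) => C BC; apply: (@sqn_tri_lt (\sum_(i <- B j) u i)%R) => //; try exact: dom_sum.
  by rewrite (le_lt_trans (hl j))// lte_fin.
rewrite sqnBC; try exact: dom_sum.
rewrite (le_lt_trans (small _ _ BC))// lte_fin (le_lt_trans _ hj)// ler_peMl ?exprn_ge0 ?invr_ge0//.
by rewrite ler1n.
Qed.

End sums.

End sqnormed_spaces.

Section direct_sum.
Context (R : realType) (V : lmodType R) (K : choiceType).
Variables (D : K -> set V) (N : K -> V -> \bar R).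
Hypothesis DN : forall k, sqnormed (D k) (N k).
Local Open Scope ereal_scope.

Definition dsum_norm (u : V) : \bar R := \esum_(k in setT) N k u.

Definition dsum_dom : set V := [set u | (forall k, D k u) /\ dsum_norm u < +oo].

Lemma sqnormed_dsum : sqnormed dsum_dom dsum_norm.
Proof.
have N0 k u : 0 <= N k u by apply: sqn_ge0 (DN k) _.
have NZ (c : R) u : (forall k, D k u) -> dsum_norm (c *: u)%R = (c ^+ 2)%:E * dsum_norm u.
  move=> Du; rewrite /dsum_norm -esumZl ?sqr_ge0//; apply: eq_esum => k _.
  by case: (DN k) => _ _ _ h _; exact: h.
have NDle (e : R) u v : (0 < e)%R -> (forall k, D k u) -> (forall k, D k v) ->
    dsum_norm (u + v)%R <= (1 + e)%:E * dsum_norm u + (1 + e^-1)%:E * dsum_norm v.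
  move=> e0 Du Dv; have e1 : (0 <= 1 + e)%R by rewrite addr_ge0// ltW.
  have e2 : (0 <= 1 + e^-1)%R by rewrite addr_ge0// invr_ge0 ltW.
  rewrite /dsum_norm -!esumZl// -esumD//.
  - by apply: le_esum => k _; apply: (sqnD_le (DN k)).
  - by move=> k _; rewrite mule_ge0.
  - by move=> k _; rewrite mule_ge0.
split=> //.
- split; last by rewrite /dsum_norm esum1// => k _; exact: sqn0 (DN k).
  split=> [k|]; first exact: dom0 (DN k).
  by rewrite /dsum_norm esum1// => k _; exact: sqn0 (DN k).
- move=> c u v [Du Nu] [Dv Nv]; split=> [k|]; first exact: (dom_lin (DN k)).
  have Dcu k : D k (c *: u)%R by exact: (domZ (DN k)).
  rewrite (le_lt_trans (NDle 1%R _ _ ltr01 Dcu Dv))// NZ//.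
  rewrite lte_add_pinfty// !lte_mul_pinfty// ?lee_fin ?sqr_ge0// ?addr_ge0 ?invr_ge0//.
- by split=> [u|u []//]; apply: esum_ge0.
- by move=> c u [Du _]; exact: NZ.
- by move=> e u v e0 [Du _] [Dv _]; exact: NDle.
Qed.

(** The components converge separately and the first hypothesis glues their limits into one vector.
    The tails need no uniformity, since the distance is estimated on finite sets of components. *)
Lemma sqcomplete_dsum :
  (forall l : K -> V, (forall k, D k (l k)) ->
     exists F, forall k, D k F /\ N k (F - l k)%R = 0) ->
  (forall k, sqcomplete (D k) (N k)) -> sqcomplete dsum_dom dsum_norm.
Proof.
move=> glue Nc u Du uC.
have N0 k v : 0 <= N k v by apply: sqn_ge0 (DN k) _.
have Nle k v : N k v <= dsum_norm v.
  by have := le_esum_fset (N^~ v) [fset k]%fset; rewrite big_seq_fset1.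
have [l hl] : exists l : K -> V, forall k, D k (l k) /\
    forall i, N k (l k - u i)%R <= (2 * 2^-1 ^+ i)%:E.
  suff h k : exists l, D k l /\ forall i, N k (l - u i)%R <= (2 * 2^-1 ^+ i)%:E.
    by have [l hl] := choice h; exists l.
  have [||l Dl hl] := Nc k u; last by exists l.
    by move=> j; case: (Du j).
  by move=> i j ij; rewrite (le_trans (Nle _ _))// uC.
have [F hF] := glue l (fun k => (hl k).1).
have Fu k i : N k (F - u i)%R <= (4 * 2^-1 ^+ i)%:E.
  have [Dl lu] := hl k; have [DF Fl] := hF k; have Dui : D k (u i) by case: (Du i).
  rewrite (le_trans (sqn_tri (DN k) DF Dl Dui))// Fl mule0 add0e.
  rewrite (le_trans (lee_wpmul2l _ (lu i)))// -EFinM lee_fin mulrA.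
  by rewrite ler_wpM2r ?exprn_ge0 ?invr_ge0// -natrM.
(* On a finite set of components, compare with [u m] for m so large that the errors 8 times 2^-m add
   up to less than e; what remains is 2 N(u m - u i) <= 2 times 2^-i. This is the origin of the
   factor 2 in [sqcomplete]. *)
have main i : dsum_norm (F - u i)%R <= (2 * 2^-1 ^+ i)%:E.
  apply: esum_le => A; apply/lee_addgt0Pr => e e0.
  have [j hj] := @half_pow_small R (8 * (#|` A|)%:R) e (mulr_ge0 (ler0n _ 8) (ler0n _ _)) e0.
  set m := maxn i j.
  rewrite (@le_trans _ _ (\sum_(k <- A) ((8 * 2^-1 ^+ m)%:E + 2%:E * N k (u m - u i)%R)))//.
    apply: lee_sum => k _; have [DF _] := hF k.
    have Dum : D k (u m) by case: (Du m). have Dui : D k (u i) by case: (Du i).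
    rewrite (le_trans (sqn_tri (DN k) DF Dum Dui))// leeD2r//.
    rewrite (le_trans (lee_wpmul2l _ (Fu k m)))// -EFinM lee_fin mulrA.
    by rewrite ler_wpM2r ?exprn_ge0 ?invr_ge0// -natrM.
  rewrite big_split/= addeC leeD//.
    rewrite -ge0_sume_distrr// EFinM lee_wpmul2l//.
    by rewrite (le_trans (le_esum_fset _ _))// uC// leq_maxl.
  rewrite sumEFin lee_fin big_const_seq count_predT iter_addr_0 -[X in (X <= _)%R]mulr_natr.
  by rewrite mulrAC ltW// hj// leq_maxr.
have DF : dsum_dom F.
  split=> [k|]; first by case: (hF k).
  have Du0 k : D k (u 0%N) by case: (Du 0%N).
  have DF k : D k F by case: (hF k).
  have h : dsum_dom (F - u 0%N)%R.
    split=> [k|]; first exact: (domB (DN k)).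
    by rewrite (le_lt_trans (main 0%N))// ltry.
  by have [_] := domD sqnormed_dsum h (Du 0%N); rewrite subrK.
by exists F.
Qed.

End direct_sum.

(** * Symmetrization *)

Section sums_over_permutations.

(** A permutation of n + 1 letters amounts to the image of the first letter and a permutation of the
    n others, as in the expansion of a determinant along a row. *)
Lemma sum_perm_recl (M : nmodType) n (F : 'S_n.+1 -> M) :
  \sum_p F p = \sum_j \sum_(p : 'S_n) F (lift_perm ord0 j p).
Proof.
rewrite (partition_big (fun p : 'S_n.+1 => p ord0) xpredT)//=.
apply: eq_bigr => j _; rewrite (reindex (lift_perm ord0 j)).
  by apply: eq_bigl => p; rewrite lift_perm_id eqxx.
(* Deleting [i] from the domain and [s i] from the range, with renumbering, inverts [lift_perm]. *)
pose ulsf i (s : 'S_n.+1) k := odflt k (unlift (s i) (s (lift i k))).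
have ulsfK i (s : 'S_n.+1) k : lift (s i) (ulsf i s k) = s (lift i k).
  rewrite /ulsf; have := neq_lift i k.
  by rewrite -(can_eq (permK s)) => /unlift_some[] ? ? ->.
have inj_ulsf : injective (ulsf ord0 _).
  move=> s; apply: can_inj (ulsf (s ord0) s^-1%g) _ => k'.
  by rewrite {1}/ulsf ulsfK !permK liftK.
exists (fun s => perm (inj_ulsf s)) => [s _ | s].
  by apply/permP => k'; rewrite permE /ulsf lift_perm_lift lift_perm_id liftK.
move/(s _ =P _) => si0; apply/permP => k.
case: (unliftP ord0 k) => [k'|] ->; rewrite ?lift_perm_id//.
by rewrite lift_perm_lift -si0 permE ulsfK.
Qed.

(** [Symn] and [block_sym] sum over permutations of [size s] letters; this moves the sum to the
    fixed type 'S_n. The predicate is given for all m so that it can be transported. *)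
Lemma sum_perm_seq (M : nmodType) (T : Type) n (t : n.-tuple T) (f : seq T -> M)
    (Q : forall m, pred 'S_m) :
  \sum_(p : 'S_(size t) | Q _ p) f (perm_seq p) =
  \sum_(p : 'S_n | Q _ p) f (permute_tuple p t).
Proof.
case: t => s es; have e := eqP es; move: es; rewrite -e {e} => es /=.
apply: eq_bigr => p _; congr f; apply: eq_map => i.
by congr (tnth _ _); apply: val_inj.
Qed.

Lemma permute_tupleM (T : Type) n (p r : 'S_n) (t : n.-tuple T) :
  permute_tuple p (permute_tuple r t) = permute_tuple (p * r)%g t.
Proof. by apply: eq_from_tnth => i; rewrite !tnth_mktuple permM. Qed.

Lemma permute_tuple_perm_eq (T : eqType) n (p : 'S_n) (t : n.-tuple T) :
  perm_eq (permute_tuple p t) t.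
Proof. by apply/tuple_permP; exists p. Qed.

End sums_over_permutations.

(** * Counting the permutations that preserve the blocks *)

Section counting_block_permutations.

(** The product of the factorials of the multiplicities, in the recursive form that an induction on
    the list produces. *)
Fixpoint fact_list (ks : seq nat) : nat :=
  if ks is k :: ks' then (count_mem k ks * fact_list ks')%N else 1%N.

Lemma fact_list_gt0 ks : (0 < fact_list ks)%N.
Proof. by elim: ks => //= k ks IH; rewrite eqxx muln_gt0 IH. Qed.

(** The first letter can go to any position of [ls] carrying the value [k], which gives the head
    factor; deleting that position leaves the same problem for shorter lists. *)
Lemma count_matching_perm n (ks ls : n.-tuple nat) : perm_eq ks ls ->
  (\sum_(p : 'S_n | [forall i, tnth ls (p i) == tnth ks i]) 1 = fact_list ks)%N.
Proof.
elim: n ks ls => [|n IH] ks ls ksls.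
  rewrite (bigD1 1%g)/=; last by apply/forallP => -[].
  rewrite [ks]tuple0/= big1// => p /andP[_ /eqP pn]; exfalso; apply: pn.
  by apply/permP => -[].
rewrite big_mkcond sum_perm_recl; case/tupleP : ks ksls => k ks ksls.
transitivity (\sum_(j < n.+1 | tnth ls j == k) fact_list ks)%N; last first.
  rewrite sum_nat_const mulnC /= mulnC; congr (_ * _)%N.
  rewrite -[RHS]/(count_mem k (k :: ks)); rewrite -[k :: ks]/(tval [tuple of k :: ks]) (seq.permP ksls).
  rewrite -sum1_card -sum1_count big_tuple.
  by apply: eq_bigl.
rewrite [RHS]big_mkcond; apply: eq_bigr => j _; case: ifPn => [/eqP ljk|ljk]; last first.
  rewrite big1// => p _; case: ifPn => // /forallP /(_ ord0).
  by rewrite lift_perm_id tnth0 (negbTE ljk).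
pose ls' := [tuple tnth ls (lift j i) | i < n].
have pls' : perm_eq ks ls'.
  rewrite -(perm_cons k) (perm_trans ksls)// perm_sym.
  rewrite (_ : k :: ls' = permute_tuple (lift_perm ord0 j 1%g) ls).
    exact: permute_tuple_perm_eq.
  rewrite /permute_tuple/= enum_ordSl/= lift_perm_id ljk; congr cons.
  rewrite -map_comp; apply: eq_map => i /=.
  by rewrite lift_perm_lift perm1.
rewrite -(IH _ _ pls') [RHS]big_mkcond; apply: eq_bigr => p _.
congr (if _ then _ else _); apply/forallP/forallP => h i.
  by have := h (lift ord0 i); rewrite lift_perm_lift tnth_mktuple tnthS.
case: (unliftP ord0 i) => [i'|] ->.
  by have := h i'; rewrite lift_perm_lift tnth_mktuple tnthS.
by rewrite lift_perm_id ljk tnth0.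
Qed.

Lemma fact_list_nseq a k ks : k \notin ks ->
  fact_list (nseq a k ++ ks) = (a`! * fact_list ks)%N.
Proof.
move=> kks; elim: a => [|a IH] /=; first by rewrite mul1n.
rewrite IH eqxx count_cat (count_memPn kks) addn0 count_nseq /= eqxx mul1n add1n.
by rewrite factS mulnA.
Qed.

Lemma fact_list_blocks (al : multiindex) : fact_list (blocks al) = fact_index al.
Proof.
rewrite /blocks /fact_index.
have -> : (\prod_(k <- finsupp al) (al k)`! = \prod_(k <- sort leq (finsupp al)) (al k)`!)%N.
  by apply: perm_big; rewrite perm_sym perm_sort.
have : uniq (sort leq (finsupp al)) by rewrite sort_uniq fset_uniq.
elim: (sort leq _) => [|k s IH] /=; first by rewrite big_nil.
move=> /andP[ks us]; rewrite big_cons fact_list_nseq ?IH//.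
apply/flattenP => -[_ /mapP[j js ->]]; rewrite mem_nseq => /andP[_ /eqP kj].
by rewrite kj js in ks.
Qed.

Lemma size_blocks (al : multiindex) : size (blocks al) = deg al.
Proof.
rewrite /blocks size_flatten /shape -map_comp /deg sumnE big_map.
under eq_bigr do rewrite /= size_nseq.
by apply: perm_big; rewrite perm_sort.
Qed.

Definition blocks_tuple (al : multiindex) : (deg al).-tuple nat :=
  tcast (size_blocks al) (in_tuple (blocks al)).

Lemma val_blocks_tuple al : blocks_tuple al = blocks al :> seq nat.
Proof. by rewrite val_tcast. Qed.

Lemma tnth_blocks al i : tnth (blocks_tuple al) i = block al i.
Proof. by rewrite (tnth_nth 0%N) val_blocks_tuple. Qed.

(** For m = [deg al] this is the Young subgroup of type al_0, al_1, ..., of order al_0! al_1! ... *)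
Definition block_perm (al : multiindex) m : pred 'S_m :=
  fun p => [forall i, block al (p i) == block al i].

Lemma count_block_perm al :
  (\sum_(p : 'S_(deg al) | block_perm al p) 1 = fact_index al)%N.
Proof.
rewrite -fact_list_blocks -val_blocks_tuple -(@count_matching_perm _ _ (blocks_tuple al))//.
by apply: eq_bigl => p; apply: eq_forallb => i; rewrite !tnth_blocks.
Qed.

Lemma block_permM al m (p r : 'S_m) : block_perm al p -> block_perm al r ->
  block_perm al (p * r)%g.
Proof.
move=> /forallP hp /forallP hr; apply/forallP => i.
by rewrite permM (eqP (hr _)) (eqP (hp _)).
Qed.

Lemma block_permV al m (p : 'S_m) : block_perm al p -> block_perm al (p^-1)%g.
Proof.
move=> /forallP hp; apply/forallP => i.
by rewrite -(eqP (hp _)) permKV.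
Qed.

End counting_block_permutations.

Section symmetrization.
Context (R : realType) (T : Type).
Implicit Types f g : seq T -> R^o.

Definition sym_tuple n (f : n.-tuple T -> R) (t : n.-tuple T) : R :=
  n`!%:R^-1 * \sum_(p : 'S_n) f (permute_tuple p t).

Definition bsym_tuple (al : multiindex) n (f : n.-tuple T -> R) (t : n.-tuple T) : R :=
  (fact_index al)%:R^-1 * \sum_(p : 'S_n | block_perm al p) f (permute_tuple p t).

Lemma Symn_tuple n f (t : n.-tuple T) : Symn f t = sym_tuple (component n f) t.
Proof.
by rewrite /Symn (sum_perm_seq t f (fun _ _ => true)) size_tuple.
Qed.

Lemma block_sym_tuple al n f (t : n.-tuple T) :
  block_sym al f t = bsym_tuple al (component n f) t.
Proof. by rewrite /block_sym (sum_perm_seq t f (block_perm al)). Qed.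

Lemma component_Symn n f : component n (Symn f) = sym_tuple (component n f).
Proof. by apply/funext => t; exact: Symn_tuple. Qed.

Lemma component_block_sym al n f :
  component n (block_sym al f) = bsym_tuple al (component n f).
Proof. by apply/funext => t; exact: block_sym_tuple. Qed.

Lemma sym_tuple_perm n (f : n.-tuple T -> R) (p : 'S_n) t :
  sym_tuple f (permute_tuple p t) = sym_tuple f t.
Proof.
rewrite /sym_tuple; congr (_ * _); rewrite [RHS](reindex_inj (mulIg p))/=.
by apply: eq_bigr => r _; rewrite permute_tupleM.
Qed.

Lemma sym_tuple_comp n (f : n.-tuple T -> R) (p : 'S_n) t :
  sym_tuple (fun t => f (permute_tuple p t)) t = sym_tuple f t.
Proof.
rewrite /sym_tuple; congr (_ * _); rewrite [RHS](reindex_inj (mulgI p))/=.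
by apply: eq_bigr => r _; rewrite permute_tupleM.
Qed.

Lemma sym_tuple_id n (f : n.-tuple T -> R) :
  (forall p t, f (permute_tuple p t) = f t) -> sym_tuple f = f.
Proof.
move=> fs; apply/funext => t; rewrite /sym_tuple.
under eq_bigr do rewrite fs.
rewrite sumr_const card_Sn -[f t *+ _]mulr_natl mulrA mulVf ?mul1r//.
Qed.

Lemma bsym_tuple_perm al n (f : n.-tuple T -> R) (p : 'S_n) t : block_perm al p ->
  bsym_tuple al f (permute_tuple p t) = bsym_tuple al f t.
Proof.
move=> bp; rewrite /bsym_tuple; congr (_ * _); rewrite [RHS](reindex_inj (mulIg p))/=.
apply: eq_big => [r|r _]; last by rewrite permute_tupleM.
apply/idP/idP => [br|/block_permM/(_ (block_permV bp))]; first exact: block_permM.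
by rewrite mulgK.
Qed.

Lemma fact_index_neq0 al : (fact_index al)%:R != 0 :> R.
Proof. by rewrite pnatr_eq0 -lt0n -fact_list_blocks fact_list_gt0. Qed.

Lemma bsym_tuple_id al (f : (deg al).-tuple T -> R) :
  (forall p t, block_perm al p -> f (permute_tuple p t) = f t) -> bsym_tuple al f = f.
Proof.
move=> fs; apply/funext => t; rewrite /bsym_tuple.
rewrite (eq_bigr (fun=> 1%:R * f t)); last by move=> p bp; rewrite fs// mul1r.
by rewrite -mulr_suml -natr_sum count_block_perm mulrA mulVf ?mul1r// fact_index_neq0.
Qed.

End symmetrization.

Section symmetric_functions.
Context (R : realType) (T : eqType).
Implicit Types F : seq T -> R^o.

Definition symmetric F := forall s s', perm_eq s s' -> F s = F s'.

(** On symmetric F and sequences of length n + 1 this is n + 1 times the creation operator: one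
    point of s is consumed by h, the others by F. The recursion changes F into F (y :: _), so F has
    to stay arbitrary in inductions. *)
Fixpoint crea (h : T -> R) F (s : seq T) : R :=
  if s is y :: s' then h y * F s' + crea h (fun t => F (y :: t)) s' else 0.

Lemma crea_cat h F s1 s2 : crea h F (s1 ++ s2) =
  crea h (fun t => F (t ++ s2)) s1 + crea h (fun t => F (s1 ++ t)) s2.
Proof.
elim: s1 F => [|y s1 IH] F /=; first by rewrite add0r.
by rewrite IH addrA.
Qed.

Lemma eq_crea h F G s : (forall t, F t = G t) -> crea h F s = crea h G s.
Proof. by move=> FG; congr crea; apply/funext. Qed.

(** Permutations are generated by exchanges of adjacent segments, and [crea_cat] distributes the
    consumed point over the segments. *)
Lemma symmetric_crea h F : symmetric F -> symmetric (crea h F).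
Proof.
move=> sF s s' /(catCA_perm_subst _); apply => s1 s2 s3.
rewrite !crea_cat addrCA; congr (_ + (_ + _)); apply: eq_crea => t; apply: sF.
- by rewrite perm_catCA.
- by rewrite perm_catCA.
- by rewrite perm_catCA.
Qed.

Lemma crea_nth h F s : crea h F s =
  \sum_(j < size s) h (tnth (in_tuple s) j) * F (take j s ++ drop j.+1 s).
Proof.
elim: s F => [|y s IH] F; first by rewrite big_ord0.
rewrite /= IH big_ord_recl/= drop0; congr (_ * _ + _).
apply: eq_bigr => i _; congr (h _ * _).
by rewrite !(tnth_nth y).
Qed.

(** Permutations are grouped by the point j put in front; the n! arrangements of the other points
    give the same value of the symmetric F, and n! / (n + 1)! is the factor on the right. *)
Lemma sym_tuple_crea n h F (t : n.+1.-tuple T) : symmetric F ->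
  sym_tuple (component n.+1 (fun s => if s is y :: s' then h y * F s' else 0)) t =
  n.+1%:R^-1 * crea h F t.
Proof.
move=> sF; rewrite /sym_tuple sum_perm_recl crea_nth factS natrM invfM -mulrA.
congr (_ * _); rewrite mulr_sumr.
transitivity (\sum_(j < n.+1) h (tnth t j) * F (take j t ++ drop j.+1 t)); last first.
  case: t => s es; have e := eqP es; move: es; rewrite -e {e} => es /=.
  apply: eq_bigr => i _; congr (h _ * _).
  by congr (tnth _ _); apply: val_inj.
apply: eq_bigr => j _.
rewrite (eq_bigr (fun=> h (tnth t j) * F (take j t ++ drop j.+1 t))).
  set c := (h _ * F _); rewrite sumr_const card_Sn -[c *+ _]mulr_natl mulrA mulVf ?mul1r//.
move=> p _; rewrite /component /permute_tuple/= enum_ordSl/= lift_perm_id.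
congr (_ * _); apply: sF; rewrite -(perm_cons (tnth t j)).
apply: (@perm_trans _ t).
  have := permute_tuple_perm_eq (lift_perm ord0 j p) t.
  by rewrite /permute_tuple/= enum_ordSl/= lift_perm_id.
rewrite perm_sym -cat_cons -cat1s -catA perm_catCA cat1s.
rewrite (tnth_nth (tnth t j)) -drop_nth ?cat_take_drop//.
by rewrite size_tuple.
Qed.

Lemma Symn_symmetric F : symmetric F -> Symn F = F.
Proof.
move=> sF; apply/funext => s.
rewrite -[s]/(tval (in_tuple s)) Symn_tuple sym_tuple_id// => p t.
by apply: sF; exact: permute_tuple_perm_eq.
Qed.

End symmetric_functions.

(** * Orthogonal polynomials with a parameter *)

Section measurable_inverse.
Context (R : realType).

(** The continuous functions x / (x^2 + 1/(n + 1)) converge pointwise to 1/x, also at x = 0 where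
    the inverse is 0 by convention. *)
Lemma measurable_inv : measurable_fun setT (fun x : R => x^-1).
Proof.
pose e (n : nat) : R := n.+1%:R^-1.
have e0 n : 0 < e n by rewrite invr_gt0.
apply: (measurable_fun_cvg (h := fun n (x : R) => x / (x ^+ 2 + e n))) => [n|x _].
  apply: continuous_measurable_fun => x; apply: cvgM; first exact: cvg_id.
  apply: cvgV; first by rewrite gt_eqF// ltr_wpDl// sqr_ge0.
  by apply: cvgD; [exact: exprn_continuous|exact: cvg_cst].
have [->|x0] := eqVneq x 0.
  by rewrite invr0; under eq_fun do rewrite mul0r; exact: cvg_cst.
rewrite [X in _ --> X](_ : _ = x / (x ^+ 2 + 0)); last first.
  by rewrite addr0 expr2 invfM mulrA mulfV// mul1r.
apply: cvgM; first exact: cvg_cst.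
apply: cvgV; first by rewrite addr0 expf_neq0.
by apply: cvgD; [exact: cvg_cst|exact: cvg_harmonic].
Qed.

Lemma measurable_funV d (T : measurableType d) (f : T -> R) :
  measurable_fun setT f -> measurable_fun setT (fun x => (f x)^-1).
Proof. exact: measurableT_comp measurable_inv. Qed.

End measurable_inverse.

(** * The moment functional and the support of a measure on the line *)

Section moment_functional.
Context (R : realType) (P : {measure set R -> \bar R}).
Hypothesis P1 : P setT = 1%E.
Hypothesis Pmom : forall n, (\int[P]_s (`|s| ^+ n)%:E < +oo)%E.
Implicit Types p : {poly R}.

Lemma measurable_horner p : measurable_fun setT (horner p).
Proof.
rewrite (_ : horner p = fun s => \sum_(i < size p) p`_i * s ^+ i); last first.
  by apply/funext => s; rewrite horner_coef.
by apply: measurable_sum => i; apply: measurable_funM => //; exact: measurable_funX.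
Qed.

Lemma integrable_horner p : P.-integrable setT (EFin \o horner p).
Proof.
rewrite (_ : EFin \o _ = (fun s => \sum_(i < size p) (p`_i * s ^+ i)%:E)%E); last first.
  by apply/funext => s /=; rewrite horner_coef sumEFin.
apply: integrable_sum => // i _.
rewrite (_ : (fun s => _) = (fun s => (p`_i)%:E * (s ^+ i)%:E)%E); last first.
  by apply/funext => s; rewrite EFinM.
apply: integrableZl => //; apply/integrableP; split.
  by apply/measurable_EFinP; exact: measurable_funX.
by rewrite (le_lt_trans _ (Pmom i))//; under eq_integral do rewrite /= normrX.
Qed.

Definition mom_fun p : R := \int[P]_s p.[s].

Lemma mom_funE p : ((mom_fun p)%:E = \int[P]_s p.[s]%:E)%E.
Proof.
by rewrite /mom_fun /Rintegral fineK//; apply: integrable_fin_num => //; exact: integrable_horner.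
Qed.

Lemma mom_funD p p' : mom_fun (p + p') = mom_fun p + mom_fun p'.
Proof.
rewrite /mom_fun -RintegralD//; try exact: integrable_horner.
by apply: eq_Rintegral => s _; rewrite hornerD.
Qed.

Lemma mom_funZ c p : mom_fun (c *: p) = c * mom_fun p.
Proof.
rewrite /mom_fun -RintegralZl//; try exact: integrable_horner.
by apply: eq_Rintegral => s _; rewrite hornerZ.
Qed.

Lemma mom_fun0 : mom_fun 0 = 0.
Proof. by rewrite -(scale0r (1 : {poly R})) mom_funZ mul0r. Qed.

Lemma mom_fun_sum (I : Type) (r : seq I) (F : I -> {poly R}) :
  mom_fun (\sum_(i <- r) F i) = \sum_(i <- r) mom_fun (F i).
Proof.
by elim: r => [|i r IH]; rewrite ?big_nil ?mom_fun0// !big_cons mom_funD IH.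
Qed.

(** A point outside the support has a null neighbourhood, hence lies in a null ball with rational
    centre and radius 1/(n + 1); there are countably many of these. *)
Lemma ae_msupport : {ae P, forall s, msupport P s}.
Proof.
pose U (z : rat * nat) : set R := ball (ratr z.1 : R) (z.2.+1%:R^-1).
pose F k : set R := if (choice.unpickle k : option (rat * nat)) is Some z then
  (if P (U z) == 0%E then U z else set0) else set0.
have FE z : F (choice.pickle z) = if P (U z) == 0%E then U z else set0.
  by rewrite /F choice.pickleK.
have nF k : P.-negligible (F k).
  rewrite /F; case: (choice.unpickle k : option (rat * nat)) => [z|]; last exact: negligible_set0.
  case: ifPn => [/eqP Uz|_]; last exact: negligible_set0.
  by exists (U z); split => //; exact: measurable_ball.
suff : P.-negligible (~` (msupport P)) by [].
apply: negligibleS (negligible_bigcup nF).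
move=> s /existsNP[e /not_implyP[e0 /negP]]; rewrite -leNgt => Pe.
have {Pe} Pe : P (ball s e) = 0%E by apply/eqP; rewrite eq_le Pe measure_ge0.
have [n ne] : exists n, n.+1%:R^-1 < e / 2.
  have [n _ /(_ n (leqnn n))/= h] := near_infty_natSinv_lt (PosNum (divr_gt0 e0 (ltr0n R 2))).
  by exists n.
have n0 : 0 < n.+1%:R^-1 :> R by rewrite invr_gt0.
have UE r : U (r, n) = ball (ratr r : R) n.+1%:R^-1 by [].
move: (n.+1%:R^-1 : R) n0 ne UE => k k0 ke UE.
have [r] : exists r : rat, ratr r \in `](s - k), (s + k)[%R.
  by apply: rat_in_itvoo; lra.
rewrite in_itv/= => /andP[sr rs].
have sU : U (r, n) s by rewrite UE /ball/= ltr_distlC; apply/andP; lra.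
suff PU0 : P (U (r, n)) = 0%E.
  by exists (choice.pickle (r, n)); [exact: Logic.I|rewrite FE PU0 eqxx].
apply: (subset_measure0 _ _ _ Pe); try exact: measurable_ball.
move=> y; rewrite UE /ball/= => yr; move: sU; rewrite UE /ball/= => sr'.
rewrite -(subrK (ratr r) s) -addrA (le_lt_trans (ler_normD _ _))//.
by rewrite distrC in sr'; lra.
Qed.

(** This lets relations that are given on the support only, such as the recurrence, be used under
    the integral. *)
Lemma eq_mom_fun p p' : (forall s, msupport P s -> p.[s] = p'.[s]) ->
  mom_fun p = mom_fun p'.
Proof.
move=> pp'; rewrite /mom_fun /Rintegral; congr fine; apply: ae_eq_integral => //.
- by apply/measurable_EFinP; exact: measurable_horner.
- by apply/measurable_EFinP; exact: measurable_horner.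
- by apply: filterS ae_msupport => s /pp' -> _.
Qed.

Lemma mom_fun_sqr_ge0 p : 0 <= mom_fun (p ^+ 2).
Proof. by apply: Rintegral_ge0 => s _; rewrite horner_exp sqr_ge0. Qed.

(** By continuity |p| stays above |p(s)| / 2 on a ball around s, and that ball has positive
    measure. *)
Lemma mom_fun_sqr_gt0 p s : msupport P s -> p.[s] != 0 -> 0 < mom_fun (p ^+ 2).
Proof.
move=> Ps ps; have p2 : 0 < `|p.[s]| / 2 by rewrite divr_gt0 ?normr_gt0.
have /cvgrPdist_lt/(_ _ p2) [e /= e0 he] : {for s, continuous (horner p)}.
  exact: continuous_horner.
have Pball := Ps _ e0.
rewrite -lte_fin mom_funE.
apply: (@lt_le_trans _ _ (\int[P]_(t in ball s e) ((`|p.[s]| / 2) ^+ 2)%:E)%E).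
  rewrite integral_cst//; last exact: measurable_ball.
  by rewrite mule_gt0// lte_fin exprn_gt0.
rewrite [leRHS](_ : _ = \int[P]_t ((p.[t] ^+ 2)%:E))%E; last first.
  by apply: eq_integral => t _; rewrite horner_exp.
apply: (@le_trans _ _ (\int[P]_(t in ball s e) ((p.[t] ^+ 2)%:E))%E); last first.
  apply: ge0_subset_integral => //; first exact: measurable_ball.
    by apply/measurable_EFinP; apply: measurable_funX; exact: measurable_horner.
  by move=> t _; rewrite lee_fin sqr_ge0.
apply: ge0_le_integral => //; first exact: measurable_ball.
- by apply/measurable_EFinP; apply: measurable_funTS; apply: measurable_funX; exact: measurable_horner.
move=> t st; rewrite lee_fin -[leRHS]real_normK ?num_real// lerXn2r ?nnegrE ?normr_ge0 ?ltW//.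
have := he t st; have := ler_normD (p.[s] - p.[t]) p.[t]; rewrite subrK; lra.
Qed.

Lemma mom_fun_sqr_eq0 p : mom_fun (p ^+ 2) = 0 ->
  forall s, msupport P s -> p.[s] = 0.
Proof.
move=> p0 s Ps; apply/eqP; apply: contraT => /(mom_fun_sqr_gt0 Ps).
by rewrite p0 ltxx.
Qed.

(** A nonzero polynomial of degree at most n has at most n roots. *)
Lemma poly_support_card p n : p != 0 -> (size p <= n.+1)%N ->
  (forall s, msupport P s -> p.[s] = 0) -> (msupport P #<= `I_n)%card.
Proof.
move=> p0 pn pS.
have Bn (B : {fset R}) : [set` B] `<=` msupport P -> (#|` B| <= n)%N.
  move=> BS; rewrite -ltnS (leq_trans _ pn)//; apply: max_poly_roots => //; last exact: fset_uniq.
  by apply/allP => s sB; apply/rootP/pS/BS.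
have [/finite_setP[k Sk]|infS] := pselect (finite_set (msupport P)); last first.
  have [B /Bn BS nB] := infinite_set_fset n.+1 infS.
  by have := leq_trans nB BS; rewrite ltnn.
have finS : finite_set (msupport P) by apply/finite_setP; exists k.
have := Bn (fset_set (msupport P)); rewrite (card_fset_set Sk) fset_setK// => /(_ (@subset_refl _ _)) kn.
by rewrite (card_le_eql Sk) card_le_II.
Qed.

Lemma msupport_nonempty : ~ (msupport P #<= `I_0)%card.
Proof.
rewrite II0 card_le0 => /eqP S0.
have : {ae P, forall s : R, False} by apply: filterS ae_msupport => s; rewrite S0.
move=> [N [mN PN]] sub; have : P setT = 0%E.
  by apply: (subset_measure0 _ _ _ PN) => // s _; apply: sub.
by rewrite P1 => /eqP; rewrite onee_eq0.
Qed.

End moment_functional.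

Section boxes.
Context (R : realType) (d : nat).

Definition box (M : R) : set (d.-tuple R) := [set x | forall i, `|tnth x i| <= M].

Lemma measurable_box M : measurable (box M).
Proof.
rewrite (_ : box M = rect (fun=> `[- M, M]%classic)).
  by apply: measurable_rect => i; exact: measurable_itv.
by apply/seteqP; split => x /= xM i; have := xM i; rewrite /= in_itv/= ler_norml.
Qed.

Lemma bounded_borel_box M : bounded_borel (box M).
Proof. by split; [exact: measurable_box|exists M]. Qed.

Lemma in_box (x : d.-tuple R) : exists M, box M x.
Proof.
exists (\sum_i `|tnth x i|) => i.
by rewrite (bigD1 i)//= lerDl sumr_ge0.
Qed.

Lemma le_box (M N : R) : M <= N -> box M `<=` box N.
Proof. by move=> MN x xM i; exact: le_trans (xM i) MN. Qed.

Lemma bounded_borelP (L : set (d.-tuple R)) :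
  bounded_borel L <-> measurable L /\ exists M, L `<=` box M.
Proof. by split=> -[mL [M LM]]; split => //; exists M => x /LM. Qed.

Lemma leb_box_lty M : (leb R d (box M) < +oo)%E.
Proof.
rewrite (_ : box M = rect (fun=> `[- M, M]%classic)); last first.
  by apply/seteqP; split => x /= xM i; have := xM i; rewrite /= in_itv/= ler_norml.
rewrite /leb tuple_prod_rect; last by move=> i; exact: measurable_itv.
have fin : (leb1 (`[(- M)%R, M]%classic : set R) < +oo)%E.
  rewrite /leb1 lebesgue_measure_itv/=; case: ifP => // _.
  by rewrite -EFinB ltry.
elim: d => [|n IH]; first by rewrite big_ord0 ltry.
by rewrite big_ord_recl lte_mul_pinfty// ge0_fin_numE.
Qed.

End boxes.

Section orthogonal_polynomials.
Context (R : realType) (d : nat) (sigma : R.-pker (d.-tuple R) ~> R).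
Hypothesis sigma_moments : moment_bound sigma.
Variables (q : nat -> d.-tuple R -> {poly R}) (a b : nat -> d.-tuple R -> R).
Hypothesis q_orthogonal : monic_orthogonal sigma q a b.
Local Notation E := (d.-tuple R).
Local Notation supp x := (msupport (sigma x)).
Local Notation L x := (mom_fun (sigma x)).

Lemma sigma_mom x n : (\int[sigma x]_s (`|s| ^+ n)%:E < +oo)%E.
Proof.
have [M xM] := in_box x; have [C C0 hC] := sigma_moments (bounded_borel_box d M).
by rewrite (le_lt_trans (hC n x xM))// ltry.
Qed.
Local Hint Resolve sigma_mom : core.

Lemma sigmaT x : sigma x setT = 1%E. Proof. exact: prob_kernel. Qed.

Definition qnorm n x : R := L x (q n x ^+ 2).

Lemma qnormE n x : ((qnorm n x)%:E = \int[sigma x]_s ((q n x).[s] ^+ 2)%:E)%E.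
Proof.
by rewrite /qnorm mom_funE//; apply: eq_integral => s _; rewrite horner_exp.
Qed.

Lemma qnorm_ge0 n x : 0 <= qnorm n x. Proof. exact: mom_fun_sqr_ge0. Qed.

Lemma q_small n x : (supp x #<= `I_n)%card -> q n x = 0.
Proof. by case: (q_orthogonal x) => _ h _ _ _; exact: h. Qed.

Lemma q_monic n x : ~ (supp x #<= `I_n)%card -> q n x \is monic /\ size (q n x) = n.+1.
Proof. by case: (q_orthogonal x) => h _ _ _ _; exact: h. Qed.

Lemma size_q n x : (size (q n x) <= n.+1)%N.
Proof.
have [/q_small ->|/q_monic[_ ->]//] := pselect (supp x #<= `I_n)%card.
by rewrite size_poly0.
Qed.

(** If the support has more than n points, q^(n) is monic of degree n and cannot vanish on it. The
    degenerate case is thereby detected by a function of x whose measurability can be proved. *)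
Lemma qnorm_neq0 n x : (qnorm n x != 0) <-> ~ (supp x #<= `I_n)%card.
Proof.
split=> [w0 /q_small q0|nS]; first by move: w0; rewrite /qnorm q0 expr0n/= mom_fun0 ?eqxx.
apply/eqP => w0; apply: nS.
have [//|nS'] := pselect (supp x #<= `I_n)%card.
apply: (poly_support_card (p := q n x)); rewrite ?size_q//.
  by rewrite -size_poly_gt0; have [_ ->] := q_monic nS'.
exact: mom_fun_sqr_eq0.
Qed.

Lemma q_eq0 n x : qnorm n x = 0 -> q n x = 0.
Proof.
move=> w0; apply: q_small; apply: contrapT => /qnorm_neq0.
by rewrite w0 eqxx.
Qed.

Lemma qnorm_pred n x : qnorm n.+1 x != 0 -> qnorm n x != 0.
Proof.
move=> /qnorm_neq0 nS; apply/qnorm_neq0 => S; apply: nS.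
by apply: card_le_trans S _; rewrite card_le_II.
Qed.

Lemma q0E x : q 0 x = 1.
Proof.
have [qm /eqP/size_poly1P[c c0 qc]] := q_monic (msupport_nonempty (sigmaT x)).
by move: qm; rewrite qc monicE lead_coefC => /eqP ->.
Qed.

Lemma L_orth n m x : n != m -> L x (q n x * q m x) = 0.
Proof.
move=> nm; case: (q_orthogonal x) => _ _ /(_ n m nm) h _ _; rewrite -[RHS]h.
by apply: eq_Rintegral => s _; rewrite hornerM.
Qed.

Lemma q_rec n x s : supp x s -> s * (q n x).[s] =
  (q n.+1 x).[s] + b n x * (q n x).[s] + (if n is n'.+1 then a n x * (q n' x).[s] else 0).
Proof.
case: (q_orthogonal x) => _ _ _ [h0 h1] _ Ss; case: n => [|n]; last exact: h1.
by rewrite h0// q0E hornerC mulr1 addr0.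
Qed.

Lemma L_Xqq n m x : L x ('X * q n x * q m x) =
  L x (q n.+1 x * q m x) + b n x * L x (q n x * q m x) +
  (if n is n'.+1 then a n x * L x (q n' x * q m x) else 0).
Proof.
pose p : {poly R} := q n.+1 x * q m x + b n x *: (q n x * q m x) +
  (if n is n'.+1 then a n x *: (q n' x * q m x) else 0).
transitivity (L x p).
  apply: eq_mom_fun => // s Ss; rewrite !hornerM hornerX q_rec// /p !hornerD hornerZ !hornerM.
  by case: n {p} => [|n]; rewrite ?horner0 ?hornerZ ?hornerM; ring.
rewrite /p !mom_funD// mom_funZ//; congr (_ + _).
by case: n {p} => [|n]; rewrite ?mom_fun0 ?mom_funZ.
Qed.

Lemma L_Xqq_diag n x : L x ('X * q n x * q n x) = b n x * qnorm n x.
Proof.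
rewrite L_Xqq L_orth ?gtn_eqF// add0r -expr2.
by case: n => [|n]; rewrite ?addr0// L_orth ?mulr0 ?addr0// ltn_eqF.
Qed.

Lemma L_Xqq_low n x : L x ('X * q n.+1 x * q n x) = a n.+1 x * qnorm n x.
Proof.
by rewrite L_Xqq [X in X + _ + _]L_orth ?gtn_eqF// ?(ltn_trans (ltnSn n))// L_orth ?gtn_eqF// mulr0 !add0r -expr2.
Qed.

(** The integral of s q^(n+1) q^(n) is computed twice, once by the recurrence for s q^(n+1) and once
    by that for s q^(n). Iterated, ||q^(n)||^2 = a_1 ... a_n. *)
Lemma qnormS n x : qnorm n.+1 x = a n.+1 x * qnorm n x.
Proof.
rewrite -L_Xqq_low mulrAC L_Xqq -expr2 L_orth ?ltn_eqF// mulr0 addr0.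
by case: n => [|n]; rewrite ?addr0// L_orth ?mulr0 ?addr0// ltn_eqF// ltnW.
Qed.

(** Local boundedness of the a_n is converted here into local boundedness of the density of rho_n,
    one factor a_n at a time. Absolute values are taken because a bound over an empty D may be
    negative. *)
Lemma qnorm_bounded n (D : set E) :
  (forall (n : nat) (D : set E), (0 < n)%N -> bounded_borel D ->
     exists C : R, forall x, D x -> a n x <= C) ->
  bounded_borel D -> exists C : R, forall x, D x -> qnorm n x <= C.
Proof.
move=> a_bounded bD; elim: n => [|n [C hC]].
  exists 1 => x _; rewrite /qnorm q0E expr1n /mom_fun.
  by under eq_Rintegral do rewrite hornerC; rewrite Rintegral_cst// sigmaT mulr1.
have [C' hC'] := a_bounded n.+1 D isT bD; exists (`|C'| * `|C|) => x Dx.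
rewrite qnormS.
have an : `|a n.+1 x| <= `|C'|.
  case: (q_orthogonal x) => _ _ _ _ /(_ n.+1 isT)[h1 h2].
  have a0 : 0 <= a n.+1 x by have [/h2 ->|/h1/ltW] := pselect (supp x #<= `I_n.+1)%card.
  by rewrite ger0_norm// (le_trans (hC' x Dx))// ler_norm.
rewrite (le_trans (ler_norm _))// normrM ler_pM// ger0_norm ?qnorm_ge0//.
by rewrite (le_trans (hC x Dx))// ler_norm.
Qed.

Section measurability.

(* [q n x] is measurable in x because the coefficients of the recurrence are ratios of
   moments wherever they matter. *)
Definition mcoef (p : E -> {poly R}) :=
  (exists N, forall x, (size (p x) <= N)%N) /\
  forall i, measurable_fun setT (fun x => (p x)`_i).

Lemma mcoefM p p' : mcoef p -> mcoef p' -> mcoef (fun x => p x * p' x).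
Proof.
move=> [[N pN] mp] [[N' pN'] mp']; split.
  exists (N + N')%N => x; rewrite (leq_trans (size_mul_leq _ _))//.
  by rewrite (leq_trans (leq_pred _))// leq_add.
move=> i; under eq_fun do rewrite coefM.
by apply: measurable_sum => j; exact: measurable_funM.
Qed.

Lemma mcoefD p p' : mcoef p -> mcoef p' -> mcoef (fun x => p x + p' x).
Proof.
move=> [[N pN] mp] [[N' pN'] mp']; split.
  exists (maxn N N') => x; rewrite (leq_trans (size_polyD _ _))//.
  by rewrite geq_max !leq_max pN pN' orbT.
by move=> i; under eq_fun do rewrite coefD; exact: measurable_funD.
Qed.

Lemma mcoefZ (c : E -> R) p : measurable_fun setT c -> mcoef p ->
  mcoef (fun x => c x *: p x).
Proof.
move=> mc [[N pN] mp]; split.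
  by exists N => x; rewrite (leq_trans (size_scale_leq _ _)).
by move=> i; under eq_fun do rewrite coefZ; exact: measurable_funM.
Qed.

Lemma mcoef_cst p : mcoef (fun=> p).
Proof. by split; first by exists (size p). Qed.

Lemma measurable_mcoef p : mcoef p ->
  measurable_fun setT (fun y : E * R => (p y.1).[y.2]).
Proof.
move=> [[N pN] mp].
rewrite (_ : (fun y => _) = fun y : E * R => \sum_(i < N) (p y.1)`_i * y.2 ^+ i).
  apply: measurable_sum => i; apply: measurable_funM; last first.
    by apply: measurable_funX; exact: measurable_snd.
  exact: (measurableT_comp (mp i)).
by apply/funext => y; rewrite (horner_coef_wide _ (pN _)).
Qed.

Lemma measurable_Rintegral_sigma (g : E * R -> R) : measurable_fun setT g ->
  measurable_fun setT (fun x => \int[sigma x]_s g (x, s)).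
Proof.
move=> mg; apply: (@measurableT_comp _ _ _ _ _ _ (@fine R)) => //.
under eq_fun do rewrite integralE.
apply: emeasurable_funB.
  have mp : measurable_fun setT ((EFin \o g)^\+)%E.
    by apply: measurable_funepos; exact/measurable_EFinP.
  have := measurable_integral_pker sigma mp (funepos_ge0 _); congr (measurable_fun _ _).
  by apply/funext => x; apply: eq_integral => s _; rewrite !funeposE.
have mn : measurable_fun setT ((EFin \o g)^\-)%E.
  by apply: measurable_funeneg; exact/measurable_EFinP.
have := measurable_integral_pker sigma mn (funeneg_ge0 _); congr (measurable_fun _ _).
by apply/funext => x; apply: eq_integral => s _; rewrite !funenegE.
Qed.

Lemma measurable_L p : mcoef p -> measurable_fun setT (fun x => L x (p x)).
Proof. by move/measurable_mcoef/measurable_Rintegral_sigma. Qed.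

(** Where the norm does not vanish these quotients are b_n and a_n. They replace them because b_n(x)
    is arbitrary once the support has at most n points, and so need not be measurable in x. *)
Let B n x := L x ('X * q n x * q n x) / qnorm n x.
Let A n x := if n is n'.+1 then L x ('X * q n x * q n' x) / qnorm n' x else 0.
Let r n x : {poly R} := 'X * q n x + (- B n x) *: q n x +
  (- A n x) *: (if n is n'.+1 then q n' x else 0).

Let r_supp n x s : qnorm n x != 0 -> supp x s -> (q n.+1 x).[s] = (r n x).[s].
Proof.
move=> wn Ss; have BE : B n x = b n x by rewrite /B L_Xqq_diag mulfK.
rewrite /r !hornerD !hornerZ hornerM hornerX q_rec// BE.
case: n wn {BE} => [|n] wn; first by rewrite horner0; ring.
have -> : A n.+1 x = a n.+1 x by rewrite /A L_Xqq_low mulfK// qnorm_pred.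
by ring.
Qed.

Let size_r n x : (size (r n x) <= n.+2)%N.
Proof.
rewrite /r (leq_trans (size_polyD _ _))// geq_max; apply/andP; split; last first.
  rewrite (leq_trans (size_scale_leq _ _))//.
  by case: n => [|n]; rewrite ?size_poly0// (leq_trans (size_q _ _))// leqW.
rewrite (leq_trans (size_polyD _ _))// geq_max; apply/andP; split; last first.
  by rewrite (leq_trans (size_scale_leq _ _))// (leq_trans (size_q _ _)).
by rewrite (leq_trans (size_mul_leq _ _))// size_polyX/= ltnS size_q.
Qed.

(** If ||q^(n+1)|| is not 0, the support has more than n + 1 points, while q^(n+1) and [r n] agree
    on it and have degree at most n + 1; so they agree as polynomials. *)
Let qS n x : q n.+1 x = if qnorm n.+1 x != 0 then r n x else 0.
Proof.
case: ifPn => [w1|/negPn/eqP/q_eq0//]; apply/eqP; rewrite -subr_eq0; apply/negPn/negP => h.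
move/qnorm_neq0 : (w1); apply; apply: (poly_support_card h).
  by rewrite (leq_trans (size_polyD _ _))// geq_max size_q size_polyN size_r.
move=> s Ss; rewrite hornerD hornerN (r_supp _ Ss) ?subrr//.
exact: qnorm_pred.
Qed.

Let measurable_neq0 (f : E -> R) : measurable_fun setT f ->
  measurable_fun setT (fun x => (f x != 0)%:R : R).
Proof.
move=> mf; rewrite (_ : (fun x => _) = \1_(~` (f @^-1` [set 0]))).
  apply: measurable_indic; apply: measurableC.
  by rewrite -[X in measurable X]setTI; exact: mf.
apply/funext => x; rewrite indicE; congr (nat_of_bool _)%:R.
apply/idP/idP => [/eqP h|]; first by rewrite inE.
by rewrite inE/= => /eqP.
Qed.

(** Two consecutive polynomials are carried through the induction, since the recurrence is of second
    order. *)
Lemma mcoef_q n : mcoef (q n).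
Proof.
suff [] : mcoef (q n) /\ mcoef (q n.+1) by [].
have mX : mcoef (fun=> 'X) by exact: mcoef_cst.
have step k : mcoef (q k) -> mcoef (if k is k'.+1 then q k' else fun=> 0) -> mcoef (q k.+1).
  move=> mk mk'.
  have mw : measurable_fun setT (qnorm k).
    rewrite (_ : qnorm k = fun x => L x (q k x * q k x)); last by apply/funext => x; rewrite -expr2.
    by apply: measurable_L; exact: mcoefM.
  have mr : mcoef (r k).
    apply: mcoefD; first (apply: mcoefD; first exact: mcoefM).
      apply: mcoefZ => //; apply: measurable_funN; apply: measurable_funM.
        by apply: measurable_L; apply: mcoefM => //; exact: mcoefM.
      exact: measurable_funV.
    case: k mk mk' {mw} => [|k] mk mk'; first by apply: (@mcoefZ (fun=> - 0)); [exact: measurable_cst|exact: mcoef_cst].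
    apply: mcoefZ => //; apply: measurable_funN; apply: measurable_funM.
      by apply: measurable_L; apply: mcoefM => //; exact: mcoefM.
    apply: measurable_funV.
    rewrite (_ : qnorm k = fun x => L x (q k x * q k x)); last by apply/funext => x; rewrite -expr2.
    by apply: measurable_L; exact: mcoefM.
  (* The set where q^(k+1) vanishes must be measurable before q^(k+1) is known to be; therefore its
     norm is computed from [r k]. *)
  have w1E x : qnorm k.+1 x = (qnorm k x != 0)%:R * L x (r k x * r k x).
    case: (eqVneq (qnorm k x) 0) => [wk|wk].
      rewrite mul0r; apply/eqP; apply: contraT => /qnorm_pred.
      by rewrite wk eqxx.
    rewrite mul1r; apply: eq_mom_fun => // s Ss.
    by rewrite horner_exp hornerM expr2 (r_supp wk Ss).
  have mw1 : measurable_fun setT (qnorm k.+1).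
    rewrite (funext w1E); apply: measurable_funM; first exact: measurable_neq0.
    by apply: measurable_L; exact: mcoefM.
  rewrite (_ : q k.+1 = fun x => (qnorm k.+1 x != 0)%:R *: r k x).
    by apply: mcoefZ => //; exact: measurable_neq0.
  by apply/funext => x; rewrite qS; case: ifP => _; rewrite ?scale1r ?scale0r.
have m0 : mcoef (q 0) by rewrite (_ : q 0 = fun=> 1); [exact: mcoef_cst|exact/funext/q0E].
elim: n => [|n [IHn IHn1]]; split => //; first exact: (step 0%N m0 (mcoef_cst 0)).
exact: (step n.+1).
Qed.

Lemma measurable_qnorm n : measurable_fun setT (qnorm n).
Proof.
rewrite (_ : qnorm n = fun x => L x (q n x * q n x)); last by apply/funext => x; rewrite -expr2.
by apply: measurable_L; apply: mcoefM; exact: mcoef_q.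
Qed.

Lemma measurable_q n : measurable_fun setT (fun y : E * R => (q n y.1).[y.2]).
Proof. by apply: measurable_mcoef; exact: mcoef_q. Qed.

Lemma integral_rho (rho : nat -> {sigma_finite_measure set E -> \bar R}) n (f : E -> \bar R) :
  rho_spec sigma q rho -> measurable_fun setT f -> (forall x, (0 <= f x)%E) ->
  (\int[rho n]_x f x = \int[leb R d]_x (f x * (qnorm n x)%:E))%E.
Proof.
move=> rhoE mf f0; apply: integral_density => //.
- exact: measurable_qnorm.
- exact: qnorm_ge0.
- move=> D mD; transitivity (\int[leb R d]_(x in D) \int[sigma x]_s ((q n x).[s] ^+ 2)%:E)%E; first exact: rhoE.
  by apply: eq_integral => x _; rewrite qnormE.
Qed.

End measurability.

Section monomials.

Let Span x i (f : R -> R) := exists c : nat -> R, forall s, supp x s ->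
  f s = \sum_(m < i.+1) c m * (q m x).[s].

Let SpanD x i f g : Span x i f -> Span x i g -> Span x i (fun s => f s + g s).
Proof.
move=> [c hc] [c' hc']; exists (fun m => c m + c' m) => s Ss.
by rewrite hc// hc'// -big_split; apply: eq_bigr => m _; rewrite mulrDl.
Qed.

Let SpanZ x i c f : Span x i f -> Span x i (fun s => c * f s).
Proof.
move=> [c' hc']; exists (fun m => c * c' m) => s Ss.
by rewrite hc'// mulr_sumr; apply: eq_bigr => m _; rewrite mulrA.
Qed.

Let Spanq x i m : (m <= i)%N -> Span x i (fun s => (q m x).[s]).
Proof.
move=> mi; exists (fun j => (j == m)%:R) => s _.
rewrite (bigD1 (Ordinal (mi : (m < i.+1)%N)))//= eqxx mul1r big1 ?addr0// => j.
by rewrite -val_eqE/= => /negbTE ->; rewrite mul0r.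
Qed.

Let Span0 x i : Span x i (fun=> 0).
Proof. by exists (fun=> 0) => s _; rewrite big1// => m _; rewrite mul0r. Qed.

(** Multiplying by s raises the index by at most one, by the recurrence. The coefficients depend on
    x with no control; [monomial_expansion] identifies them. *)
Let SpanX x i : Span x i (fun s => s ^+ i).
Proof.
elim: i => [|i [c hc]].
  by exists (fun=> 1) => s _; rewrite big_ord1 q0E hornerC mulr1.
suff [c' hc'] : Span x i.+1 (fun s => \sum_(m < i.+1) c m * (s * (q m x).[s])).
  exists c' => s Ss; rewrite exprS hc// -hc'// mulr_sumr.
  by apply: eq_bigr => m _; rewrite mulrCA.
have qm m : (m <= i)%N -> Span x i.+1 (fun s => s * (q m x).[s]).
  move=> mi; have [c' hc'] : Span x i.+1 (fun s => (q m.+1 x).[s] + b m x * (q m x).[s] +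
      (if m is m'.+1 then a m x * (q m' x).[s] else 0)).
    apply: SpanD; first apply: SpanD; [exact: Spanq|by apply: SpanZ; apply: Spanq; exact: leqW|].
    case: m mi => [|m] mi; first exact: Span0.
    by apply: SpanZ; apply: Spanq; rewrite leqW// ltnW.
  by exists c' => s Ss; rewrite -hc'// q_rec.
suff H k : (k <= i.+1)%N -> Span x i.+1 (fun s => \sum_(m < k) c m * (s * (q m x).[s])).
  exact: (H i.+1 (leqnn _)).
elim: k => [_|k IH ki].
  by have [c' hc'] := Span0 x i.+1; exists c' => s Ss; rewrite -hc'// big_ord0.
have [c' hc'] := SpanD (IH (ltnW ki)) (SpanZ (c k) (qm k ki)).
by exists c' => s Ss; rewrite -hc'// big_ord_recr.
Qed.

(** The Fourier coefficient of s^i along q^(m)(x, .), equal to 0 where q^(m)(x, .) = 0 since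
    inversion sends 0 to 0. *)
Definition mono_coef i m x : R := L x ('X^i * q m x) / qnorm m x.

Lemma measurable_mono_coef i m : measurable_fun setT (mono_coef i m).
Proof.
apply: measurable_funM; last by apply: measurable_funV; exact: measurable_qnorm.
by apply: measurable_L; apply: mcoefM; [exact: mcoef_cst|exact: mcoef_q].
Qed.

(** The pointwise coefficients are pinned down by orthogonality where q^(m) does not vanish and are
    irrelevant elsewhere; this replaces a choice made for each x by coefficients measurable in x. *)
Lemma monomial_expansion i x s : supp x s ->
  s ^+ i = \sum_(m < i.+1) mono_coef i m x * (q m x).[s].
Proof.
move=> Ss; have [c hc] := SpanX x i; rewrite hc//; apply: eq_bigr => m _.
have [/q_eq0 ->|wm] := eqVneq (qnorm m x) 0; first by rewrite horner0 !mulr0.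
congr (_ * _); rewrite /mono_coef.
rewrite (_ : L x _ = c m * qnorm m x) ?mulfK//.
rewrite (@eq_mom_fun _ _ _ (\sum_(j < i.+1) c j *: (q j x * q m x)))//; last first.
  move=> t St; rewrite hornerM hornerXn hc// horner_sum mulr_suml.
  by apply: eq_bigr => j _; rewrite hornerZ hornerM mulrA.
rewrite mom_fun_sum// (bigD1 m)//= mom_funZ// -expr2 big1 ?addr0// => j jm.
by rewrite mom_funZ// L_orth ?mulr0.
Qed.

(** The right-hand side is the sum of all such squares by Parseval, and the other terms are
    nonnegative. It puts the coefficients, multiplied by a bounded function of bounded support, into
    L^2(rho_m). *)
Lemma mono_coef_bessel i m x : (m <= i)%N ->
  mono_coef i m x ^+ 2 * qnorm m x <= L x ('X^(i.*2)).
Proof.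
move=> mi.
rewrite (@eq_mom_fun _ _ _ (\sum_(j < i.+1) \sum_(k < i.+1)
    (mono_coef i j x * mono_coef i k x) *: (q j x * q k x)))//; last first.
  move=> s Ss; rewrite hornerXn -addnn exprD (monomial_expansion _ Ss) mulr_suml horner_sum.
  apply: eq_bigr => j _; rewrite mulr_sumr horner_sum; apply: eq_bigr => k _.
  by rewrite hornerZ hornerM mulrACA.
rewrite mom_fun_sum// (bigD1 (Ordinal (mi : (m < i.+1)%N)))//=.
have diag (j : 'I_i.+1) : L x (\sum_(k < i.+1) (mono_coef i j x * mono_coef i k x) *: (q j x * q k x)) =
    mono_coef i j x ^+ 2 * qnorm j x.
  rewrite mom_fun_sum// (bigD1 j)//= mom_funZ// -!expr2 big1 ?addr0// => k kj.
  by rewrite mom_funZ// L_orth ?mulr0// eq_sym.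
rewrite (diag (Ordinal (mi : (m < i.+1)%N))) lerDl sumr_ge0// => j _; rewrite diag.
by rewrite mulr_ge0 ?sqr_ge0 ?qnorm_ge0.
Qed.

End monomials.

End orthogonal_polynomials.

(** * Fock space and the isometry [Sym J] *)

Section projected_square_integrable.
Context d (T : measurableType d) (R : realType) (V : lmodType R).
Variables (mu : {measure set T -> \bar R}) (phi : V -> T -> R).
Variables (proj : (T -> R) -> (T -> R)) (c : R).
Hypothesis phi_lin : forall a u v x, phi (a *: u + v) x = a * phi u x + phi v x.
Hypothesis phi_onto : forall f, exists u, phi u = f.
Hypothesis proj_lin : forall a f g x,
  proj (fun x => a * f x + g x) x = a * proj f x + proj g x.
Hypothesis proj_idem : forall f, proj (proj f) = proj f.
Hypothesis measurable_proj : forall f, measurable_fun setT f -> measurable_fun setT (proj f).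
Hypothesis proj_le : forall f, measurable_fun setT f -> (sqint mu (proj f) <= sqint mu f)%E.
Hypothesis c_gt0 : 0 < c.

(** Common frame for a degree of Fock space and for G_alpha: [phi] reads one component off the
    encoding, [proj] averages over a group of permutations, and [c] is n! or alpha!. *)
Definition proj_dom : set V := [set u | phi u \in Lfun mu 2%:E /\ proj (phi u) = phi u %[ae mu]].

Definition proj_norm (u : V) : \bar R := (c%:E * sqint mu (phi u))%E.

Let phiD u v : phi (u + v) = (fun x => phi u x + phi v x).
Proof. by apply/funext => x; rewrite -[u]scale1r phi_lin mul1r scale1r. Qed.

Let phi0 : phi 0 = fun=> 0.
Proof.
by apply/funext => x; have := phi_lin (-1) 0 0 x; rewrite scaler0 addr0 mulN1r addNr.
Qed.

Let phiZ a u : phi (a *: u) = (fun x => a * phi u x).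
Proof. by apply/funext => x; rewrite -[_ *: _]addr0 phi_lin phi0 addr0. Qed.

Let phiB u v : phi (u - v) = (fun x => phi u x - phi v x).
Proof.
by rewrite phiD; apply/funext => x; rewrite -scaleN1r phiZ mulN1r.
Qed.

Let proj0 : proj (fun=> 0) = fun=> 0.
Proof.
apply/funext => x; have := proj_lin (-1) (fun=> 0) (fun=> 0) x.
by rewrite mulr0 addr0 mulN1r addNr.
Qed.

Lemma sqnormed_proj : sqnormed proj_dom proj_norm.
Proof.
split.
- split; last first.
    rewrite /proj_norm phi0 /sqint integral0_eq ?mule0// => x _.
    by rewrite expr0n.
  by split; rewrite phi0; [exact: Lfun2_0|rewrite proj0; exact: aeW].
- move=> a u v [Lu Su] [Lv Sv]; split.
    rewrite (_ : phi _ = fun x => a * phi u x + phi v x); first exact: Lfun2_lin.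
    by apply/funext => x; exact: phi_lin.
  rewrite (_ : phi _ = fun x => a * phi u x + phi v x); last first.
    by apply/funext => x; exact: phi_lin.
  apply: filterS2 Su Sv => x Su Sv _.
  by rewrite proj_lin Su// Sv.
- split=> [u|u [Lu _]]; first by rewrite mule_ge0 ?sqint_ge0// lee_fin ltW.
  by rewrite lte_mul_pinfty ?lee_fin ?(ltW c_gt0)//; exact: sqint_lt_pinfty.
- move=> a u [Lu _]; rewrite /proj_norm phiZ sqintZ ?muleA; last exact: Lfun2_measurable Lu.
  by rewrite [(c%:E * _)%E]muleC.
- move=> e u v e0 [Lu _] [Lv _]; rewrite /proj_norm phiD.
  rewrite !muleA ![(_ * c%:E)%E]muleC -!muleA -ge0_muleDr ?mule_ge0 ?sqint_ge0 ?lee_fin ?addr_ge0 ?invr_ge0 ?(ltW e0)//.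
  rewrite lee_wpmul2l ?lee_fin ?(ltW c_gt0)//.
  by apply: sqintD_le => //; [exact: Lfun2_measurable Lu|exact: Lfun2_measurable Lv].
Qed.

(** The factor c is absorbed by scaling with its square root. The L^2 limit is then projected to
    become exactly invariant; [proj] is a contraction that fixes each [u i] almost everywhere, so
    the estimates survive. *)
Lemma sqcomplete_proj : sqcomplete proj_dom proj_norm.
Proof.
move=> u Du uC.
have hex j : exists v, phi v = fun x => Num.sqrt c * phi (u j) x by exact: phi_onto.
have [w hw] := choice hex.
have cc : Num.sqrt c ^+ 2 = c by rewrite sqr_sqrtr// ltW.
have mu_ j : measurable_fun setT (phi (u j)) by apply: Lfun2_measurable (Du j).1.
have scale f : measurable_fun setT f -> sqint mu (fun x => Num.sqrt c * f x) = (c%:E * sqint mu f)%E.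
  by move=> mf; rewrite sqintZ// cc.
have [||l Ll hl] := @Lfun2_complete _ _ _ mu (fun j => phi (w j)).
- move=> j; rewrite hw (_ : (fun x => _) = fun x => Num.sqrt c * phi (u j) x + 0).
    apply: Lfun2_lin; [exact: (Du j).1|exact: Lfun2_0].
  by apply/funext => x; rewrite addr0.
- move=> i j ij; rewrite !hw.
  rewrite (_ : (fun x => _) = fun x => Num.sqrt c * (phi (u j) x - phi (u i) x)).
    by rewrite scale; [have := uC i j ij; rewrite /proj_norm phiB|exact: measurable_funB].
  by apply/funext => x; rewrite mulrBr.
have ml := Lfun2_measurable Ll.
have sc0 : Num.sqrt c != 0 by rewrite gt_eqF// sqrtr_gt0.
pose l' x := (Num.sqrt c)^-1 * l x.
have ml' : measurable_fun setT l' by exact: measurable_funM.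
have hl' i : (c%:E * sqint mu (fun x => l' x - phi (u i) x)%R <= (2^-1 ^+ i)%:E)%E.
  rewrite -scale; last exact: measurable_funB.
  have := hl i; rewrite hw; congr (sqint mu _ <= _)%E.
  by apply/funext => x; rewrite mulrBr /l' mulrA mulfV// mul1r.
have [v phiv] := phi_onto (proj l').
have mpl' : measurable_fun setT (proj l') by exact: measurable_proj.
have main i : (proj_norm (v - u i)%R <= (2^-1 ^+ i)%:E)%E.
  rewrite /proj_norm phiB phiv (le_trans _ (hl' i))// lee_wpmul2l ?lee_fin ?(ltW c_gt0)//.
  have mi : measurable_fun setT (fun x => -1 * phi (u i) x + l' x).
    by apply: measurable_funD => //; exact: measurable_funM.
  rewrite (@ae_eq_sqint _ _ _ _ _ (proj (fun x => -1 * phi (u i) x + l' x))).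
  + rewrite (le_trans (proj_le mi))//.
    by rewrite (_ : (fun x => _) = (fun x => l' x - phi (u i) x))//; apply/funext => x; rewrite mulN1r addrC.
  + exact: measurable_funB.
  + exact: measurable_proj.
  + apply: filterS (Du i).2 => x h _.
    by rewrite proj_lin h// mulN1r addrC.
exists v; last first.
  move=> i; rewrite (le_trans (main i))// lee_fin ler_peMl ?exprn_ge0 ?invr_ge0//.
  by rewrite ler1n.
split; last by rewrite phiv proj_idem; exact: aeW.
rewrite (_ : phi v = fun x => 1 * (phi v x - phi (u 0%N) x) + phi (u 0%N) x); last first.
  by apply/funext => x; rewrite mul1r subrK.
apply: Lfun2_lin; last exact: (Du 0%N).1.
apply/Lfun2P; split; first by rewrite phiv; exact: measurable_funB.
have := main 0%N; rewrite /proj_norm phiB => h.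
rewrite -(@lte_pmul2l _ c%:E)// ?lte_fin// (le_lt_trans h)//.
by rewrite gt0_muley ?lte_fin// ltry.
Qed.

End projected_square_integrable.

Section averages.
Context d (T : measurableType d) (R : realType) (n : nat).
Variable m' : nat -> {sigma_finite_measure set T -> \bar R}.
Variable B : pred 'S_n.
Hypothesis m'B : forall (p : 'S_n) (i : 'I_n), B p -> m' (p i) = m' i.
Local Notation mu := (tuple_prod n m').

Definition avg_tuple (N : nat) (f : n.-tuple T -> R) (t : n.-tuple T) : R :=
  N%:R^-1 * \sum_(p : 'S_n | B p) f (permute_tuple p t).

Lemma avg_tuple_lin N a f g t : avg_tuple N (fun t => a * f t + g t) t =
  a * avg_tuple N f t + avg_tuple N g t.
Proof.
by rewrite /avg_tuple big_split/= mulrDr -mulr_sumr mulrCA.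
Qed.

Lemma measurable_comp_permute (f : n.-tuple T -> R) (p : 'S_n) :
  measurable_fun setT f -> measurable_fun setT (fun t => f (permute_tuple p t)).
Proof. by move=> mf; exact: measurableT_comp mf (measurable_permute_tuple p). Qed.

Lemma measurable_avg_tuple N f : measurable_fun setT f ->
  measurable_fun setT (avg_tuple N f).
Proof.
move=> mf; apply: measurable_funM => //.
rewrite (_ : (fun t => _) = fun t => \sum_(p : 'S_n) if B p then f (permute_tuple p t) else 0).
  apply: measurable_sum => p; case: (B p) => //.
  exact: measurable_comp_permute.
by apply/funext => t; rewrite big_mkcond.
Qed.

Lemma sqint_permute (p : 'S_n) f : B p -> measurable_fun setT f ->
  sqint mu (fun t => f (permute_tuple p t)) = sqint mu f.
Proof.
move=> Bp mf; rewrite /sqint.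
rewrite -[RHS](@integral_tuple_prod_perm _ _ _ _ _ p)//; last 2 first.
- exact: measurable_sqr.
- by move=> t; rewrite lee_fin sqr_ge0.
by move=> i; exact: m'B.
Qed.

(** Lagrange's identity: the difference of the two sides is half the sum of the squares of F i - F
    j. *)
Lemma sqr_sum_le (I : Type) (r : seq I) (P : pred I) (F : I -> R) :
  (\sum_(i <- r | P i) F i) ^+ 2 <=
  (\sum_(i <- r | P i) 1%N)%N%:R * \sum_(i <- r | P i) F i ^+ 2.
Proof.
rewrite expr2 mulr_suml natr_sum mulr_suml.
set S := \sum_(i <- r | P i) F i.
rewrite -subr_ge0 -sumrB.
suff -> : \sum_(i <- r | P i) (1 * \sum_(j <- r | P j) F j ^+ 2 - F i * S) =
    2^-1 * \sum_(i <- r | P i) \sum_(j <- r | P j) (F i - F j) ^+ 2.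
  by rewrite mulr_ge0 ?invr_ge0// sumr_ge0// => i _; rewrite sumr_ge0// => j _; exact: sqr_ge0.
have -> : \sum_(i <- r | P i) \sum_(j <- r | P j) (F i - F j) ^+ 2 =
  \sum_(i <- r | P i) \sum_(j <- r | P j) F i ^+ 2 +
  \sum_(i <- r | P i) \sum_(j <- r | P j) F j ^+ 2 - 2 * \sum_(i <- r | P i) F i * S.
  rewrite -!big_split/= mulr_sumr -sumrB; apply: eq_bigr => i _.
  rewrite /S mulr_sumr mulr_sumr -big_split/= -sumrB; apply: eq_bigr => j _.
  by ring.
rewrite [X in X + _ - _]exchange_big/= sumrB.
rewrite (eq_bigr (fun=> \sum_(j <- r | P j) F j ^+ 2)); last by move=> i _; rewrite mul1r.
by field.
Qed.

(** By the Cauchy-Schwarz inequality the square of an average is at most the average of the squares,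
    and each permuted copy of f has the same squared norm. *)
Lemma sqint_avg_le N f : (\sum_(p : 'S_n | B p) 1 = N)%N -> (0 < N)%N ->
  measurable_fun setT f -> (sqint mu (avg_tuple N f) <= sqint mu f)%E.
Proof.
move=> BN N0 mf; rewrite /avg_tuple sqintZ; last first.
  rewrite (_ : (fun t => _) = fun t => 1%:R^-1^-1 * (1%:R^-1 * \sum_(p | B p) f (permute_tuple p t))).
    by apply: measurable_funM => //; exact: (measurable_avg_tuple 1).
  by apply/funext => t; rewrite mulrA mulVf ?mul1r// invr1 oner_neq0.
have Nr : N%:R != 0 :> R by rewrite pnatr_eq0 -lt0n.
apply: (@le_trans _ _ ((N%:R^-1 ^+ 2)%:E * (N%:R%:E * \sum_(p : 'S_n | B p) sqint mu f))%E).
  rewrite lee_wpmul2l ?lee_fin ?sqr_ge0//.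
  have -> : (\sum_(p : 'S_n | B p) sqint mu f = \sum_(p : 'S_n | B p)
      \int[mu]_t ((f (permute_tuple p t)) ^+ 2)%:E)%E.
    by apply: eq_bigr => p Bp; rewrite -[LHS](sqint_permute Bp).
  have ms p : measurable_fun setT (fun t => ((f (permute_tuple p t)) ^+ 2)%:E).
    by apply: measurable_sqr; exact: measurable_comp_permute.
  have s0 p t : setT t -> (0 <= ((f (permute_tuple p t)) ^+ 2)%:E)%E.
    by move=> _; rewrite lee_fin sqr_ge0.
  have -> : (\sum_(p : 'S_n | B p) \int[mu]_t ((f (permute_tuple p t)) ^+ 2)%:E =
      \int[mu]_t \sum_(p : 'S_n | B p) ((f (permute_tuple p t)) ^+ 2)%:E)%E.
    rewrite -big_filter -ge0_integral_sum//.
    by apply: eq_integral => t _; rewrite big_filter.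
  rewrite -ge0_integralZl//; last 2 first.
  - rewrite (_ : (fun t => _) = fun t => \sum_(p : 'S_n) if B p then ((f (permute_tuple p t)) ^+ 2)%:E else 0%E)%E.
      by apply: emeasurable_sum => p; case: (B p) => //.
    by apply/funext => t; rewrite big_mkcond.
  - by move=> t _; apply: sume_ge0 => p _; exact: s0.
  apply: ge0_le_integral => //.
  - by move=> t _; rewrite lee_fin sqr_ge0.
  - apply: measurable_sqr.
    rewrite (_ : (fun t => _) = fun t => \sum_(p : 'S_n) if B p then f (permute_tuple p t) else 0).
      apply: measurable_sum => p; case: (B p) => //.
      exact: measurable_comp_permute.
    by apply/funext => t; rewrite big_mkcond.
  - apply: measurable_funeM.
    rewrite (_ : (fun t => _) = fun t => \sum_(p : 'S_n) if B p then ((f (permute_tuple p t)) ^+ 2)%:E else 0%E)%E.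
      by apply: emeasurable_sum => p; case: (B p) => //.
    by apply/funext => t; rewrite big_mkcond.
  - move=> t _; rewrite sumEFin -EFinM lee_fin -BN.
    exact: sqr_sum_le.
rewrite (_ : \sum_(p | B p) sqint mu f = N%:R%:E * sqint mu f)%E.
  rewrite !muleA -!EFinM.
  by rewrite (_ : _ * _ = 1) ?mul1e//; field.
rewrite -BN natr_sum -sumEFin ge0_sume_distrl//.
by apply: eq_bigr => p _; rewrite mul1e.
Qed.

End averages.

Section symmetrized_L2.
Context d (T : measurableType d) (R : realType) (V : lmodType R).

Variables (n : nat) (m : {sigma_finite_measure set T -> \bar R}).
Variable phi : V -> n.-tuple T -> R.
Hypothesis phi_lin : forall a u v x, phi (a *: u + v) x = a * phi u x + phi v x.
Hypothesis phi_onto : forall f, exists u, phi u = f.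
Local Notation mu := (tuple_prod n (fun _ => m)).

Lemma sqint_sym_le f : measurable_fun setT f -> (sqint mu (sym_tuple f) <= sqint mu f)%E.
Proof.
move=> mf; apply: (@sqint_avg_le _ _ _ _ (fun=> m) xpredT) => //; last exact: fact_gt0.
by rewrite sum1_card card_Sn.
Qed.

Lemma measurable_sym_tuple f : measurable_fun setT f ->
  measurable_fun setT (@sym_tuple R T n f).
Proof. exact: measurable_avg_tuple. Qed.

Lemma sqnormed_sym : sqnormed (proj_dom mu phi (@sym_tuple R T n)) (proj_norm mu phi n`!%:R).
Proof.
apply: sqnormed_proj => //.
by move=> a f g x; exact: avg_tuple_lin.
Qed.

Lemma sqcomplete_sym : sqcomplete (proj_dom mu phi (@sym_tuple R T n)) (proj_norm mu phi n`!%:R).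
Proof.
apply: sqcomplete_proj => //.
- by move=> a f g x; exact: avg_tuple_lin.
- by move=> f; apply: sym_tuple_id => p t; exact: sym_tuple_perm.
- exact: measurable_sym_tuple.
- exact: sqint_sym_le.
Qed.

End symmetrized_L2.

Section block_symmetrized_L2.
Context d (T : measurableType d) (R : realType) (V : lmodType R).
Variables (al : multiindex) (m : nat -> {sigma_finite_measure set T -> \bar R}).
Variable phi : V -> (deg al).-tuple T -> R.
Hypothesis phi_lin : forall a u v x, phi (a *: u + v) x = a * phi u x + phi v x.
Hypothesis phi_onto : forall f, exists u, phi u = f.
Local Notation mu := (tuple_prod (deg al) (fun j => m (block al j))).

Let fact0 : 0 < (fact_index al)%:R :> R.
Proof. by rewrite ltr0n -fact_list_blocks fact_list_gt0. Qed.

Lemma sqint_bsym_le f : measurable_fun setT f -> (sqint mu (bsym_tuple al f) <= sqint mu f)%E.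
Proof.
move=> mf; apply: (@sqint_avg_le _ _ _ _ (fun j => m (block al j)) (block_perm al (m := deg al))) => //.
- by move=> p i /forallP /(_ i) /eqP ->.
- exact: count_block_perm.
- by rewrite -fact_list_blocks fact_list_gt0.
Qed.

Lemma measurable_bsym_tuple n f : measurable_fun setT f ->
  measurable_fun setT (@bsym_tuple R T al n f).
Proof. exact: measurable_avg_tuple. Qed.

Lemma sqnormed_bsym :
  sqnormed (proj_dom mu phi (@bsym_tuple R T al _)) (proj_norm mu phi (fact_index al)%:R).
Proof.
apply: sqnormed_proj => //.
by move=> a f g x; exact: avg_tuple_lin.
Qed.

Lemma sqcomplete_bsym :
  sqcomplete (proj_dom mu phi (@bsym_tuple R T al _)) (proj_norm mu phi (fact_index al)%:R).
Proof.
apply: sqcomplete_proj => //.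
- by move=> a f g x; exact: avg_tuple_lin.
- by move=> f; apply: bsym_tuple_id => p t; exact: bsym_tuple_perm.
- exact: measurable_bsym_tuple.
- exact: sqint_bsym_le.
Qed.

End block_symmetrized_L2.

Section Lfun2_space.
Context d (T : measurableType d) (R : realType) (mu : {measure set T -> \bar R}).

End Lfun2_space.

Section fock_space.
Context (R : realType) (d : nat) (sigma : R.-pker (d.-tuple R) ~> R).
Local Notation E := (d.-tuple R).
Local Notation X := (d.-tuple R * R)%type.
Local Notation pow := (dx_sigma_pow sigma).

Definition fockn_dom n : set (seq X -> R^o) := proj_dom (pow n) (component n) (@sym_tuple R X n).
Definition fockn_norm n (F : seq X -> R^o) : \bar R := proj_norm (pow n) (component n) n`!%:R F.

Lemma fock_sqnormE : fock_sqnorm sigma = dsum_norm fockn_norm.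
Proof.
apply/funext => F; rewrite /fock_sqnorm nneseries_esumT//.
by move=> n; rewrite mule_ge0 ?lee_fin// sqint_ge0.
Qed.

Lemma fockE : fock sigma = dsum_dom fockn_dom fockn_norm.
Proof.
apply/funext => F; apply/propext; rewrite /fock /dsum_dom /= fock_sqnormE.
split=> -[h Foo]; split=> // n; have [h1 h2] := h n; split => //.
  by rewrite -component_Symn.
by rewrite component_Symn.
Qed.

Lemma component_onto n (T : Type) (f : n.-tuple T -> R) :
  exists F : seq T -> R^o, component n F = f.
Proof.
exists (fun s => if insub s is Some t then f t else 0).
by apply/funext => t; rewrite /component valK.
Qed.

Lemma sqnormed_fockn n : sqnormed (fockn_dom n) (fockn_norm n).
Proof. exact: sqnormed_sym. Qed.

Lemma sqnormed_fock : sqnormed (fock sigma) (fock_sqnorm sigma).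
Proof. rewrite fockE fock_sqnormE; apply: sqnormed_dsum; exact: sqnormed_fockn. Qed.

Lemma sqcomplete_fock : sqcomplete (fock sigma) (fock_sqnorm sigma).
Proof.
rewrite fockE fock_sqnormE; apply: sqcomplete_dsum.
- exact: sqnormed_fockn.
(* The degree n component only sees sequences of length n, so limits chosen degree by degree are
   glued along the length. *)
- move=> l Dl; exists (fun s => l (size s) s) => k.
  have e : component k (fun s => l (size s) s) = component k (l k).
    by apply/funext => t; rewrite /component size_tuple.
  split; first by rewrite /fockn_dom /proj_dom/= e; exact: Dl.
  rewrite /fockn_norm /proj_norm.
  rewrite (_ : component k _ = fun=> 0); last first.
    apply/funext => t; rewrite /component.
    transitivity (l (size t) t - l k t); first by [].
    by rewrite size_tuple subrr.
  by rewrite /sqint integral0_eq ?mule0// => x _; rewrite expr0n.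
- by move=> k; apply: sqcomplete_sym => // f; exact: component_onto.
Qed.

Context (rho : nat -> {sigma_finite_measure set E -> \bar R}).

Definition Gcomp_dom al : set (multiindex -> seq E -> R^o) :=
  proj_dom (rho_prod rho al) (fun f => component (deg al) (f al)) (@bsym_tuple R E al _).
Definition Gcomp_norm al (f : multiindex -> seq E -> R^o) : \bar R :=
  proj_norm (rho_prod rho al) (fun f => component (deg al) (f al)) (fact_index al)%:R f.

Lemma GcompE al f : Gcomp rho al (f al) = Gcomp_dom al f.
Proof. by rewrite /Gcomp /Gcomp_dom component_block_sym. Qed.

Lemma GsqnormE : Gsqnorm rho = dsum_norm Gcomp_norm.
Proof. by []. Qed.

Lemma GspaceE : Gspace rho = dsum_dom Gcomp_dom Gcomp_norm.
Proof.
apply/funext => F; apply/propext.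
by split=> -[h Foo]; split=> // n; have := h n; rewrite GcompE.
Qed.

Lemma sqnormed_Gcomp_dom al : sqnormed (Gcomp_dom al) (Gcomp_norm al).
Proof. exact: sqnormed_bsym. Qed.

Lemma sqnormed_Gspace : sqnormed (Gspace rho) (Gsqnorm rho).
Proof. rewrite GspaceE GsqnormE; apply: sqnormed_dsum; exact: sqnormed_Gcomp_dom. Qed.

Lemma sqcomplete_Gspace : sqcomplete (Gspace rho) (Gsqnorm rho).
Proof.
rewrite GspaceE GsqnormE; apply: sqcomplete_dsum.
- exact: sqnormed_Gcomp_dom.
- move=> l Dl; exists (fun al => l al al) => k.
  split; first exact: Dl.
  rewrite /Gcomp_norm /proj_norm.
  rewrite (_ : component _ _ = fun=> 0); last first.
    apply/funext => t; rewrite /component.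
    transitivity (l k k t - l k k t); first by [].
    by rewrite subrr.
  by rewrite /sqint integral0_eq ?mule0// => x _; rewrite expr0n.
- move=> k; apply: sqcomplete_bsym => // f.
  by have [F <-] := component_onto f; exists (fun=> F).
Qed.

Lemma sqnormed_Gcomp al : sqnormed (Gcomp rho al) (Gcomp_sqnorm rho al).
Proof.
rewrite (_ : Gcomp rho al = proj_dom (rho_prod rho al) (component (deg al)) (@bsym_tuple R E al _)).
  exact: sqnormed_bsym.
by apply/funext => g; rewrite /Gcomp component_block_sym.
Qed.

End fock_space.

(** * Inner products and orthogonality *)

Section inner_product.
Context d (T : measurableType d) (R : realType) (mu : {measure set T -> \bar R}).
Implicit Types u v w : T -> R.

Definition ip u v : R := \int[mu]_x (u x * v x).

Lemma integrable_mul u v : u \in Lfun mu 2%:E -> v \in Lfun mu 2%:E ->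
  mu.-integrable setT (EFin \o (fun x => u x * v x)).
Proof. by move=> Lu Lv; apply/Lfun1_integrable; exact: Lfun2_mul_Lfun1. Qed.

Lemma ipC u v : ip u v = ip v u.
Proof. by rewrite /ip; apply: eq_Rintegral => x _; rewrite mulrC. Qed.

Lemma ip_lin c u v w : u \in Lfun mu 2%:E -> v \in Lfun mu 2%:E -> w \in Lfun mu 2%:E ->
  ip u (fun x => c * v x + w x) = c * ip u v + ip u w.
Proof.
move=> Lu Lv Lw; have iv := integrable_mul Lu Lv; have iw := integrable_mul Lu Lw.
rewrite /ip -RintegralZl// -RintegralD//.
  by apply: eq_Rintegral => x _; rewrite mulrDr mulrCA.
exact: (integrableZl measurableT c iv).
Qed.

Lemma ip0 u : ip u (fun=> 0) = 0.
Proof. by rewrite /ip /Rintegral integral0_eq// => x _; rewrite mulr0. Qed.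

Lemma ip_sqint u : u \in Lfun mu 2%:E -> sqint mu u = (ip u u)%:E.
Proof.
move=> Lu; rewrite /ip /Rintegral fineK; last exact: integrable_fin_num (integrable_mul Lu Lu).
by apply: eq_integral => x _; rewrite expr2.
Qed.

Lemma ip_sum u (I : Type) (r : seq I) (P : pred I) (F : I -> T -> R) :
  u \in Lfun mu 2%:E -> (forall i, F i \in Lfun mu 2%:E) ->
  ip u (fun x => \sum_(i <- r | P i) F i x) = \sum_(i <- r | P i) ip u (F i) /\
  (fun x => \sum_(i <- r | P i) F i x) \in Lfun mu 2%:E.
Proof.
move=> Lu LF; elim: r => [|i r [IH1 IH2]].
  rewrite (_ : (fun x => _) = fun=> 0); last by apply/funext => x; rewrite big_nil.
  by rewrite ip0 big_nil; split => //; exact: Lfun2_0.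
case Pi : (P i); last first.
  rewrite (_ : (fun x => _) = fun x => \sum_(i <- r | P i) F i x); first by rewrite big_cons Pi.
  by apply/funext => x; rewrite big_cons Pi.
rewrite (_ : (fun x => _) = fun x => 1 * F i x + \sum_(i <- r | P i) F i x); last first.
  by apply/funext => x; rewrite big_cons Pi mul1r.
by rewrite ip_lin// big_cons Pi mul1r IH1; split => //; exact: Lfun2_lin.
Qed.

Lemma sqintD_orth u v : u \in Lfun mu 2%:E -> v \in Lfun mu 2%:E -> ip u v = 0 ->
  sqint mu (fun x => u x + v x) = (sqint mu u + sqint mu v)%E.
Proof.
move=> Lu Lv uv; rewrite (_ : (fun x => _) = fun x => 1 * u x + v x); last first.
  by apply/funext => x; rewrite mul1r.
have Luv : (fun x => 1 * u x + v x) \in Lfun mu 2%:E by exact: Lfun2_lin.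
rewrite !ip_sqint// ip_lin// ipC ip_lin// uv ![ip (fun x => _) v]ipC ip_lin// [ip v u]ipC uv.
by rewrite -EFinD; congr (_%:E); ring.
Qed.

(* [u] has integral zero, in a form that survives iterated integration without
   any integrability assumption on [u]. *)
Definition balanced u : Prop :=
  (\int[mu]_x (Num.max (u x) 0)%:E = \int[mu]_x (Num.max (- u x) 0)%:E)%E.

(** If both parts have infinite integral, the real-valued integral is 0 by convention, so the
    conclusion persists. *)
Lemma balanced_Rintegral u : balanced u -> \int[mu]_x u x = 0.
Proof.
rewrite /balanced /Rintegral => h; rewrite integralE.
rewrite [X in (X - _)%E](_ : _ = \int[mu]_x (Num.max (u x) 0)%:E)%E; last first.
  by apply: eq_integral => x _; rewrite funeposE EFin_max.
rewrite [X in (_ - X)%E](_ : _ = \int[mu]_x (Num.max (u x) 0)%:E)%E.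
  by case: (\int[mu]_x _)%E => //= r; rewrite subrr.
by rewrite h; apply: eq_integral => x _; rewrite funenegE EFin_max.
Qed.

Lemma integrable_balanced u : measurable_fun setT u -> mu.-integrable setT (EFin \o u) ->
  \int[mu]_x u x = 0 -> balanced u.
Proof.
move=> mf iu u0; rewrite /balanced.
have h : (\int[mu]_x (EFin \o u) x = 0)%E.
  by have := integrable_fin_num measurableT iu; move/fineK => <-; congr _%:E.
move: h; rewrite integralE.
rewrite [X in (X - _)%E](_ : _ = \int[mu]_x (Num.max (u x) 0)%:E)%E; last first.
  by apply: eq_integral => x _; rewrite funeposE /= EFin_max.
rewrite [X in (_ - X)%E](_ : _ = \int[mu]_x (Num.max (- u x) 0)%:E)%E; last first.
  by apply: eq_integral => x _; rewrite funenegE /= EFin_max.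
by case: (\int[mu]_x (Num.max (u x) 0)%:E)%E (\int[mu]_x (Num.max (- u x) 0)%:E)%E => [r||] [s||]//= [] /eqP; rewrite subr_eq0 => /eqP ->.
Qed.

Lemma balancedZ c u : measurable_fun setT u -> balanced u -> balanced (fun x => c * u x).
Proof.
have Zp k v : 0 <= k -> measurable_fun setT v ->
    (\int[mu]_x (Num.max (k * v x) 0)%:E = k%:E * \int[mu]_x (Num.max (v x) 0)%:E)%E.
  move=> k0 mv; rewrite -ge0_integralZl_EFin//.
  - by apply: eq_integral => x _; rewrite -EFinM maxr_pMr// mulr0.
  - by move=> x _; rewrite lee_fin le_max lexx orbT.
  - by apply/measurable_EFinP; exact: measurable_maxr.
move=> mu_ bu; have mNu : measurable_fun setT (fun x => - u x) by exact: measurableT_comp.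
have [c0|/ltW c0] := leP 0 c; rewrite /balanced.
  rewrite Zp// bu -Zp//; apply: eq_integral => x _; by rewrite mulrN.
rewrite -oppr_ge0 in c0.
rewrite (_ : (\int[mu]_x (Num.max (c * u x) 0)%:E = \int[mu]_x (Num.max (- c * - u x) 0)%:E)%E); last first.
  by apply: eq_integral => x _; rewrite mulrNN.
by rewrite Zp// -bu -Zp//; apply: eq_integral => x _; rewrite mulNr.
Qed.

End inner_product.

Section functions_J.
Context (R : realType) (d : nat) (sigma : R.-pker (d.-tuple R) ~> R).
Hypothesis sigma_moments : moment_bound sigma.
Variables (q : nat -> d.-tuple R -> {poly R}) (a b : nat -> d.-tuple R -> R).
Hypothesis q_orthogonal : monic_orthogonal sigma q a b.
Local Notation E := (d.-tuple R).
Local Notation X := (d.-tuple R * R)%type.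
Local Notation pow := (dx_sigma_pow sigma).

Definition tmap1 n (t : n.-tuple X) : n.-tuple E := [tuple of map fst t].

Definition JT n (ks : 'I_n -> nat) (g : n.-tuple E -> R) (t : n.-tuple X) : R :=
  g (tmap1 t) * \prod_i (q (ks i) (tnth t i).1).[(tnth t i).2].

Lemma measurable_tmap1 n : measurable_fun setT (@tmap1 n).
Proof.
apply/measurable_fun_tnthP => i.
rewrite (_ : _ \o _ = fst \o (@tnth _ X ^~ i)); last by apply/funext => t /=; rewrite tnth_map.
by apply: measurableT_comp => //; exact: measurable_tnth.
Qed.

Lemma measurable_JT n ks (g : n.-tuple E -> R) : measurable_fun setT g ->
  measurable_fun setT (JT ks g).
Proof.
move=> mg; apply: measurable_funM; first exact: (measurableT_comp mg (@measurable_tmap1 _)).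
apply: measurable_prod => i _.
exact: measurableT_comp (measurable_q sigma_moments q_orthogonal (ks i)) (measurable_tnth i).
Qed.

Lemma component_Jop (f : multiindex -> seq E -> R^o) al :
  component (deg al) (J_op q f al) =
  JT (fun i => block al i) (component (deg al) (f al)).
Proof.
apply/funext => t; rewrite /component /J_op /JT; congr (_ * _).
rewrite (big_nth (0%N, thead [tuple of [:: point : X]])) size_zip size_blocks size_tuple minnn big_mkord.
apply: eq_bigr => i _; rewrite nth_zip/=; last by rewrite size_blocks size_tuple.
by rewrite (tnth_nth (thead [tuple point : X])).
Qed.

(** The variables s_1, ..., s_n are integrated out one at a time by Tonelli's theorem: each [u i] is
    a weight on R^d x R whose marginal on R^d is [m i]. *)
Lemma integral_pow_marginal n (u : 'I_n -> X -> R) (m : nat -> {sigma_finite_measure set E -> \bar R})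
    (G : n.-tuple E -> R) :
  (forall i, measurable_fun setT (u i)) -> (forall i y, 0 <= u i y) ->
  (forall i (H : E -> \bar R), measurable_fun setT H -> (forall x, (0 <= H x)%E) ->
     (\int[dx_sigma sigma]_y ((u i y)%:E * H y.1) = \int[m i]_x H x)%E) ->
  measurable_fun setT G -> (forall x, 0 <= G x) ->
  (\int[pow n]_t (G (tmap1 t) * \prod_i u i (tnth t i))%:E =
   \int[tuple_prod n m]_x (G x)%:E)%E.
Proof.
have mprod k (u' : 'I_k -> X -> R) : (forall i, measurable_fun setT (u' i)) ->
    measurable_fun setT (fun t : k.-tuple X => \prod_i u' i (tnth t i)).
  move=> mu'; apply: measurable_prod => i _.
  exact: measurableT_comp (mu' i) (measurable_tnth i).
elim: n u m G => [|n IH] u m G mu_ u0 um mG G0.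
  rewrite /dx_sigma_pow !integral_tuple_prod0//; last 2 first.
  - apply/measurable_EFinP; apply: measurable_funM; last exact: mprod.
    exact: measurableT_comp mG (@measurable_tmap1 _).
  - exact/measurable_EFinP.
  by rewrite big_ord0 mulr1; congr (G _)%:E; apply: val_inj.
have mF : measurable_fun setT (fun t : n.+1.-tuple X => (G (tmap1 t) * \prod_i u i (tnth t i))%:E).
  apply/measurable_EFinP; apply: measurable_funM; last exact: mprod.
  exact: measurableT_comp mG (@measurable_tmap1 _).
have F0 t : (0 <= (G (tmap1 t) * \prod_i u i (tnth t i))%:E)%E.
  by rewrite lee_fin mulr_ge0//; exact: prodr_ge0.
rewrite [LHS](integral_tuple_prodS _ mF)//.
rewrite [RHS]integral_tuple_prodS//; last exact/measurable_EFinP.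
pose H x := (\int[tuple_prod n (m \o S)]_t (G [tuple of x :: t])%:E)%E.
have mH : measurable_fun setT H.
  apply: (@measurable_fun_fubini_tonelli_F _ _ _ _ _ (tuple_prod n (m \o S))
     (fun z : E * n.-tuple E => (G [tuple of z.1 :: z.2])%:E)).
  - by apply/measurable_EFinP; exact: measurable_fun_tuple_cons.
  - by move=> z; rewrite lee_fin.
have H0 x : (0 <= H x)%E by apply: integral_ge0 => t _; rewrite lee_fin.
rewrite -(um ord0 H)//; apply: eq_integral => y _.
have mGy : measurable_fun setT (fun t : n.-tuple E => G [tuple of y.1 :: t]).
  exact: (measurableT_comp (measurable_fun_tuple_cons mG) (measurable_pair1 y.1)).
rewrite /H -(IH (fun i => u (lift ord0 i)) (m \o S))//; last first.
  by move=> i H' mH' H'0; have := um (lift ord0 i) H' mH' H'0; rewrite lift0.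
rewrite -ge0_integralZl_EFin//; last 2 first.
- by move=> t _; rewrite lee_fin mulr_ge0//; exact: prodr_ge0.
- apply/measurable_EFinP; apply: measurable_funM; last exact: (mprod n (fun i => u (lift ord0 i))).
  exact: measurableT_comp mGy (@measurable_tmap1 _).
apply: eq_integral => t _; rewrite -EFinM; congr _%:E.
rewrite big_ord_recl mulrCA; congr (_ * (_ * _)).
  by congr G; apply: val_inj.
by apply: eq_bigr => i _; rewrite !(tnth_nth (thead [tuple y])) lift0.
Qed.

Variable rho : nat -> {sigma_finite_measure set E -> \bar R}.
Hypothesis rhoE : rho_spec sigma q rho.

Lemma integral_q2_marginal n (H : E -> \bar R) : measurable_fun setT H ->
  (forall x, (0 <= H x)%E) ->
  (\int[dx_sigma sigma]_y (((q n y.1).[y.2] ^+ 2)%:E * H y.1) = \int[rho n]_x H x)%E.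
Proof.
move=> mH H0; have mq := measurable_q sigma_moments q_orthogonal n.
have q0 (y : X) : (0 <= ((q n y.1).[y.2] ^+ 2)%:E)%E by rewrite lee_fin sqr_ge0.
rewrite integral_kprod; last 2 first.
- apply: emeasurable_funM; first exact: measurable_sqr.
  exact: measurableT_comp mH measurable_fst.
- by move=> y; rewrite mule_ge0.
rewrite (integral_rho sigma_moments q_orthogonal)//; apply: eq_integral => x _ /=.
rewrite ge0_integralZr//.
- by rewrite -(qnormE sigma_moments) muleC.
- apply: measurable_sqr; exact: measurable_horner.
- by move=> s _; exact: (q0 (x, s)).
Qed.

Lemma sqint_JT n (ks : nat -> nat) (g : n.-tuple E -> R) : measurable_fun setT g ->
  sqint (pow n) (JT (fun i => ks i) g) = sqint (tuple_prod n (fun j => rho (ks j))) g.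
Proof.
move=> mg; rewrite /sqint.
rewrite -(@integral_pow_marginal n (fun i y => (q (ks i) y.1).[y.2] ^+ 2)); first last.
- by move=> x; exact: sqr_ge0.
- exact: measurable_funX.
- by move=> i H mH H0; exact: integral_q2_marginal.
- by move=> i y; exact: sqr_ge0.
- by move=> i; apply: measurable_funX; exact: (measurable_q sigma_moments q_orthogonal).
by apply: eq_integral => t _; rewrite exprMn prodrXl.
Qed.

End functions_J.

Section orthogonality.
Context (R : realType) (d : nat) (sigma : R.-pker (d.-tuple R) ~> R).
Local Notation E := (d.-tuple R).
Local Notation X := (d.-tuple R * R)%type.
Local Notation pow := (dx_sigma_pow sigma).

Lemma measurable_marginal n (psi : 'I_n -> X -> R) (K : n.-tuple E -> R) :
  (forall i, measurable_fun setT (psi i)) -> measurable_fun setT K ->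
  measurable_fun setT (fun t : n.-tuple X => K (tmap1 t) * \prod_i psi i (tnth t i)).
Proof.
move=> mpsi mK; apply: measurable_funM.
  exact: measurableT_comp mK (@measurable_tmap1 _ _ _).
apply: measurable_prod => i _.
exact: measurableT_comp (mpsi i) (measurable_tnth i).
Qed.

Lemma balanced_kprod (f : X -> R) : measurable_fun setT f ->
  (forall x, balanced (sigma x) (fun s => f (x, s))) -> balanced (dx_sigma sigma) f.
Proof.
move=> mf bf; have mNf : measurable_fun setT (fun y => - f y) by exact: measurableT_comp.
have kE (g : X -> R) : measurable_fun setT g ->
    (\int[dx_sigma sigma]_y (Num.max (g y) 0)%:E =
     \int[leb R d]_x \int[sigma x]_s (Num.max (g (x, s)) 0)%:E)%E.
  move=> mg; apply: (@integral_kprod _ _ _ _ _ _ _ (fun y => (Num.max (g y) 0)%:E)).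
  - by apply/measurable_EFinP; exact: measurable_maxr.
  - by move=> y; rewrite lee_fin le_max lexx orbT.
rewrite /balanced (kE _ mf) (kE _ mNf).
by apply: eq_integral => x _; exact: bf.
Qed.

(** Tonelli's theorem is peeled off until the balanced coordinate comes first. Working with
    [balanced] instead of a vanishing integral avoids integrability conditions on the other
    factors. *)
Lemma balanced_pow n (psi : 'I_n -> X -> R) (K : n.-tuple E -> R) i0 :
  (forall i, measurable_fun setT (psi i)) -> measurable_fun setT K ->
  (forall x, balanced (sigma x) (fun s => psi i0 (x, s))) ->
  balanced (pow n) (fun t => K (tmap1 t) * \prod_i psi i (tnth t i)).
Proof.
elim: n psi K i0 => [|n IH] psi K i0 mpsi mK bpsi; first by case: i0 bpsi.
set f := fun t : n.+1.-tuple X => _.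
have mf : measurable_fun setT f by exact: measurable_marginal.
have mNf : measurable_fun setT (fun y => - f y) by exact: measurableT_comp.
have mp : measurable_fun setT (fun t => (Num.max (f t) 0)%:E).
  by apply/measurable_EFinP; exact: measurable_maxr.
have mn : measurable_fun setT (fun t => (Num.max (- f t) 0)%:E).
  by apply/measurable_EFinP; exact: measurable_maxr.
have p0 t : (0 <= (Num.max (f t) 0)%:E)%E by rewrite lee_fin le_max lexx orbT.
have n0 t : (0 <= (Num.max (- f t) 0)%:E)%E by rewrite lee_fin le_max lexx orbT.
rewrite /balanced (integral_tuple_prodS _ mp p0) (integral_tuple_prodS _ mn n0).
have fE y (t : n.-tuple X) : f [tuple of y :: t] =
    (K [tuple of y.1 :: tmap1 t] * psi ord0 y) * \prod_i psi (lift ord0 i) (tnth t i).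
  rewrite /f big_ord_recl mulrA; congr (_ * _ * _).
    by congr K; apply: val_inj.
  by apply: eq_bigr => i _; rewrite !(tnth_nth (thead [tuple y])) lift0.
have [j i0j|i00] := unliftP ord0 i0.
  apply: eq_integral => y _.
  have mKy : measurable_fun setT (fun x : n.-tuple E => K [tuple of y.1 :: x] * psi ord0 y).
    apply: measurable_funM => //.
    exact: (measurableT_comp (measurable_fun_tuple_cons mK) (measurable_pair1 y.1)).
  have := IH (fun i => psi (lift ord0 i)) _ j (fun i => mpsi _) mKy.
  rewrite /balanced -i0j => /(_ bpsi) h.
  under eq_integral do rewrite fE.
  by rewrite h; apply: eq_integral => t _; rewrite fE.
(* When the balanced factor is the first one, its variable has to be integrated innermost. *)
have swap (g : n.+1.-tuple X -> \bar R) : measurable_fun setT g -> (forall t, (0 <= g t)%E) ->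
    (\int[dx_sigma sigma]_y \int[pow n]_t g [tuple of y :: t] =
     \int[pow n]_t \int[dx_sigma sigma]_y g [tuple of y :: t])%E.
  move=> mg g0.
  apply: (@fubini_tonelli _ _ _ _ _ _ _ (fun z : X * n.-tuple X => g [tuple of z.1 :: z.2])) => //.
  exact: (measurable_fun_tuple_cons mg).
apply: (eq_trans (swap _ mp p0)); apply: (eq_trans _ (esym (swap _ mn n0))).
apply: eq_integral => t _ /=.
apply: balanced_kprod.
  exact: (measurableT_comp (measurable_fun_tuple_cons mf) (measurable_pair2 t)).
move=> x; set k := K [tuple of x :: tmap1 t] * \prod_i psi (lift ord0 i) (tnth t i).
rewrite (_ : (fun s => _) = fun s => k * psi ord0 (x, s)); last first.
  by apply/funext => s; rewrite fE /k; ring.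
apply: balancedZ; last by rewrite -i00.
exact: (measurableT_comp (mpsi ord0) (measurable_pair1 x)).
Qed.

Hypothesis sigma_moments : moment_bound sigma.
Variables (q : nat -> d.-tuple R -> {poly R}) (a b : nat -> d.-tuple R -> R).
Hypothesis q_orthogonal : monic_orthogonal sigma q a b.

(** In coordinate i the integrand contains q^(k) q^(l) with k different from l, whose integral over
    the fibre vanishes. *)
Lemma ip_JT0 n (ks ls : 'I_n -> nat) g h i : measurable_fun setT g -> measurable_fun setT h ->
  ks i != ls i -> ip (pow n) (JT q ks g) (JT q ls h) = 0.
Proof.
move=> mg mh kl; rewrite /ip.
have mq k := measurable_q sigma_moments q_orthogonal k.
rewrite (_ : (fun t => _) = fun t => (fun x => g x * h x) (tmap1 t) *
    \prod_i ((q (ks i) (tnth t i).1).[(tnth t i).2] * (q (ls i) (tnth t i).1).[(tnth t i).2])); last first.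
  by apply/funext => t; rewrite /JT big_split/=; ring.
apply: balanced_Rintegral.
apply: (@balanced_pow n (fun i y => (q (ks i) y.1).[y.2] * (q (ls i) y.1).[y.2])
  (fun x => g x * h x) i).
- by move=> j; exact: measurable_funM.
- exact: measurable_funM.
- move=> x; rewrite (_ : (fun s => _) = horner (q (ks i) x * q (ls i) x)); last first.
    by apply/funext => s; rewrite hornerM.
  apply: integrable_balanced; first exact: measurable_horner.
    exact: integrable_horner (sigma_mom sigma_moments x) _.
  exact: (L_orth q_orthogonal x kl).
Qed.

Lemma JT_permute n (ks : 'I_n -> nat) g (p : 'S_n) (t : n.-tuple X) :
  JT q ks g (permute_tuple p t) =
  JT q (fun i => ks ((p^-1)%g i)) (fun x => g (permute_tuple p x)) t.
Proof.
rewrite /JT; congr (_ * _).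
  by congr g; apply: eq_from_tnth => i; rewrite tnth_map !tnth_mktuple tnth_map.
rewrite [RHS](reindex_inj (@perm_inj _ p)); apply: eq_bigr => i _ /=.
by rewrite tnth_mktuple permK.
Qed.

End orthogonality.

Section symmetrized_inner_products.
Context d (T : measurableType d) (R : realType) (n : nat).
Variable m : {sigma_finite_measure set T -> \bar R}.
Local Notation mu := (tuple_prod n (fun _ => m)).
Implicit Types u v : n.-tuple T -> R.

Lemma Lfun2_permute (p : 'S_n) u : u \in Lfun mu 2%:E ->
  (fun t => u (permute_tuple p t)) \in Lfun mu 2%:E.
Proof.
move=> Lu; have mu_ := Lfun2_measurable Lu; apply/Lfun2P; split.
  exact: measurable_comp_permute.
by rewrite (@sqint_permute _ _ _ _ (fun=> m) xpredT)//; exact: sqint_lt_pinfty.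
Qed.

Lemma Lfun2Z c d' (S : measurableType d') (nu : {measure set S -> \bar R}) (u : S -> R) :
  u \in Lfun nu 2%:E -> (fun x => c * u x) \in Lfun nu 2%:E.
Proof.
move=> Lu; rewrite (_ : (fun x => _) = fun x => c * u x + 0); last by apply/funext => x; rewrite addr0.
by apply: Lfun2_lin => //; exact: Lfun2_0.
Qed.

Lemma ipZ c d' (S : measurableType d') (nu : {measure set S -> \bar R}) (u v : S -> R) :
  u \in Lfun nu 2%:E -> v \in Lfun nu 2%:E -> ip nu u (fun x => c * v x) = c * ip nu u v.
Proof.
move=> Lu Lv; rewrite (_ : (fun x => _) = fun x => c * v x + 0); last by apply/funext => x; rewrite addr0.
by rewrite ip_lin// ?ip0 ?addr0//; exact: Lfun2_0.
Qed.

Lemma Lfun2_sym u : u \in Lfun mu 2%:E -> sym_tuple u \in Lfun mu 2%:E.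
Proof.
move=> Lu; apply: Lfun2Z.
by have [] := @ip_sum _ _ _ mu u _ (index_enum _) xpredT (fun p t => u (permute_tuple p t)) Lu (fun p => Lfun2_permute p Lu).
Qed.

Lemma ip_sym u v : u \in Lfun mu 2%:E -> v \in Lfun mu 2%:E ->
  ip mu (sym_tuple u) (sym_tuple v) =
  n`!%:R^-1 * \sum_(p : 'S_n) ip mu u (fun t => v (permute_tuple p t)).
Proof.
move=> Lu Lv; have Ls := Lfun2_sym Lv; have LU p := Lfun2_permute p Lu.
have LV p := Lfun2_permute p Lv.
transitivity (ip mu u (sym_tuple v)).
  have [h1 h2] := @ip_sum _ _ _ mu _ _ (index_enum _) xpredT (fun p t => u (permute_tuple p t)) Ls LU.
  rewrite ipC ipZ// h1.
  rewrite (eq_bigr (fun=> 1%:R * ip mu u (sym_tuple v))); last first.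
    move=> p _; rewrite mul1r ipC /ip.
    rewrite -[RHS](@Rintegral_tuple_prod_perm _ _ _ n (fun=> m) p)//.
      by apply: eq_Rintegral => t _; rewrite sym_tuple_perm.
    by apply: measurable_funM; [exact: Lfun2_measurable Lu|exact: Lfun2_measurable Ls].
  rewrite -mulr_suml -natr_sum sum1_card card_Sn mulrA mulVf ?mul1r//.
have [h1 h2] := @ip_sum _ _ _ mu _ _ (index_enum _) xpredT (fun p t => v (permute_tuple p t)) Lu LV.
by rewrite ipZ// h1.
Qed.

End symmetrized_inner_products.

(** * Orthogonal sums in Fock space *)

Section fock_direct_sum.
Context (R : realType) (d : nat) (sigma : R.-pker (d.-tuple R) ~> R).
Local Notation E := (d.-tuple R).
Local Notation X := (d.-tuple R * R)%type.
Local Notation pow := (dx_sigma_pow sigma).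
Local Notation fock := (fock sigma).
Local Notation fock_sqnorm := (fock_sqnorm sigma).
Implicit Types F G : seq X -> R^o.

Lemma component_in_degree m n F : component m (in_degree n F) =
  if m == n then component m F else fun=> 0.
Proof.
apply/funext => t; rewrite /component /in_degree size_tuple.
by case: (m == n).
Qed.

Lemma fock_in_degree n F : component n F \in Lfun (pow n) 2%:E ->
  sym_tuple (component n F) = component n F %[ae pow n] ->
  fock (in_degree n F) /\ fock_sqnorm (in_degree n F) = (n`!%:R%:E * sqint (pow n) (component n F))%E.
Proof.
move=> LF SF.
have NE : fock_sqnorm (in_degree n F) = (n`!%:R%:E * sqint (pow n) (component n F))%E.
  rewrite fock_sqnormE /dsum_norm.
  transitivity (\esum_(k in [set n]) fockn_norm sigma k F); last first.
    by rewrite esum_set1// mule_ge0// sqint_ge0.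
  rewrite [RHS]esum_mkcond; apply: eq_esum => k _.
  rewrite /fockn_norm /proj_norm component_in_degree.
  have [->|kn] := eqVneq k n; first by rewrite mem_set.
  rewrite memNset; last by move=> /= /eqP; exact/negP.
  by rewrite /sqint integral0_eq ?mule0// => x _; rewrite expr0n.
split=> //; split; last first.
  by rewrite NE lte_mul_pinfty// ?lee_fin// sqint_lt_pinfty.
move=> m; rewrite component_Symn component_in_degree.
have [->|mn] := eqVneq m n; first by split.
split; first exact: Lfun2_0.
by rewrite sym_tuple_id//; exact: aeW.
Qed.

Lemma fock_sqnormD F G : fock F -> fock G ->
  (forall n, ip (pow n) (component n F) (component n G) = 0) ->
  fock_sqnorm (F + G) = (fock_sqnorm F + fock_sqnorm G)%E.
Proof.
move=> [Ff _] [Gf _] FG; rewrite /fock_sqnorm -nneseriesD//; last 2 first.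
- by move=> n _ _; rewrite mule_ge0// sqint_ge0.
- by move=> n _ _; rewrite mule_ge0// sqint_ge0.
apply: eq_eseriesr => n _; rewrite -ge0_muleDr ?sqint_ge0//; congr (_ * _)%E.
apply: sqintD_orth => //; [exact: (Ff n).1|exact: (Gf n).1].
Qed.

Lemma sum_fctE (T I : Type) (r : seq I) (u : I -> T -> R^o) x :
  (\sum_(i <- r) u i) x = \sum_(i <- r) u i x.
Proof. by elim: r => [|i r IH]; rewrite ?big_nil// !big_cons -IH. Qed.

Lemma fock_pyth (K : choiceType) (u : K -> seq X -> R^o) (A : {fset K}) :
  (forall i, fock (u i)) ->
  (forall i j n, i != j -> ip (pow n) (component n (u i)) (component n (u j)) = 0) ->
  fock_sqnorm (\sum_(i <- A) u i) = (\sum_(i <- A) fock_sqnorm (u i))%E.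
Proof.
move=> Du uij; have : uniq A by exact: fset_uniq.
elim: (enum_fset A) => [_|i r IH /= /andP[ir ur]].
  by rewrite !big_nil (sqn0 (sqnormed_fock sigma)).
rewrite !big_cons -IH// fock_sqnormD//.
  by apply: (dom_sum (sqnormed_fock sigma)).
move=> n; have LU j : component n (u j) \in Lfun (pow n) 2%:E by have [h _] := Du j; exact: (h n).1.
rewrite (_ : component n (\sum_(j <- r) u j) = fun t => \sum_(j <- r | true) component n (u j) t); last first.
  by apply/funext => t; rewrite /component sum_fctE.
have [-> _] := ip_sum r xpredT (LU i) LU.
rewrite big_seq big1// => j jr; apply: uij.
by apply: contraNneq ir => ->.
Qed.

End fock_direct_sum.

Section symmetrized_J.
Context (R : realType) (d : nat) (sigma : R.-pker (d.-tuple R) ~> R).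
Hypothesis sigma_moments : moment_bound sigma.
Variables (q : nat -> d.-tuple R -> {poly R}) (a b : nat -> d.-tuple R -> R).
Hypothesis q_orthogonal : monic_orthogonal sigma q a b.
Variable rho : nat -> {sigma_finite_measure set (d.-tuple R) -> \bar R}.
Hypothesis rhoE : rho_spec sigma q rho.
Local Notation E := (d.-tuple R).
Local Notation X := (d.-tuple R * R)%type.
Local Notation pow := (dx_sigma_pow sigma).
Local Notation Jal al := (JT q (fun i : 'I__ => block al i)).

Lemma count_blocks (al : multiindex) k : count_mem k (blocks al) = al k.
Proof.
rewrite /blocks count_flatten -map_comp sumnE big_map.
rewrite (eq_bigr (fun j => (j == k) * al j)%N); last by move=> j _; rewrite /= count_nseq.
have s : perm_eq (sort leq (finsupp al)) (finsupp al) by rewrite perm_sort.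
rewrite (perm_big _ s)/=.
have [kal|kal] := boolP (k \in finsupp al).
  rewrite (big_fsetD1 k)//= eqxx mul1n big_seq big1 ?addn0// => j.
  by rewrite in_fsetD1 => /andP[/negbTE -> _]; rewrite mul0n.
rewrite [al k]fsfun_dflt// big_seq big1// => j jal.
by case: eqP => [jk|]; rewrite ?mul0n//; rewrite -jk jal in kal.
Qed.

Lemma block_perm_inj (al be : multiindex) n (p : 'S_n) : deg al = n -> deg be = n ->
  (forall i : 'I_n, block al i = block be (p i)) -> al = be.
Proof.
move=> aln ben h; apply/fsfunP => k; rewrite -!count_blocks.
have -> // : perm_eq (blocks al) (blocks be) -> count_mem k (blocks al) = count_mem k (blocks be).
  by move/seq.permP.
pose ta : n.-tuple nat := [tuple block al i | i < n].
pose tb : n.-tuple nat := [tuple block be i | i < n].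
have ea : blocks al = ta.
  apply: (@eq_from_nth _ 0%N) => [|i]; rewrite size_blocks aln ?size_tuple// => ni.
  by rewrite -(tnth_nth 0%N ta (Ordinal ni)) tnth_mktuple.
have eb : blocks be = tb.
  apply: (@eq_from_nth _ 0%N) => [|i]; rewrite size_blocks ben ?size_tuple// => ni.
  by rewrite -(tnth_nth 0%N tb (Ordinal ni)) tnth_mktuple.
rewrite ea eb; apply/tuple_permP; exists p.
by congr tval; apply: eq_from_tnth => i; rewrite !tnth_mktuple.
Qed.

Lemma Lfun2_JT al g : g \in Lfun (rho_prod rho al) 2%:E ->
  Jal al g \in Lfun (pow (deg al)) 2%:E.
Proof.
move=> /Lfun2P[mg goo]; apply/Lfun2P; split.
  exact: (measurable_JT sigma_moments q_orthogonal).
by rewrite (sqint_JT sigma_moments q_orthogonal rhoE (block al)).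
Qed.

Lemma component_Jop_deg f al n : deg al = n ->
  component n (J_op q f al) = Jal al (component n (f al)).
Proof. by move=> <-; exact: component_Jop. Qed.

Lemma JT_block_perm al n g (p : 'S_n) t : block_perm al p ->
  Jal al g (permute_tuple p t) = Jal al (fun x => g (permute_tuple p x)) t.
Proof.
move=> bp; rewrite JT_permute; congr (JT q _ _ _); apply/funext => i.
by have /forallP/(_ i)/eqP := block_permV bp.
Qed.

Lemma JT_bsym al n g : Jal al (bsym_tuple al g) = bsym_tuple al (Jal al g) :> (n.-tuple X -> R).
Proof.
apply/funext => t; rewrite /bsym_tuple.
rewrite [in RHS](eq_bigr _ (fun p bp => JT_block_perm g t bp)).
by rewrite /JT -mulrA mulr_suml.
Qed.

(** Averaging over a subgroup first changes nothing in the average over the whole group. *)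
Lemma sym_bsym al (u : (deg al).-tuple X -> R) : sym_tuple (bsym_tuple al u) = sym_tuple u.
Proof.
apply/funext => t; rewrite /sym_tuple /bsym_tuple -mulr_sumr exchange_big/=.
rewrite (eq_bigr (fun=> 1%:R * (\sum_(p : 'S_(deg al)) u (permute_tuple p t)))); last first.
  move=> r _; rewrite mul1r [RHS](reindex_inj (mulgI r))/=.
  by apply: eq_bigr => p _; rewrite permute_tupleM.
rewrite -mulr_suml -natr_sum count_block_perm mulrA; congr (_ * _).
by rewrite mulVf ?mul1r//; exact: fact_index_neq0.
Qed.

(** In the sum over permutations from [ip_sym], a permutation outside the Young subgroup pairs two
    different q's in some coordinate and contributes 0; each of the alpha! others contributes the
    full squared norm of J g, since g is block symmetric. The n! of Fock space cancels the
    normalization. *)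
Lemma sqint_sym_JT al g : g \in Lfun (rho_prod rho al) 2%:E ->
  (forall p t, block_perm al p -> g (permute_tuple p t) = g t) ->
  ((deg al)`!%:R%:E * sqint (pow (deg al)) (sym_tuple (Jal al g)) =
   (fact_index al)%:R%:E * sqint (rho_prod rho al) g)%E.
Proof.
move=> Lg gs; have LJ := Lfun2_JT Lg.
rewrite -(sqint_JT sigma_moments q_orthogonal rhoE (block al)); last exact: Lfun2_measurable Lg.
rewrite !ip_sqint//; last exact: Lfun2_sym.
rewrite ip_sym// -!EFinM mulrA mulfV ?mul1r; last by rewrite pnatr_eq0 -lt0n fact_gt0.
congr _%:E; rewrite (bigID (block_perm al (m := deg al)))/= [X in _ + X]big1 ?addr0.
  rewrite (eq_bigr (fun=> 1%:R * ip (pow (deg al)) (Jal al g) (Jal al g))).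
    by rewrite -mulr_suml -natr_sum count_block_perm.
  move=> p bp; rewrite mul1r; congr (ip _ _ _); apply/funext => t.
  by rewrite JT_block_perm//; congr (JT q _ _ _); apply/funext => x; exact: gs.
move=> p; rewrite negb_forall => /existsP[i bi].
have mg := Lfun2_measurable Lg.
rewrite (_ : (fun t => _) = fun t => JT q (fun i => block al ((p^-1)%g i)) (fun x => g (permute_tuple p x)) t).
  apply: (ip_JT0 sigma_moments q_orthogonal (i := p i)) => //.
    exact: measurable_comp_permute.
  by rewrite permK.
by apply/funext => t; rewrite JT_permute.
Qed.

(** The block sequences of distinct multi-indices are not rearrangements of each other, so every
    permuted pairing meets two different q's somewhere. *)
Lemma ip_sym_JT al be n g h : deg al = n -> deg be = n -> al != be ->
  Jal al g \in Lfun (pow n) 2%:E -> Jal be h \in Lfun (pow n) 2%:E ->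
  measurable_fun setT g -> measurable_fun setT h ->
  ip (pow n) (sym_tuple (Jal al g)) (sym_tuple (Jal be h)) = 0.
Proof.
move=> aln ben albe Lg Lh mg mh; rewrite ip_sym// big1 ?mulr0// => p _.
have [i bi] : exists i : 'I_n, block al i != block be ((p^-1)%g i).
  apply/existsP; apply: contraNT albe; rewrite negb_exists => /forallP h1.
  apply/eqP; apply: (block_perm_inj (p := (p^-1)%g) aln ben) => i.
  by have := h1 i; rewrite negbK => /eqP.
rewrite (_ : (fun t => _) = JT q (fun i => block be ((p^-1)%g i)) (fun x => h (permute_tuple p x))).
  apply: (ip_JT0 sigma_moments q_orthogonal (i := i)) => //.
  exact: measurable_comp_permute.
by apply/funext => t; rewrite JT_permute.
Qed.

(** Membership in G_alpha gives block symmetry only almost everywhere; the exact symmetry that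
    [sqint_sym_JT] asks for is gained by passing to the block average. *)
Lemma Gcomp_bsym al g : Gcomp rho al g ->
  bsym_tuple al (component (deg al) g) \in Lfun (rho_prod rho al) 2%:E /\
  sqint (rho_prod rho al) (bsym_tuple al (component (deg al) g)) =
  sqint (rho_prod rho al) (component (deg al) g).
Proof.
rewrite /Gcomp component_block_sym => -[Lg Sg]; have mg := Lfun2_measurable Lg.
have mb := @measurable_bsym_tuple _ _ _ al _ _ mg.
have e : sqint (rho_prod rho al) (bsym_tuple al (component (deg al) g)) =
  sqint (rho_prod rho al) (component (deg al) g) by exact: ae_eq_sqint.
by split=> //; apply/Lfun2P; rewrite e; split=> //; exact: sqint_lt_pinfty.
Qed.

Lemma Sym_comp_fock f al : Gcomp rho al (f al) ->
  fock sigma (Sym_comp (J_op q f) al) /\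
  fock_sqnorm sigma (Sym_comp (J_op q f) al) = Gcomp_sqnorm rho al (f al).
Proof.
move=> Gf; have [Lf Sf] := Gf; have [Lb Nb] := Gcomp_bsym Gf.
have [|| h1 h2] := @fock_in_degree _ _ sigma (deg al) (Symn (J_op q f al)).
- by rewrite component_Symn component_Jop; apply: Lfun2_sym; exact: Lfun2_JT.
- by rewrite component_Symn sym_tuple_id; [exact: aeW|move=> p t; exact: sym_tuple_perm].
split => //; rewrite /Sym_comp h2 component_Symn component_Jop -sym_bsym -JT_bsym.
rewrite sqint_sym_JT//; last by move=> p t bp; exact: bsym_tuple_perm.
by rewrite Nb.
Qed.

Lemma Sym_comp_orth f g al be n : Gcomp rho al (f al) -> Gcomp rho be (g be) -> al != be ->
  ip (pow n) (component n (Sym_comp (J_op q f) al)) (component n (Sym_comp (J_op q g) be)) = 0.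
Proof.
move=> [Lf _] [Lg _] albe; rewrite /Sym_comp !component_in_degree.
case: eqP => [aln|_]; last by rewrite ipC ip0.
case: eqP => [ben|_]; last by rewrite ip0.
rewrite !component_Symn !component_Jop_deg//.
have L al' f' : n = deg al' -> component (deg al') f' \in Lfun (rho_prod rho al') 2%:E ->
   Jal al' (component n f') \in Lfun (pow n) 2%:E /\ measurable_fun setT (component n f').
  by move=> -> h; split; [exact: Lfun2_JT|exact: Lfun2_measurable h].
have [L1 m1] := L _ _ aln Lf; have [L2 m2] := L _ _ ben Lg.
exact: ip_sym_JT.
Qed.

Lemma Sym_comp_pyth f (A : {fset multiindex}) : Gspace rho f ->
  fock_sqnorm sigma (\sum_(al <- A) Sym_comp (J_op q f) al) =
  (\sum_(al <- A) fock_sqnorm sigma (Sym_comp (J_op q f) al))%E.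
Proof.
move=> [Gf _]; apply: fock_pyth.
- by move=> al; have [] := Sym_comp_fock (Gf al).
- by move=> al be n albe; exact: Sym_comp_orth.
Qed.

(** The summands are pairwise orthogonal with summable squared norms, so completeness provides a
    sum. Since [Sym_op] is chosen by [xget], this existence is what gives it meaning. *)
Lemma Sym_op_spec f : Gspace rho f -> let F := Sym_op sigma (J_op q f) in
  [/\ fock sigma F, sums_to (fock_sqnorm sigma) (Sym_comp (J_op q f)) F &
      fock_sqnorm sigma F = Gsqnorm rho f].
Proof.
move=> Gf F; have [Gf1 Gf2] := Gf.
have SF al := Sym_comp_fock (Gf1 al).
have pyth A := Sym_comp_pyth A Gf.
have NE : (\esum_(al in [set: multiindex]) fock_sqnorm sigma (Sym_comp (J_op q f) al) = Gsqnorm rho f)%E.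
  by apply: eq_esum => al _; rewrite (SF al).2.
have DF al := (SF al).1.
have [l Dl hl] := sums_to_exists (sqnormed_fock sigma) DF pyth (@sqcomplete_fock _ _ sigma)
  (ltac:(by rewrite NE)).
have [FF Fs] : (fock sigma `&` [set F | sums_to (fock_sqnorm sigma) (Sym_comp (J_op q f)) F]) F.
  by apply: (@xgetPex _ 0 [set F | fock sigma F /\ sums_to (fock_sqnorm sigma) (Sym_comp (J_op q f)) F]); exists l.
split=> //.
by rewrite -NE; apply: (sums_to_sqn (sqnormed_fock sigma) DF pyth).
Qed.

End symmetrized_J.

(** * Field operators on vectors dominated by polynomial weights *)

Section polynomial_weights.
Context (R : realType) (d : nat) (sigma : R.-pker (d.-tuple R) ~> R).
Hypothesis sigma_moments : moment_bound sigma.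
Local Notation E := (d.-tuple R).
Local Notation X := (d.-tuple R * R)%type.
Local Notation pow := (dx_sigma_pow sigma).

(* By [moment_bound], [wt M k] is integrable for every M and k, and a field operator
   turns a bound by [Wt M k] into a bound by [Wt M k.+1]. *)
Definition wt (M : R) (k : nat) (y : X) : R := \1_(box M) y.1 * (1 + `|y.2|) ^+ k.

Lemma wt_ge0 M k y : 0 <= wt M k y.
Proof. by rewrite mulr_ge0// exprn_ge0// addr_ge0. Qed.

Lemma wt_le M M' k k' y : M <= M' -> (k <= k')%N -> wt M k y <= wt M' k' y.
Proof.
move=> MM kk; apply: ler_pM; rewrite ?exprn_ge0 ?addr_ge0//.
  rewrite !indicE; have [yM|] := boolP (y.1 \in box M); last by rewrite ler0n.
  by rewrite mem_set//; apply: le_box MM _ _; rewrite inE in yM.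
by apply: ler_weXn2l => //; rewrite lerDl.
Qed.

Lemma measurable_wt M k : measurable_fun setT (wt M k).
Proof.
apply: measurable_funM.
  apply: (measurableT_comp (f := \1_(box M) : E -> R)); last exact: measurable_fst.
  by apply: measurable_indic; exact: measurable_box.
apply: measurable_funX; apply: measurable_funD => //.
by apply: measurableT_comp => //; exact: measurable_snd.
Qed.

Lemma wt_sqr M k y : wt M k y ^+ 2 = wt M (k * 2) y.
Proof. by rewrite /wt exprMn -exprM indicE; case: (_ \in _); rewrite ?expr1n ?expr0n ?mul0r. Qed.

Lemma integral_wt_lty M k : (\int[dx_sigma sigma]_y (wt M k y)%:E < +oo)%E.
Proof.
have [C C0 hC] := sigma_moments (bounded_borel_box d M).
have mw : measurable_fun setT (fun y : X => (wt M k y)%:E).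
  by apply/measurable_EFinP; exact: measurable_wt.
rewrite integral_kprod//; last by move=> y; rewrite lee_fin wt_ge0.
(* From (1 + |s|)^k <= 2^k (1 + |s|^k), proved separately for |s| <= 1 and |s| > 1, and the moment
   bound. *)
pose K := 2 ^+ k * (1 + C ^+ k * k`!%:R).
have K0 : 0 <= K by rewrite mulr_ge0 ?exprn_ge0// addr_ge0// mulr_ge0// exprn_ge0// ltW.
apply: (@le_lt_trans _ _ (\int[leb R d]_x (K%:E * (\1_(box M) x)%:E))%E).
  apply: ge0_le_integral => //.
  - by move=> x _; apply: integral_ge0 => s _; rewrite lee_fin wt_ge0.
  - apply: (@measurable_integral_pker _ _ _ _ R sigma (fun y => (wt M k y)%:E)) => // y.
    by rewrite lee_fin wt_ge0.
  - apply: measurable_funeM; apply/measurable_EFinP; apply: measurable_indic; exact: measurable_box.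
  move=> x _; rewrite indicE; have [xM|xM] := boolP (x \in box M); last first.
    rewrite mule0 integral0_eq// => s _.
    by rewrite /wt indicE/= (negbTE xM) mul0r.
  rewrite mule1.
  apply: (@le_trans _ _ (\int[sigma x]_s ((2 ^+ k)%:E * (1%:E + (`|s| ^+ k)%:E)))%E).
    apply: ge0_le_integral => //.
    + by move=> s _; rewrite lee_fin wt_ge0.
    + by apply/measurable_EFinP; apply: (measurableT_comp (measurable_wt M k)); exact: measurable_pair1.
    + apply: measurable_funeM; apply: emeasurable_funD => //.
      by apply/measurable_EFinP; apply: measurable_funX; exact: normr_measurable.
    + move=> s _; rewrite -EFinD -EFinM lee_fin /wt indicE/= xM mul1r.
      have [s1|s1] := leP `|s| 1.
        apply: (@le_trans _ _ (2 ^+ k * 1)); last first.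
          by rewrite ler_wpM2l ?exprn_ge0// lerDl exprn_ge0.
        rewrite mulr1; apply: lerXn2r; rewrite ?nnegrE ?addr_ge0//.
        by lra.
      apply: (@le_trans _ _ (2 ^+ k * `|s| ^+ k)); last first.
        by rewrite ler_wpM2l ?exprn_ge0// lerDr.
      rewrite -exprMn; apply: lerXn2r; rewrite ?nnegrE ?addr_ge0 ?mulr_ge0//.
      by lra.
  have ms : measurable_fun setT (fun s : R => (`|s| ^+ k)%:E).
    by apply/measurable_EFinP; apply: measurable_funX; exact: normr_measurable.
  rewrite ge0_integralZl_EFin ?exprn_ge0//; last 2 first.
  - by move=> s _; rewrite -EFinD lee_fin addr_ge0// exprn_ge0.
  - exact: emeasurable_funD.
  rewrite ge0_integralD//.
  rewrite integral_cst// mul1e EFinM; apply: lee_wpmul2l; first by rewrite lee_fin exprn_ge0.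
  rewrite [leRHS]EFinD; apply: leeD; first by rewrite sigmaT.
  by apply: hC; rewrite inE in xM.
rewrite ge0_integralZl_EFin//; last first.
  by apply/measurable_EFinP; apply: measurable_indic; exact: measurable_box.
rewrite integral_indic ?setIT; [|exact: measurableT|exact: measurable_box].
by rewrite lte_mul_pinfty ?lee_fin//; exact: leb_box_lty.
Qed.

Definition Wt M k (s : seq X) : R := \prod_(y <- s) wt M k y.

Lemma Wt_ge0 M k s : 0 <= Wt M k s.
Proof. by apply: prodr_ge0 => y _; exact: wt_ge0. Qed.

Lemma Wt_cons M k y s : Wt M k (y :: s) = wt M k y * Wt M k s.
Proof. by rewrite /Wt big_cons. Qed.

Lemma Wt_le M M' k k' s : M <= M' -> (k <= k')%N -> Wt M k s <= Wt M' k' s.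
Proof.
move=> MM kk; elim: s => [|y s IH]; first by rewrite /Wt !big_nil.
by rewrite !Wt_cons; apply: ler_pM => //; [exact: wt_ge0|exact: Wt_ge0|exact: wt_le].
Qed.

Lemma measurable_Wt M k n : measurable_fun setT (fun t : n.-tuple X => Wt M k t).
Proof.
rewrite (_ : (fun t => _) = fun t : n.-tuple X => \prod_(i < n) wt M k (tnth t i)).
  apply: measurable_prod => i _.
  exact: measurableT_comp (measurable_wt M k) (measurable_tnth i).
by apply/funext => t; rewrite /Wt big_tuple.
Qed.

Lemma integral_Wt_lty M k n : (\int[pow n]_t (Wt M k t)%:E < +oo)%E.
Proof.
elim: n => [|n IH].
  rewrite /dx_sigma_pow integral_tuple_prod0; first by rewrite /Wt big_nil ltry.
  by apply/measurable_EFinP; exact: measurable_Wt.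
rewrite /dx_sigma_pow integral_tuple_prodS; last 2 first.
- by apply/measurable_EFinP; exact: measurable_Wt.
- by move=> t; rewrite lee_fin Wt_ge0.
rewrite (eq_integral (fun y => (wt M k y)%:E * (\int[pow n]_t (Wt M k t)%:E))%E); last first.
  move=> y _; rewrite -ge0_integralZl_EFin//.
  - by apply: eq_integral => t _; rewrite -EFinM -Wt_cons.
  - by move=> t _; rewrite lee_fin Wt_ge0.
  - by apply/measurable_EFinP; exact: measurable_Wt.
  - exact: wt_ge0.
have I0 : (0 <= \int[pow n]_t (Wt M k t)%:E)%E by apply: integral_ge0 => t _; rewrite lee_fin Wt_ge0.
rewrite ge0_integralZr//; last 2 first.
- by apply/measurable_EFinP; exact: measurable_wt.
- by move=> y _; rewrite lee_fin wt_ge0.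
have J0 : (0 <= \int[dx_sigma sigma]_y (wt M k y)%:E)%E.
  by apply: integral_ge0 => y _; rewrite lee_fin wt_ge0.
by rewrite lte_mul_pinfty// ge0_fin_numE// integral_wt_lty.
Qed.

Lemma sqint_Wt_lty M k n : (sqint (pow n) (fun t => Wt M k t) < +oo)%E.
Proof.
have := integral_Wt_lty M (k * 2) n; rewrite /sqint; congr (_ < _)%E.
apply: eq_integral => t _; congr _%:E; elim: (tval t) => [|y s IH].
  by rewrite /Wt !big_nil expr1n.
by rewrite !Wt_cons exprMn -IH wt_sqr.
Qed.

Definition dom M k N C (s : seq X) : R := if (size s <= N)%N then C * Wt M k s else 0.

Lemma dom_ge0 M k N C s : 0 <= C -> 0 <= dom M k N C s.
Proof. by rewrite /dom; case: ifP => // _ C0; rewrite mulr_ge0// Wt_ge0. Qed.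

Lemma dom_le M M' k k' N N' C C' s : M <= M' -> (k <= k')%N -> (N <= N')%N ->
  0 <= C -> C <= C' -> dom M k N C s <= dom M' k' N' C' s.
Proof.
move=> MM kk NN C0 CC; rewrite /dom; case: ifPn => [sN|sN].
  rewrite (leq_trans sN)//; apply: ler_pM => //; first exact: Wt_ge0.
  exact: Wt_le.
by case: ifP => // _; rewrite mulr_ge0 ?Wt_ge0// (le_trans C0).
Qed.

(** The bound is uniform in the index: with J = unit it concerns a single vector, with J = nat it is
    the majorant in dominated convergence. The cutoff in [dom] also makes the degree bounded. *)
Definition dominated (J : Type) (F : J -> seq X -> R^o) :=
  exists M k N C, 0 <= C /\ forall j s, `|F j s| <= dom M k N C s.

Lemma dominated_lin (J : Type) c (F G : J -> seq X -> R^o) : dominated F -> dominated G ->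
  dominated (fun j s => c * F j s + G j s).
Proof.
move=> [M [k [N [C [C0 hF]]]]] [M' [k' [N' [C' [C'0 hG]]]]].
exists (Num.max M M'), (maxn k k'), (maxn N N'), (`|c| * C + C'); split.
  by rewrite addr_ge0// mulr_ge0.
move=> j s; rewrite (le_trans (ler_normD _ _))// normrM.
apply: (@le_trans _ _ (`|c| * dom (Num.max M M') (maxn k k') (maxn N N') C s +
  dom (Num.max M M') (maxn k k') (maxn N N') C' s)).
  apply: lerD.
    apply: ler_wpM2l => //; apply: (le_trans (hF j s)).
    by apply: dom_le => //; rewrite ?le_max ?lexx// leq_maxl.
  apply: (le_trans (hG j s)).
  by apply: dom_le => //; rewrite ?le_max ?lexx ?orbT// leq_maxr.
rewrite /dom; case: ifP => _; last by rewrite mulr0 addr0.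
by rewrite mulrA -mulrDl.
Qed.

Lemma dominated_sub (J J' : Type) (u : J' -> J) (F : J -> seq X -> R^o) :
  dominated F -> dominated (fun j => F (u j)).
Proof.
move=> [M [k [N [C [C0 hF]]]]]; exists M, k, N, C; split => // j s; exact: hF.
Qed.

Definition measurable_seq (F : seq X -> R^o) := forall n, measurable_fun setT (component n F).

Definition Bdd F := measurable_seq F /\ dominated (fun _ : unit => F).

Lemma Bdd_lin c F G : Bdd F -> Bdd G -> Bdd (fun s => c * F s + G s).
Proof.
move=> [mF dF] [mG dG]; split; last exact: (dominated_lin c dF dG).
move=> n; apply: (@measurable_funD _ _ _ _ (fun t => (c : R) * component n F t) (component n G)) => //.
  by apply: measurable_funM => //; exact: mF.
exact: mG.
Qed.

Lemma dom_Lfun2 F M k N C n : measurable_fun setT (component n F) ->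
  (forall s, `|F s| <= dom M k N C s) -> component n F \in Lfun (pow n) 2%:E.
Proof.
move=> mF hF; apply/Lfun2P; split=> //.
apply: (@le_lt_trans _ _ (sqint (pow n) (fun t => `|C| * Wt M k t))).
  apply: le_sqint => //; first by apply: measurable_funM => //; exact: measurable_Wt.
  move=> t; rewrite (le_trans (hF _))// (le_trans _ (ler_norm _))//.
  rewrite /dom; case: ifP => _; last by rewrite mulr_ge0 ?Wt_ge0.
  by rewrite ler_wpM2r ?Wt_ge0// ler_norm.
rewrite sqintZ; last exact: measurable_Wt.
by rewrite lte_mul_pinfty ?lee_fin ?sqr_ge0// sqint_Wt_lty.
Qed.

Lemma Bdd_Lfun2 F n : Bdd F -> component n F \in Lfun (pow n) 2%:E.
Proof.
by move=> [mF [M [k [N [C [C0 hF]]]]]]; apply: (@dom_Lfun2 _ M k N C) => // s; exact: (hF tt).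
Qed.

End polynomial_weights.

Section field_operators.
Context (R : realType) (d : nat) (sigma : R.-pker (d.-tuple R) ~> R).
Hypothesis sigma_moments : moment_bound sigma.
Local Notation E := (d.-tuple R).
Local Notation X := (d.-tuple R * R)%type.
Local Notation pow := (dx_sigma_pow sigma).

Definition bddE (phi : E -> R) := exists M, bounded_on (box M) phi.

Lemma bddE_wt phi : bddE phi -> exists M C, 0 <= C /\
  forall k (y : X), `|phi y.1| * (1 + `|y.2|) ^+ k <= C * wt M k y.
Proof.
move=> [M /bounded_on_ge0[_ [C C0 hC]]]; exists M, C; split=> // k y.
by rewrite /wt mulrA ler_wpM2r// exprn_ge0// addr_ge0.
Qed.

Lemma bddE_measurable phi : bddE phi -> measurable_fun setT phi.
Proof. by move=> [M []]. Qed.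

Lemma measurable_fst_comp phi : bddE phi -> measurable_fun setT (fun y : X => phi y.1).
Proof.
by move=> /bddE_measurable mphi; apply: (measurableT_comp mphi); exact: measurable_fst.
Qed.

(* The field operator conjugated by the multiplication by n! in degree n: this absorbs
   the symmetrization in [creation] and the factor n + 1 in [annihilation]. *)
Definition fieldt (phi : E -> R) (F : seq X -> R^o) : seq X -> R^o := fun s =>
  crea (fun y => phi y.1) F s + \int[dx_sigma sigma]_y (phi y.1 * F (y :: s)) +
  (\sum_(y <- s) phi y.1 * y.2) * F s.

Definition FVt (phis : seq (E -> R)) : seq X -> R^o := foldr fieldt (@vacuum R d) phis.

Definition FV (phis : seq (E -> R)) : seq X -> R^o := fun s => FVt phis s / (size s)`!%:R.

Lemma crea_lin (h : X -> R) c (F G : seq X -> R^o) s :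
  crea h (fun t => c * F t + G t) s = c * crea h F s + crea h G s.
Proof.
elim: s F G => [|y s IH] F G /=; first by rewrite mulr0 addr0.
by rewrite IH; ring.
Qed.

Lemma crea_le (h : X -> R) M k K C (F : seq X -> R^o) s : 0 <= C -> 0 <= K ->
  (forall y, `|h y| <= K * wt M k y) ->
  (forall t, size t = (size s).-1 -> `|F t| <= C * Wt M k t) ->
  `|crea h F s| <= (size s)%:R * (K * C) * Wt M k s.
Proof.
move=> C0 K0 hK; elim: s C C0 F => [|y s IH] C C0 F FC /=; first by rewrite normr0 !mul0r.
rewrite (le_trans (ler_normD _ _))// normrM Wt_cons.
apply: (@le_trans _ _ ((K * wt M k y) * (C * Wt M k s) + (size s)%:R * (K * (C * wt M k y)) * Wt M k s)).
  apply: lerD; first by apply: ler_pM => //; exact: FC.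
  case: (posnP (size s)) => [|s0]; first by case: (s) => //= _; rewrite normr0 !mul0r.
  apply: IH; first by rewrite mulr_ge0// wt_ge0.
  by move=> t tE; rewrite -mulrA -Wt_cons; apply: FC; rewrite /= tE prednK.
by rewrite -natr1 le_eqVlt; apply/orP; left; apply/eqP; ring.
Qed.

(** Multiplication by s at a point costs one power of 1 + |s| there; this is why the exponent grows
    by one with each field operator. *)
Lemma sum_le_wt phi M C k (s : seq X) : 0 <= C ->
  (forall k (y : X), `|phi y.1| * (1 + `|y.2|) ^+ k <= C * wt M k y) ->
  `|\sum_(y <- s) phi y.1 * y.2| * Wt M k s <= (size s)%:R * C * Wt M k.+1 s.
Proof.
move=> C0 hC; have := Wt_ge0 M k s; have := Wt_ge0 M k.+1 s.
(* The sum runs over a part [t] while the weight keeps all of [s], whichever point is selected. *)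
suff h (t : seq X) : {subset t <= s} ->
    `|\sum_(y <- t) phi y.1 * y.2| * Wt M k s <= (size t)%:R * C * Wt M k.+1 s.
  by move=> _ _; exact: h.
elim: t => [_|y t IH ts]; first by rewrite big_nil normr0 !mul0r.
rewrite big_cons; apply: (@le_trans _ _ ((`|phi y.1 * y.2| + `|\sum_(y <- t) phi y.1 * y.2|) * Wt M k s)).
  by rewrite ler_wpM2r ?Wt_ge0// ler_normD.
rewrite mulrDl -natr1 !mulrDl mul1r addrC; apply: lerD.
  by apply: IH => z zt; apply: ts; rewrite inE zt orbT.
have ys : y \in s by apply: ts; rewrite inE eqxx.
have y1 : `|phi y.1 * y.2| <= C * (1 + `|y.2|).
  have := hC 1%N y; rewrite expr1 normrM => h1.
  apply: (@le_trans _ _ (C * wt M 1 y)); last first.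
    by rewrite ler_wpM2l// /wt expr1 ler_piMl ?addr_ge0// indicE lern1 leq_b1.
  apply: le_trans h1; apply: ler_wpM2l => //; by rewrite lerDr.
have -> : Wt M k.+1 s = (1 + `|y.2|) * wt M k y * Wt M k.+1 (rem y s).
  rewrite /Wt (perm_big _ (perm_to_rem ys))/= big_cons; congr (_ * _).
  by rewrite /wt exprS; ring.
have -> : Wt M k s = wt M k y * Wt M k (rem y s).
  by rewrite /Wt (perm_big _ (perm_to_rem ys))/= big_cons.
rewrite [leRHS](_ : _ = C * (1 + `|y.2|) * (wt M k y * Wt M k.+1 (rem y s))); last by ring.
apply: ler_pM => //; first by rewrite mulr_ge0 ?wt_ge0// Wt_ge0.
by apply: ler_wpM2l; rewrite ?wt_ge0//; exact: Wt_le.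
Qed.

(** The exponent doubles because both [phi] and [F] contribute the weight of the integrated
    point. *)
Lemma annihilation_bound phi F M k C K s : bddE phi ->
  (forall y : X, `|phi y.1| <= K * wt M k y) -> 0 <= K -> 0 <= C -> measurable_seq F ->
  (forall t, size t = (size s).+1 -> `|F t| <= C * Wt M k t) ->
  (dx_sigma sigma).-integrable setT (fun y => (phi y.1 * F (y :: s))%:E) /\
  `|\int[dx_sigma sigma]_y (phi y.1 * F (y :: s))| <=
  K * C * Wt M k s * fine (\int[dx_sigma sigma]_y (wt M (k * 2) y)%:E)%E.
Proof.
move=> bphi hK K0 C0 mF hF.
have mg : measurable_fun setT (fun y : X => phi y.1 * F (y :: s)).
  apply: measurable_funM; first exact: measurable_fst_comp.
  have := mF (size s).+1 => /measurable_fun_tuple_cons h.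
  exact: (measurableT_comp h (measurable_pair2 (in_tuple s))).
have gle y : `|phi y.1 * F (y :: s)| <= (K * C * Wt M k s) * wt M (k * 2) y.
  rewrite normrM; apply: (@le_trans _ _ (K * wt M k y * (C * Wt M k (y :: s)))).
    by apply: ler_pM => //; exact: hF.
  by rewrite Wt_cons -wt_sqr le_eqVlt; apply/orP; left; apply/eqP; ring.
have KW0 : 0 <= K * C * Wt M k s by rewrite !mulr_ge0// Wt_ge0.
have mw : measurable_fun setT (fun y : X => (wt M (k * 2) y)%:E).
  by apply/measurable_EFinP; exact: measurable_wt.
have Jfin := integral_wt_lty sigma_moments M (k * 2).
have Jge0 : (0 <= \int[dx_sigma sigma]_y (wt M (k * 2) y)%:E)%E.
  by apply: integral_ge0 => y _; rewrite lee_fin wt_ge0.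
have le1 : (\int[dx_sigma sigma]_y `|(phi y.1 * F (y :: s))%:E| <=
    (K * C * Wt M k s * fine (\int[dx_sigma sigma]_y (wt M (k * 2) y)%:E)%E)%:E)%E.
  rewrite EFinM fineK ?ge0_fin_numE// -ge0_integralZl_EFin//.
    apply: ge0_le_integral => //.
    - by apply: measurableT_comp => //; apply/measurable_EFinP.
    - exact: measurable_funeM.
    - by move=> y _; rewrite -EFinM lee_fin; exact: gle.
  by move=> y _; rewrite lee_fin wt_ge0.
have int : (dx_sigma sigma).-integrable setT (fun y => (phi y.1 * F (y :: s))%:E).
  apply/integrableP; split; first exact/measurable_EFinP.
  by rewrite (le_lt_trans le1)// ltry.
split=> //; rewrite (le_trans (le_normr_Rintegral _ _))//.
rewrite -lee_fin; apply: le_trans le1; rewrite /Rintegral fineK//.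
have /integrable_abse/(integrable_fin_num measurableT) := int.
by congr (_ \is a fin_num).
Qed.

Lemma crea_tuple (h : X -> R) (F : seq X -> R^o) n (t : n.+1.-tuple X) :
  crea h F t = \sum_(j < n.+1) h (tnth t j) * F [tuple tnth t (lift j i) | i < n].
Proof.
rewrite crea_nth; have x0 : X := thead t.
have e : size t = n.+1 by rewrite size_tuple.
rewrite (reindex (cast_ord (esym e))); last first.
  by exists (cast_ord e) => i _; rewrite ?cast_ordK ?cast_ordKV.
apply: eq_bigr => j _; congr (_ * F _).
  by congr h; rewrite !(tnth_nth x0).
rewrite (_ : nat_of_ord (cast_ord (esym e) j) = j)//; apply: (@eq_from_nth _ x0).
  by rewrite [RHS]size_tuple size_cat size_take size_drop e/= ltn_ord subSS subnKC// -ltnS ltn_ord.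
have jn : (j <= n)%N by rewrite -ltnS ltn_ord.
move=> i; rewrite size_cat size_take size_drop e/= ltn_ord subSS subnKC// => ni.
rewrite -[RHS](tnth_nth _ [tuple tnth t (lift j i) | i < n] (Ordinal ni)) tnth_mktuple.
rewrite (tnth_nth x0) nth_cat size_take e ltn_ord /=/bump; case: ltnP => ij.
  by rewrite nth_take.
by rewrite nth_drop addSn subnKC.
Qed.

Lemma measurable_crea (h : X -> R) F : measurable_fun setT h -> measurable_seq F ->
  measurable_seq (crea h F).
Proof.
move=> mh mF [|n]; first by rewrite (_ : component 0 _ = fun=> 0)//; apply/funext => t; rewrite /component tuple0.
rewrite (_ : component n.+1 _ = fun t => \sum_(j < n.+1) h (tnth t j) *
    component n F [tuple tnth t (lift j i) | i < n]).
  apply: measurable_sum => j; apply: measurable_funM.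
    exact: measurableT_comp mh (measurable_tnth j).
  apply: (measurableT_comp (mF n)); apply/measurable_fun_tnthP => i.
  rewrite (_ : _ \o _ = (@tnth _ X ^~ (lift j i))); first exact: measurable_tnth.
  by apply/funext => t /=; rewrite tnth_mktuple.
by apply/funext => t; rewrite /component crea_tuple.
Qed.

Lemma measurable_Rintegral_left n (g : X * n.-tuple X -> R) : measurable_fun setT g ->
  measurable_fun setT (fun t => \int[dx_sigma sigma]_y g (y, t)).
Proof.
move=> mg; apply: (measurableT_comp (@fine_measurable R setT measurableT)).
rewrite (_ : (fun t => _) = fun t => (\int[dx_sigma sigma]_y (EFin \o g)^\+ (y, t) -
  \int[dx_sigma sigma]_y (EFin \o g)^\- (y, t))%E); last first.
  apply/funext => t; rewrite integralE; congr (_ - _)%E; apply: eq_integral => y _.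
    by rewrite !funeposE.
  by rewrite !funenegE.
have mg' : measurable_fun setT (EFin \o g) by exact/measurable_EFinP.
apply: emeasurable_funB.
  have mp : measurable_fun setT ((EFin \o g)^\+)%E by exact: measurable_funepos.
  exact: (@measurable_fun_fubini_tonelli_G _ _ _ _ _ (dx_sigma sigma) _ mp (funepos_ge0 _)).
have mn : measurable_fun setT ((EFin \o g)^\-)%E by exact: measurable_funeneg.
exact: (@measurable_fun_fubini_tonelli_G _ _ _ _ _ (dx_sigma sigma) _ mn (funeneg_ge0 _)).
Qed.

Definition ubdd (J : Type) (phi : J -> E -> R) := exists M C, 0 <= C /\
  forall j, measurable_fun setT (phi j) /\ forall x, `|phi j x| <= C * \1_(box M) x.

Lemma ubdd_wt (J : Type) (phi : J -> E -> R) : ubdd phi -> exists M C, 0 <= C /\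
  forall j k (y : X), `|phi j y.1| * (1 + `|y.2|) ^+ k <= C * wt M k y.
Proof.
move=> [M [C [C0 h]]]; exists M, C; split=> // j k y.
by rewrite /wt mulrA ler_wpM2r ?(h j).2// exprn_ge0// addr_ge0.
Qed.

Lemma ubdd_bddE (J : Type) (phi : J -> E -> R) j : ubdd phi -> bddE (phi j).
Proof. by move=> [M [C [C0 h]]]; exists M; split; [exact: (h j).1|exists C; exact: (h j).2]. Qed.

Lemma bddE_ubdd (J : Type) phi : bddE phi -> ubdd (fun _ : J => phi).
Proof. by move=> [M /bounded_on_ge0[mphi [C C0 h]]]; exists M, C. Qed.

Lemma dominated_fieldt (J : Type) (F : J -> seq X -> R^o) phi :
  (forall j, measurable_seq (F j)) -> dominated F -> ubdd phi ->
  dominated (fun j => fieldt (phi j) (F j)).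
Proof.
move=> mF [M1 [k [N [C1 [C10 hF1]]]]] bphi; have [M2 [K [K0 hK1]]] := ubdd_wt bphi.
pose M := Num.max M1 M2.
have hF j s : `|F j s| <= dom M k N C1 s.
  by apply: (le_trans (hF1 j s)); apply: dom_le => //; rewrite le_max lexx.
have hK j k' (y : X) : `|phi j y.1| * (1 + `|y.2|) ^+ k' <= K * wt M k' y.
  by apply: (le_trans (hK1 j k' y)); apply: ler_wpM2l => //; apply: wt_le; rewrite // le_max lexx orbT.
have hK0 j k' (y : X) : `|phi j y.1| <= K * wt M k' y.
  apply: le_trans (hK j k' y); rewrite ler_peMr// exprn_ege1// lerDl//.
pose J0 := fine (\int[dx_sigma sigma]_y (wt M (k * 2) y)%:E)%E.
have J00 : 0 <= J0.
  by apply: fine_ge0; apply: integral_ge0 => y _; rewrite lee_fin wt_ge0.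
exists M, k.+1, N.+1, (N.+1%:R * (K * C1) + K * C1 * J0 + N.+1%:R * K * C1); split.
  by rewrite !addr_ge0// ?mulr_ge0//.
(* Beyond degree N + 1 the three summands only see values of [F j] in degrees above N, where it
   vanishes. *)
move=> j s; rewrite /dom; case: ifPn => [sN|]; last first.
  rewrite -ltnNge => Ns.
  have F0 t : (N < size t)%N -> F j t = 0.
    move=> Nt; apply/eqP; rewrite -normr_eq0 eq_le normr_ge0 andbT (le_trans (hF _ _))//.
    by rewrite /dom leqNgt Nt.
  rewrite /fieldt (F0 s) ?mulr0 ?addr0//; last by rewrite (leq_trans _ Ns).
  rewrite (_ : \int[_]_y _ = 0); last first.
    rewrite /Rintegral integral0_eq// => y _.
    by rewrite F0 ?mulr0//= ltnS; apply: ltnW; exact: ltnW.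
  rewrite addr0.
  have := @crea_le (fun y => phi j y.1) M k K 0 (F j) s (lexx _) K0 (hK0 j k).
  rewrite mulr0 mulr0 mul0r; apply => t ts.
  by rewrite F0 ?normr0 ?mul0r// ts; case: (size s) Ns.
have Fs t : `|F j t| <= C1 * Wt M k t.
  by apply: (le_trans (hF _ _)); rewrite /dom; case: ifP => // _; rewrite mulr_ge0// Wt_ge0.
have W1 : Wt M k s <= Wt M k.+1 s by exact: Wt_le.
have sN' : (size s)%:R <= N.+1%:R :> R by rewrite ler_nat.
rewrite /fieldt (le_trans (ler_normD _ _))// [leRHS]mulrDl; apply: lerD; last first.
  rewrite normrM; apply: (@le_trans _ _ (`|\sum_(y <- s) phi j y.1 * y.2| * (C1 * Wt M k s))).
    by apply: ler_wpM2l.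
  rewrite mulrCA; apply: (@le_trans _ _ (C1 * ((size s)%:R * K * Wt M k.+1 s))).
    by apply: ler_wpM2l => //; apply: sum_le_wt => //; exact: hK.
  rewrite mulrA ler_wpM2r ?Wt_ge0// mulrC -!mulrA ler_wpM2r// mulr_ge0//.
rewrite (le_trans (ler_normD _ _))// mulrDl; apply: lerD.
  apply: (@le_trans _ _ ((size s)%:R * (K * C1) * Wt M k s)); first by apply: crea_le => //; exact: hK0.
  by apply: ler_pM => //; rewrite ?mulr_ge0 ?Wt_ge0// ler_wpM2r// mulr_ge0.
have [_ h] := annihilation_bound (ubdd_bddE j bphi) (hK0 j k) K0 C10 (mF j) (fun t _ => Fs t) (s := s).
apply: (le_trans h); rewrite -/J0 -mulrA [_ * J0]mulrC mulrA.
by apply: ler_wpM2l => //; rewrite !mulr_ge0.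
Qed.

Lemma measurable_fieldt phi F : bddE phi -> Bdd F -> measurable_seq (fieldt phi F).
Proof.
move=> bphi [mF _] n; apply: (@measurable_funD _ _ _ _
  (fun t : n.-tuple X => crea (fun y => phi y.1) F t + \int[dx_sigma sigma]_y (phi y.1 * F (y :: t)))).
  apply: (@measurable_funD _ _ _ _ (fun t : n.-tuple X => crea (fun y => phi y.1) F t)).
    exact: measurable_crea (measurable_fst_comp bphi) mF n.
  have mg : measurable_fun setT (fun z : X * n.-tuple X => phi z.1.1 * F (z.1 :: z.2)).
    apply: measurable_funM.
      by apply: (measurableT_comp (measurable_fst_comp bphi)); exact: measurable_fst.
    exact: (measurable_fun_tuple_cons (mF n.+1)).
  exact: measurable_Rintegral_left mg.
apply: measurable_funM; last exact: mF.
rewrite (_ : (fun t => _) = fun t : n.-tuple X => \sum_(i < n) phi (tnth t i).1 * (tnth t i).2).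
  apply: measurable_sum => i; apply: measurable_funM.
    exact: measurableT_comp (measurable_fst_comp bphi) (measurable_tnth i).
  exact: (measurableT_comp (@measurable_snd _ _ _ _) (measurable_tnth i)).
by apply/funext => t; rewrite big_tuple.
Qed.

Lemma Bdd_fieldt phi F : bddE phi -> Bdd F -> Bdd (fieldt phi F).
Proof.
move=> bphi BF; split; first exact: measurable_fieldt.
by apply: (dominated_fieldt (fun _ => BF.1) BF.2); exact: bddE_ubdd.
Qed.

Lemma integrable_field phi F s : bddE phi -> Bdd F ->
  (dx_sigma sigma).-integrable setT (fun y => (phi y.1 * F (y :: s))%:E).
Proof.
move=> bphi [mF [M1 [k [N [C1 [C10 hF1]]]]]]; have [M2 [K [K0 hK1]]] := bddE_wt bphi.
pose M := Num.max M1 M2.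
have hF t : `|F t| <= C1 * Wt M k t.
  apply: (le_trans (hF1 tt t)); apply: (@le_trans _ _ (dom M k N C1 t)).
    by apply: dom_le => //; rewrite le_max lexx.
  by rewrite /dom; case: ifP => // _; rewrite mulr_ge0// Wt_ge0.
have hK (y : X) : `|phi y.1| <= K * wt M k y.
  apply: (@le_trans _ _ (`|phi y.1| * (1 + `|y.2|) ^+ k)).
    by rewrite ler_peMr// exprn_ege1// lerDl//.
  by apply: (le_trans (hK1 _ _)); apply: ler_wpM2l => //; apply: wt_le; rewrite // le_max lexx orbT.
by have [] := annihilation_bound bphi hK K0 C10 mF (fun t _ => hF t) (s := s).
Qed.

Lemma fieldt_lin phi c F G s : bddE phi -> Bdd F -> Bdd G ->
  fieldt phi (fun s => c * F s + G s) s = c * fieldt phi F s + fieldt phi G s.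
Proof.
move=> bphi BF BG; rewrite /fieldt crea_lin.
have iF := integrable_field s bphi BF; have iG := integrable_field s bphi BG.
have -> : \int[dx_sigma sigma]_y (phi y.1 * (c * F (y :: s) + G (y :: s))) =
  c * (\int[dx_sigma sigma]_y (phi y.1 * F (y :: s))) + \int[dx_sigma sigma]_y (phi y.1 * G (y :: s)).
  rewrite -RintegralZl// -RintegralD//; last exact: (integrableZl measurableT c iF).
  by apply: eq_Rintegral => y _; ring.
by ring.
Qed.

Lemma crea_lin_l (h g : X -> R) c (F : seq X -> R^o) s :
  crea (fun y => c * h y + g y) F s = c * crea h F s + crea g F s.
Proof.
elim: s F => [|y s IH] F /=; first by rewrite mulr0 addr0.
by rewrite IH; ring.
Qed.

Lemma fieldt_lin_l phi psi c F s : bddE phi -> bddE psi -> Bdd F ->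
  fieldt (fun x => c * phi x + psi x) F s = c * fieldt phi F s + fieldt psi F s.
Proof.
move=> bphi bpsi BF; rewrite /fieldt (crea_lin_l (fun y => phi y.1)).
have iF := integrable_field s bphi BF; have iG := integrable_field s bpsi BF.
have -> : \int[dx_sigma sigma]_y ((c * phi y.1 + psi y.1) * F (y :: s)) =
  c * (\int[dx_sigma sigma]_y (phi y.1 * F (y :: s))) + \int[dx_sigma sigma]_y (psi y.1 * F (y :: s)).
  rewrite -RintegralZl// -RintegralD//; last exact: (integrableZl measurableT c iF).
  by apply: eq_Rintegral => y _; ring.
have -> : \sum_(y <- s) (c * phi y.1 + psi y.1) * y.2 =
   c * (\sum_(y <- s) phi y.1 * y.2) + \sum_(y <- s) psi y.1 * y.2.
  by rewrite mulr_sumr -big_split/=; apply: eq_bigr => y _; ring.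
by ring.
Qed.

Lemma symmetric_fieldt phi F : symmetric F -> symmetric (fieldt phi F).
Proof.
move=> sF s s' ss'; rewrite /fieldt (symmetric_crea _ sF ss') (sF _ _ ss').
rewrite (perm_big _ ss')/=; congr (_ + _ + _).
by apply: eq_Rintegral => y _; rewrite (sF (y :: s) (y :: s'))// perm_cons.
Qed.

Lemma Bdd_vacuum : Bdd (@vacuum R d).
Proof.
split.
  case=> [|n].
    rewrite (_ : component 0 _ = fun=> 1)//.
    by apply/funext => t; rewrite /component tuple0.
  rewrite (_ : component n.+1 _ = fun=> 0)//.
  by apply/funext => t; case/tupleP: t.
exists 0, 0%N, 0%N, 1; split => // _ [|y s]; rewrite /dom /= ?normr0//.
by rewrite normr1 mul1r /Wt big_nil.
Qed.

Lemma symmetric_vacuum : symmetric (@vacuum R d).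
Proof. by move=> [|y s] [|y' s']// /perm_size. Qed.

Lemma Bdd_FVt phis : (forall phi, phi \in phis -> bddE phi) -> Bdd (FVt phis).
Proof.
elim: phis => [_|phi phis IH b]; first exact: Bdd_vacuum.
apply: Bdd_fieldt; first by apply: b; rewrite inE eqxx.
by apply: IH => psi h; apply: b; rewrite inE h orbT.
Qed.

Lemma symmetric_FVt phis : symmetric (FVt phis).
Proof.
by elim: phis => [|phi phis IH]; [exact: symmetric_vacuum|exact: symmetric_fieldt].
Qed.

End field_operators.

(** * Test functions as bounded measurable functions of bounded support *)

Section test_functions_measurable.
Context (R : realType) (d : nat).
Local Notation E := (d.-tuple R).

Definition rowt (t : E) : 'rV[R]_d := \row_i tnth t i.

Lemma row_fun_rowt (f : E -> R) t : row_fun f (rowt t) = f t.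
Proof. by congr f; apply: eq_from_tnth => i; rewrite tnth_mktuple mxE. Qed.

(** Continuity is available on row vectors and the product sigma-algebra on tuples; an open set is a
    countable union of cubes with rational data, which are rectangles. *)
Lemma measurable_open_row (U : set 'rV[R]_d) : open U -> measurable [set t : E | U (rowt t)].
Proof.
move=> oU; set V := [set t | _].
pose B (z : d.-tuple rat * nat) : set E :=
  rect (fun i => ball (ratr (tnth z.1 i) : R) z.2.+1%:R^-1).
pose F k : set E := if (choice.unpickle k : option (d.-tuple rat * nat)) is Some z then
  (if `[< B z `<=` V >] then B z else set0) else set0.
have -> : V = \bigcup_k F k.
  apply/seteqP; split=> [t|t [k _]]; last first.
    rewrite /F; case: (choice.unpickle k : option (d.-tuple rat * nat)) => // z.
    by case: asboolP => // h; exact: h.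
  move=> Ut; have /nbhs_ballP[e /= e0 tU] : nbhs (rowt t) U by exact: open_nbhs_nbhs.
  have [n ne] : exists n, n.+1%:R^-1 < e / 2.
    have [n _ /(_ n (leqnn n))/= h] := near_infty_natSinv_lt (PosNum (divr_gt0 e0 (ltr0n R 2))).
    by exists n.
  have n0 : 0 < n.+1%:R^-1 :> R by rewrite invr_gt0.
  have ex i : exists r : rat, ball (ratr r : R) n.+1%:R^-1 (tnth t i).
    have [r] : exists r : rat, ratr r \in `](tnth t i - n.+1%:R^-1), (tnth t i + n.+1%:R^-1)[%R.
      apply: rat_in_itvoo; move: (n.+1%:R^-1) n0 => k k0; lra.
    rewrite in_itv/= => /andP[h1 h2]; exists r; rewrite /ball/= ltr_distlC.
    by move: (n.+1%:R^-1) h1 h2 => k h1 h2; apply/andP; lra.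
  have [r hr] := choice ex.
  pose z := ([tuple r i | i < d], n).
  have Bz : B z `<=` V.
    move=> t' Bt'; apply: tU; split=> // i j; rewrite !mxE.
    have := Bt' j; rewrite /= tnth_mktuple; have := hr j.
    rewrite /ball/=; move: (n.+1%:R^-1) ne n0 => k ke k0.
    by rewrite !ltr_distlC => /andP[? ?] /andP[? ?]; apply/andP; lra.
  exists (choice.pickle z) => //; rewrite /F choice.pickleK asboolT// => i.
  by rewrite /= tnth_mktuple; exact: hr.
apply: bigcupT_measurable => k; rewrite /F.
case: (choice.unpickle k : option (d.-tuple rat * nat)) => // z.
case: asboolP => // _; apply: measurable_rect => i; exact: measurable_ball.
Qed.

Lemma measurable_test (f : test_function R d) : measurable_fun setT (f : E -> R).
Proof.
apply: (measurability _ (RGenOpens.measurableE R)) => /= _ [_ [a [b ->]] <-].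
have [cf _] := test_smooth f [::].
rewrite setTI (_ : _ @^-1` _ = [set t : E | (row_fun f @^-1` `]a, b[%classic) (rowt t)]).
  apply: measurable_open_row; apply: open_comp; last exact: interval_open.
  by move=> v _; exact: cf.
by apply/seteqP; split=> t /=; rewrite row_fun_rowt.
Qed.

Lemma le_mx_norm (v : 'rV[R]_d) i : `|v ord0 i| <= `|v|.
Proof.
rewrite [leRHS]/Num.Def.normr/= mx_normrE.
exact: (le_bigmax _ (fun ij : 'I_1 * 'I_d => `|v ij.1 ij.2|) (ord0, i)).
Qed.

Lemma bddE_test (f : test_function R d) : bddE (f : E -> R).
Proof.
set K := closure [set v | row_fun f v != 0].
have cK : compact K := @test_compact _ _ f.
have [cf _] := test_smooth f [::].
have [M [_ hM]] := compact_bounded cK.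
have cg : compact (row_fun f @` K).
  by apply: continuous_compact => //; apply: continuous_subspaceT => v; exact: cf.
have [N [_ hN]] := compact_bounded cg.
exists (M + 1); split; first exact: measurable_test.
exists `|N + 1| => t; have [->|ft0] := eqVneq (f t) 0.
  by rewrite normr0 mulr_ge0.
have Kt : K (rowt t) by apply: subset_closure; rewrite /= row_fun_rowt.
rewrite indicE mem_set ?mulr1.
  rewrite -row_fun_rowt (le_trans _ (ler_norm _))//; apply: (hN (N + 1)); first by rewrite ltrDl.
  by exists (rowt t).
move=> i; apply: (@le_trans _ _ `|rowt t|).
  by have := le_mx_norm (rowt t) i; rewrite mxE.
by apply: (hM (M + 1)) => //; rewrite ltrDl.
Qed.

Lemma bddE_tests (fs : seq (test_function R d)) phi :
  phi \in [seq test_fun f | f <- fs] -> bddE phi.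
Proof.
elim: fs => //= f fs IH; rewrite inE => /orP[/eqP ->|//]; exact: bddE_test.
Qed.

End test_functions_measurable.

Section field_vectors.
Context (R : realType) (d : nat) (sigma : R.-pker (d.-tuple R) ~> R).
Hypothesis sigma_moments : moment_bound sigma.
Local Notation E := (d.-tuple R).
Local Notation X := (d.-tuple R * R)%type.
Local Notation pow := (dx_sigma_pow sigma).
Local Notation FVt := (FVt sigma).
Local Notation FV := (FV sigma).

Lemma eq_crea_size (h : X -> R) (F G : seq X -> R^o) s :
  (forall t, (size t).+1 = size s -> F t = G t) -> crea h F s = crea h G s.
Proof.
elim: s F G => //= y s IH F G FG; rewrite FG//; congr (_ + _).
by apply: IH => t ts; apply: FG; rewrite /= ts.
Qed.

Lemma creation_crea (h : X -> R) (F : seq X -> R^o) s : symmetric F ->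
  creation h (fun t => F t / (size t)`!%:R) s = crea h F s / (size s)`!%:R.
Proof.
move=> sF; rewrite -[s]/(tval (in_tuple s)); move: (in_tuple s); case: (size s) => [|n] t.
  rewrite /creation Symn_tuple /sym_tuple tuple0 /= mul0r big1 ?mulr0// => p _.
  by rewrite /component tuple0.
rewrite /creation Symn_tuple sym_tuple_crea; last first.
  by move=> u v uv; rewrite (sF _ _ uv) (perm_size uv).
rewrite (@eq_crea_size _ _ (fun t => n`!%:R^-1 * F t + 0)); last first.
  by move=> u; rewrite size_tuple => -[->]; rewrite addr0 mulrC.
rewrite (_ : crea _ _ _ = n`!%:R^-1 * crea h F t); last first.
  have := crea_lin h (n`!%:R^-1) F (fun=> 0) t.
  have -> : crea h (fun=> 0 : R) t = 0.
    by elim: (tval t) => //= y u IH; rewrite mulr0 add0r.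
  by rewrite addr0.
by rewrite size_tuple factS natrM invfM mulrA mulrC.
Qed.

(** Conjugation by n! turns [field_op] into [fieldt]: the 1/(n + 1) of creation and the n + 1 of
    annihilation are both absorbed, provided the vector is symmetric. *)
Lemma field_vectorE (fs : seq (test_function R d)) :
  field_vector sigma fs = FV [seq test_fun f | f <- fs].
Proof.
elim: fs => [|f fs IH].
  by apply/funext => -[|y s]; rewrite /FV /= ?divr1// mul0r.
have bf := bddE_test f.
have Bf : Bdd (FVt [seq test_fun g | g <- fs]).
  by apply: Bdd_FVt => //; exact: bddE_tests.
rewrite /= IH; apply/funext => s; rewrite /field_op.
have -> : tens_monom f 0 = (fun y => f y.1) by apply/funext => y; rewrite /tens_monom expr0 mulr1.
have -> : tens_monom f 1 = (fun y => f y.1 * y.2) by apply/funext => y; rewrite /tens_monom expr1.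
set F := FVt [seq test_fun g | g <- fs] in Bf *.
have sF : symmetric F by exact: symmetric_FVt.
transitivity (creation (fun y => f y.1) (fun t => F t / (size t)`!%:R) s
   + annihilation sigma (fun y => f y.1) (fun t => F t / (size t)`!%:R) s
   + neutral (fun y => f y.1 * y.2) (fun t => F t / (size t)`!%:R) s); first by [].
rewrite creation_crea// /FV /= -/F /fieldt /annihilation /neutral !mulrDl; congr (_ + _ + _); last by rewrite mulrA.
rewrite (_ : \int[_]_y _ = (size s).+1`!%:R^-1 * \int[dx_sigma sigma]_y (f y.1 * F (y :: s))).
  rewrite mulrA [RHS]mulrC; congr (_ * _); rewrite factS natrM invfM mulrA mulfV ?mul1r//.
rewrite -RintegralZl//; last exact: integrable_field.
by apply: eq_Rintegral => y _; exact: (etrans (mulrA _ _ _) (mulrC _ _)).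
Qed.

Lemma Bdd_FV phis : (forall phi, phi \in phis -> bddE phi) -> Bdd (FV phis).
Proof.
move=> /(Bdd_FVt sigma_moments)[mF [M [k [N [C [C0 hF]]]]]]; split.
  move=> n; rewrite (_ : component n _ = fun t => component n (FVt phis) t / n`!%:R).
    by apply: measurable_funM => //; exact: mF.
  by apply/funext => t; rewrite /component /FV size_tuple.
exists M, k, N, C; split=> // u s; apply: le_trans (hF u s).
rewrite /FV normrM ler_piMr// normfV normr_nat invf_le1 ?ltr0n ?fact_gt0//.
by rewrite ler1n fact_gt0.
Qed.

Lemma symmetric_FV phis : symmetric (FV phis).
Proof.
by move=> s s' ss'; rewrite /FV (symmetric_FVt sigma phis ss') (perm_size ss').
Qed.

Lemma Bdd_fock F : Bdd F -> symmetric F -> fock sigma F.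
Proof.
move=> BF sF; have BF' := BF; move: BF' => [mF [M [k [N [C [C0 hF]]]]]].
have LF n : component n F \in Lfun (pow n) 2%:E by exact: Bdd_Lfun2.
split; first by move=> n; rewrite Symn_symmetric//; split => //; exact: aeW.
rewrite /fock_sqnorm (nneseries_split 0 N.+1)/=; last first.
  by move=> n _; rewrite mule_ge0 ?sqint_ge0// lee_fin.
rewrite eseries0 ?adde0; last first.
  move=> n Nn _; rewrite (_ : component n F = fun=> 0).
    by rewrite /sqint integral0_eq ?mule0// => x _; rewrite expr0n.
  apply/funext => t; apply/eqP; rewrite -normr_eq0 eq_le normr_ge0 andbT.
  by apply: (le_trans (hF tt t)); rewrite /dom size_tuple leqNgt Nn.
apply: lte_sum_pinfty => n _; rewrite lte_mul_pinfty ?lee_fin//.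
exact: sqint_lt_pinfty (LF n).
Qed.

Lemma fock_FV phis : (forall phi, phi \in phis -> bddE phi) -> fock sigma (FV phis).
Proof. by move=> b; apply: Bdd_fock; [exact: Bdd_FV|exact: symmetric_FV]. Qed.

End field_vectors.

(** * Surjectivity of [Sym J] *)

Section range_of_isometry.
Context (R : realType) (V1 V2 : lmodType R).
Variables (D1 : set V1) (N1 : V1 -> \bar R) (D2 : set V2) (N2 : V2 -> \bar R).
Variable U : V1 -> V2.
Hypotheses (DN1 : sqnormed D1 N1) (DN2 : sqnormed D2 N2) (C1 : sqcomplete D1 N1).
Hypothesis UD : forall u, D1 u -> D2 (U u).
Hypothesis UN : forall u, D1 u -> N2 (U u) = N1 u.
Hypothesis UL : forall c u v, D1 u -> D1 v -> N2 (U (c *: u + v) - (c *: U u + U v))%R = 0%E.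
Local Open Scope ereal_scope.

(** The range is taken up to null vectors, because the map applied here, [Sym_op], is linear only
    modulo null vectors. *)
Definition rng : set V2 := [set F | D2 F /\ exists2 h, D1 h & N2 (F - U h)%R = 0].

Lemma null_trans u v w : D2 u -> D2 v -> D2 w -> N2 (u - v)%R = 0 -> N2 (v - w)%R = 0 ->
  N2 (u - w)%R = 0.
Proof.
move=> Du Dv Dw uv vw; apply/eqP; rewrite eq_le (sqn_ge0 DN2) andbT.
by rewrite (le_trans (sqn_tri DN2 Du Dv Dw))// uv vw !mule0 adde0.
Qed.

Lemma rng_null F G : D2 F -> rng G -> N2 (F - G)%R = 0 -> rng F.
Proof.
move=> DF [DG [h Dh Gh]] FG; split=> //; exists h => //.
exact: (null_trans DF DG (UD Dh)).
Qed.

Lemma rng_U h : D1 h -> rng (U h).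
Proof.
by move=> Dh; split; [exact: UD|exists h => //; rewrite subrr (sqn0 DN2)].
Qed.

Lemma rng_lin c F G : rng F -> rng G -> rng (c *: F + G)%R.
Proof.
move=> [DF [f Df Ff]] [DG [g Dg Gg]].
have DFG : D2 (c *: F + G)%R by exact: (dom_lin DN2).
have Du : D2 (c *: U f + U g)%R by apply: (dom_lin DN2) => //; exact: UD.
split=> //; exists (c *: f + g)%R; first exact: (dom_lin DN1).
apply: (null_trans DFG Du); first exact/UD/(dom_lin DN1).
  rewrite (_ : _ - _ = c *: (F - U f) + (G - U g))%R; last by rewrite scalerBr opprD addrACA.
  have DFf : D2 (F - U f)%R by apply: (domB DN2) => //; exact: UD.
  have DGg : D2 (G - U g)%R by apply: (domB DN2) => //; exact: UD.
  apply/eqP; rewrite eq_le (sqn_ge0 DN2) andbT.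
  rewrite (le_trans (sqnD2 DN2 (domZ DN2 c DFf) DGg))//.
  by case: DN2 => _ _ _ -> // _; rewrite Ff Gg !mule0 adde0.
rewrite (sqnBC DN2)// ?UL//; first exact/UD/(dom_lin DN1).
Qed.

Lemma sqn_UB u v : D1 u -> D1 v -> N2 (U u - U v)%R = N1 (u - v)%R.
Proof.
move=> Du Dv; have Duv : D1 (u - v)%R by exact: (domB DN1).
rewrite -UN//; apply/esym; apply: (sqn_null DN2); [exact: UD|by apply: (domB DN2); exact: UD|].
have := UL (-1) Dv Du; rewrite !scaleN1r.
by rewrite [(- v + u)%R]addrC [(- U v + U u)%R]addrC.
Qed.

Lemma rng_closed F : D2 F ->
  (forall e : R, (0 < e)%R -> exists2 G, rng G & N2 (F - G)%R < e%:E) -> rng F.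
Proof.
move=> DF cF.
(* An error 2^-j / 8 becomes 2^-j / 4 after one triangle inequality with factor 2, and two of these,
   doubled again, give the Cauchy bound. *)
have e0 (j : nat) : (0 < 8^-1 * 2^-1 ^+ j :> R)%R by rewrite mulr_gt0// ?exprn_gt0// invr_gt0.
have ex (j : nat) : exists h, D1 h /\ N2 (F - U h)%R <= (4^-1 * 2^-1 ^+ j)%:E.
  have [G [DG [h Dh Gh]] FG] := cF _ (e0 j); exists h; split=> //.
  rewrite (le_trans (sqn_tri DN2 DF DG (UD Dh)))// Gh mule0 adde0.
  rewrite (_ : _ * _ = 2 * (8^-1 * 2^-1 ^+ j))%R; last by field.
  by rewrite EFinM lee_wpmul2l// ltW.
have [h hh] := choice ex.
have Dh j : D1 (h j) by have [] := hh j.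
have hC i j : (i <= j)%N -> N1 (h j - h i)%R <= (2^-1 ^+ i)%:E.
  move=> ij; rewrite -sqn_UB//.
  rewrite (le_trans (sqn_tri DN2 (UD (Dh j)) DF (UD (Dh i))))//.
  have -> : (2^-1 ^+ i = 2 * (4^-1 * 2^-1 ^+ i) + 2 * (4^-1 * 2^-1 ^+ i) :> R)%R by field.
  apply: (@le_trans _ _ (2%:E * (4^-1 * 2^-1 ^+ i)%:E + 2%:E * (4^-1 * 2^-1 ^+ i)%:E)); last first.
    by rewrite -!EFinM -EFinD.
  apply: leeD; apply: lee_wpmul2l => //.
    rewrite (sqnBC DN2)//; last exact: UD.
    rewrite (le_trans (hh j).2)// lee_fin ler_wpM2l ?invr_ge0//.
    by apply: ler_wiXn2l => //; rewrite ?invr_ge0// invf_le1// ler1n.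
  exact: (hh i).2.
have [l Dl hl] := C1 Dh hC.
split=> //; exists l => //; apply: (sqn_eq0P DN2) => e e_gt0.
(* The final estimate is 2/4 + 4 = 9/2 times 2^-j, rounded up to 5. *)
have [j hj] := @half_pow_small R 5 e (ler0n _ _) e_gt0.
have := hj j (leqnn j); rewrite -lte_fin; apply: le_lt_trans.
rewrite (le_trans (sqn_tri DN2 DF (UD (Dh j)) (UD Dl)))//.
apply: (@le_trans _ _ (2%:E * (4^-1 * 2^-1 ^+ j)%:E + 2%:E * (2 * 2^-1 ^+ j)%:E)).
  apply: leeD; apply: lee_wpmul2l => //; first exact: (hh j).2.
  by rewrite sqn_UB// (sqnBC DN1)//; exact: (hl j).
rewrite -!EFinM -EFinD lee_fin.
have : (0 <= 2^-1 ^+ j :> R)%R by rewrite exprn_ge0// invr_ge0.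
by move: (2^-1 ^+ j)%R => x; lra.
Qed.

End range_of_isometry.

Section products_of_functions.
Context d (T : measurableType d) (R : realType).

Lemma measurable_prod_tnth n (w : 'I_n -> T -> R) : (forall i, measurable_fun setT (w i)) ->
  measurable_fun setT (fun t : n.-tuple T => \prod_(i < n) w i (tnth t i)).
Proof.
move=> mw; apply: measurable_prod => i _.
exact: measurableT_comp (mw i) (measurable_tnth i).
Qed.

Lemma sqint_prod n (m : nat -> {sigma_finite_measure set T -> \bar R}) (w : 'I_n -> T -> R) :
  (forall i, measurable_fun setT (w i)) ->
  sqint (tuple_prod n m) (fun t => \prod_(i < n) w i (tnth t i)) =
  (\prod_(i < n) sqint (m i) (w i))%E.
Proof.
elim: n m w => [|n IH] m w mw.
  rewrite big_ord0 /sqint integral_tuple_prod0; first by rewrite big_ord0 expr1n.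
  by apply: measurable_sqr; exact: measurable_prod_tnth.
have mF := @measurable_sqr _ _ _ _ (measurable_prod_tnth mw).
rewrite big_ord_recl.
rewrite (eq_bigr (fun i : 'I_n => sqint ((m \o S) i) (w (lift ord0 i)))); last first.
  by move=> i _; rewrite lift0.
rewrite -(IH (m \o S) (fun i => w (lift ord0 i)))//.
apply: (eq_trans (integral_tuple_prodS m mF (fun t => sqr_ge0 _))).
have ms := @measurable_sqr _ _ _ _ (measurable_prod_tnth (fun i => mw (lift ord0 i))).
rewrite /sqint -ge0_integralZr//; last 3 first.
- exact: measurable_sqr.
- by move=> y _; rewrite lee_fin sqr_ge0.
- by apply: integral_ge0 => t _; rewrite lee_fin sqr_ge0.
apply: eq_integral => y _; rewrite -ge0_integralZl_EFin//; last 2 first.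
- by move=> t _; rewrite lee_fin sqr_ge0.
- exact: sqr_ge0.
apply: eq_integral => t _; rewrite -EFinM -exprMn big_ord_recl; congr ((_ * _) ^+ 2)%:E.
by apply: eq_bigr => i _; rewrite !(tnth_nth y) lift0.
Qed.

Lemma Lfun2_prod n (m : nat -> {sigma_finite_measure set T -> \bar R}) (w : 'I_n -> T -> R) :
  (forall i, w i \in Lfun (m i) 2%:E) ->
  (fun t => \prod_(i < n) w i (tnth t i)) \in Lfun (tuple_prod n m) 2%:E.
Proof.
move=> Lw; have mw i := Lfun2_measurable (Lw i).
apply/Lfun2P; split; first exact: measurable_prod_tnth.
rewrite sqint_prod//.
suff [] : (0 <= \prod_(i < n) sqint (m i) (w i) /\ \prod_(i < n) sqint (m i) (w i) < +oo)%E by [].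
elim/big_ind : _ => [|x y [x0 xoo] [y0 yoo]|i _]; first by rewrite ltry lee01.
- by rewrite mule_ge0//; split => //; rewrite lte_mul_pinfty// ge0_fin_numE.
- by rewrite sqint_ge0 sqint_lt_pinfty.
Qed.

End products_of_functions.

Section tensors.
Context (R : realType) (d : nat) (sigma : R.-pker (d.-tuple R) ~> R).
Hypothesis sigma_moments : moment_bound sigma.
Local Notation E := (d.-tuple R).
Local Notation X := (d.-tuple R * R)%type.
Local Notation pow := (dx_sigma_pow sigma).
Local Notation dxs := (dx_sigma sigma).

Fixpoint tens (us : seq (X -> R)) (s : seq X) : R :=
  match us, s with
  | [::], [::] => 1
  | u :: us', y :: s' => u y * tens us' s'
  | _, _ => 0
  end.

Lemma tens_size us s : size s != size us -> tens us s = 0.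
Proof.
elim: us s => [|u us IH] [|y s]//=; rewrite eqSS => h.
by rewrite IH ?mulr0.
Qed.

Lemma tens_cat_lin pre c u v us s :
  tens (pre ++ (fun y => c * u y + v y) :: us) s =
  c * tens (pre ++ u :: us) s + tens (pre ++ v :: us) s.
Proof.
elim: pre s => [|w pre IH] [|y s] /=; rewrite ?mulr0 ?addr0//; first by ring.
by rewrite IH; ring.
Qed.

Lemma tens_prod n (us : n.-tuple (X -> R)) (t : n.-tuple X) :
  tens us t = \prod_(i < n) tnth us i (tnth t i).
Proof.
elim: n us t => [|n IH] us t; first by rewrite big_ord0 (tuple0 us) (tuple0 t).
case/tupleP: us => u us; case/tupleP: t => y t.
rewrite big_ord_recl /= IH; congr (_ * _).
by apply: eq_bigr => i _; rewrite !tnthS.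
Qed.

Lemma component_tens n (us : n.-tuple (X -> R)) :
  component n (tens us : seq X -> R^o) = fun t => \prod_(i < n) tnth us i (tnth t i).
Proof. by apply/funext => t; exact: tens_prod. Qed.

Lemma component_tens0 n us : size us != n ->
  component n (tens us : seq X -> R^o) = fun=> 0.
Proof.
by move=> nu; apply/funext => t; rewrite /component tens_size// size_tuple eq_sym.
Qed.

Lemma sqint_tens us : (forall u, u \in us -> measurable_fun setT u) ->
  sqint (pow (size us)) (component (size us) (tens us : seq X -> R^o)) =
  (\prod_(u <- us) sqint dxs u)%E.
Proof.
move=> mus; have -> : us = in_tuple us :> seq _ by [].
rewrite component_tens (@sqint_prod _ _ _ _ (fun=> dxs)); last first.
  by move=> i; apply: mus; exact: mem_tnth.
by rewrite [RHS]big_tuple.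
Qed.

Lemma Lfun2_tens us n : (forall u, u \in us -> u \in Lfun dxs 2%:E) ->
  component n (tens us : seq X -> R^o) \in Lfun (pow n) 2%:E.
Proof.
move=> Lus; have [e|nu] := eqVneq (size us) n; last first.
  by rewrite component_tens0//; exact: Lfun2_0.
rewrite -e; have -> : us = in_tuple us :> seq _ by [].
rewrite component_tens; apply: (@Lfun2_prod _ _ _ _ (fun=> dxs)) => i.
by apply: Lus; exact: mem_tnth.
Qed.

End tensors.

Section range_of_Sym.
Context (R : realType) (d : nat) (sigma : R.-pker (d.-tuple R) ~> R).
Hypothesis sigma_moments : moment_bound sigma.
Variables (q : nat -> d.-tuple R -> {poly R}) (a b : nat -> d.-tuple R -> R).
Hypothesis q_orthogonal : monic_orthogonal sigma q a b.
Variable rho : nat -> {sigma_finite_measure set (d.-tuple R) -> \bar R}.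
Hypothesis rhoE : rho_spec sigma q rho.
Local Notation E := (d.-tuple R).
Local Notation X := (d.-tuple R * R)%type.
Local Notation pow := (dx_sigma_pow sigma).
Local Notation dxs := (dx_sigma sigma).
Local Notation fock := (fock sigma).
Local Notation fock_sqnorm := (fock_sqnorm sigma).
Local Notation SJ h := (Sym_op sigma (J_op q h)).

Lemma Symn_lin (T : Type) c (F G : seq T -> R^o) :
  Symn (fun s => c * F s + G s) = fun s => c * Symn F s + Symn G s.
Proof.
apply/funext => s; rewrite /Symn mulrCA -mulrDr; congr (_ * _).
by rewrite mulr_sumr -big_split.
Qed.

Lemma Sym_comp_lin c f g al : Sym_comp (J_op q (c *: f + g)) al =
  c *: Sym_comp (J_op q f) al + Sym_comp (J_op q g) al.
Proof.
apply/funext => s; rewrite /Sym_comp.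
have -> : J_op q (c *: f + g) al = (fun s => c * J_op q f al s + J_op q g al s).
  by apply/funext => t; rewrite /J_op mulrA -mulrDl.
transitivity (c * in_degree (deg al) (Symn (J_op q f al)) s + in_degree (deg al) (Symn (J_op q g al)) s); last by [].
rewrite Symn_lin /in_degree; case: (size s == deg al) => //.
by rewrite mulr0 addr0.
Qed.

(** Both vectors are sums of the same family, and sums are unique up to null vectors; the choice
    made in [Sym_op] allows no more. *)
Lemma Sym_op_lin c f g : Gspace rho f -> Gspace rho g ->
  fock_sqnorm (SJ (c *: f + g) - (c *: SJ f + SJ g))%R = 0%E.
Proof.
move=> Gf Gg; have Gfg : Gspace rho (c *: f + g) by exact: (dom_lin (sqnormed_Gspace rho)).
have [Ff Sf _] := Sym_op_spec sigma_moments q_orthogonal rhoE Gf.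
have [Fg Sg _] := Sym_op_spec sigma_moments q_orthogonal rhoE Gg.
have [Ffg Sfg _] := Sym_op_spec sigma_moments q_orthogonal rhoE Gfg.
have DF h al : Gspace rho h -> fock (Sym_comp (J_op q h) al).
  by case=> Gh _; have [] := Sym_comp_fock sigma_moments q_orthogonal rhoE (Gh al).
have DL := dom_lin (sqnormed_fock sigma) c Ff Fg.
have SL := sums_to_lin (sqnormed_fock sigma) (fun al => DF f al Gf) (fun al => DF g al Gg)
  (Sym_comp_lin c f g) Ff Fg Sf Sg.
exact: (sums_to_uniq (sqnormed_fock sigma) (fun al => DF _ al Gfg) Ffg DL Sfg SL).
Qed.

Definition Rng : set (seq X -> R^o) := rng (Gspace rho) fock fock_sqnorm (fun h => SJ h).

Lemma Rng_null F G : fock F -> Rng G -> fock_sqnorm (F - G) = 0%E -> Rng F.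
Proof.
apply: (rng_null (sqnormed_fock sigma)) => h Gh.
by have [] := Sym_op_spec sigma_moments q_orthogonal rhoE Gh.
Qed.

Lemma Rng_lin c F G : Rng F -> Rng G -> Rng (c *: F + G).
Proof.
apply: (rng_lin (sqnormed_Gspace rho) (sqnormed_fock sigma)).
  by move=> h Gh; have [] := Sym_op_spec sigma_moments q_orthogonal rhoE Gh.
by move=> c' f g Gf Gg; exact: Sym_op_lin.
Qed.

Lemma Rng_closed F : fock F ->
  (forall e : R, 0 < e -> exists2 G : seq X -> R^o, Rng G & (fock_sqnorm (F - G)%R < e%:E)%E) -> Rng F.
Proof.
apply: (rng_closed (sqnormed_Gspace rho) (sqnormed_fock sigma) (@sqcomplete_Gspace _ _ rho)).
- by move=> h Gh; have [] := Sym_op_spec sigma_moments q_orthogonal rhoE Gh.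
- by move=> h Gh; have [] := Sym_op_spec sigma_moments q_orthogonal rhoE Gh.
- by move=> c' f g Gf Gg; exact: Sym_op_lin.
Qed.

Lemma in_degree_eq (T : Type) n (F G : seq T -> R^o) : component n F = component n G ->
  in_degree n F = in_degree n G.
Proof.
move=> FG; apply/funext => s; rewrite /in_degree; case: eqP => // sn.
by have := congr1 (fun f => f (Tuple (introT eqP sn))) FG.
Qed.

Lemma Sym_comp_block_sym (g : seq E -> R^o) al :
  Sym_comp (J_op q (fun _ => block_sym al g)) al = Sym_comp (J_op q (fun _ => g)) al.
Proof.
apply: in_degree_eq; rewrite !component_Symn !component_Jop component_block_sym.
by rewrite JT_bsym sym_bsym.
Qed.

Lemma Gcomp_block_sym al g : component (deg al) g \in Lfun (rho_prod rho al) 2%:E ->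
  Gcomp rho al (block_sym al g).
Proof.
move=> Lg; have mg := Lfun2_measurable Lg; rewrite /Gcomp !component_block_sym; split.
  apply/Lfun2P; split; first exact: measurable_bsym_tuple.
  by rewrite (le_lt_trans (@sqint_bsym_le _ _ _ al rho (component (deg al) g) mg))//; exact: sqint_lt_pinfty.
by rewrite bsym_tuple_id; [exact: aeW|move=> p t; exact: bsym_tuple_perm].
Qed.

Lemma Sym_comp_local f g al : f al = g al -> Sym_comp (J_op q f) al = Sym_comp (J_op q g) al.
Proof. by move=> fg; rewrite /Sym_comp /J_op fg. Qed.

Lemma Rng_single al (g : seq E -> R^o) : component (deg al) g \in Lfun (rho_prod rho al) 2%:E ->
  Rng (Sym_comp (J_op q (fun _ => g)) al).
Proof.
move=> Lg; pose h be := if be == al then block_sym al g else 0.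
have Gh be : Gcomp rho be (h be).
  rewrite /h; case: eqP => [->|_]; first exact: Gcomp_block_sym.
  exact: dom0 (sqnormed_Gcomp rho be).
have hG : Gspace rho h.
  split=> //; rewrite /Gsqnorm.
  suff -> : (\esum_(be in [set: multiindex]) Gcomp_sqnorm rho be (h be) =
      \esum_(be in [set al]) Gcomp_sqnorm rho be (h be))%E.
    rewrite esum_set1; last exact: sqn_ge0 (sqnormed_Gcomp rho al) _.
    exact: (sqn_lty (sqnormed_Gcomp rho al)).
  rewrite [RHS]esum_mkcond; apply: eq_esum => be _.
  have [->|bal] := eqVneq be al; first by rewrite mem_set.
  rewrite memNset; last by move=> /= /eqP; exact/negP.
  by rewrite /h (negbTE bal); exact: sqn0 (sqnormed_Gcomp rho be).
have [Fh Sh _] := Sym_op_spec sigma_moments q_orthogonal rhoE hG.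
have SE : Sym_comp (J_op q h) al = Sym_comp (J_op q (fun _ => g)) al.
  by rewrite -Sym_comp_block_sym; apply: Sym_comp_local; rewrite /h eqxx.
have S0 be : be != al -> Sym_comp (J_op q h) be = 0.
  move=> bal; apply/funext => s; rewrite /Sym_comp /in_degree; case: ifP => // _.
  rewrite /Symn big1 ?mulr0// => p _.
  rewrite /J_op /h (negbTE bal); exact: mul0r.
have DS be : fock (Sym_comp (J_op q h) be).
  by have [] := Sym_comp_fock sigma_moments q_orthogonal rhoE (Gh be).
have Rh : Rng (SJ h).
  have UD f : Gspace rho f -> fock (SJ f).
    by move=> Gf; have [] := Sym_op_spec sigma_moments q_orthogonal rhoE Gf.
  exact: (rng_U (sqnormed_fock sigma) UD hG).
rewrite -SE; apply: (Rng_null (DS al) Rh).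
apply: (sums_to_uniq (sqnormed_fock sigma) DS (DS al) Fh _ Sh) => e e0.
exists [fset al]%fset => A /fsubsetP/(_ al (fset11 _)) alA.
rewrite (big_fsetD1 al)//= big_seq big1 ?addr0.
  by rewrite subrr (sqn0 (sqnormed_fock sigma)) lte_fin.
by move=> be; rewrite in_fsetD1 => /andP[bal _]; exact: S0.
Qed.

Lemma Symn_in_degree n (F : seq X -> R^o) : (forall s, size s != n -> F s = 0) ->
  Symn F = in_degree n (Symn F).
Proof.
move=> F0; apply/funext => s; rewrite /in_degree; case: eqP => // /eqP sn.
rewrite /Symn big1 ?mulr0// => p _; apply: F0.
by rewrite /perm_seq size_map size_enum_ord.
Qed.

Lemma fock_Symn_deg n (F : seq X -> R^o) : (forall s, size s != n -> F s = 0) ->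
  component n F \in Lfun (pow n) 2%:E ->
  fock (Symn F) /\
  fock_sqnorm (Symn F) = (n`!%:R%:E * sqint (pow n) (sym_tuple (component n F)))%E.
Proof.
move=> F0 LF; rewrite (Symn_in_degree F0) -component_Symn; apply: fock_in_degree.
  by rewrite component_Symn; exact: Lfun2_sym.
rewrite component_Symn sym_tuple_id; [exact: aeW|move=> p t; exact: sym_tuple_perm].
Qed.

Lemma fock_Symn_tens us : (forall u, u \in us -> u \in Lfun dxs 2%:E) -> fock (Symn (tens us)).
Proof.
move=> Lus; apply: (@fock_Symn_deg (size us) (tens us) _ _).1.
  by move=> s; exact: tens_size.
exact: Lfun2_tens.
Qed.

Definition qfun (w : (E -> R) * nat) : X -> R := fun y => w.1 y.1 * (q w.2 y.1).[y.2].

Lemma Lfun2_qfun w : w.1 \in Lfun (rho w.2) 2%:E -> qfun w \in Lfun dxs 2%:E.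
Proof.
move=> /Lfun2P[mw woo]; have mq := measurable_q sigma_moments q_orthogonal w.2.
apply/Lfun2P; split.
  by apply: measurable_funM => //; apply: (measurableT_comp mw); exact: measurable_fst.
move: woo; rewrite /sqint -(integral_q2_marginal sigma_moments q_orthogonal rhoE); last 2 first.
- exact: measurable_sqr.
- by move=> x; rewrite lee_fin sqr_ge0.
by congr (_ < _)%E; apply: eq_integral => y _; rewrite -EFinM /qfun exprMn mulrC.
Qed.

Lemma multiindex_count (ms : seq nat) : exists al : multiindex, perm_eq (blocks al) ms.
Proof.
pose al : multiindex := [fsfun k in seq_fset tt ms => count_mem k ms | 0%N].
exists al; apply/allP => k _ /=; apply/eqP.
rewrite count_blocks fsfunE seq_fsetE.
by case: ifPn => // /count_memPn ->.
Qed.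

(** Symmetrization forgets the order of the factors, so they can be sorted by the index of their q;
    the tensor then lies in the image of a single G_alpha, where alpha counts the indices. *)
Lemma Rng_qtens (ws : seq ((E -> R) * nat)) :
  (forall w, w \in ws -> w.1 \in Lfun (rho w.2) 2%:E) -> Rng (Symn (tens [seq qfun w | w <- ws])).
Proof.
have [n] := ubnP (size ws).
have -> : ws = in_tuple ws :> seq _ by [].
move: (in_tuple ws); move: (size ws) => {n}n wt _ Lw.
have [al /[dup] aln] := multiindex_count [seq w.2 | w <- wt].
move=> /tuple_permP[p] pE.
have {aln} e : deg al = n by rewrite -size_blocks (perm_size aln) size_map size_tuple.
have bE (i : 'I_n) : block al i = (tnth wt (p i)).2.
  by rewrite /block pE (nth_map i) ?size_enum_ord// nth_ord_enum tnth_map.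
move: p pE bE; case: _ / e wt Lw => wt Lw p _ bE.
pose G (x : (deg al).-tuple E) := \prod_i (tnth wt (p i)).1 (tnth x i).
have [g gG] := component_onto G.
have LG : component (deg al) g \in Lfun (rho_prod rho al) 2%:E.
  rewrite gG; apply: (Lfun2_prod (w := fun i => (tnth wt (p i)).1)) => i.
  by rewrite bE; apply: Lw; exact: mem_tnth.
have := Rng_single LG; congr Rng.
rewrite [RHS](@Symn_in_degree (deg al)); last first.
  by move=> s h; apply: tens_size; rewrite size_map size_tuple.
apply: in_degree_eq; rewrite !component_Symn component_Jop gG.
rewrite (component_tens [tuple of [seq qfun w | w <- wt]]).
apply/funext => t; rewrite -[RHS](sym_tuple_comp _ (p^-1)%g); congr (sym_tuple _ t).
apply/funext => {}t; rewrite (reindex_inj (@perm_inj _ p))/= /JT -big_split.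
by apply: eq_bigr => i _; rewrite /= tnth_map tnth_mktuple permK /qfun /= tnth_map bE.
Qed.

Definition mono (u : X -> R) := exists v k, bddE v /\ u = fun y => v y.1 * y.2 ^+ k.

Lemma sqint_wt_dxs M k : (sqint dxs (wt M k) < +oo)%E.
Proof.
have := integral_wt_lty sigma_moments M (k * 2); congr (_ < _)%E.
by apply: eq_integral => y _; rewrite wt_sqr.
Qed.

Lemma Lfun2_mono u : mono u -> u \in Lfun dxs 2%:E.
Proof.
move=> [v [k [bv ->]]]; have [M [C [C0 hC]]] := bddE_wt bv.
have mu : measurable_fun setT (fun y : X => v y.1 * y.2 ^+ k).
  apply: measurable_funM; first exact: measurable_fst_comp.
  by apply: measurable_funX; exact: measurable_snd.
apply/Lfun2P; split => //.
apply: (@le_lt_trans _ _ (sqint dxs (fun y => C * wt M k y))).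
  apply: le_sqint => //; first by apply: measurable_funM => //; exact: measurable_wt.
  move=> y; rewrite [leRHS]ger0_norm ?mulr_ge0 ?wt_ge0// (le_trans _ (hC k y))//.
  rewrite normrM ler_wpM2l// normrX; apply: lerXn2r; rewrite ?nnegrE ?addr_ge0//.
  by rewrite lerDr.
rewrite sqintZ; last exact: measurable_wt.
by rewrite lte_mul_pinfty ?lee_fin ?sqr_ge0//; exact: sqint_wt_dxs.
Qed.

(** By Bessel's inequality the squared norm is at most that of v(x) s^k in H. *)
Lemma Lfun2_mono_coef v k m : bddE v -> (m <= k)%N ->
  (fun x => v x * mono_coef sigma q k m x) \in Lfun (rho m) 2%:E.
Proof.
move=> bv mk; have mv := bddE_measurable bv.
have mc := measurable_mono_coef sigma_moments q_orthogonal k m.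
have mvc : measurable_fun setT (fun x => v x * mono_coef sigma q k m x) by exact: measurable_funM.
apply/Lfun2P; split => //.
rewrite /sqint (integral_rho sigma_moments q_orthogonal)//; last 2 first.
- exact: measurable_sqr.
- by move=> x; rewrite lee_fin sqr_ge0.
have /Lfun2P[mu uoo] : (fun y : X => v y.1 * y.2 ^+ k) \in Lfun dxs 2%:E.
  by apply: Lfun2_mono; exists v, k.
apply: le_lt_trans uoo; rewrite /sqint integral_kprod; last 2 first.
- exact: measurable_sqr.
- by move=> y; rewrite lee_fin sqr_ge0.
apply: ge0_le_integral => //.
- by move=> x _; rewrite mule_ge0 ?lee_fin ?sqr_ge0// qnorm_ge0.
- apply: emeasurable_funM; first exact: measurable_sqr.
  by apply/measurable_EFinP; exact: (measurable_qnorm sigma_moments q_orthogonal).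
- apply: (@measurable_integral_pker _ _ _ _ R sigma (fun y => ((v y.1 * y.2 ^+ k) ^+ 2)%:E)).
    exact: measurable_sqr.
  by move=> y; rewrite lee_fin sqr_ge0.
move=> x _; rewrite -EFinM exprMn -mulrA.
apply: (@le_trans _ _ ((v x ^+ 2)%:E * (mom_fun (sigma x) 'X^(k.*2))%:E)%E).
  rewrite -EFinM lee_fin ler_wpM2l ?sqr_ge0//.
  exact: (mono_coef_bessel sigma_moments q_orthogonal).
rewrite (mom_funE (sigma_mom sigma_moments x)) -ge0_integralZl_EFin ?sqr_ge0//; last 2 first.
- by move=> s _; rewrite hornerXn lee_fin -mul2n exprM exprn_ge0// sqr_ge0.
- by apply/measurable_EFinP; exact: measurable_horner.
rewrite le_eqVlt; apply/orP; left; apply/eqP; apply: eq_integral => s _.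
by rewrite -EFinM hornerXn /= exprMn -exprM muln2.
Qed.

(** The expansion holds for s in the support of sigma(x, .), hence for almost every s for each x,
    and then almost everywhere for dx sigma(x, ds). *)
Lemma mono_ae v k : bddE v ->
  (fun y : X => v y.1 * y.2 ^+ k) =
  (fun y => \sum_(m < k.+1) qfun (fun x => v x * mono_coef sigma q k m x, nat_of_ord m) y) %[ae dxs].
Proof.
move=> bv; have /Lfun2P[mu _] : (fun y : X => v y.1 * y.2 ^+ k) \in Lfun dxs 2%:E.
  by apply: Lfun2_mono; exists v, k.
have mf : measurable_fun setT (fun y : X => \sum_(m < k.+1) qfun (fun x => v x * mono_coef sigma q k m x, nat_of_ord m) y).
  apply: measurable_sum => m; apply: (@Lfun2_measurable _ _ _ dxs); apply: Lfun2_qfun.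
  by apply: Lfun2_mono_coef => //; rewrite -ltnS ltn_ord.
apply: sqintB_eq0 => //.
rewrite /sqint integral_kprod; last 2 first.
- by apply: measurable_sqr; exact: measurable_funB.
- by move=> y; rewrite lee_fin sqr_ge0.
apply: integral0_eq => x _.
rewrite (@ae_eq_integral _ _ _ (sigma x) setT (cst 0%E))//; first exact: integral0.
- apply/measurable_EFinP; apply: (measurableT_comp (f := fun r : R => r ^+ 2)) => //.
  exact: (measurableT_comp (measurable_funB mu mf) (measurable_pair1 x)).
- apply: filterS (ae_msupport (sigma x)) => s Ss _ /=.
  rewrite /qfun /= (monomial_expansion sigma_moments q_orthogonal k Ss) mulr_sumr.
  rewrite (eq_bigr (fun m : 'I_k.+1 => v x * mono_coef sigma q k m x * (q m x).[s])).
    by rewrite subrr expr0n.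
  by move=> m _; rewrite mulrA.
Qed.

End range_of_Sym.

Section surjectivity.
Context (R : realType) (d : nat) (sigma : R.-pker (d.-tuple R) ~> R).
Hypothesis sigma_moments : moment_bound sigma.
Variables (q : nat -> d.-tuple R -> {poly R}) (a b : nat -> d.-tuple R -> R).
Hypothesis q_orthogonal : monic_orthogonal sigma q a b.
Variable rho : nat -> {sigma_finite_measure set (d.-tuple R) -> \bar R}.
Hypothesis rhoE : rho_spec sigma q rho.
Local Notation E := (d.-tuple R).
Local Notation X := (d.-tuple R * R)%type.
Local Notation pow := (dx_sigma_pow sigma).
Local Notation dxs := (dx_sigma sigma).
Local Notation fock := (fock sigma).
Local Notation fock_sqnorm := (fock_sqnorm sigma).
Local Notation SJ h := (Sym_op sigma (J_op q h)).
Local Notation Rng := (Rng sigma q rho).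
Local Notation qf := (qfun q).

(** The difference is the symmetrization of a tensor with a null factor; the norm of a tensor is the
    product of the norms and symmetrization is a contraction. *)
Lemma Symn_tens_null pre u u' us :
  (forall v, v \in pre ++ us -> v \in Lfun dxs 2%:E) -> u \in Lfun dxs 2%:E ->
  u' \in Lfun dxs 2%:E -> u = u' %[ae dxs] ->
  fock_sqnorm (Symn (tens (pre ++ u :: us)) - Symn (tens (pre ++ u' :: us))) = 0%E.
Proof.
move=> L Lu Lu' uu'; pose D y := -1 * u' y + u y.
have LD : D \in Lfun dxs 2%:E by exact: Lfun2_lin.
have L' v : v \in pre ++ D :: us -> v \in Lfun dxs 2%:E.
  rewrite mem_cat inE => /or3P[h|/eqP ->//|h]; apply: L; by rewrite mem_cat h ?orbT.
have D0 : sqint dxs D = 0%E.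
  rewrite (@ae_eq_sqint _ _ _ _ _ (fun=> 0))//.
  - by rewrite /sqint integral0_eq// => y _; rewrite expr0n.
  - exact: Lfun2_measurable LD.
  - by apply: filterS uu' => y h _; rewrite /D h// mulN1r addNr.
have -> : Symn (tens (pre ++ u :: us)) - Symn (tens (pre ++ u' :: us)) =
    Symn (tens (pre ++ D :: us)).
  apply/funext => s; have -> : tens (pre ++ D :: us) =
     fun s => -1 * tens (pre ++ u' :: us) s + tens (pre ++ u :: us) s.
    by apply/funext => t; rewrite tens_cat_lin.
  by rewrite Symn_lin mulN1r addrC.
have [_ ->] := @fock_Symn_deg _ _ sigma _ _ (tens_size (us := pre ++ D :: us)) (Lfun2_tens _ L').
apply/eqP; rewrite mule_eq0; apply/orP; right.
rewrite eq_le sqint_ge0 andbT (le_trans (sqint_sym_le _ _))//.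
  exact: Lfun2_measurable (Lfun2_tens _ L').
rewrite sqint_tens; last by move=> v /L'; exact: Lfun2_measurable.
by rewrite big_cat big_cons/= D0 mul0e mule0.
Qed.

(** Monomial factors are converted one at a time into combinations of functions v(x) q^(m)(x, s) and
    moved to the front list, until only the case [Rng_qtens] is left. *)
Lemma Rng_tens ws us : (forall w, w \in ws -> w.1 \in Lfun (rho w.2) 2%:E) ->
  (forall u, u \in us -> mono u) -> Rng (Symn (tens ([seq qf w | w <- ws] ++ us))).
Proof.
elim: us ws => [|u us IH] ws Lws mus.
  by rewrite cats0; exact: (Rng_qtens sigma_moments q_orthogonal rhoE).
have mus' v : v \in us -> mono v by move=> h; apply: mus; rewrite inE h orbT.
have Lq w : w.1 \in Lfun (rho w.2) 2%:E -> qf w \in Lfun dxs 2%:E.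
  exact: (Lfun2_qfun sigma_moments q_orthogonal rhoE).
have L v : v \in [seq qf w | w <- ws] ++ us -> v \in Lfun dxs 2%:E.
  rewrite mem_cat => /orP[/mapP[w wws ->]|/mus'].
    by apply: Lq; exact: Lws.
  exact: Lfun2_mono.
pose P (v : X -> R) := v \in Lfun dxs 2%:E /\ Rng (Symn (tens ([seq qf w | w <- ws] ++ v :: us))).
have Plin c v v' : P v -> P v' -> P (fun y => c * v y + v' y).
  move=> [Lv Rv] [Lv' Rv']; split; first exact: Lfun2_lin.
  have -> : tens ([seq qf w | w <- ws] ++ (fun y => c * v y + v' y) :: us) =
     fun s => c * tens ([seq qf w | w <- ws] ++ v :: us) s + tens ([seq qf w | w <- ws] ++ v' :: us) s.
    by apply/funext => t; rewrite tens_cat_lin.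
  by rewrite Symn_lin; exact: (Rng_lin sigma_moments q_orthogonal rhoE).
have Pq w : w.1 \in Lfun (rho w.2) 2%:E -> P (qf w).
  move=> Lw; split; first exact: Lq.
  have Lr w' : w' \in rcons ws w -> w'.1 \in Lfun (rho w'.2) 2%:E.
    rewrite mem_rcons inE => /orP[/eqP ->|h]; [exact: Lw|exact: Lws h].
  by have := IH (rcons ws w) Lr mus'; rewrite map_rcons cat_rcons.
have P0 : P (fun=> 0).
  have -> : (fun=> 0) = (fun y : X => 0 * 0 + 0) :> (X -> R).
    by apply/funext => y; rewrite mulr0 addr0.
  have -> : (fun y : X => 0 * 0 + 0) = qf (fun=> 0, 0%N) :> (X -> R).
    by apply/funext => y; rewrite /qfun /= mulr0 mul0r addr0.
  by apply: Pq; exact: Lfun2_0.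
have [v [k [bv uE]]] := mus u (mem_head _ _).
pose u' y := \sum_(m < k.+1) qf (fun x => v x * mono_coef sigma q k m x, nat_of_ord m) y.
have Pu' : P u'.
  rewrite /u' (_ : (fun y => _) = fun y => \sum_(m <- enum 'I_k.+1) qf (fun x => v x * mono_coef sigma q k m x, nat_of_ord m) y); last first.
    by apply/funext => y; rewrite big_enum.
  elim: (enum 'I_k.+1) => [|m ms IHm].
    by rewrite (_ : (fun y => _) = fun=> 0); [exact: P0|apply/funext => y; rewrite big_nil].
  rewrite (_ : (fun y => _) = fun y => 1 * qf (fun x => v x * mono_coef sigma q k m x, nat_of_ord m) y +
    \sum_(m <- ms) qf (fun x => v x * mono_coef sigma q k m x, nat_of_ord m) y); last first.
    by apply/funext => y; rewrite big_cons mul1r.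
  have Lw : (fun x => v x * mono_coef sigma q k m x) \in Lfun (rho m) 2%:E.
    by apply: (Lfun2_mono_coef sigma_moments q_orthogonal rhoE bv); rewrite -ltnS ltn_ord.
  exact: (Plin 1 _ _ (Pq (_, nat_of_ord m) Lw) IHm).
have Lu : u \in Lfun dxs 2%:E by apply: Lfun2_mono => //; exact: (mus u (mem_head _ _)).
have uu' : u = u' %[ae dxs] by rewrite uE; exact: (mono_ae sigma_moments q_orthogonal rhoE).
apply: (Rng_null sigma_moments q_orthogonal rhoE) Pu'.2 _.
  apply: fock_Symn_tens => w; rewrite mem_cat inE => /or3P[h|/eqP ->//|h]; apply: L; by rewrite mem_cat h ?orbT.
exact: (Symn_tens_null L Lu Pu'.1 uu').
Qed.

(* contains the field vectors, and lies in the range because s^k is a combination of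
   q^(0), ..., q^(k) on the support of sigma(x, .) *)
Inductive polyprod : (seq X -> R^o) -> Prop :=
| polyprod_tens us : (forall u, u \in us -> mono u) -> polyprod (tens us)
| polyprod_lin c F G : polyprod F -> polyprod G -> polyprod (fun s => c * F s + G s).

Lemma polyprod0 : polyprod (fun=> 0).
Proof.
have h : polyprod (tens [::]) by exact: polyprod_tens.
have := polyprod_lin (-1) h h.
by congr polyprod; apply/funext => s; rewrite mulN1r addNr.
Qed.

Lemma polyprodD F G : polyprod F -> polyprod G -> polyprod (fun s => F s + G s).
Proof.
move=> pF pG; have := polyprod_lin 1 pF pG.
by congr polyprod; apply/funext => s; rewrite mul1r.
Qed.

Lemma polyprodZ c F : polyprod F -> polyprod (fun s => c * F s).
Proof.
move=> pF; have := polyprod_lin c pF polyprod0.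
by congr polyprod; apply/funext => s; rewrite addr0.
Qed.

Definition tcons (u : X -> R) (F : seq X -> R^o) : seq X -> R^o := fun s =>
  if s is y :: s' then u y * F s' else 0.

Lemma polyprod_tcons u F : mono u -> polyprod F -> polyprod (tcons u F).
Proof.
move=> mu; elim=> [us mus|c G G' pG IHG pG' IHG'].
  have : polyprod (tens (u :: us)).
    by apply: polyprod_tens => v; rewrite inE => /orP[/eqP ->//|]; exact: mus.
  by congr polyprod; apply/funext => -[].
have := polyprod_lin c IHG IHG'.
congr polyprod; apply/funext => -[|y s] /=; first by rewrite mulr0 addr0.
by rewrite mulrDr mulrCA.
Qed.

Lemma crea0 (h : X -> R) s : crea h (fun=> 0 : R) s = 0.
Proof. by elim: s => //= y s ->; rewrite mulr0 add0r. Qed.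

Lemma polyprod_crea h us : mono h -> (forall u, u \in us -> mono u) -> polyprod (crea h (tens us)).
Proof.
move=> mh; elim: us => [_|u us IH mus].
  have : polyprod (tens [:: h]) by apply: polyprod_tens => v; rewrite inE => /eqP ->.
  congr polyprod; apply/funext => -[//|y s].
  transitivity (h y * tens [::] s + crea h (fun=> 0) s); last by [].
  by rewrite crea0 addr0.
have mus' v : v \in us -> mono v by move=> k; apply: mus; rewrite inE k orbT.
have p1 : polyprod (tens (h :: u :: us)).
  by apply: polyprod_tens => v; rewrite inE => /orP[/eqP ->//|]; exact: mus.
have mu : mono u by apply: mus; exact: mem_head.
have := polyprodD p1 (polyprod_tcons mu (IH mus')).
congr polyprod; apply/funext => -[|y s] /=; first by rewrite addr0.
congr (_ + _).
have := crea_lin h (u y) (tens us) (fun=> 0) s.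
rewrite crea0 addr0 => <-; congr crea.
by apply/funext => t; rewrite addr0.
Qed.

Lemma mono_mul (v : E -> R) k (u : X -> R) : bddE v -> mono u -> mono (fun y => v y.1 * y.2 ^+ k * u y).
Proof.
move=> [M /bounded_on_ge0[mv [C C0 hv]]] [v' [k' [[M' /bounded_on_ge0[mv' [C' C0' hv']]] ->]]].
exists (fun x => v x * v' x), (k + k')%N; split; last first.
  by apply/funext => y; rewrite exprD; ring.
exists M; split; first exact: measurable_funM.
exists (C * C') => x; rewrite normrM -mulrA [C' * _]mulrC mulrA.
apply: ler_pM => //; apply: (le_trans (hv' x)).
by rewrite ler_piMr// indicE lern1 leq_b1.
Qed.

Lemma polyprod_neutral phi us : bddE phi -> (forall u, u \in us -> mono u) ->
  polyprod (fun s => (\sum_(y <- s) phi y.1 * y.2) * tens us s).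
Proof.
move=> bphi; elim: us => [_|u us IH mus].
  have := polyprod0; congr polyprod; apply/funext => -[|y s]; first by rewrite big_nil mul0r.
  by rewrite mulr0.
have mus' v : v \in us -> mono v by move=> k; apply: mus; rewrite inE k orbT.
have mu : mono u by apply: mus; exact: mem_head.
have p1 : polyprod (tens ((fun y => phi y.1 * y.2 ^+ 1 * u y) :: us)).
  apply: polyprod_tens => v; rewrite inE => /orP[/eqP ->|]; last exact: mus'.
  exact: mono_mul.
have := polyprodD p1 (polyprod_tcons mu (IH mus')).
congr polyprod; apply/funext => -[|y s] /=; first by rewrite mulr0 addr0.
by rewrite big_cons expr1; ring.
Qed.

Lemma mono_fst (phi : E -> R) : bddE phi -> mono (fun y : X => phi y.1).
Proof. by move=> bphi; exists phi, 0%N; split=> //; apply/funext => y; rewrite expr0 mulr1. Qed.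

Lemma Bdd_polyprod F : polyprod F -> Bdd F.
Proof.
elim=> [us mus|c G G' _ BG _ BG']; last exact: Bdd_lin.
elim: us mus => [_|u us IH mus].
  have -> : tens [::] = @vacuum R d by apply/funext => -[].
  exact: Bdd_vacuum.
have [|mG [M [k [N [C [C0 hC]]]]]] := IH; first by move=> v h; apply: mus; rewrite inE h orbT.
have Lu : u \in Lfun dxs 2%:E by apply: Lfun2_mono => //; apply: mus; exact: mem_head.
have [v [k' [bv uE]]] := mus u (mem_head _ _).
have [M' [C' [C'0 hC']]] := bddE_wt bv.
split.
  case=> [|n].
    by rewrite (_ : component 0 _ = fun=> 0)//; apply/funext => t; rewrite /component tuple0.
  rewrite (_ : component n.+1 _ = fun t => u (thead t) * component n (tens us : _ -> R^o) [tuple of behead t]).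
    apply: measurable_funM.
      apply: (measurableT_comp (Lfun2_measurable Lu)); exact: measurable_tnth.
    by apply: (measurableT_comp (mG n)); exact: measurable_behead.
  by apply/funext => t; case/tupleP: t => y t; rewrite theadE.
exists (Num.max M M'), (maxn k k'), N.+1, (C' * C); split; first exact: mulr_ge0.
move=> j [|y s]; first by rewrite normr0 dom_ge0// mulr_ge0.
rewrite /dom /= ltnS normrM; have := hC j s; rewrite /dom; case: ifP => _ h; last first.
  by rewrite (_ : `|tens us s| = 0) ?mulr0//; apply/eqP; rewrite eq_le normr_ge0 andbT.
rewrite Wt_cons mulrACA; apply: ler_pM => //.
  rewrite uE normrM; apply: (@le_trans _ _ (C' * wt M' k' y)).
    apply: le_trans (hC' k' y); apply: ler_wpM2l => //; rewrite normrX.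
    by apply: lerXn2r; rewrite ?nnegrE ?addr_ge0// lerDr.
  by apply: ler_wpM2l => //; apply: wt_le; rewrite ?le_max ?lexx ?orbT// leq_maxr.
apply: (le_trans h); apply: ler_wpM2l => //.
by apply: Wt_le; rewrite ?le_max ?lexx// leq_maxl.
Qed.

(** Creation inserts the factor [phi] at every place, the neutral part multiplies one factor by
    phi(x) s, which keeps it a monomial, and annihilation contracts the first factor to a number. *)
Lemma polyprod_fieldt phi F : bddE phi -> polyprod F -> polyprod (fieldt sigma phi F).
Proof.
move=> bphi; elim=> [us mus|c G G' pG IHG pG' IHG']; last first.
  have := polyprod_lin c IHG IHG'; congr polyprod; apply/funext => s.
  by rewrite fieldt_lin//; exact: Bdd_polyprod.
apply: polyprodD; last exact: polyprod_neutral.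
apply: polyprodD; first by apply: polyprod_crea => //; exact: mono_fst.
case: us mus => [_|u us mus].
  have := polyprod0; congr polyprod; apply/funext => s.
  by rewrite /Rintegral integral0_eq// => y _; rewrite /= mulr0.
have mus' v : v \in us -> mono v by move=> k; apply: mus; rewrite inE k orbT.
have := polyprodZ (\int[dxs]_y (phi y.1 * u y)) (polyprod_tens mus').
congr polyprod; apply/funext => s.
have i1 : dxs.-integrable setT (EFin \o (fun y => phi y.1 * u y)).
  apply: integrable_mul.
    by apply: Lfun2_mono => //; exact: mono_fst.
  by apply: Lfun2_mono => //; apply: mus; exact: mem_head.
rewrite -RintegralZr//; apply: eq_Rintegral => y _ /=; by rewrite mulrA.
Qed.

Lemma polyprod_FVt phis : (forall phi, phi \in phis -> bddE phi) -> polyprod (FVt sigma phis).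
Proof.
elim: phis => [_|phi phis IH b0].
  have : polyprod (tens [::]) by exact: polyprod_tens.
  by congr polyprod; apply/funext => -[].
apply: polyprod_fieldt; first by apply: b0; exact: mem_head.
by apply: IH => psi h; apply: b0; rewrite inE h orbT.
Qed.

Lemma Rng_polyprod F : polyprod F -> Rng (Symn (fun s => F s / (size s)`!%:R)).
Proof.
elim=> [us mus|c G G' _ RG _ RG'].
  have R1 : Rng (Symn (tens us)) by apply: (Rng_tens (ws := [::])).
  have := Rng_lin sigma_moments q_orthogonal rhoE ((size us)`!%:R^-1 - 1) R1 R1.
  congr Rng; have -> : (fun s => tens us s / (size s)`!%:R : R^o) =
     (fun s => ((size us)`!%:R^-1 - 1) * tens us s + tens us s).
    apply/funext => s; rewrite mulrBl mul1r subrK mulrC.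
    by have [->//|su] := eqVneq (size s) (size us); rewrite tens_size// !mulr0.
  by rewrite Symn_lin.
have := Rng_lin sigma_moments q_orthogonal rhoE c RG RG'.
congr Rng; have -> : (fun s => (c * G s + G' s) / (size s)`!%:R : R^o) =
    (fun s => c * (G s / (size s)`!%:R) + G' s / (size s)`!%:R).
  by apply/funext => s; rewrite mulrDl mulrA.
by rewrite Symn_lin.
Qed.

Lemma Rng_FV phis : (forall phi, phi \in phis -> bddE phi) -> Rng (FV sigma phis).
Proof.
move=> b0; have := Rng_polyprod (polyprod_FVt b0); congr Rng.
apply: Symn_symmetric; exact: symmetric_FV.
Qed.

Variables (mu : probability (DprimeType R d) R).
Variable I : (seq X -> R^o) -> Dprime R d -> R^o.
Hypothesis I_unitary : fock_unitary sigma mu I.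

Lemma Rng_fock F : fock F -> Rng F.
Proof.
move=> fF; apply: (Rng_closed sigma_moments q_orthogonal rhoE fF) => e e0.
have [_ _ /(_ F fF e e0)[l hl]] := I_unitary.
exists (\sum_(u <- l) u.1 *: field_vector sigma u.2) => //.
elim: l {hl} => [|u l IH].
  rewrite big_nil; have R1 : Rng (FV sigma [::]) by exact: Rng_FV.
  have := Rng_lin sigma_moments q_orthogonal rhoE (-1) R1 R1.
  by rewrite scaleN1r addNr.
rewrite big_cons; have Ru : Rng (field_vector sigma u.2).
  by rewrite (field_vectorE sigma_moments); apply: Rng_FV; exact: bddE_tests.
exact: (Rng_lin sigma_moments q_orthogonal rhoE u.1 Ru IH).
Qed.

End surjectivity.

(** * Products of smeared fields *)

Section tame_convergence.
Context (R : realType) (d : nat) (sigma : R.-pker (d.-tuple R) ~> R).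
Hypothesis sigma_moments : moment_bound sigma.
Local Notation E := (d.-tuple R).
Local Notation X := (d.-tuple R * R)%type.
Local Notation pow := (dx_sigma_pow sigma).
Local Notation dxs := (dx_sigma sigma).
Local Notation FVt := (FVt sigma).
Local Notation FV := (FV sigma).

(** Pointwise convergence under a common polynomial weight: strong enough to give convergence in
    Fock space ([tame_fock]), and preserved by field operators ([tame_fieldt]), which convergence in
    norm would not be. *)
Definition tame (F_ : nat -> seq X -> R^o) (F : seq X -> R^o) :=
  [/\ forall j, measurable_seq (F_ j), dominated F_, Bdd F &
      forall s, (F_ ^~ s : nat -> R) @ \oo --> (F s : R)].

Lemma tame_cst F : Bdd F -> tame (fun _ => F) F.
Proof.
move=> BF; split=> //; [by move=> _; exact: BF.1| |by move=> s; exact: cvg_cst].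
by have [M [k [N [C [C0 h]]]]] := BF.2; exists M, k, N, C; split => // j s; exact: (h tt s).
Qed.

Lemma crea_cvg (h_ : nat -> X -> R) h (F_ : nat -> seq X -> R^o) F s :
  (forall y, h_ ^~ y @ \oo --> h y) -> (forall s, (F_ ^~ s : nat -> R) @ \oo --> (F s : R)) ->
  (fun j => crea (h_ j) (F_ j) s) @ \oo --> crea h F s.
Proof.
move=> hc; elim: s F_ F => [|y s IH] F_ F Fc /=; first exact: cvg_cst.
apply: cvgD; first by apply: cvgM; [exact: hc|exact: Fc].
by apply: IH => t; exact: Fc.
Qed.

Lemma sum_cvg (phi_ : nat -> E -> R) (phi : E -> R) (s : seq X) :
  (forall x, phi_ ^~ x @ \oo --> phi x) ->
  (fun j => \sum_(y <- s) phi_ j y.1 * y.2) @ \oo --> \sum_(y <- s) phi y.1 * y.2.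
Proof.
move=> pc; elim: s => [|y s IH].
  under eq_fun do rewrite big_nil; rewrite big_nil; exact: cvg_cst.
under eq_fun do rewrite big_cons; rewrite big_cons.
by apply: cvgD => //; apply: cvgM; [exact: pc|exact: cvg_cst].
Qed.

Lemma annihilation_cvg (phi_ : nat -> E -> R) phi (F_ : nat -> seq X -> R^o) F s :
  ubdd phi_ -> bddE phi -> (forall x, phi_ ^~ x @ \oo --> phi x) -> tame F_ F ->
  (fun j => \int[dxs]_y (phi_ j y.1 * F_ j (y :: s))) @ \oo --> \int[dxs]_y (phi y.1 * F (y :: s)).
Proof.
move=> up bp pc [mF [M1 [k [N [C1 [C10 hF1]]]]] BF Fc].
have [M2 [K [K0 hK1]]] := ubdd_wt up; pose M := Num.max M1 M2.
have hF j t : `|F_ j t| <= C1 * Wt M k t.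
  apply: (le_trans (hF1 j t)); apply: (@le_trans _ _ (dom M k N C1 t)).
    by apply: dom_le => //; rewrite le_max lexx.
  by rewrite /dom; case: ifP => // _; rewrite mulr_ge0// Wt_ge0.
have hK j (y : X) : `|phi_ j y.1| <= K * wt M k y.
  apply: (@le_trans _ _ (`|phi_ j y.1| * (1 + `|y.2|) ^+ k)).
    by rewrite ler_peMr// exprn_ege1// lerDl//.
  by apply: (le_trans (hK1 j k y)); apply: ler_wpM2l => //; apply: wt_le; rewrite // le_max lexx orbT.
have ii j := integrable_field sigma_moments s (ubdd_bddE j up)
  (conj (mF j) (dominated_sub (fun=> j) (ex_intro _ M1 (ex_intro _ k (ex_intro _ N (ex_intro _ C1 (conj C10 hF1))))))).
have i0 := integrable_field sigma_moments s bp BF.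
have KW0 : 0 <= K * C1 * Wt M k s by rewrite !mulr_ge0// Wt_ge0.
apply: fine_cvg; rewrite fineK; last exact: integrable_fin_num i0.
have [] := @dominated_convergence _ _ _ dxs setT measurableT
  (fun j y => (phi_ j y.1 * F_ j (y :: s))%:E) (fun y => (phi y.1 * F (y :: s))%:E)
  (fun y => ((K * C1 * Wt M k s) * wt M (k * 2) y)%:E).
- by move=> j; exact: measurable_int (ii j).
- exact: measurable_int i0.
- apply: aeW => y _; apply: cvg_EFin; first by apply: nearW.
  by apply: cvgM; [exact: pc|exact: Fc].
- apply: (integrableZl measurableT (K * C1 * Wt M k s) (f := fun y => (wt M (k * 2) y)%:E)).
  apply/integrableP; split; first by apply/measurable_EFinP; exact: measurable_wt.
  have := integral_wt_lty sigma_moments M (k * 2); congr (_ < _)%E.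
  by apply: eq_integral => y _ /=; rewrite ger0_norm// wt_ge0.
- apply: aeW => y j _; rewrite lee_fin normrM.
  apply: (@le_trans _ _ (K * wt M k y * (C1 * Wt M k (y :: s)))); first by apply: ler_pM.
  by rewrite Wt_cons -wt_sqr le_eqVlt; apply/orP; left; apply/eqP; ring.
- by move=> _ _ h; exact: h.
Qed.

Lemma tame_fieldt (phi_ : nat -> E -> R) phi (F_ : nat -> seq X -> R^o) F :
  ubdd phi_ -> bddE phi -> (forall x, phi_ ^~ x @ \oo --> phi x) -> tame F_ F ->
  tame (fun j => fieldt sigma (phi_ j) (F_ j)) (fieldt sigma phi F).
Proof.
move=> up bp pc tF; have [mF dF BF Fc] := tF.
have BFj j : Bdd (F_ j) by split; [exact: mF|exact: (dominated_sub (fun=> j) dF)].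
split.
- by move=> j; apply: measurable_fieldt => //; exact: ubdd_bddE up.
- exact: dominated_fieldt.
- exact: Bdd_fieldt.
move=> s; apply: cvgD; last by apply: cvgM; [exact: sum_cvg|exact: Fc].
apply: cvgD; last exact: annihilation_cvg.
by apply: crea_cvg => // y; exact: pc.
Qed.

Lemma tame_FVt (phis : seq (E -> R)) (phi_ : nat -> E -> R) phi ts :
  (forall psi, psi \in phis ++ ts -> bddE psi) ->
  ubdd phi_ -> bddE phi -> (forall x, phi_ ^~ x @ \oo --> phi x) ->
  tame (fun j => FVt (phis ++ phi_ j :: ts)) (FVt (phis ++ phi :: ts)).
Proof.
move=> bps up bp pc; elim: phis bps => [bps|psi phis IH bps].
  by apply: tame_fieldt => //; apply: tame_cst; exact: Bdd_FVt.
apply: tame_fieldt.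
- by apply: bddE_ubdd; apply: bps; exact: mem_head.
- by apply: bps; exact: mem_head.
- by move=> x; exact: cvg_cst.
- by apply: IH => f h; apply: bps; rewrite inE h orbT.
Qed.

(** Domination bounds the degree, so finitely many components matter; in each of them dominated
    convergence applies with a majorant of doubled exponent. *)
Lemma dominated_fock0 (D : nat -> seq X -> R^o) : (forall j, measurable_seq (D j)) ->
  dominated D -> (forall s, (D ^~ s : nat -> R) @ \oo --> (0 : R)) ->
  forall e : R, 0 < e -> exists j0, forall j, (j0 <= j)%N -> (fock_sqnorm sigma (D j) < e%:E)%E.
Proof.
move=> mD [M [k [N [C [C0 hD]]]]] Dc e e0.
have LD j n : component n (D j) \in Lfun (pow n) 2%:E by exact: (dom_Lfun2 sigma_moments (mD j n) (hD j)).
pose a n j : R := fine (sqint (pow n) (component n (D j))).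
have aE n j : sqint (pow n) (component n (D j)) = (a n j)%:E.
  rewrite fineK// ge0_fin_numE ?sqint_ge0//; exact: sqint_lt_pinfty (LD j n).
have ac n : a n @ \oo --> (0 : R).
  have iW : (pow n).-integrable setT (fun t => (C ^+ 2 * Wt M (k * 2) t)%:E).
    apply: (integrableZl measurableT (C ^+ 2) (f := fun t : n.-tuple X => (Wt M (k * 2) t)%:E)).
    apply/integrableP; split; first by apply/measurable_EFinP; exact: measurable_Wt.
    have := integral_Wt_lty sigma_moments M (k * 2) n; congr (_ < _)%E.
    by apply: eq_integral => t _ /=; rewrite ger0_norm// Wt_ge0.
  have [] := @dominated_convergence _ _ _ (pow n) setT measurableT
    (fun j t => (component n (D j) t ^+ 2)%:E) (fun=> 0%E) (fun t => (C ^+ 2 * Wt M (k * 2) t)%:E).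
  - by move=> j; apply: measurable_sqr; exact: mD.
  - exact: measurable_cst.
  - apply: aeW => t _; apply: cvg_EFin; first by apply: nearW.
    rewrite [X in _ --> X](_ : _ = 0 * 0 :> R); last by rewrite mulr0.
    by under eq_fun do rewrite /= expr2; apply: cvgM; exact: Dc.
  - exact: iW.
  - apply: aeW => t j _; rewrite lee_fin ger0_norm ?sqr_ge0//.
    rewrite -[leLHS]real_normK ?num_real// [leRHS](_ : _ = (C * Wt M k t) ^+ 2); last first.
      rewrite exprMn; congr (_ * _); elim: (tval t) => [|y s IH]; first by rewrite /Wt !big_nil expr1n.
      by rewrite !Wt_cons exprMn -IH wt_sqr.
    apply: lerXn2r; rewrite ?nnegrE// ?mulr_ge0 ?Wt_ge0//.
    by apply: (le_trans (hD j t)); rewrite /dom; case: ifP => // _; rewrite mulr_ge0// Wt_ge0.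
  move=> _ _; rewrite integral0 => h.
  exact: (fine_cvg h).
have NE j : fock_sqnorm sigma (D j) = (\sum_(0 <= n < N.+1) n`!%:R * a n j)%:E.
  rewrite /fock_sqnorm (nneseries_split 0 N.+1)/=; last first.
    by move=> n _; rewrite mule_ge0 ?sqint_ge0// lee_fin.
  rewrite eseries0 ?adde0; last first.
    move=> n Nn _; rewrite (_ : component n (D j) = fun=> 0).
      by rewrite /sqint integral0_eq ?mule0// => x _; rewrite expr0n.
    apply/funext => t; apply/eqP; rewrite -normr_eq0 eq_le normr_ge0 andbT.
    by apply: (le_trans (hD j t)); rewrite /dom size_tuple leqNgt Nn.
  by rewrite -sumEFin; apply: eq_bigr => n _; rewrite aE EFinM.
have sc : (fun j => \sum_(0 <= n < N.+1) n`!%:R * a n j) @ \oo --> (0 : R).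
  rewrite [X in _ --> X](_ : _ = \sum_(0 <= n < N.+1) n`!%:R * 0); last first.
    by rewrite big1// => n _; rewrite mulr0.
  elim: (index_iota 0 N.+1) => [|n l IH].
    by under eq_fun do rewrite big_nil; rewrite big_nil; exact: cvg_cst.
  under eq_fun do rewrite big_cons; rewrite big_cons.
  by apply: cvgD => //; apply: cvgM; [exact: cvg_cst|exact: ac].
have /cvgrPdist_lt/(_ e e0)[j0 _ h] := sc.
exists j0 => j jj; rewrite NE lte_fin; apply: le_lt_trans (h j jj).
by rewrite sub0r normrN ler_norm.
Qed.

Lemma tame_fock (F_ : nat -> seq X -> R^o) F : tame F_ F ->
  forall e : R, 0 < e -> exists j0, forall j, (j0 <= j)%N ->
   (fock_sqnorm sigma (fun s => (F s / (size s)`!%:R - F_ j s / (size s)`!%:R)%R : R^o) < e%:E)%E.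
Proof.
move=> [mF dF BF Fc]; apply: dominated_fock0.
- move=> j n; rewrite (_ : component n _ = fun t => (component n F t - component n (F_ j) t) / n`!%:R).
    by apply: measurable_funM => //; apply: measurable_funB; [exact: BF.1|exact: mF].
  by apply/funext => t; rewrite /component size_tuple mulrBl.
- have dF' : dominated (fun _ : nat => F) by have [_ d' _ _] := tame_cst BF.
  have [M [k [N [C [C0 h]]]]] := dominated_lin (-1) dF dF'.
  exists M, k, N, C; split=> // j s; rewrite -mulrBl; apply: (le_trans _ (h j s)).
  rewrite mulN1r addrC normrM ler_piMr// normfV normr_nat invf_le1 ?ltr0n ?fact_gt0//.
  by rewrite ler1n fact_gt0.
- move=> s; rewrite (_ : 0 = F s / (size s)`!%:R - F s / (size s)`!%:R); last by rewrite subrr.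
  apply: cvgB; first exact: cvg_cst.
  by apply: cvgM; [exact: Fc|exact: cvg_cst].
Qed.

Lemma FVt_slot_lin (phis : seq (E -> R)) c phi psi ts :
  (forall f, f \in phis ++ ts -> bddE f) -> bddE phi -> bddE psi ->
  FVt (phis ++ (fun x => c * phi x + psi x) :: ts) =
  (fun s => c * FVt (phis ++ phi :: ts) s + FVt (phis ++ psi :: ts) s).
Proof.
move=> bf bphi bpsi; elim: phis bf => [bf|f phis IH bf].
  by apply/funext => s /=; rewrite fieldt_lin_l//; exact: Bdd_FVt.
have bfs g : bddE g -> forall h, h \in phis ++ g :: ts -> bddE h.
  move=> bg h; rewrite mem_cat inE => /or3P[k|/eqP ->//|k]; apply: bf; by rewrite inE mem_cat k ?orbT.
rewrite /= IH; last by move=> g h; apply: bf; rewrite inE h orbT.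
apply/funext => s; rewrite fieldt_lin//; first by apply: bf; exact: mem_head.
  by apply: Bdd_FVt => //; exact: bfs.
by apply: Bdd_FVt => //; exact: bfs.
Qed.

End tame_convergence.

(** * Smooth functions approximating the indicator of an open box *)

Section bump_functions.
Context (R : realType).

(* [flat 0] is the classical flat function; all its derivatives lie in the algebra
   generated by the [flat k], by d/dt (t^-k e^(-1/t)) = (t^-(k+2) - k t^-(k+1)) e^(-1/t). *)
Definition flat (k : nat) (t : R) : R := if 0 < t then t^-1 ^+ k * expR (- t^-1) else 0.

(** With u = 1/t > 0, the exponential series gives e^u >= u^(k+1) / (k+1)!. The linear bound in t
    gives continuity at 0. *)
Lemma flat_le k t : `|flat k t| <= k.+1`!%:R * `|t|.
Proof.
rewrite /flat; case: ifPn => [t0|_]; last by rewrite normr0 mulr_ge0.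
have u0 : 0 < t^-1 by rewrite invr_gt0.
have h : t^-1 ^+ k.+1 * expR (- t^-1) <= k.+1`!%:R.
  have h1 := expR_ge1Dxn k (ltW u0).
  have f0 : 0 < k.+1`!%:R :> R by rewrite ltr0n fact_gt0.
  rewrite expRN ler_pdivrMr ?expR_gt0//.
  rewrite -ler_pdivrMl// mulrC; apply: le_trans h1; by rewrite lerDr.
rewrite ger0_norm; last by rewrite mulr_ge0 ?expR_ge0// exprn_ge0// ltW.
rewrite (gtr0_norm t0) -ler_pdivrMr//.
by rewrite mulrAC -exprSr.
Qed.

Lemma flat_mul k t : flat k.+1 t * t = flat k t.
Proof.
rewrite /flat; case: ifPn => [t0|_]; last by rewrite mul0r.
by rewrite exprSr -!mulrA; congr (_ * _); rewrite mulrCA mulVf ?mulr1// gt_eqF.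
Qed.

Lemma flat_continuous0 k : {for 0, continuous (flat k : R -> R)}.
Proof.
have f0 : flat k 0 = 0 by rewrite /flat ltxx.
apply/cvgrPdist_lt => e e0; rewrite f0; near=> t.
rewrite sub0r normrN (le_lt_trans (flat_le k t))//.
have c0 : 0 < k.+1`!%:R :> R by rewrite ltr0n fact_gt0.
rewrite -ltr_pdivlMl// mulrC.
near: t; apply/nbhs_ballP; exists (e / k.+1`!%:R) => /=; first by rewrite divr_gt0.
by move=> t; rewrite /ball/= sub0r normrN.
Unshelve. all: by end_near.
Qed.

Lemma is_derive_flat k (t : R) :
  is_derive t 1 (flat k) (flat k.+2 t - k%:R * flat k.+1 t).
Proof.
have [t0|t0|->] := ltgtP t 0.
- have -> : flat k.+2 t - k%:R * flat k.+1 t = 0.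
    by rewrite /flat ltNge (ltW t0)/= mulr0 subr0.
  apply: (@near_eq_is_derive _ _ _ (cst (0 : R))).
  near=> s; rewrite /flat ltNge ltW//.
  by near: s; exact: lt_nbhsl.
- have tn0 : t != 0 by rewrite gt_eqF.
  have d1 : is_derive t 1 (fun s : R => s^-1) (- t ^- 2 *: 1).
    exact: (@is_deriveV _ id t 1 1).
  have d2 : is_derive t 1 (expR \o (fun s : R => - s^-1)) (expR (- t^-1) * - (- t ^- 2 *: 1)).
    by apply: is_derive1_comp; exact: is_deriveN.
  have d3 := is_deriveM (is_deriveX k d1) d2.
  apply: (@near_eq_is_derive _ _ _ ((fun s : R => s^-1) ^+ k * (expR \o (fun s : R => - s^-1)))).
    near=> s; rewrite /flat ifT; last by near: s; exact: lt_nbhsr.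
    by rewrite /GRing.mul /= exprfctE.
  apply: is_derive_eq; rewrite /flat t0.
  rewrite exprfctE /= /GRing.scale /= !mulr1 opprK -!exprVn.
  move: (t^-1) (expR _) => u w; case: k {d3} => [|k]; first by ring.
  by rewrite succnK !exprS; ring.
- rewrite [flat k.+2 0]/flat [flat k.+1 0]/flat ltxx mulr0 subr0.
  (* At 0 the difference quotient is [flat k.+1], which is continuous there with value 0. *)
  apply/is_derive1_caratheodory; exists (flat k.+1); split.
  + by move=> z; rewrite [flat k 0]/flat ltxx !subr0 flat_mul.
  + exact: flat_continuous0.
  + by rewrite /flat ltxx.
Unshelve. all: by end_near.
Qed.

Lemma flat_continuous k : continuous (flat k : R -> R).
Proof.
move=> t; apply: differentiable_continuous; apply/derivable1_diffP.
by have [] := is_derive_flat k t.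
Qed.

Variable d : nat.

Inductive flat_alg : ('rV[R]_d -> R) -> Prop :=
| flat_alg_flat k c r j : flat_alg (fun v => flat k (c * v ord0 j + r))
| flat_alg_cst r : flat_alg (fun _ => r)
| flat_algD f g : flat_alg f -> flat_alg g -> flat_alg (fun v => f v + g v)
| flat_algM f g : flat_alg f -> flat_alg g -> flat_alg (fun v => f v * g v).

Lemma flat_alg_continuous f : flat_alg f -> continuous f.
Proof.
elim=> [k c r j|r|{}f g _ cf _ cg|{}f g _ cf _ cg] v.
- apply: (@continuous_comp _ _ _ (fun v : 'rV[R]_d => c * v ord0 j + r) (flat k)); last exact: flat_continuous.
  have h : c * v' ord0 j + r @[v' --> v] --> c * v ord0 j + r.
    exact: (cvgD (cvgM (cvg_cst c) (@coord_continuous _ _ _ ord0 j v)) (cvg_cst r)).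
  exact: h.
- exact: cst_continuous.
- exact: (cvgD (cf v) (cg v)).
- exact: (cvgM (cf v) (cg v)).
Qed.

Lemma flat_alg_derive f i : flat_alg f -> exists2 g, flat_alg g &
  forall v, is_derive v (delta_mx ord0 i) f (g v).
Proof.
elim=> [k c r j|r|{}f g Af [f' Af' df] Ag [g' Ag' dg]|{}f g Af [f' Af' df] Ag [g' Ag' dg]].
- pose e : R := (i == j)%:R.
  exists (fun v => (c * e) * flat k.+2 (c * v ord0 j + r) + (- (c * e) * k%:R) * flat k.+1 (c * v ord0 j + r)).
    by apply: flat_algD; apply: flat_algM => //; constructor.
  (* Along a basis vector the argument of [flat k] is affine, of slope c if the coordinate matches
     and 0 otherwise, so the directional derivative is the derivative of [psi] at 0. *)
  move=> v; pose psi (z : R) := flat k ((c * e) * z + (c * v ord0 j + r)).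
  have dpsi : is_derive (0 : R) 1 psi ((flat k.+2 (c * v ord0 j + r) - k%:R * flat k.+1 (c * v ord0 j + r)) * (c * e)).
    apply: (@is_derive1_comp _ (flat k) (fun z => (c * e) * z + (c * v ord0 j + r))).
      by rewrite mulr0 add0r; exact: is_derive_flat.
    have h := is_deriveD (is_deriveM (is_derive_cst (c * e) (0 : R) 1) (is_derive_id (0 : R) 1)) (is_derive_cst (c * v ord0 j + r) (0 : R) 1).
    by apply: is_derive_eq; rewrite /GRing.scale/= mulr1 mulr0 !addr0.
  have E : (fun h : R => h^-1 *: (((fun v : 'rV[R]_d => flat k (c * v ord0 j + r)) \o shift v) (h *: delta_mx ord0 i) - flat k (c * v ord0 j + r))) =
     (fun h : R => h^-1 *: ((psi \o shift 0) (h *: (1 : R)) - psi 0)).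
    apply/funext => h; rewrite /psi /= !mxE eqxx/= mulr0 add0r addr0.
    congr (_ *: (flat k _ - _)); rewrite /e [j == i]eq_sym /GRing.scale/= mulr1; ring.
  have [D1 D2] := dpsi.
  have D3 : 'D_(delta_mx ord0 i) (fun v : 'rV[R]_d => flat k (c * v ord0 j + r)) v = 'D_1 psi (0 : R).
    by rewrite /derive E.
  split; first by rewrite /derivable E.
  by rewrite D3 D2; ring.
- by exists (fun _ => 0); [exact: flat_alg_cst|move=> v; exact: is_derive_cst].
- exists (fun v => f' v + g' v); first exact: flat_algD.
  by move=> v; exact: is_deriveD.
- exists (fun v => f v * g' v + g v * f' v); first by apply: flat_algD; exact: flat_algM.
  by move=> v; exact: is_deriveM.
Qed.

Lemma flat_alg_smooth f : flat_alg f -> smooth f.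
Proof.
move=> Af s; have A : flat_alg (iter_partial s f).
  elim: s => //= i s IH; have [g Ag dg] := flat_alg_derive i IH.
  rewrite (_ : (fun v => _) = g)//; apply/funext => v.
  by have [_] := dg v.
split; first exact: flat_alg_continuous.
move=> i v; have [g Ag dg] := flat_alg_derive i A.
by have [] := dg v.
Qed.

Definition oitv (a b : 'I_d -> R) : set (d.-tuple R) := rect (fun i => `]a i, b i[%classic).

(** The flat function vanishes for arguments <= 0 and tends to 1 as its argument grows; the factor n
    + 1 therefore drives the product to the indicator of the open box while its support stays in the
    closure of that box. *)
Definition bump (a b : 'I_d -> R) (n : nat) (x : d.-tuple R) : R :=
  \prod_i (flat 0 (n.+1%:R * (tnth x i - a i)) * flat 0 (n.+1%:R * (b i - tnth x i))).

Lemma flat0_ge0 t : 0 <= flat 0 t.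
Proof. by rewrite /flat; case: ifP => // _; rewrite mulr_ge0// expR_ge0. Qed.

Lemma flat0_le1 t : flat 0 t <= 1.
Proof.
rewrite /flat; case: ifP => // t0; rewrite expr0 mul1r -[leRHS]expR0 ler_expR.
by rewrite oppr_le0 invr_ge0 ltW.
Qed.

Lemma bump_out a b n x : ~ oitv a b x -> bump a b n x = 0.
Proof.
move=> /existsNP[i /negP xi]; rewrite /bump (bigD1 i)//=.
move: xi; rewrite in_itv/= negb_and => /orP[h|h].
  by rewrite /flat ltNge pmulr_rle0// subr_le0 leNgt h !mul0r.
by rewrite [flat 0 (_ * (b i - _))]/flat ltNge pmulr_rle0// subr_le0 leNgt h mulr0 mul0r.
Qed.

Lemma bump_bound a b n x : 0 <= bump a b n x <= 1.
Proof.
rewrite prodr_ge0/=; last by move=> i _; rewrite mulr_ge0// flat0_ge0.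
apply: prodr_ile1 => i _.
by rewrite mulr_ge0 ?flat0_ge0//= mulr_ile1 ?flat0_ge0 ?flat0_le1.
Qed.

Lemma bump_cvg a b x : bump a b ^~ x @ \oo --> (\1_(oitv a b) x : R).
Proof.
have [xab|xab] := pselect (oitv a b x); last first.
  rewrite indicE memNset//; under eq_fun do rewrite bump_out//; exact: cvg_cst.
rewrite indicE mem_set//.
have fc (t : R) : 0 < t -> (fun n => flat 0 (n.+1%:R * t)) @ \oo --> (1 : R).
  move=> t0; rewrite -[X in _ --> X]expR0.
  under eq_fun => n do rewrite /flat pmulr_rgt0// t0 expr0 mul1r.
  have h : (fun n : nat => - (n.+1%:R * t)^-1) @ \oo --> (0 : R).
    rewrite -[X in _ --> X]oppr0; apply: cvgN.
    under eq_fun do rewrite invfM; rewrite -(mul0r t^-1).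
    by apply: cvgM; [exact: cvg_harmonic|exact: cvg_cst].
  by apply: continuous_cvg; [exact: continuous_expR|exact: h].
rewrite /bump [X in _ --> X](_ : _ = \prod_(i < d) (1 * 1) :> R); last first.
  by rewrite big1// => i _; rewrite mulr1.
elim: (index_enum _) => [|i l IH].
  by under eq_fun do rewrite big_nil; rewrite big_nil; exact: cvg_cst.
under eq_fun do rewrite big_cons; rewrite big_cons.
have := xab i; rewrite /= in_itv/= => /andP[h1 h2].
by apply: cvgM => //; apply: cvgM; apply: fc; rewrite subr_gt0.
Qed.

Lemma flat_alg_bump a b n : flat_alg (row_fun (bump a b n)).
Proof.
rewrite /row_fun /bump; elim: (index_enum _) => [|i l IH].
  by rewrite (_ : (fun v => _) = fun=> 1); [exact: flat_alg_cst|apply/funext => v; rewrite big_nil].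
rewrite (_ : (fun v => _) = fun v : 'rV[R]_d =>
   (flat 0 (n.+1%:R * v ord0 i + - (n.+1%:R * a i)) * flat 0 (- n.+1%:R * v ord0 i + n.+1%:R * b i)) *
   \prod_(i <- l) (flat 0 (n.+1%:R * (tnth [tuple v ord0 i | i < d] i - a i)) *
     flat 0 (n.+1%:R * (b i - tnth [tuple v ord0 i | i < d] i)))); last first.
  apply/funext => v; rewrite big_cons tnth_mktuple; congr (flat 0 _ * flat 0 _ * _).
    by rewrite mulrBr.
  by rewrite mulrBr addrC mulNr.
by apply: flat_algM => //; apply: flat_algM; exact: flat_alg_flat.
Qed.

Lemma bump_compact a b n : compact (closure [set v | row_fun (bump a b n) v != 0]).
Proof.
apply: bounded_closed_compact; last exact: closed_closure.
pose M := \sum_i (`|a i| + `|b i|).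
have hM i x : a i < x -> x < b i -> `|x| <= M.
  move=> ax xb; rewrite /M (bigD1 i)//=.
  apply: (@le_trans _ _ (`|a i| + `|b i|)); last first.
    by rewrite lerDl sumr_ge0// => j _; rewrite addr_ge0.
  rewrite ler_norml; apply/andP; split.
    have := ler_norm (- a i); rewrite normrN; have := normr_ge0 (b i); lra.
  by have := ler_norm (b i); have := normr_ge0 (a i); lra.
have M0 : 0 <= M by apply: sumr_ge0 => i _; rewrite addr_ge0.
have sub : [set v | row_fun (bump a b n) v != 0] `<=` [set v : 'rV[R]_d | forall i, `|v ord0 i| <= M].
  move=> v /= v0 i; have vab : oitv a b [tuple v ord0 i | i < d].
    by apply: contrapT => h; move: v0; rewrite /row_fun bump_out// eqxx.
  have := vab i; rewrite /= in_itv/= tnth_mktuple => /andP[h1 h2].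
  exact: hM h1 h2.
have cl : closed [set v : 'rV[R]_d | forall i, `|v ord0 i| <= M].
  rewrite (_ : [set v : 'rV[R]_d | _] = \bigcap_(i in [set: 'I_d]) ((fun v : 'rV[R]_d => `|v ord0 i|) @^-1` [set x | x <= M])).
    apply: closed_bigI => i _; apply: closed_comp; last exact: closed_le.
    by move=> v _; exact: (cvg_norm (@coord_continuous _ _ _ ord0 i v)).
  by apply/seteqP; split=> v /= h i => [_|]; exact: h.
exists M; split=> [|N MN v cv]; first by rewrite num_real.
have := closure_subset sub cv; rewrite -((closure_id _).1 cl) => /= h.
rewrite [leLHS]/Num.Def.normr/= mx_normrE.
apply: bigmax_le => [|[k i] _] /=; first exact: le_trans M0 (ltW MN).
by rewrite ord1; exact: le_trans (h i) (ltW MN).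
Qed.

Definition bump_test a b n : test_function R d :=
  TestFunction (flat_alg_smooth (flat_alg_bump a b n)) (@bump_compact a b n).

End bump_functions.

Section multiplicative_limits.
Context d (T : measurableType d) (R : realType) (mu : {measure set T -> \bar R}).

(** Passage to the limit in one factor of a product: [Y] collects the other factors, whose product
    is only known to be measurable. *)
Lemma mul_limit (u v Y : T -> R) : measurable_fun setT Y ->
  u \in Lfun mu 2%:E -> v \in Lfun mu 2%:E ->
  (forall e : R, 0 < e -> exists u' v', [/\ u' \in Lfun mu 2%:E, v' \in Lfun mu 2%:E,
     u' = (fun x => v' x * Y x) %[ae mu], (sqint mu (fun x => u x - u' x)%R < e%:E)%E
     & (sqint mu (fun x => v x - v' x)%R < e%:E)%E]) ->
  u = (fun x => v x * Y x) %[ae mu].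
Proof.
move=> mY Lu Lv h; have m1 := Lfun2_measurable Lu; have m2 := Lfun2_measurable Lv.
(* dividing by [1 + |Y|] makes the unbounded factor [Y] harmless in L^2 *)
pose W x := (1 + `|Y x|)^-1.
have W0 x : 0 < 1 + `|Y x| by rewrite ltr_pwDl.
have mW : measurable_fun setT W.
  by apply: measurable_funV; apply: measurable_funD => //; exact: measurableT_comp.
have mf : measurable_fun setT (fun x => W x * (u x - v x * Y x)).
  by apply: measurable_funM => //; apply: measurable_funB => //; exact: measurable_funM.
suff : sqint mu (fun x => W x * (u x - v x * Y x)) = 0%E.
  move=> /(sqint_eq0 mf); apply: filterS => x + _ => /(_ Logic.I)/eqP.
  by rewrite mulf_eq0 invr_eq0 gt_eqF//= subr_eq0 => /eqP.
apply/eqP; rewrite eq_le sqint_ge0 andbT; apply/lee_addgt0Pr => e e0; rewrite add0e.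
have e4 : 0 < e / 4 by rewrite divr_gt0.
have [u' [v' [Lu' Lv' u'v' uu' vv']]] := h _ e4.
have m3 := Lfun2_measurable Lu'; have m4 := Lfun2_measurable Lv'.
pose f x := W x * (u x - u' x); pose g x := W x * ((v' x - v x) * Y x).
have mF : measurable_fun setT f by apply: measurable_funM => //; exact: measurable_funB.
have mg : measurable_fun setT g.
  by apply: measurable_funM => //; apply: measurable_funM => //; exact: measurable_funB.
rewrite (@ae_eq_sqint _ _ _ _ _ (fun x => f x + g x))//; last 2 first.
- exact: measurable_funD.
- by apply: filterS u'v' => x k _; rewrite /f /g k//; ring.
have := @sqintD_le _ _ _ mu 1 f g ltr01 mF mg; rewrite invr1 => /le_trans; apply.
have Wle x : 0 <= W x <= 1.
  by rewrite invr_ge0 (ltW (W0 x))/= invf_le1// lerDl.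
have fle : (sqint mu f <= (e / 4)%:E)%E.
  apply: le_trans (ltW uu'); apply: le_sqint => //; first exact: measurable_funB.
  move=> x; rewrite /f normrM; have /andP[w0 w1] := Wle x.
  by rewrite (ger0_norm w0) ler_piMl.
have gle : (sqint mu g <= (e / 4)%:E)%E.
  apply: le_trans (ltW vv'); apply: le_sqint => //; first exact: measurable_funB.
  move=> x; rewrite /g !normrM; have /andP[w0 w1] := Wle x.
  rewrite (ger0_norm w0) mulrCA distrC ler_piMr// /W mulrC ler_pdivrMr// mul1r.
  by rewrite lerDr.
apply: (@le_trans _ _ (2%:E * (e / 4)%:E + 2%:E * (e / 4)%:E)%E).
  by apply: leeD; apply: lee_wpmul2l.
by rewrite -!EFinM -EFinD lee_fin; lra.
Qed.

Lemma aeS (P Q : T -> Prop) : (\forall x \ae mu, P x) -> (forall x, P x -> Q x) ->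
  \forall x \ae mu, Q x.
Proof. by move=> aP PQ; apply: filterS aP. Qed.

Lemma aeS2 (P Q S : T -> Prop) : (\forall x \ae mu, P x) -> (\forall x \ae mu, Q x) ->
  (forall x, P x -> Q x -> S x) -> \forall x \ae mu, S x.
Proof. by move=> aP aQ PQS; apply: filterS2 aP aQ. Qed.

Lemma aeS4 (P Q P' Q' S : T -> Prop) : (\forall x \ae mu, P x) -> (\forall x \ae mu, Q x) ->
  (\forall x \ae mu, P' x) -> (\forall x \ae mu, Q' x) ->
  (forall x, P x -> Q x -> P' x -> Q' x -> S x) -> \forall x \ae mu, S x.
Proof.
move=> aP aQ aP' aQ' h; apply: filterS2 (filterI aP aQ) (filterI aP' aQ') => x [? ?] [? ?].
exact: h.
Qed.

End multiplicative_limits.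

(** * The field vectors of bounded measurable functions are mapped to products *)

Section products_of_fields.
Context (R : realType) (d : nat) (sigma : R.-pker (d.-tuple R) ~> R).
Hypothesis sigma_moments : moment_bound sigma.
Local Notation E := (d.-tuple R).
Local Notation X := (d.-tuple R * R)%type.
Local Notation FVt := (FVt sigma).
Local Notation FV := (FV sigma).
Local Notation fock := (fock sigma).
Local Notation fock_sqnorm := (fock_sqnorm sigma).
Variables (mu : probability (DprimeType R d) R).
Variable I : (seq X -> R^o) -> Dprime R d -> R^o.
Hypothesis I_unitary : fock_unitary sigma mu I.

Lemma I_Lfun F : fock F -> I F \in Lfun mu 2%:E.
Proof. by move=> fF; have [[h _ _] _ _] := I_unitary; have [] := h F fF. Qed.

Lemma I_sqint F : fock F -> sqint mu (I F) = fock_sqnorm F.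
Proof. by move=> fF; have [[h _ _] _ _] := I_unitary; have [] := h F fF. Qed.

Lemma I_lin c F G : fock F -> fock G -> I (c *: F + G) = (fun w => c * I F w + I G w) %[ae mu].
Proof. by move=> fF fG; have [[_ h _] _ _] := I_unitary; exact: h. Qed.

Lemma I_dist F G : fock F -> fock G ->
  sqint mu (fun w => I F w - I G w) = fock_sqnorm (F - G).
Proof.
move=> fF fG; have fFG : fock (-1 *: G + F) by exact: (dom_lin (sqnormed_fock sigma)).
rewrite addrC -scaleN1r -I_sqint//; apply: ae_eq_sqint.
- by apply: measurable_funB; apply: Lfun2_measurable; exact: I_Lfun.
- by apply: Lfun2_measurable; exact: I_Lfun.
- by apply: (aeS (I_lin (-1) fG fF)) => w h _; rewrite h// mulN1r addrC.
Qed.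

Lemma I_null F G : fock F -> fock G -> fock_sqnorm (F - G) = 0%E -> I F = I G %[ae mu].
Proof.
move=> fF fG FG; apply: sqintB_eq0; last by rewrite I_dist.
- by apply: Lfun2_measurable; exact: I_Lfun.
- by apply: Lfun2_measurable; exact: I_Lfun.
Qed.

Definition multI (phis : seq (E -> R)) : Prop :=
  I (FV phis) = (fun w => \prod_(phi <- phis) I (FV [:: phi]) w) %[ae mu].

Lemma multI_tests (fs : seq (test_function R d)) : multI [seq test_fun f | f <- fs].
Proof.
have [_ h _] := I_unitary; have := h fs; rewrite (field_vectorE sigma_moments) /multI => h1.
have h2 : (fun w : Dprime R d => \prod_(f <- fs) w f) =
    (fun w => \prod_(phi <- [seq test_fun f | f <- fs]) I (FV [:: phi]) w) %[ae mu].
  elim: fs {h1} => [|f fs IH]; first by apply: aeW => w _; rewrite !big_nil.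
  have := h [:: f]; rewrite (field_vectorE sigma_moments) => h1.
  apply: (aeS2 IH h1) => w k1 k2 _; rewrite !big_cons k1//= k2//.
  by rewrite big_seq1.
by apply: (aeS2 h1 h2) => w k1 k2 _; rewrite k1// k2.
Qed.

Lemma FV_slot_lin (phis : seq (E -> R)) c phi psi ts :
  (forall f, f \in phis ++ ts -> bddE f) -> bddE phi -> bddE psi ->
  FV (phis ++ (fun x => c * phi x + psi x) :: ts) =
  c *: FV (phis ++ phi :: ts) + FV (phis ++ psi :: ts).
Proof.
move=> bf bphi bpsi; apply/funext => s; rewrite /FV FVt_slot_lin//.
by rewrite mulrDl -mulrA.
Qed.

Lemma slot_bdd (phis : seq (E -> R)) phi ts : (forall f, f \in phis ++ ts -> bddE f) -> bddE phi ->
  forall f, f \in phis ++ phi :: ts -> bddE f.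
Proof.
move=> bf bphi f; rewrite mem_cat inE => /or3P[h|/eqP ->//|h]; apply: bf; by rewrite mem_cat h ?orbT.
Qed.

Lemma prod_slot (phis : seq (E -> R)) phi ts w :
  \prod_(f <- phis ++ phi :: ts) I (FV [:: f]) w =
  I (FV [:: phi]) w * \prod_(f <- phis ++ ts) I (FV [:: f]) w :> R.
Proof. by rewrite !big_cat big_cons/= mulrCA. Qed.

Lemma multI_lin (phis : seq (E -> R)) c phi psi ts :
  (forall f, f \in phis ++ ts -> bddE f) -> bddE phi -> bddE psi ->
  multI (phis ++ phi :: ts) -> multI (phis ++ psi :: ts) ->
  multI (phis ++ (fun x => c * phi x + psi x) :: ts).
Proof.
move=> bf bphi bpsi h1 h2; rewrite /multI FV_slot_lin//.
have f1 := fock_FV sigma_moments (slot_bdd bf bphi).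
have f2 := fock_FV sigma_moments (slot_bdd bf bpsi).
have b0 : forall f : E -> R, f \in [::] ++ [::] -> bddE f by [].
have g1 : fock (FV [:: phi]) by apply: (fock_FV sigma_moments); exact: (slot_bdd (phis := [::]) b0 bphi).
have g2 : fock (FV [:: psi]) by apply: (fock_FV sigma_moments); exact: (slot_bdd (phis := [::]) b0 bpsi).
have h3 := I_lin c f1 f2; have h4 := I_lin c g1 g2.
rewrite -(@FV_slot_lin [::] c phi psi [::])// in h4.
apply: (aeS4 h1 h2 h3 h4) => w k1 k2 k3 k4 _.
rewrite k3// k1// k2// !prod_slot/= k4//.
by rewrite mulrDl mulrA.
Qed.

(** One slot varies; the product over the other slots is the factor [Y] of [mul_limit], and tame
    convergence in the slot gives convergence in Fock space on both sides. *)
Lemma multI_limit (phis : seq (E -> R)) (phi_ : nat -> E -> R) phi ts :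
  (forall f, f \in phis ++ ts -> bddE f) -> ubdd phi_ -> bddE phi ->
  (forall x, phi_ ^~ x @ \oo --> phi x) -> (forall j, multI (phis ++ phi_ j :: ts)) ->
  multI (phis ++ phi :: ts).
Proof.
move=> bf up bphi pc h.
have b0 : forall f : E -> R, f \in [::] ++ [::] -> bddE f by [].
have bs j := ubdd_bddE j up.
have f1 g : bddE g -> fock (FV (phis ++ g :: ts)).
  by move=> bg; exact: (fock_FV sigma_moments (slot_bdd bf bg)).
have f2 g : bddE g -> fock (FV [:: g]).
  by move=> bg; exact: (fock_FV sigma_moments (slot_bdd (phis := [::]) b0 bg)).
pose Y (w : Dprime R d) := \prod_(f <- phis ++ ts) I (FV [:: f]) w : R.
have mY : measurable_fun setT (Y : DprimeType R d -> R).
  have : forall f, f \in phis ++ ts -> measurable_fun setT (I (FV [:: f]) : DprimeType R d -> R).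
    by move=> f /bf bg; apply: (@Lfun2_measurable _ _ _ mu); apply: I_Lfun; exact: f2.
  rewrite /Y; elim: (phis ++ ts) => [|f l IH] ml.
    rewrite (_ : (fun w => _) = fun=> 1)//; apply/funext => w; by rewrite big_nil.
  rewrite (_ : (fun w => _) = fun w : DprimeType R d => (I (FV [:: f]) w : R) * \prod_(f <- l) I (FV [:: f]) w); last first.
    by apply/funext => w; rewrite big_cons.
  apply: measurable_funM; first by apply: ml; exact: mem_head.
  by apply: IH => g gl; apply: ml; rewrite inE gl orbT.
rewrite /multI.
suff : I (FV (phis ++ phi :: ts)) = (fun w => I (FV [:: phi]) w * Y w) %[ae mu].
  by move=> k; apply: (aeS k) => w {}k _; rewrite k// prod_slot.
apply: (mul_limit mY).
- exact: I_Lfun (f1 _ bphi).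
- exact: I_Lfun (f2 _ bphi).
move=> e e0; have t1 := tame_FVt sigma_moments bf up bphi pc.
have t2 := tame_FVt sigma_moments b0 up bphi pc.
have [j1 hj1] := tame_fock sigma_moments t1 e0.
have [j2 hj2] := tame_fock sigma_moments t2 e0.
pose j := maxn j1 j2; exists (I (FV (phis ++ phi_ j :: ts))), (I (FV [:: phi_ j])).
split.
- exact: I_Lfun (f1 _ (bs j)).
- exact: I_Lfun (f2 _ (bs j)).
- by apply: (aeS (h j)) => w k _; rewrite k// prod_slot.
- rewrite (I_dist (f1 _ bphi) (f1 _ (bs j))); exact: (hj1 j (leq_maxl _ _)).
- rewrite (I_dist (f2 _ bphi) (f2 _ (bs j))); exact: (hj2 j (leq_maxr _ _)).
Qed.

Lemma oitv_box (a b : 'I_d -> R) : exists M, oitv a b `<=` box M.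
Proof.
exists (\sum_i (`|a i| + `|b i|)) => x xab i; have := xab i; rewrite /= in_itv/= => /andP[h1 h2].
rewrite (bigD1 i)//=; apply: (@le_trans _ _ (`|a i| + `|b i|)); last first.
  by rewrite lerDl sumr_ge0// => j _; rewrite addr_ge0.
rewrite ler_norml; apply/andP; split.
  have := ler_norm (- a i); rewrite normrN; have := normr_ge0 (b i); lra.
by have := ler_norm (b i); have := normr_ge0 (a i); lra.
Qed.

Lemma measurable_oitv (a b : 'I_d -> R) : measurable (oitv a b).
Proof. by apply: measurable_rect => i; exact: measurable_itv. Qed.

Lemma multI_oitv (phis : seq (E -> R)) a b ts : (forall f, f \in phis ++ ts -> bddE f) ->
  (forall f : test_function R d, multI (phis ++ test_fun f :: ts)) ->
  multI (phis ++ \1_(oitv a b) :: ts).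
Proof.
move=> bf h; have [M hM] := oitv_box a b.
have le1 x : \1_(oitv a b) x <= 1 * \1_(box M) x :> R.
  rewrite mul1r !indicE; have [xo|] := boolP (x \in oitv a b); last by rewrite ler0n.
  by rewrite mem_set//; apply: hM; rewrite inE in xo.
apply: (multI_limit (phi_ := bump a b)) => //.
- exists M, 1; split=> // j; split; first exact: (measurable_test (bump_test a b j)).
  move=> x; apply: le_trans (le1 x); have /andP[b0 b1] := bump_bound a b j x.
  rewrite ger0_norm// indicE; have [|/negP xo] := boolP (x \in oitv a b); first by [].
  by rewrite bump_out// => k; apply: xo; rewrite inE.
- exists M; split; first by apply: measurable_indic; exact: measurable_oitv.
  by exists 1 => x; rewrite ger0_norm// indicE ler0n.
- by move=> x; exact: bump_cvg.
- by move=> j; exact: (h (bump_test a b j)).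
Qed.

(** Monotone class argument in a single slot, started from indicators of open boxes, which are
    limits of test functions. *)
Lemma multI_slot (phis : seq (E -> R)) ts : (forall f, f \in phis ++ ts -> bddE f) ->
  (forall f : test_function R d, multI (phis ++ test_fun f :: ts)) ->
  forall phi, bddE phi -> multI (phis ++ phi :: ts).
Proof.
move=> bf h phi [M [mphi [C hC]]].
(* [phi] vanishes off the closed cube of half-side M, which lies in this open cube; the indicator of
   an open cube is a limit of bumps. *)
pose N := M + 1; pose Q : set E := oitv (fun=> - N) (fun=> N).
pose G1 : set (set R) := [set A | A = setT \/ exists x, A = `]-oo, x[%classic].
pose G : set (set E) := [set rect A | A in [set A | forall i, G1 (A i)]].
have G1I : setI_closed G1.
  move=> A B [->|[x ->]] [->|[y ->]]; rewrite ?setTI ?setIT.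
  - by left. - by right; exists y. - by right; exists x.
  right; exists (Num.min x y); apply/seteqP; split=> z /=; rewrite !in_itv/= lt_min.
    by move=> [-> ->].
  by move=> /andP[-> ->].
(* Rectangles of half-lines []-oo, x[] generate the Borel sets and, cut down to [Q], are open boxes
   again. *)
have GQ A : (forall i, G1 (A i)) -> exists c : 'I_d -> R, rect A `&` Q = oitv (fun=> - N) c.
  move=> GA; have ex i : exists c, A i `&` `]- N, N[%classic = `]- N, c[%classic.
    case: (GA i) => [->|[x ->]]; first by exists N; rewrite setTI.
    exists (Num.min x N); apply/seteqP; split=> z /=; rewrite !in_itv/= lt_min.
      by move=> [-> /andP[-> ->]].
    by move=> /andP[-> /andP[-> ->]].
  have [c hc] := choice ex; exists c; rewrite /Q /oitv rectI; congr rect.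
  by apply/funext => i; rewrite hc.
have [M' QM] := oitv_box (fun=> - N) (fun=> N).
have Qle x : \1_Q x <= \1_(box M') x :> R.
  rewrite !indicE; have [xo|] := boolP (x \in Q); last by rewrite ler0n.
  by rewrite mem_set//; apply: QM; rewrite inE in xo.
have Qb f : bounded_on Q f -> bddE f.
  move=> /bounded_on_ge0[mf [K K0 hK]]; exists M'; split=> //; exists K => x.
  by apply: (le_trans (hK x)); apply: ler_wpM2l.
apply: (@bounded_measurable_ind _ _ _ G Q (fun phi => multI (phis ++ phi :: ts))).
- exact: measurable_oitv.
- move=> _ _ [A GA <-] [B GB <-]; exists (fun i => A i `&` B i); last by rewrite rectI.
  by move=> i; apply: G1I.
- apply: tuple_measurableE; first by left.
  rewrite eqEsubset; split=> A.
    have -> : @measurable _ R = <<s @RGenInftyO.G R >> by exact: RGenInftyO.measurableE.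
    apply: smallest_sub; first exact: smallest_sigma_algebra.
    by move=> _ [x ->]; apply: sub_sigma_algebra; right; exists x.
  apply: smallest_sub; first exact: sigma_algebra_measurable.
  by move=> _ [->|[x ->]]; [exact: measurableT|exact: measurable_itv].
- exact: multI_oitv.
- by move=> _ [A GA <-]; have [c ->] := GQ A GA; exact: multI_oitv.
- by move=> c f g bF bG; apply: multI_lin => //; exact: Qb.
- move=> f_ f K mf_ hf bF fc hm; apply: (multI_limit (phi_ := f_)) => //; last exact: Qb.
  exists M', `|K|; split=> // j; split; first exact: mf_.
  move=> x; apply: (le_trans (hf j x)); apply: (@le_trans _ _ (`|K| * \1_Q x)).
    by rewrite ler_wpM2r// ler_norm.
  by apply: ler_wpM2l.
split=> //; exists `|C| => x; apply: (le_trans (hC x)).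
apply: (@le_trans _ _ (`|C| * \1_(box M) x)); first by rewrite ler_wpM2r// ler_norm.
apply: ler_wpM2l => //; rewrite !indicE; have [xM|] := boolP (x \in box M); last by rewrite ler0n.
rewrite mem_set//; rewrite inE in xM => i; rewrite /= in_itv/=.
have := xM i; rewrite ler_norml /N => /andP[h1 h2]; apply/andP; lra.
Qed.

(** Slots are released one after the other; the tail of test functions [fs] is what makes the
    induction from the right end go through. *)
Lemma multI_bdd phis : (forall f, f \in phis -> bddE f) -> multI phis.
Proof.
suff h (fs : seq (test_function R d)) : (forall f, f \in phis -> bddE f) ->
    multI (phis ++ [seq test_fun f | f <- fs]).
  by have := h [::]; rewrite cats0.
elim/last_ind: phis fs => [|phis phi IH] fs bf; first exact: multI_tests.
rewrite cat_rcons; apply: multI_slot.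
- move=> f; rewrite mem_cat => /orP[k|]; last exact: bddE_tests.
  by apply: bf; rewrite mem_rcons inE k orbT.
- move=> f; apply: (IH (f :: fs)) => g k.
  by apply: bf; rewrite mem_rcons inE k orbT.
- by apply: bf; rewrite mem_rcons mem_head.
Qed.

End products_of_fields.

(** * Factorization over disjoint regions *)

Section splitting.
Context (R : realType) (d : nat) (sigma : R.-pker (d.-tuple R) ~> R).
Local Notation X := (d.-tuple R * R)%type.
Local Notation pow := (dx_sigma_pow sigma).
Local Notation dxs := (dx_sigma sigma).
Local Notation fock_sqnorm := (fock_sqnorm sigma).

Variable P : pred X.
Hypothesis mP : measurable [set y | P y].

Definition inP (s : seq X) := [seq y <- s | P y].
Definition outP (s : seq X) := [seq y <- s | ~~ P y].

Lemma size_inP_outP s : (size (inP s) + size (outP s) = size s)%N.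
Proof. by rewrite !size_filter count_predC. Qed.

Lemma measurable_mask (m : bitseq) n (F : seq X -> R^o) : measurable_seq F ->
  measurable_fun setT (fun t : n.-tuple X => F (mask m t)).
Proof.
move=> mF; pose js := mask m (iota 0 n).
pose x0 : X := point.
pose u (t : n.-tuple X) : (size js).-tuple X := [tuple nth x0 t (nth 0%N js j) | j < size js].
have uE t : u t = mask m t :> seq X.
  have -> : mask m t = [seq nth x0 t j | j <- js].
    by rewrite /js map_mask; congr mask; rewrite -[in iota _ _](size_tuple t) map_nth_iota0 ?take_size.
  apply: (@eq_from_nth _ x0); rewrite size_tuple ?size_map// => i ni.
  rewrite -[LHS](tnth_nth x0 (u t) (Ordinal ni)) tnth_mktuple/=.
  by rewrite (nth_map 0%N).
rewrite (_ : (fun t => _) = component (size js) F \o u); last first.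
  by apply/funext => t /=; rewrite /component uE.
apply: measurableT_comp; first exact: mF.
apply/measurable_fun_tnthP => j.
have [jn|nj] := ltnP (nth 0%N js j) n.
  rewrite (_ : _ \o _ = fun t => tnth t (Ordinal jn)); first exact: measurable_tnth.
  by apply/funext => t /=; rewrite tnth_mktuple (tnth_nth x0).
rewrite (_ : _ \o _ = cst x0)//.
by apply/funext => t /=; rewrite tnth_mktuple nth_default// size_tuple.
Qed.

(** On each of the 2^n patterns of membership in P, [inP] and [outP] select fixed coordinates. *)
Lemma measurable_split n (F G : seq X -> R^o) : measurable_seq F -> measurable_seq G ->
  measurable_fun setT (fun t : n.-tuple X => F (inP t) * G (outP t)).
Proof.
move=> mF mG.
pose S (m : {ffun 'I_n -> bool}) : set (n.-tuple X) := rect (fun i => [set y | P y = m i]).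
have mS m : measurable (S m).
  apply: measurable_rect => i; case: (m i) => //.
  rewrite (_ : [set y | _] = ~` [set y | P y]); first exact: measurableC.
  by apply/seteqP; split=> y /= => [->//|/negP/negbTE].
rewrite (_ : (fun t => _) = fun t : n.-tuple X => \sum_(m : {ffun 'I_n -> bool})
   \1_(S m) t * (F (mask (codom m) t) * G (mask (map negb (codom m)) t))).
  apply: measurable_sum => m; apply: measurable_funM; first exact: measurable_indic.
  by apply: measurable_funM; exact: measurable_mask.
apply/funext => t; pose m0 := [ffun i => P (tnth t i)].
rewrite (bigD1 m0)//= big1 ?addr0; last first.
  move=> m mm0; rewrite indicE memNset ?mul0r// => h; case/eqP: mm0.
  by apply/ffunP => i; rewrite ffunE; have := h i.
rewrite indicE mem_set ?mul1r; last by move=> i /=; rewrite ffunE.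
have cE : codom m0 = map P t.
  rewrite codomE -[in RHS](map_tnth_enum t) -map_comp; apply: eq_map => i /=.
  by rewrite ffunE.
by rewrite cE -map_comp /inP /outP !filter_mask.
Qed.

Lemma pascal_sum (M : nmodType) (f : nat -> nat -> M) n :
  \sum_(k < n.+2) f k (n.+1 - k)%N *+ 'C(n.+1, k) =
  \sum_(k < n.+1) f k.+1 (n - k)%N *+ 'C(n, k) + \sum_(k < n.+1) f k (n - k).+1 *+ 'C(n, k).
Proof.
rewrite big_ord_recl subn0 bin0.
rewrite (eq_bigr (fun k : 'I_n.+1 => f k.+1 (n - k)%N *+ 'C(n, k.+1) + f k.+1 (n - k)%N *+ 'C(n, k))); last first.
  by move=> k _; rewrite lift0 subSS binS mulrnDr.
rewrite big_split/= addrA addrC; congr (_ + _).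
rewrite big_ord_recr/= bin_small// mulr0n addr0 [RHS]big_ord_recl subn0 bin0; congr (_ + _).
apply: eq_bigr => k _; rewrite lift0 subnS prednK// subn_gt0; exact: ltn_ord.
Qed.

Local Open Scope ereal_scope.

Lemma emulrn_ge0 (x : \bar R) k : 0 <= x -> 0 <= (x *+ k)%R.
Proof. by move=> x0; elim: k => // k IH; rewrite mulrS adde_ge0. Qed.

Lemma emulrnE (x : \bar R) k : 0 <= x -> (x *+ k)%R = k%:R%:E * x.
Proof.
move=> x0; elim: k => [|k IH]; first by rewrite mulr0n mul0e.
rewrite mulrS IH -natr1 addrC EFinD ge0_muleDl//; first by rewrite mul1e.
Qed.

(** The first point lies in P or not, which gives the two halves of Pascal's rule. There is only an
    inequality, since on the right F and G are integrated over the whole space instead of over P and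
    its complement. *)
Lemma integral_split n (F G : seq X -> R^o) : measurable_seq F -> measurable_seq G ->
  (forall s, (0 <= F s)%R) -> (forall s, (0 <= G s)%R) ->
  \int[pow n]_t (F (inP t) * G (outP t))%:E <=
  (\sum_(k < n.+1) (\int[pow k]_t (F t)%:E * \int[pow (n - k)]_t (G t)%:E)%E *+ 'C(n, k))%R.
Proof.
elim: n F G => [|n IH] F G mF mG F0 G0.
  rewrite big_ord_recl big_ord0 bin0 mulr1n addr0 /dx_sigma_pow !integral_tuple_prod0//.
  - by apply/measurable_EFinP; exact: mG.
  - by apply/measurable_EFinP; exact: mF.
  - by apply/measurable_EFinP; exact: measurable_split.
have I0 (H : seq X -> R^o) k : (forall s, (0 <= H s)%R) -> 0 <= \int[pow k]_t (H t)%:E.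
  by move=> H0; apply: integral_ge0 => t _; rewrite lee_fin.
have mcons (H : seq X -> R^o) y : measurable_seq H -> measurable_seq (fun s => H (y :: s)).
  move=> mH k; have := mH k.+1 => /measurable_fun_tuple_cons h.
  exact: (measurableT_comp h (measurable_pair1 y)).
have mint (H : seq X -> R^o) k : measurable_seq H -> (forall s, (0 <= H s)%R) ->
    measurable_fun setT (fun y => \int[pow k]_t (H (y :: t))%:E).
  move=> mH H0; apply: (@measurable_fun_fubini_tonelli_F _ _ _ _ _ (pow k)
    (fun z : X * k.-tuple X => (H (z.1 :: z.2))%:E)).
    by apply/measurable_EFinP; exact: (measurable_fun_tuple_cons (mH k.+1)).
  by move=> z; rewrite lee_fin.
have consE (H : seq X -> R^o) k : measurable_seq H -> (forall s, (0 <= H s)%R) ->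
    \int[dxs]_y \int[pow k]_t (H (y :: t))%:E = \int[pow k.+1]_t (H t)%:E.
  move=> mH H0; rewrite [RHS](@integral_tuple_prodS _ _ _ _ _ (fun t => (H t)%:E))//.
    by apply/measurable_EFinP; exact: mH.
  by move=> t; rewrite lee_fin.
rewrite [leRHS](_ : _ = (\sum_(k < n.+1) (\int[pow k.+1]_t (F t)%:E * \int[pow (n - k)]_t (G t)%:E)%E *+ 'C(n, k)) +
  (\sum_(k < n.+1) (\int[pow k]_t (F t)%:E * \int[pow (n - k).+1]_t (G t)%:E)%E *+ 'C(n, k)))%R; last first.
  exact: (@pascal_sum (\bar R) (fun k l => \int[pow k]_t (F t)%:E * \int[pow l]_t (G t)%:E) n).
rewrite -(consE (fun s => (F (inP s) * G (outP s))%R) n); last 2 first.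
- by move=> k; exact: measurable_split.
- by move=> s; rewrite mulr_ge0.
pose A y := (\sum_(k < n.+1) (\int[pow k]_t (F (y :: t))%:E * \int[pow (n - k)]_t (G t)%:E)%E *+ 'C(n, k))%R.
pose B y := (\sum_(k < n.+1) (\int[pow k]_t (F t)%:E * \int[pow (n - k)]_t (G (y :: t))%:E)%E *+ 'C(n, k))%R.
have A0 y : 0 <= A y.
  by apply: sume_ge0 => k _; apply: emulrn_ge0; apply: mule_ge0; apply: integral_ge0 => t _; rewrite lee_fin.
have B0 y : 0 <= B y.
  by apply: sume_ge0 => k _; apply: emulrn_ge0; apply: mule_ge0; apply: integral_ge0 => t _; rewrite lee_fin.
have mn (f : X -> \bar R) k : measurable_fun setT f -> measurable_fun setT (fun y => (f y *+ k)%R).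
  move=> mf; elim: k => [|k IHk]; first exact: measurable_cst.
  rewrite (_ : (fun y => _) = fun y => f y + (f y *+ k)%R); first exact: emeasurable_funD.
  by apply/funext => y; rewrite mulrS.
have mA : measurable_fun setT A.
  apply: emeasurable_sum => k; apply: mn; apply: emeasurable_funM; first exact: mint.
  exact: measurable_cst.
have mB : measurable_fun setT B.
  apply: emeasurable_sum => k; apply: mn; apply: emeasurable_funM; first exact: measurable_cst.
  exact: mint.
apply: (@le_trans _ _ (\int[dxs]_y (A y + B y))).
  apply: ge0_le_integral => //.
  - by move=> y _; apply: integral_ge0 => t _; rewrite lee_fin mulr_ge0.
  - apply: (@measurable_fun_fubini_tonelli_F _ _ _ _ _ (tuple_prod n (fun=> dxs))
      (fun z : X * n.-tuple X => (F (inP (z.1 :: z.2)) * G (outP (z.1 :: z.2)))%:E)).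
      apply/measurable_EFinP.
      exact: (measurable_fun_tuple_cons (@measurable_split n.+1 _ _ mF mG)).
    by move=> z; rewrite lee_fin mulr_ge0.
  - exact: emeasurable_funD.
  move=> y _ /=; case Py : (P y) => /=.
    apply: le_trans (_ : A y <= _); last by rewrite leeDl.
    have := IH (fun s => F (y :: s)) G (mcons F y mF) mG (fun s => F0 _) G0.
    by rewrite /inP /outP.
  apply: le_trans (_ : B y <= _); last by rewrite leeDr.
  exact: (IH F (fun s => G (y :: s)) mF (mcons G y mG) F0 (fun s => G0 _)).
have nZ (f : X -> \bar R) k : measurable_fun setT f -> (forall y, 0 <= f y) ->
    \int[dxs]_y (f y *+ k)%R = ((\int[dxs]_y f y)%E *+ k)%R.
  move=> mf f0; elim: k => [|k IHk]; first by rewrite mulr0n integral0.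
  under eq_integral do rewrite mulrS.
  by rewrite ge0_integralD//; [rewrite IHk mulrS|move=> y _; rewrite emulrn_ge0|exact: mn].
rewrite ge0_integralD//; apply: leeD.
  rewrite ge0_integral_sum//; last 2 first.
  - by move=> k; apply: mn; apply: emeasurable_funM; [exact: mint|exact: measurable_cst].
  - by move=> k y _; apply: emulrn_ge0; apply: mule_ge0; apply: integral_ge0 => t _; rewrite lee_fin.
  apply: lee_sum => k _; rewrite nZ; last 2 first.
  - by apply: emeasurable_funM; [exact: mint|exact: measurable_cst].
  - by move=> y; apply: mule_ge0; apply: integral_ge0 => t _; rewrite lee_fin.
  rewrite ge0_integralZr ?I0//; [by rewrite consE|exact: mint|by move=> y _; exact: (I0 (fun s => F (y :: s)))].
rewrite ge0_integral_sum//; last 2 first.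
- by move=> k; apply: mn; apply: emeasurable_funM; [exact: measurable_cst|exact: mint].
- by move=> k y _; apply: emulrn_ge0; apply: mule_ge0; apply: integral_ge0 => t _; rewrite lee_fin.
apply: lee_sum => k _; rewrite nZ; last 2 first.
- by apply: emeasurable_funM; [exact: measurable_cst|exact: mint].
- by move=> y; apply: mule_ge0; apply: integral_ge0 => t _; rewrite lee_fin.
rewrite ge0_integralZl ?I0//; [by rewrite consE|exact: mint|by move=> y _; exact: (I0 (fun s => G (y :: s)))].
Qed.

Lemma cauchy_product_le (x y : nat -> \bar R) : (forall k, 0 <= x k) -> (forall k, 0 <= y k) ->
  \sum_(0 <= n <oo) \sum_(k < n.+1) x k * y (n - k)%N <=
  (\sum_(0 <= k <oo) x k) * (\sum_(0 <= l <oo) y l).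
Proof.
move=> x0 y0; apply: lime_le.
  by apply: is_cvg_nneseries => n _ _; apply: sume_ge0 => k _; rewrite mule_ge0.
apply: nearW => N; apply: (@le_trans _ _ ((\sum_(0 <= k < N) x k) * (\sum_(0 <= l < N) y l))); last first.
  apply: lee_pmul; [exact: sume_ge0|exact: sume_ge0| |]; exact: nneseries_lim_ge.
rewrite !big_mkord ge0_sume_distrl; last by move=> k _.
apply: (@le_trans _ _ (\sum_(n < N) \sum_(k < N) if (k <= n)%N then x k * y (n - k)%N else 0)).
  apply: lee_sum => n _; rewrite -big_mkcond/=.
  rewrite (big_ord_widen_cond N xpredT (fun k => x k * y (n - k)%N))//=.
rewrite exchange_big/=; apply: lee_sum => k _; rewrite -big_mkcond/= -ge0_sume_distrr//.
apply: lee_wpmul2l => //.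
rewrite -(big_mkord (fun n => (k <= n)%N) (fun n => y (n - k)%N)) -(big_mkord xpredT y).
have kN : (k <= N)%N by rewrite ltnW.
rewrite (@big_cat_nat _ _ _ k)//= [X in X + _]big_nat_cond [X in X + _]big1 ?add0e; last first.
  by move=> n /andP[/andP[_ nk]]; rewrite leqNgt nk.
rewrite -{1}[val k]add0n big_addn [leRHS](@big_cat_nat _ _ _ (N - k))//=; last exact: leq_subr.
rewrite (eq_bigl xpredT); last by move=> n; rewrite leq_addl.
under eq_bigr do rewrite addnK.
by rewrite leeDl// sume_ge0.
Qed.

(* When [F] lives on P and [G] off P, this is the symmetric tensor product of [F]
   and [G]. *)
Definition od (F G : seq X -> R^o) : seq X -> R^o := fun s =>
  (F (inP s) * G (outP s) * ((size (inP s))`!%:R * (size (outP s))`!%:R) / (size s)`!%:R)%R.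

Lemma measurable_od F G : measurable_seq F -> measurable_seq G -> measurable_seq (od F G).
Proof.
move=> mF mG n.
have mfact (H : seq X -> R^o) : measurable_seq H -> measurable_seq (fun s => H s * (size s)`!%:R)%R.
  move=> mH k; rewrite (_ : component k _ = fun t => (component k H t * k`!%:R)%R).
    by apply: measurable_funM => //; exact: mH.
  by apply/funext => t; rewrite /component size_tuple.
rewrite (_ : component n _ = fun t => ((F (inP t) * (size (inP t))`!%:R) * (G (outP t) * (size (outP t))`!%:R) / n`!%:R)%R).
  apply: measurable_funM => //.
  exact: (@measurable_split n _ _ (mfact F mF) (mfact G mG)).
by apply/funext => t; rewrite /component /od size_tuple mulrACA.
Qed.

(** The factor k! l! / n! in [od] is squared, multiplied by the n! of Fock space and by the C(n, k)
    of [integral_split]; the result is k! l!, that is, the term of the Cauchy product of the two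
    norms. *)
Lemma fock_sqnorm_od F G : measurable_seq F -> measurable_seq G ->
  fock_sqnorm (od F G) <= fock_sqnorm F * fock_sqnorm G.
Proof.
move=> mF mG.
pose x k := k`!%:R%:E * sqint (pow k) (component k F).
pose y k := k`!%:R%:E * sqint (pow k) (component k G).
have x0 k : 0 <= x k by rewrite mule_ge0 ?sqint_ge0// lee_fin.
have y0 k : 0 <= y k by rewrite mule_ge0 ?sqint_ge0// lee_fin.
apply: le_trans (cauchy_product_le x0 y0); apply: lee_nneseries => [n _|n _].
  by rewrite mule_ge0 ?sqint_ge0// lee_fin.
pose F2 (s : seq X) : R^o := ((F s * (size s)`!%:R) ^+ 2)%R.
pose G2 (s : seq X) : R^o := ((G s * (size s)`!%:R) ^+ 2)%R.
have m2 (H : seq X -> R^o) : measurable_seq H -> measurable_seq (fun s => (H s * (size s)`!%:R) ^+ 2)%R.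
  move=> mH k; rewrite (_ : component k _ = fun t => ((component k H t * k`!%:R) ^+ 2)%R).
    by apply: measurable_funX; apply: measurable_funM => //; exact: mH.
  by apply/funext => t; rewrite /component size_tuple.
have f0 k : (k`!%:R != 0 :> R)%R by rewrite pnatr_eq0 -lt0n fact_gt0.
have i2 (H : seq X -> R^o) k : measurable_seq H ->
    \int[pow k]_t ((H t * (size t)`!%:R) ^+ 2)%:E = (k`!%:R)%:E * (k`!%:R%:E * sqint (pow k) (component k H)).
  move=> mH; rewrite muleA -EFinM -expr2 -sqintZ; last exact: mH.
  by apply: eq_integral => t _; rewrite size_tuple /component mulrC.
have /= h := integral_split n (m2 F mF) (m2 G mG) (fun s => sqr_ge0 _) (fun s => sqr_ge0 _).
have -> : sqint (pow n) (component n (od F G)) =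
    ((n`!%:R^-1) ^+ 2)%:E * \int[pow n]_t (F2 (inP t) * G2 (outP t))%:E.
  rewrite -ge0_integralZl_EFin//; last 2 first.
  - by move=> t _; rewrite lee_fin mulr_ge0// sqr_ge0.
  - by apply/measurable_EFinP; apply: measurable_split; exact: m2.
  apply: eq_integral => t _; rewrite -EFinM; congr _%:E.
  rewrite /component /od size_tuple /F2 /G2 -!exprMn; congr (_ ^+ 2)%R.
  by rewrite mulrC mulrACA.
rewrite muleA -EFinM.
rewrite (_ : (n`!%:R * n`!%:R^-1 ^+ 2 = n`!%:R^-1)%R); last by field.
apply: (le_trans (lee_wpmul2l _ h)); first by rewrite lee_fin invr_ge0.
rewrite ge0_sume_distrr; last first.
  move=> k _; rewrite emulrn_ge0// mule_ge0//; apply: integral_ge0 => t _; rewrite lee_fin; exact: sqr_ge0.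
apply: lee_sum => k _; rewrite !i2//.
rewrite -/(x k) -/(y (n - k)%N).
have kn : (k <= n)%N by rewrite -ltnS ltn_ord.
have xy0 : 0 <= x k * y (n - k)%N by rewrite mule_ge0.
have XY0 : 0 <= k`!%:R%:E * x k * ((n - k)`!%:R%:E * y (n - k)%N).
  by apply: mule_ge0; apply: mule_ge0 => //; rewrite lee_fin.
rewrite emulrnE// [leLHS](_ : _ = ((n`!%:R^-1 * 'C(n, k)%:R * k`!%:R * (n - k)`!%:R)%R)%:E * (x k * y (n - k)%N)).
  rewrite (_ : (_ * _ * _ * _)%R = 1%R) ?mul1e//.
  by rewrite -!mulrA -!natrM bin_fact// mulVf.
rewrite !EFinM -!muleA; congr (_ * (_ * _)).
rewrite (muleCA (sqint _ _)); congr (_ * _); exact: muleCA.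
Qed.

End splitting.

Section factorization.
Context (R : realType) (d : nat) (sigma : R.-pker (d.-tuple R) ~> R).
Hypothesis sigma_moments : moment_bound sigma.
Local Notation E := (d.-tuple R).
Local Notation X := (d.-tuple R * R)%type.
Local Notation dxs := (dx_sigma sigma).
Local Notation FVt := (FVt sigma).
Local Notation FV := (FV sigma).
Local Notation fieldt := (fieldt sigma).
Local Notation fock := (fock sigma).
Local Notation fock_sqnorm := (fock_sqnorm sigma).

Definition ot (P : pred X) (F G : seq X -> R^o) : seq X -> R^o :=
  fun s => F (inP P s) * G (outP P s).

Definition lives (P : pred X) (F : seq X -> R^o) := forall s, ~~ all P s -> F s = 0.

Lemma inP_predC (P : pred X) s : inP (predC P) s = outP P s.
Proof. by []. Qed.

Lemma outP_predC (P : pred X) s : outP (predC P) s = inP P s.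
Proof. by apply: eq_filter => y /=; rewrite negbK. Qed.

Lemma ot_predC P F G : ot (predC P) F G = ot P G F.
Proof. by apply/funext => s; rewrite /ot inP_predC outP_predC mulrC. Qed.

Lemma crea0h (h : X -> R) s : crea h (fun=> 0) s = 0.
Proof. by elim: s => //= y s ->; rewrite mulr0 addr0. Qed.

Lemma lives_crea P (h : X -> R) F : (forall y, ~~ P y -> h y = 0) -> lives P F ->
  lives P (crea h F).
Proof.
move=> hP lF s; elim: s F lF => [|y s IH] F lF //= nP.
have [Py|nPy] := boolP (P y).
  rewrite Py/= in nP; rewrite lF// mulr0 add0r; apply: IH => // t nt.
  by apply: lF; rewrite /= Py.
rewrite hP// mul0r add0r (@eq_crea _ _ h _ (fun=> 0)) ?crea0h// => t.
by apply: lF; rewrite /= (negbTE nPy).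
Qed.

(** A created point off P contributes h = 0, and one in P is removed from [inP] without touching
    [outP]. *)
Lemma crea_ot P (h : X -> R) F G s : (forall y, ~~ P y -> h y = 0) ->
  crea h (ot P F G) s = ot P (crea h F) G s.
Proof.
move=> hP; rewrite /ot; elim: s F G => [|y s IH] F G /=; first by rewrite mul0r.
have [Py|nPy] := boolP (P y); last first.
  by rewrite hP// mul0r add0r -(IH F (fun t => G (y :: t))).
by rewrite (IH (fun t => F (y :: t)) G)/= mulrDl mulrA.
Qed.

Lemma ot_vacuuml P G : lives (predC P) G -> ot P (@vacuum R d) G = G.
Proof.
move=> lG; apply/funext => s; rewrite /ot; have [e|e] := boolP (all (predC P) s).
  have -> : inP P s = [::].
    by apply/eqP; rewrite -[_ == _]negbK -has_filter -all_predC.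
  by rewrite mul1r /outP (all_filterP e).
rewrite (lG s e); case eP : (inP P s) => [|y t]; last by rewrite mul0r.
case/negP: e; rewrite all_predC has_filter -/(inP P s) eP; by [].
Qed.

Lemma lives_FVt P phis : (forall phi, phi \in phis -> forall y : X, ~~ P y -> phi y.1 = 0) ->
  lives P (FVt phis).
Proof.
elim: phis => [_ [|y s]//|phi phis IH hphi].
have {}IH : lives P (FVt phis) by apply: IH => psi h; apply: hphi; rewrite inE h orbT.
move=> s ns; rewrite /= /fieldt (IH s ns) mulr0 addr0.
rewrite (@lives_crea P _ _ _ IH s ns); last first.
  by apply: hphi; rewrite inE eqxx.
rewrite add0r /Rintegral integral0_eq// => y _; rewrite IH ?mulr0//=.
by rewrite (negbTE ns) andbF.
Qed.

(* A field supported in P acts on the first factor only: the field operators are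
   derivations of the product over disjoint regions. *)
Lemma fieldt_ot P phi F G : bddE phi -> Bdd F -> (forall y : X, ~~ P y -> phi y.1 = 0) ->
  fieldt phi (ot P F G) = ot P (fieldt phi F) G.
Proof.
move=> bphi BF hP; apply/funext => s; rewrite /fieldt crea_ot//.
rewrite [RHS]/ot !mulrDl; congr (_ + _ + _).
  rewrite -[X in _ * X]mulr1 mulrA; set K := _ * 1; rewrite /K mulr1.
  have := integrable_field sigma_moments (inP P s) bphi BF => iF.
  rewrite -RintegralZr//; apply: eq_Rintegral => y _.
  have [Py|nPy] := boolP (P y); last by rewrite hP// !mul0r.
  by rewrite /ot /= Py/= mulrA.
rewrite /ot mulrA; congr (_ * _ * _); rewrite /inP big_filter [RHS]big_mkcond/=.
apply: eq_bigr => y _; case: ifPn => // nPy; by rewrite hP// mul0r.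
Qed.

Lemma Bdd_ot (P : pred X) F G : measurable [set y | P y] -> Bdd F -> Bdd G -> Bdd (ot P F G).
Proof.
move=> mP [mF [M [k [N [C [C0 hF]]]]]] [mG [M' [k' [N' [C' [C'0 hG]]]]]].
split; first by move=> n; exact: measurable_split.
exists (Num.max M M'), (maxn k k'), (N + N')%N, (C * C'); split; first by rewrite mulr_ge0.
move=> _ s; rewrite /ot normrM.
pose M2 := Num.max M M'; pose k2 := maxn k k'.
have WE : Wt M2 k2 (inP P s) * Wt M2 k2 (outP P s) = Wt M2 k2 s.
  by rewrite /Wt /inP /outP !big_filter [RHS](bigID P).
have hF' : `|F (inP P s)| <= dom M2 k2 N C (inP P s).
  by apply: (le_trans (hF tt _)); apply: dom_le => //; rewrite ?le_max ?lexx// leq_maxl.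
have hG' : `|G (outP P s)| <= dom M2 k2 N' C' (outP P s).
  by apply: (le_trans (hG tt _)); apply: dom_le => //; rewrite ?le_max ?lexx ?orbT// leq_maxr.
apply: (le_trans (ler_pM _ _ hF' hG')) => //.
rewrite /dom -(size_inP_outP P s); case: leqP => h1; last first.
  by rewrite mul0r; case: ifP => _//; rewrite !mulr_ge0// Wt_ge0.
case: leqP => h2; last by rewrite mulr0; case: ifP => _//; rewrite !mulr_ge0// Wt_ge0.
by rewrite leq_add// mulrACA WE.
Qed.

(** In the normalization of [fieldt], with degree n multiplied by n!, the symmetric product over
    disjoint regions is the pointwise product [ot]. *)
Lemma od_ot (P : pred X) (F G : seq X -> R^o) :
  od P (fun s => F s / (size s)`!%:R) (fun s => G s / (size s)`!%:R) =
  (fun s => ot P F G s / (size s)`!%:R).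
Proof.
apply/funext => s; rewrite /od /ot mulrACA; congr (_ / _).
have f0 k : k`!%:R != 0 :> R by rewrite pnatr_eq0 -lt0n fact_gt0.
by congr (_ * _); rewrite -mulrA mulVf ?mulr1.
Qed.

End factorization.

Section multiplicativity.
Context (R : realType) (d : nat) (sigma : R.-pker (d.-tuple R) ~> R).
Hypothesis sigma_moments : moment_bound sigma.
Local Notation E := (d.-tuple R).
Local Notation X := (d.-tuple R * R)%type.
Local Notation dxs := (dx_sigma sigma).
Local Notation pow := (dx_sigma_pow sigma).
Local Notation FVt := (FVt sigma).
Local Notation FV := (FV sigma).
Local Notation fieldt := (fieldt sigma).
Local Notation fock := (fock sigma).
Local Notation fock_sqnorm := (fock_sqnorm sigma).
Local Notation vacuum := (@vacuum R d).
Variables (mu : probability (DprimeType R d) R).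
Variable I : (seq X -> R^o) -> Dprime R d -> R^o.
Hypothesis I_unitary : fock_unitary sigma mu I.

Definition nrm (F : seq X -> R^o) : seq X -> R^o := fun s => F s / (size s)`!%:R.

Lemma fock_measurable F : fock F -> measurable_seq F.
Proof. by move=> [h _] n; exact: Lfun2_measurable (h n).1. Qed.

Lemma le_fock_sqnorm n F : (n`!%:R%:E * sqint (pow n) (component n F) <= fock_sqnorm F)%E.
Proof.
have h k : (0 <= k`!%:R%:E * sqint (pow k) (component k F))%E.
  by rewrite mule_ge0 ?sqint_ge0// lee_fin.
apply: (@le_trans _ _ (\sum_(0 <= k < n.+1) k`!%:R%:E * sqint (pow k) (component k F))%E).
  by rewrite big_nat_recr//= leeDr// sume_ge0.
exact: nneseries_lim_ge.
Qed.

Lemma symmetric_fock F : symmetric F -> measurable_seq F -> (fock_sqnorm F < +oo)%E -> fock F.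
Proof.
move=> sF mF Foo; split=> // n; split; last first.
  by rewrite (Symn_symmetric sF); apply: aeW.
apply/Lfun2P; split; first exact: mF.
apply: le_lt_trans Foo; apply: le_trans (le_fock_sqnorm n F).
by rewrite lee_pemull ?sqint_ge0// lee_fin ler1n fact_gt0.
Qed.

Lemma fock_sqnorm_ge0 F : (0 <= fock_sqnorm F)%E.
Proof.
by apply: nneseries_ge0 => k _ _; rewrite mule_ge0 ?sqint_ge0// lee_fin.
Qed.

Variable P : pred X.
Hypothesis mP : measurable [set y | P y].

Lemma symmetric_od F G : symmetric F -> symmetric G -> symmetric (od P F G).
Proof.
move=> sF sG s s' ss'; rewrite /od.
have h1 : perm_eq (inP P s) (inP P s') by exact: perm_filter.
have h2 : perm_eq (outP P s) (outP P s') by exact: perm_filter.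
by rewrite (sF _ _ h1) (sG _ _ h2) (perm_size h1) (perm_size h2) (perm_size ss').
Qed.

Lemma fock_od F G : symmetric F -> fock F -> symmetric G -> fock G -> fock (od P F G).
Proof.
move=> sF fF sG fG; apply: symmetric_fock.
- exact: symmetric_od.
- by apply: measurable_od => //; exact: fock_measurable.
apply: (@le_lt_trans _ _ (fock_sqnorm F * fock_sqnorm G)%E).
  by apply: fock_sqnorm_od => //; exact: fock_measurable.
by rewrite lte_mul_pinfty ?fock_sqnorm_ge0// ?fG.2// ge0_fin_numE ?fF.2// fock_sqnorm_ge0.
Qed.

Lemma od_lin_l c F F' G : od P (c *: F + F') G = c *: od P F G + od P F' G.
Proof.
apply/funext => s; rewrite /od.
transitivity (((c * F (inP P s) + F' (inP P s)) * G (outP P s) *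
  ((size (inP P s))`!%:R * (size (outP P s))`!%:R) / (size s)`!%:R) : R) => //.
transitivity (c * (F (inP P s) * G (outP P s) *
  ((size (inP P s))`!%:R * (size (outP P s))`!%:R) / (size s)`!%:R) + (F' (inP P s) * G (outP P s) *
  ((size (inP P s))`!%:R * (size (outP P s))`!%:R) / (size s)`!%:R) : R) => //.
by ring.
Qed.

Lemma od_predC F G : od (predC P) F G = od P G F.
Proof.
apply/funext => s; rewrite /od inP_predC outP_predC [F _ * _]mulrC.
by rewrite [X in _ * X / _]mulrC.
Qed.

Lemma small_mul (K : \bar R) (e : R) : (0 <= K)%E -> (K < +oo)%E -> 0 < e ->
  exists2 e' : R, 0 < e' & forall x, (0 <= x)%E -> (x < e'%:E)%E -> (x * K < e%:E)%E.
Proof.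
move=> K0 Koo e0; have Kf : K \is a fin_num by rewrite ge0_fin_numE.
have k0 : 0 <= fine K by exact: fine_ge0.
exists (e / (1 + fine K)); first by rewrite divr_gt0// ltr_pwDl.
move=> x x0 xe; have xf : x \is a fin_num by rewrite ge0_fin_numE// (lt_trans xe)// ltry.
move: xe; rewrite -(fineK xf) -(fineK Kf) -EFinM !lte_fin => xe.
have x0' : 0 <= fine x by exact: fine_ge0.
apply: (@le_lt_trans _ _ (fine x * (1 + fine K))); first by rewrite ler_wpM2l// lerDr.
by rewrite -ltr_pdivlMr// ltr_pwDl.
Qed.

Definition multI2 F G : Prop := I (od P F G) = (fun w => I F w * I G w) %[ae mu].

Lemma multI2_limit F G : symmetric F -> fock F -> symmetric G -> fock G ->
  (forall e : R, 0 < e -> exists U, [/\ symmetric U, fock U, (fock_sqnorm (F - U)%R < e%:E)%E & multI2 U G]) ->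
  multI2 F G.
Proof.
move=> sF fF sG fG h; apply: mul_limit.
- by apply: Lfun2_measurable; exact: (I_Lfun I_unitary fG).
- by apply: (I_Lfun I_unitary); exact: fock_od.
- exact: (I_Lfun I_unitary fF).
move=> e e0.
have [e' e'0 he'] := small_mul (fock_sqnorm_ge0 G) fG.2 e0.
have [U [sU fU FU mUG]] := h (Num.min e e') (ltac:(by rewrite lt_min e0 e'0)).
have fUG := fock_od sU fU sG fG; have fFG := fock_od sF fF sG fG.
exists (I (od P U G)), (I U); split => //.
- exact: (I_Lfun I_unitary fUG).
- exact: (I_Lfun I_unitary fU).
- rewrite (I_dist I_unitary fFG fUG).
  have -> : od P F G - od P U G = od P (F - U) G.
    by rewrite addrC -scaleN1r -od_lin_l scaleN1r addrC.
  apply: (@le_lt_trans _ _ (fock_sqnorm (F - U)%R * fock_sqnorm G)%E).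
    apply: fock_sqnorm_od => //; apply: fock_measurable => //.
    exact: (domB (sqnormed_fock sigma)).
  apply: he'; first exact: fock_sqnorm_ge0.
  by apply: (lt_le_trans FU); rewrite lee_fin ge_min lexx orbT.
rewrite (I_dist I_unitary fF fU).
by apply: (lt_le_trans FU); rewrite lee_fin ge_min lexx.
Qed.

End multiplicativity.

(** * Vectors over a region and their approximation by local fields *)

Section localization.
Context (R : realType) (d : nat) (sigma : R.-pker (d.-tuple R) ~> R).
Hypothesis sigma_moments : moment_bound sigma.
Local Notation E := (d.-tuple R).
Local Notation X := (d.-tuple R * R)%type.
Local Notation dxs := (dx_sigma sigma).
Local Notation pow := (dx_sigma_pow sigma).
Local Notation FVt := (FVt sigma).
Local Notation FV := (FV sigma).
Local Notation fieldt := (fieldt sigma).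
Local Notation fock := (fock sigma).
Local Notation fock_sqnorm := (fock_sqnorm sigma).
Local Notation vacuum := (@vacuum R d).
Variables (mu : probability (DprimeType R d) R).
Variable I : (seq X -> R^o) -> Dprime R d -> R^o.
Hypothesis I_unitary : fock_unitary sigma mu I.

Definition inD (D : set E) : pred X := fun y => y.1 \in D.

Lemma inD_C D : inD (~` D) = predC (inD D).
Proof. by apply/funext => y; rewrite /inD /= in_setC. Qed.

Lemma measurable_inD D : measurable D -> measurable [set y | inD D y].
Proof.
move=> mD; rewrite (_ : [set y | _] = fst @^-1` D).
  by rewrite -[X in measurable X]setTI; exact: measurable_fst.
by apply/seteqP; split=> y /=; rewrite /inD inE.
Qed.

Definition supp (D : set E) (a : seq (E -> R)) :=
  forall phi, phi \in a -> bddE phi /\ forall x, ~ D x -> phi x = 0.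

Inductive spanD (D : set E) : (seq X -> R^o) -> Prop :=
| span_gen a : supp D a -> spanD D (FVt a)
| span_lin (c : R) U V : spanD D U -> spanD D V -> spanD D (fun s => c * U s + V s).

(** Unlike [spanD], this span is stable under field operators of arbitrary support, so it contains
    all field vectors. *)
Inductive spanO (D : set E) : (seq X -> R^o) -> Prop :=
| spanO_gen a b : supp D a -> supp (~` D) b -> spanO D (ot (inD D) (FVt a) (FVt b))
| spanO_lin (c : R) U V : spanO D U -> spanO D V -> spanO D (fun s => c * U s + V s).

Lemma supp_bdd D a : supp D a -> forall phi, phi \in a -> bddE phi.
Proof. by move=> sa phi /sa[]. Qed.

Lemma lives_supp D a : supp D a -> lives (inD D) (FVt a).
Proof.
move=> sa; apply: lives_FVt => phi /sa[_ h] y ny; apply: h.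
by move: ny; rewrite /inD notin_setE.
Qed.

Lemma spanD_symmetric D U : spanD D U -> symmetric U.
Proof.
elim=> [a sa|c U' V _ sU _ sV]; first exact: symmetric_FVt.
by move=> s s' ss'; rewrite (sU _ _ ss') (sV _ _ ss').
Qed.

Lemma symmetric_nrm (U : seq X -> R^o) : symmetric U -> symmetric (nrm U).
Proof. by move=> sU s s' ss'; rewrite /nrm (sU _ _ ss') (perm_size ss'). Qed.

Lemma nrm_lin c (U V : seq X -> R^o) : nrm (fun s => c * U s + V s) = c *: nrm U + nrm V.
Proof. by apply/funext => s; rewrite /nrm mulrDl -mulrA. Qed.

Lemma fock_span D U : spanD D U -> fock (nrm U).
Proof.
elim=> [a sa|c U' V _ fU _ fV]; first by apply: (fock_FV sigma_moments); exact: supp_bdd sa.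
by rewrite nrm_lin; exact: (dom_lin (sqnormed_fock sigma)).
Qed.

Lemma bddE_restr (D : set E) (phi : E -> R) : measurable D -> bddE phi -> bddE (fun x => phi x * \1_D x).
Proof.
move=> mD [M [mphi [C hC]]]; exists M; split.
  by apply: measurable_funM => //; exact: measurable_indic.
exists C => x; apply: le_trans (hC x); rewrite normrM ler_piMr// indicE ger0_norm ?ler0n//.
by rewrite lern1 leq_b1.
Qed.

Lemma spanO_Bdd D U : measurable D -> spanO D U -> Bdd U.
Proof.
move=> mD; elim=> [a b sa sb|c U' V _ BU _ BV]; last exact: Bdd_lin.
apply: Bdd_ot; first exact: measurable_inD.
  by apply: (Bdd_FVt sigma_moments); exact: supp_bdd sa.
by apply: (Bdd_FVt sigma_moments); exact: supp_bdd sb.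
Qed.

Lemma supp_cons D phi a : bddE phi -> (forall x, ~ D x -> phi x = 0) -> supp D a -> supp D (phi :: a).
Proof. by move=> bphi hphi sa psi; rewrite inE => /orP[/eqP->|/sa]. Qed.

(** Cut [phi] into its parts over D and over the complement; each acts on its own factor by
    [fieldt_ot], the second one after exchanging the roles of the two regions. *)
Lemma spanO_fieldt D phi K : measurable D -> bddE phi -> spanO D K -> spanO D (fieldt phi K).
Proof.
move=> mD bphi; elim=> [a b sa sb|c U V hU IU hV IV]; last first.
  rewrite (_ : fieldt phi _ = fun s => c * fieldt phi U s + fieldt phi V s); first exact: spanO_lin.
  by apply/funext => s; apply: fieldt_lin => //; exact: (spanO_Bdd mD).
have mDc : measurable (~` D) by exact: measurableC.
have Ba : Bdd (FVt a) by apply: (Bdd_FVt sigma_moments); exact: supp_bdd sa.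
have Bb : Bdd (FVt b) by apply: (Bdd_FVt sigma_moments); exact: supp_bdd sb.
pose f1 x := phi x * \1_D x; pose f2 x := phi x * \1_(~` D) x.
have b1 : bddE f1 by exact: bddE_restr.
have b2 : bddE f2 by exact: bddE_restr.
have z1 x : ~ D x -> f1 x = 0 by move=> nD; rewrite /f1 indicE memNset// mulr0.
have z2 x : ~ (~` D) x -> f2 x = 0 by move=> nD; rewrite /f2 indicE memNset// mulr0.
have phiE : phi = fun x => 1 * f1 x + f2 x.
  apply/funext => x; rewrite /f1 /f2 !indicE in_setC mul1r -mulrDr.
  by case: (x \in D); rewrite ?addr0 ?add0r mulr1.
rewrite (_ : fieldt phi _ = fun s => 1 * ot (inD D) (FVt (f1 :: a)) (FVt b) s +
    ot (inD D) (FVt a) (FVt (f2 :: b)) s).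
  by apply: spanO_lin; apply: spanO_gen => //; exact: supp_cons.
apply/funext => s; rewrite {1}phiE fieldt_lin_l//; last first.
  by apply: Bdd_ot => //; exact: measurable_inD.
rewrite fieldt_ot//; last by move=> y; rewrite /inD notin_setE => /z1.
congr (_ + _); rewrite -!(ot_predC (inD D)) fieldt_ot// => y /=.
by rewrite /inD negbK inE => Dy; apply: z2 => /(_ Dy).
Qed.

Lemma lives_vacuum P : lives P vacuum.
Proof. by case. Qed.

Lemma spanO_FVt D a : measurable D -> (forall phi, phi \in a -> bddE phi) -> spanO D (FVt a).
Proof.
move=> mD; elim: a => [_|phi a IH ba].
  have -> : FVt [::] = ot (inD D) (FVt [::]) (FVt [::]).
    by rewrite ot_vacuuml//; exact: lives_vacuum.
  exact: spanO_gen.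
apply: spanO_fieldt => //; first by apply: ba; rewrite inE eqxx.
by apply: IH => psi h; apply: ba; rewrite inE h orbT.
Qed.

Lemma ot_vacuumr P F : lives P F -> ot P F vacuum = F.
Proof.
move=> lF; rewrite -ot_predC; apply: ot_vacuuml => s; rewrite (@eq_all _ _ P); first exact: lF.
by move=> y /=; rewrite negbK.
Qed.

(* Restriction to the configurations contained in D. *)
Lemma spanO_proj D K : spanO D K -> spanD D (ot (inD D) K vacuum).
Proof.
elim=> [a b sa sb|c U V _ hU _ hV]; last first.
  rewrite (_ : ot _ _ _ = fun s => c * ot (inD D) U vacuum s + ot (inD D) V vacuum s).
    exact: span_lin.
  by apply/funext => s; rewrite /ot mulrDl -mulrA.
(* On configurations inside D the second factor is evaluated at the empty configuration, so the
   restriction is this constant times the vector of [a]. *)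
pose c := FVt b [::].
rewrite (_ : ot _ _ _ = fun s => (c - 1) * FVt a s + FVt a s).
  by apply: span_lin; exact: span_gen.
apply/funext => s; rewrite mulrBl mul1r subrK.
rewrite -{2}(ot_vacuumr (lives_supp sa)) /ot.
have -> : inP (inD D) (inP (inD D) s) = inP (inD D) s by rewrite /inP filter_id.
have -> : outP (inD D) (inP (inD D) s) = [::].
  rewrite /outP /inP -filter_predI (@eq_filter _ _ pred0) ?filter_pred0// => y /=.
  by rewrite andNb.
by rewrite -/c mulrA [c * _]mulrC.
Qed.

(** The vacuum in the first factor leaves the vector of [b] unchanged; the fields of [a] are then
    applied one by one and act on the first factor only. *)
Lemma FVt_cat D a b : measurable D -> supp D a -> supp (~` D) b ->
  FVt (a ++ b) = ot (inD D) (FVt a) (FVt b).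
Proof.
move=> mD sa sb; elim: a sa => [_|phi a IH sa].
  by rewrite ot_vacuuml// -inD_C; exact: lives_supp.
have sa' : supp D a by move=> psi h; apply: sa; rewrite inE h orbT.
have [bphi zphi] := sa phi (mem_head _ _).
rewrite /= -/(FVt _) IH// fieldt_ot//.
  by apply: (Bdd_FVt sigma_moments); exact: supp_bdd sa'.
by move=> y; rewrite /inD notin_setE => /zphi.
Qed.

Lemma od_nrm P (F G : seq X -> R^o) : od P (nrm F) (nrm G) = nrm (ot P F G).
Proof. exact: od_ot. Qed.

Lemma multI2_gen D a b : measurable D -> supp D a -> supp (~` D) b ->
  multI2 mu I (inD D) (nrm (FVt a)) (nrm (FVt b)).
Proof.
move=> mD sa sb; rewrite /multI2 od_nrm -FVt_cat//.
have ba := supp_bdd sa; have bb := supp_bdd sb.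
have bab phi : phi \in a ++ b -> bddE phi by rewrite mem_cat => /orP[/ba|/bb].
have h1 := multI_bdd sigma_moments I_unitary ba.
have h2 := multI_bdd sigma_moments I_unitary bb.
have h3 := multI_bdd sigma_moments I_unitary bab.
rewrite /multI in h1 h2 h3.
apply: aeS2 (aeS2 h1 h2 (fun w x y => conj x y)) h3 _ => w [e1 e2] e3 _.
have e1' := e1 Logic.I; have e2' := e2 Logic.I; have e3' := e3 Logic.I.
by rewrite -[LHS]/(I (FV (a ++ b)) w) e3' big_cat -e1' -e2'.
Qed.

Lemma multI2_lin (P : pred X) c F F' G : measurable [set y | P y] ->
  symmetric F -> fock F -> symmetric F' -> fock F' -> symmetric G -> fock G ->
  multI2 mu I P F G -> multI2 mu I P F' G -> multI2 mu I P (c *: F + F') G.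
Proof.
move=> mP sF fF sF' fF' sG fG h h'; rewrite /multI2 od_lin_l.
have k := I_lin I_unitary c fF fF'.
have k' := I_lin I_unitary c (fock_od mP sF fF sG fG) (fock_od mP sF' fF' sG fG).
apply: aeS4 h h' k k' _ => w e1 e2 e3 e4 _.
by rewrite (e4 Logic.I) (e3 Logic.I) (e1 Logic.I) (e2 Logic.I) mulrDl mulrA.
Qed.

Lemma multI2_predC P F G : multI2 mu I (predC P) F G <-> multI2 mu I P G F.
Proof.
by rewrite /multI2 od_predC; split=> h; apply: aeS h _ => w e _; rewrite (e Logic.I) mulrC.
Qed.

Lemma multI2_span D U V : measurable D -> spanD D U -> spanD (~` D) V ->
  multI2 mu I (inD D) (nrm U) (nrm V).
Proof.
move=> mD sU sV; have mP := measurable_inD mD.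
have mPC : measurable [set y | predC (inD D) y] by rewrite -inD_C; apply: measurable_inD; exact: measurableC.
elim: sU => [a sa|c U1 U2 s1 h1 s2 h2]; last first.
  by rewrite nrm_lin; apply: multI2_lin => //; try (apply: symmetric_nrm; apply: spanD_symmetric; eassumption); apply: fock_span; eassumption.
elim: sV => [b sb|c V1 V2 s1 h1 s2 h2]; first exact: multI2_gen.
have sgA := span_gen sa.
rewrite nrm_lin; apply: (multI2_predC _ _ _).1.
have swap V0 : multI2 mu I (inD D) (nrm (FVt a)) (nrm V0) -> multI2 mu I (predC (inD D)) (nrm V0) (nrm (FVt a)).
  by move=> h; apply: (multI2_predC _ _ _).2.
apply: multI2_lin => //; try exact: swap;
  try (apply: symmetric_nrm; apply: spanD_symmetric; eassumption); apply: fock_span; eassumption.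
Qed.

Lemma od_vacuumr P F : lives P F -> od P F vacuum = F.
Proof.
move=> lF; have f0 k : k`!%:R != 0 :> R by rewrite pnatr_eq0 -lt0n fact_gt0.
have -> : vacuum = nrm vacuum.
  by apply/funext => -[|y s]; rewrite /nrm /= ?mul0r// divr1.
have {1}-> : F = nrm (fun s => F s * (size s)`!%:R) by apply/funext => s; rewrite /nrm mulfK.
rewrite od_nrm ot_vacuumr; first by apply/funext => s; rewrite /nrm mulfK.
by move=> s ns; rewrite lF// mul0r.
Qed.

Lemma fock_vacuum : fock vacuum.
Proof.
have -> : vacuum = FV [::] by apply/funext => -[|y s]; rewrite /FV /= ?mul0r// divr1.
exact: (fock_FV sigma_moments).
Qed.

(** The given approximation by field vectors ignores D. It is corrected by the restriction [od] with
    the vacuum, which fixes [F], is bounded by [fock_sqnorm_od], and sends field vectors to [spanD]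
    by [spanO_proj]. *)
Lemma spanD_approx D F : measurable D -> fock F -> lives (inD D) F -> forall e : R, 0 < e ->
  exists2 U, spanD D U & (fock_sqnorm (F - nrm U)%R < e%:E)%E.
Proof.
move=> mD fF lF e e0; have mP := measurable_inD mD.
have [e' e'0 he'] := small_mul (fock_sqnorm_ge0 sigma vacuum) fock_vacuum.2 e0.
have [_ _ /(_ F fF e' e'0)[l hl]] := I_unitary.
have [K sK KE] : exists2 K, spanO D K & \sum_(u <- l) u.1 *: field_vector sigma u.2 = nrm K.
  elim: (l) => [|u r [K sK IH]].
    exists (fun s => - 1 * FVt [::] s + FVt [::] s).
      by apply: spanO_lin; exact: spanO_FVt.
    by rewrite big_nil; apply/funext => s; rewrite /nrm mulN1r addNr mul0r.
  exists (fun s => u.1 * FVt [seq test_fun f | f <- u.2] s + K s).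
    by apply: spanO_lin => //; apply: spanO_FVt => //; exact: bddE_tests.
  by rewrite big_cons IH (field_vectorE sigma_moments) nrm_lin.
exists (ot (inD D) K vacuum); first exact: spanO_proj.
have -> : F - nrm (ot (inD D) K vacuum) = od (inD D) (F - nrm K) vacuum.
  have vE : vacuum = nrm vacuum.
    by apply/funext => -[|y s]; rewrite /nrm /= ?mul0r// divr1.
  have hK : od (inD D) (nrm K) vacuum = nrm (ot (inD D) K vacuum) by rewrite {1}vE od_nrm.
  rewrite -hK -{1}(od_vacuumr lF).
  by rewrite addrC -scaleN1r -od_lin_l scaleN1r addrC.
rewrite KE in hl.
apply: (@le_lt_trans _ _ (fock_sqnorm (F - nrm K)%R * fock_sqnorm vacuum)%E).
  apply: fock_sqnorm_od => //; last exact: (fock_measurable fock_vacuum).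
  apply: fock_measurable (domB (sqnormed_fock sigma) fF _).
  rewrite -KE; apply: (dom_sum (sqnormed_fock sigma)) => u.
  apply: (domZ (sqnormed_fock sigma)); rewrite (field_vectorE sigma_moments).
  by apply: (fock_FV sigma_moments); exact: bddE_tests.
by apply: he' => //; exact: fock_sqnorm_ge0.
Qed.

(* Independence of the fields over disjoint regions: it holds for products of fields by
   [multI_bdd], and passes to the limit since [od] is continuous in each argument. *)
Lemma multI_od D F G : measurable D -> symmetric F -> fock F -> lives (inD D) F ->
  symmetric G -> fock G -> lives (inD (~` D)) G -> multI2 mu I (inD D) F G.
Proof.
move=> mD sF fF lF sG fG lG; have mP := measurable_inD mD.
have mDc := measurableC mD; have mPc := measurable_inD mDc.
(* [G] is approximated first and [F] afterwards; replacing D by its complement exchanges the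
   arguments, so that [multI2_limit] serves twice. *)
suff h V : spanD (~` D) V -> multI2 mu I (inD D) F (nrm V).
  apply: (multI2_predC _ _ _).1; rewrite -inD_C; apply: (multI2_limit I_unitary mPc sG fG sF fF) => e e0.
  have [V sV GV] := spanD_approx mDc fG lG e0; exists (nrm V); split.
  - by apply: symmetric_nrm; exact: spanD_symmetric sV.
  - exact: fock_span sV.
  - exact: GV.
  by rewrite inD_C; apply: (multI2_predC _ _ _).2; exact: h.
move=> sV; have sV' := symmetric_nrm (spanD_symmetric sV).
apply: (multI2_limit I_unitary mP sF fF sV' (fock_span sV)) => e e0.
have [U sU FU] := spanD_approx mD fF lF e0; exists (nrm U); split.
- by apply: symmetric_nrm; exact: spanD_symmetric sU.
- exact: fock_span sU.
- exact: FU.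
exact: multI2_span mD sU sV.
Qed.

End localization.

Section disjoint_products.
Context (R : realType) (d : nat) (sigma : R.-pker (d.-tuple R) ~> R).
Hypothesis sigma_moments : moment_bound sigma.
Local Notation E := (d.-tuple R).
Local Notation X := (d.-tuple R * R)%type.
Local Notation dxs := (dx_sigma sigma).
Local Notation fock := (fock sigma).
Local Notation vacuum := (@vacuum R d).
Variables (mu : probability (DprimeType R d) R).
Variable I : (seq X -> R^o) -> Dprime R d -> R^o.
Hypothesis I_unitary : fock_unitary sigma mu I.

Definition Phi (hs : seq (X -> R)) : seq X -> R^o := foldr (fun h F => crea h F) vacuum hs.

(** Sorting the permutations by the point placed first reproduces the sum over points in [crea]; the
    factor 1/n! is collected by [nrm]. *)
Lemma Symn_tens hs : Symn (tens hs) = nrm (Phi hs).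
Proof.
have f0 k : k`!%:R != 0 :> R by rewrite pnatr_eq0 -lt0n fact_gt0.
elim: hs => [|h hs IH].
  rewrite Symn_symmetric; last by move=> [|y s] [|y' s']// /perm_size.
  by apply/funext => -[|y s]; rewrite /nrm /= ?divr1// mul0r.
apply/funext => s; case: s => [|y s].
  rewrite /Symn big1 ?mulr0; first by rewrite /nrm mul0r.
  by move=> p _; rewrite tens_size// /perm_seq size_map size_enum_ord.
have -> : y :: s = [tuple of y :: in_tuple s] :> seq X by [].
move: [tuple of y :: in_tuple s] => t; set n := size s in t *.
rewrite Symn_tuple /sym_tuple /nrm size_tuple mulrC; congr (_ / _).
rewrite sum_perm_recl [RHS]crea_tuple; apply: eq_bigr => j _.
set t' := [tuple tnth t (lift j i) | i < n].
have : Symn (tens hs) t' = nrm (Phi hs) t' by rewrite IH.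
rewrite Symn_tuple /sym_tuple /nrm size_tuple mulrC => /(divIf (f0 n)) eP.
transitivity (h (tnth t j) * Phi hs t'); last by [].
rewrite -eP; rewrite mulr_sumr; apply: eq_bigr => p _.
rewrite /component /permute_tuple/= enum_ordSl/= lift_perm_id; congr (_ * tens hs _).
rewrite -map_comp; apply: eq_map => i /=.
by rewrite lift_perm_lift tnth_mktuple.
Qed.

Lemma symmetric_Phi hs : symmetric (Phi hs).
Proof.
elim: hs => [|h hs IH]; first exact: symmetric_vacuum.
exact: symmetric_crea.
Qed.

Lemma crea_vacuum h : crea h vacuum = one_particle h.
Proof.
apply/funext => -[|y [|z s]]//=; first by rewrite mulr1 addr0.
by rewrite mulr0 add0r mulr0 add0r; elim: s => //= u s ->; rewrite mulr0 addr0.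
Qed.

Lemma nrm_one_particle (h : X -> R) : nrm (one_particle h) = one_particle h.
Proof. by apply/funext => -[|y [|z s]]; rewrite /nrm /= ?mul0r// divr1. Qed.

Lemma fock_nrm_Phi hs : (forall h, h \in hs -> h \in Lfun dxs 2%:E) -> fock (nrm (Phi hs)).
Proof. by move=> Lh; rewrite -Symn_tens; exact: fock_Symn_tens. Qed.

Lemma fock_one_particle h : h \in Lfun dxs 2%:E -> fock (one_particle h).
Proof.
move=> Lh; have -> : one_particle h = nrm (Phi [:: h]) by rewrite /= crea_vacuum nrm_one_particle.
by apply: fock_nrm_Phi => g; rewrite inE => /eqP ->.
Qed.

(** Disjointness is stated as a measurable set separating each factor from all later ones, the form
    consumed by the induction in [I_tens]. *)
Fixpoint disj (hs : seq (X -> R)) : Prop :=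
  if hs is h :: hs' then
    (exists D : set E, [/\ measurable D, forall y : X, ~ D y.1 -> h y = 0 &
       forall g, g \in hs' -> forall y : X, D y.1 -> g y = 0]) /\ disj hs'
  else True.

Lemma lives_nrm P (F : seq X -> R^o) : lives P F -> lives P (nrm F).
Proof. by move=> lF s ns; rewrite /nrm lF// mul0r. Qed.

(** The first factor lives over D and the others over its complement, so the vector is their [od]
    product and [multI_od] splits off one factor. *)
Lemma I_tens hs : (forall h, h \in hs -> h \in Lfun dxs 2%:E) -> disj hs ->
  I (Symn (tens hs)) = (fun w => \prod_(h <- hs) I (one_particle h) w) %[ae mu].
Proof.
rewrite Symn_tens; elim: hs => [_ _|h hs IH Lh [[D [mD hD gD]] dhs]].
  have b0 : forall phi : E -> R, phi \in [::] -> bddE phi by [].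
  have h0 := multI_bdd sigma_moments I_unitary b0; rewrite /multI in h0.
  by apply: (aeS h0) => w e _; have := e Logic.I; rewrite !big_nil.
have Lhs g : g \in hs -> g \in Lfun dxs 2%:E by move=> gh; apply: Lh; rewrite inE gh orbT.
have {}IH := IH Lhs dhs.
have lP : lives (predC (inD D)) (Phi hs).
  elim: (hs) gD => [_|g gs IHg gD]; first exact: lives_vacuum.
  apply: lives_crea.
    by move=> y /=; rewrite negbK /inD inE => Dy; apply: gD => //; rewrite inE eqxx.
  by apply: IHg => k kg; apply: gD; rewrite inE kg orbT.
have PE : nrm (Phi (h :: hs)) = od (inD D) (one_particle h) (nrm (Phi hs)).
  rewrite -nrm_one_particle od_nrm -crea_vacuum; congr nrm; apply/funext => s /=.
  rewrite -crea_ot ?ot_vacuuml// => y; rewrite /inD notin_setE; exact: hD.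
have Lh1 : h \in Lfun dxs 2%:E by apply: Lh; rewrite inE eqxx.
have m2 : multI2 mu I (inD D) (one_particle h) (nrm (Phi hs)).
  apply: (multI_od sigma_moments I_unitary mD).
  - by rewrite -crea_vacuum; apply: symmetric_crea; exact: symmetric_vacuum.
  - exact: fock_one_particle.
  - rewrite -crea_vacuum; apply: lives_crea; last exact: lives_vacuum.
    by move=> y; rewrite /inD notin_setE; exact: hD.
  - apply: symmetric_nrm; exact: symmetric_Phi.
  - exact: fock_nrm_Phi.
  - rewrite inD_C; exact: lives_nrm.
rewrite PE; apply: aeS2 m2 IH _ => w e1 e2 _.
by rewrite (e1 Logic.I) (e2 Logic.I) big_cons.
Qed.

Lemma disj_iota (hk : nat -> X -> R) (D : nat -> set E) m n :
  (forall i, (i < m + n)%N -> measurable (D i)) ->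
  (forall i y, ~ D i y.1 -> hk i y = 0) ->
  (forall i j, (i < j < m + n)%N -> D i `&` D j = set0) ->
  disj [seq hk i | i <- iota m n].
Proof.
elim: n m => [//|n IH] m mD zD dD /=; split; last first.
  by apply: IH => //; rewrite addSnnS.
exists (D m); split => //; first by apply: mD; rewrite addnS ltnS leq_addr.
  by move=> y; exact: zD.
move=> _ /mapP[j + ->] y Dy; rewrite mem_iota => /andP[mj jn]; apply: zD => Djy.
have : (D m `&` D j) y.1 by split.
by rewrite dD// mj/= -addSnnS.
Qed.

End disjoint_products.

(** * Existence of the multiple integral *)

Section multiple_integrals.
Context (R : realType) (d : nat) (sigma : R.-pker (d.-tuple R) ~> R).
Hypothesis sigma_moments : moment_bound sigma.
Variables (q : nat -> d.-tuple R -> {poly R}) (a b : nat -> d.-tuple R -> R).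
Hypothesis q_orthogonal : monic_orthogonal sigma q a b.
Variable rho : nat -> {sigma_finite_measure set (d.-tuple R) -> \bar R}.
Hypothesis rhoE : rho_spec sigma q rho.
Hypothesis a_bounded : forall (n : nat) (L : set (d.-tuple R)), (0 < n)%N ->
  bounded_borel L -> exists C : R, forall x, L x -> a n x <= C.
Local Notation E := (d.-tuple R).
Local Notation X := (d.-tuple R * R)%type.
Local Notation dxs := (dx_sigma sigma).
Local Notation fock := (fock sigma).
Variables (mu : probability (DprimeType R d) R).
Variable I : (seq X -> R^o) -> Dprime R d -> R^o.
Hypothesis I_unitary : fock_unitary sigma mu I.

(** The density of rho_k is locally bounded by [qnorm_bounded], and a bounded set has finite
    Lebesgue measure. *)
Lemma rho_bounded_lty k (D : set E) : bounded_borel D -> (rho k D < +oo)%E.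
Proof.
move=> bD; have /bounded_borelP[mD [M DM]] := bD.
have [C hC] := qnorm_bounded sigma_moments q_orthogonal k a_bounded bD.
have -> : rho k D = (\int[rho k]_x (\1_D x)%:E)%E by rewrite integral_indic// setIT.
rewrite (integral_rho sigma_moments q_orthogonal k rhoE); last 2 first.
- by apply/measurable_EFinP; exact: measurable_indic.
- by move=> x; rewrite lee_fin.
apply: (@le_lt_trans _ _ (\int[leb R d]_x (`|C|%:E * (\1_(box M) x)%:E))%E).
  apply: ge0_le_integral => //.
  - by move=> x _; rewrite mule_ge0 ?lee_fin// (qnorm_ge0 sigma).
  - apply: emeasurable_funM; first by apply/measurable_EFinP; exact: measurable_indic.
    by apply/measurable_EFinP; exact: (measurable_qnorm sigma_moments q_orthogonal).
  - apply: emeasurable_funM => //; apply/measurable_EFinP; apply: measurable_indic; exact: measurable_box.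
  move=> x _; rewrite -!EFinM lee_fin !indicE; have [|xD] := boolP (x \in D).
    rewrite inE => Dx; rewrite (mem_set (DM x Dx)) mul1r mulr1.
    exact: le_trans (hC x Dx) (ler_norm C).
  by rewrite mul0r mulr_ge0.
rewrite ge0_integralZl_EFin//; last first.
  by apply/measurable_EFinP; apply: measurable_indic; exact: measurable_box.
rewrite integral_indic ?setIT//; last exact: measurable_box.
by rewrite lte_mul_pinfty ?lee_fin// leb_box_lty.
Qed.

Lemma Lfun2_indic k (D : set E) : bounded_borel D -> \1_D \in Lfun (rho k) 2%:E.
Proof.
move=> bD; have mD := bD.1; apply/Lfun2P; split; first exact: measurable_indic.
rewrite (_ : sqint _ _ = rho k D); first exact: rho_bounded_lty.
rewrite /sqint -[in RHS](setIT D) -integral_indic//; apply: eq_integral => x _.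
by rewrite indicE; case: (_ \in _); rewrite ?expr1n ?expr0n.
Qed.

Definition Wint (al : multiindex) (g : seq E -> R^o) : Dprime R d -> R^o :=
  I (Sym_comp (J_op q (fun _ => g)) al).

Lemma Wint_fock al g : Gcomp rho al g -> fock (Sym_comp (J_op q (fun _ => g)) al).
Proof.
move=> Gg.
by have [] := @Sym_comp_fock _ _ _ sigma_moments _ _ _ q_orthogonal _ rhoE (fun _ => g) al Gg.
Qed.

Lemma Wint_sqint al g : Gcomp rho al g -> sqint mu (Wint al g) = Gcomp_sqnorm rho al g.
Proof.
move=> Gg; rewrite (I_sqint I_unitary (Wint_fock Gg)).
by have [] := @Sym_comp_fock _ _ _ sigma_moments _ _ _ q_orthogonal _ rhoE (fun _ => g) al Gg.
Qed.

Lemma Wint_simple al (D : nat -> set E) :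
  (forall i, (i < deg al)%N -> bounded_borel (D i)) ->
  (forall i j, (i < j < deg al)%N -> D i `&` D j = set0) ->
  Wint al (simple_vector al D) = (fun w => \prod_(i < deg al) Zint q I (block al i) (D i) w) %[ae mu].
Proof.
move=> bD dD; set n := deg al.
(* Only the first |alpha| sets are assumed bounded and disjoint; the empty set at the other indices
   makes every index admissible. *)
pose D' i := if (i < n)%N then D i else set0.
have bD' i : bounded_borel (D' i).
  rewrite /D'; case: ifP => [/bD//|_]; split => //; by exists 0.
pose hk i : X -> R := fun y => \1_(D' i) y.1 * (q (block al i) y.1).[y.2].
pose hs := [seq hk i | i <- iota 0 n].
have Lh h : h \in hs -> h \in Lfun dxs 2%:E.
  move=> /mapP[i _ ->]; apply: (@Lfun2_qfun _ _ _ sigma_moments _ _ _ q_orthogonal _ rhoE (\1_(D' i), block al i)).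
  exact: Lfun2_indic.
have dh : disj hs.
  apply: (disj_iota (D := D')) => [i _|i y nD|i j /andP[ij jn]].
  - by have [] := bD' i.
  - by rewrite /hk indicE memNset// mul0r.
  by rewrite /D' (ltn_trans ij jn) jn dD// ij.
have h := I_tens sigma_moments I_unitary Lh dh.
have WE : Wint al (simple_vector al D) = I (Symn (tens hs)).
  rewrite /Wint /simple_vector (Sym_comp_block_sym q).
  have szh : size hs = n by rewrite size_map size_iota.
  rewrite (@Symn_in_degree _ _ n (tens hs)); last by move=> s sn; rewrite tens_size// szh.
  congr I; apply: in_degree_eq; rewrite !component_Symn; congr sym_tuple.
  pose us := [tuple hk i | i < n].
  have -> : hs = us :> seq _.
    by rewrite /hs -val_enum_ord -map_comp.
  rewrite component_Jop component_tens; apply/funext => t; rewrite /JT.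
  under [RHS]eq_bigr do rewrite tnth_mktuple.
  rewrite big_split/=; congr (_ * _).
  rewrite /component; have x0 : E := point.
  transitivity (\prod_(i < size (tmap1 t)) \1_(D i) (nth x0 (tmap1 t) i) : R).
    by apply: eq_bigr => i _; rewrite (tnth_nth x0).
  rewrite size_tuple; apply: eq_bigr => i _.
  rewrite -tnth_nth tnth_map /D'.
  by rewrite (_ : (i < n)%N)//; exact: ltn_ord.
rewrite WE; apply: (aeS h) => w e _; rewrite (e Logic.I) big_map.
rewrite -{1}[n]subn0 -/(index_iota 0 n) big_mkord.
by apply: eq_bigr => i _; rewrite /Zint /hk /D' ltn_ord.
Qed.

Lemma multiple_integral_Wint al : multiple_integral q rho mu I al (Wint al).
Proof.
split.
- by move=> g Gg; exact: (I_Lfun I_unitary (Wint_fock Gg)).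
- move=> c g h Gg Gh.
  have := I_lin I_unitary c (Wint_fock Gg) (Wint_fock Gh).
  by rewrite -(Sym_comp_lin q c (fun _ => g) (fun _ => h) al).
- by exists 1 => g Gg; rewrite mul1e Wint_sqint.
- exact: Wint_simple.
Qed.

End multiple_integrals.

(** * Uniqueness of the multiple integral *)

Section dominated_convergence_L2.
Context dT (T : measurableType dT) (R : realType) (mu : {measure set T -> \bar R}).

Lemma sqint_dominated (f_ : nat -> T -> R) (f g : T -> R) :
  (forall j, measurable_fun setT (f_ j)) -> measurable_fun setT f -> g \in Lfun mu 2%:E ->
  (forall j x, `|f_ j x| <= g x) -> (forall x, `|f x| <= g x) ->
  (\forall x \ae mu, f_ ^~ x @ \oo --> f x) ->
  forall e : R, 0 < e -> exists j, (sqint mu (fun x => f x - f_ j x)%R < e%:E)%E.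
Proof.
move=> mf_ mf Lg hf_ hf fc e e0; have mg := Lfun2_measurable Lg.
have Lg2 : (fun x => 2 * g x) \in Lfun mu 2%:E.
  exact: Lfun2Z.
have mD j : measurable_fun setT (fun x => f x - f_ j x) by exact: measurable_funB.
have [] := @dominated_convergence _ _ _ mu setT measurableT
  (fun j x => ((f x - f_ j x) ^+ 2)%:E) (fun=> 0%E) (fun x => ((2 * g x) ^+ 2)%:E).
- by move=> j; exact: measurable_sqr.
- exact: measurable_cst.
- apply: filterS fc => x fx _; apply: cvg_EFin; first by apply: nearW.
  have h : (fun j => f x - f_ j x) @ \oo --> (0 : R).
    by rewrite -(subrr (f x)); apply: cvgB => //; exact: cvg_cst.
  rewrite [X in _ --> X](_ : _ = 0 * 0 :> R); last by rewrite mulr0.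
  by under eq_fun do rewrite /= expr2; exact: cvgM.
- exact: Lfun2_integrable_sqr.
- apply: aeW => x j _; rewrite lee_fin ger0_norm ?sqr_ge0//.
  rewrite -[leLHS]real_normK ?num_real//; apply: lerXn2r; rewrite ?nnegrE//.
    by rewrite mulr_ge0// (le_trans _ (hf x)).
  by rewrite (le_trans (ler_normB _ _))// mulr2n mulrDl !mul1r lerD.
move=> _ _; rewrite integral0 => /fine_cvgP[fin /cvgrPdist_lt/(_ e e0)[j0 _ hj]].
have [j1 _ fin1] := fin; pose j := maxn j0 j1.
exists j; have := hj j (leq_maxl _ _); rewrite /= sub0r normrN => h.
have fj : sqint mu (fun x => f x - f_ j x)%R \is a fin_num := fin1 j (leq_maxr _ _).
rewrite -(fineK fj) lte_fin; exact: le_lt_trans (ler_norm _) h.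
Qed.

Lemma Lfun2_le (f g : T -> R) : measurable_fun setT f -> g \in Lfun mu 2%:E ->
  (forall x, `|f x| <= g x) -> f \in Lfun mu 2%:E.
Proof.
move=> mf /Lfun2P[mg goo] fg; apply/Lfun2P; split=> //; apply: le_lt_trans goo.
by apply: le_sqint => // x; apply: le_trans (fg x) (ler_norm _).
Qed.

End dominated_convergence_L2.

Section separating_sets.
Context (R : realType) (d : nat).
Local Notation E := (d.-tuple R).

(* countably many half-spaces separating the points of R^d *)
Definition sep_set (k : nat) : set E :=
  if @choice.unpickle ('I_d * rat)%type k is Some (i, r) then [set x | tnth x i < ratr r] else set0.

Lemma measurable_sep_set k : measurable (sep_set k).
Proof.
rewrite /sep_set; case: choice.unpickle => [[i r]|//].
rewrite (_ : [set x | _] = (@tnth d R ^~ i) @^-1` `]-oo, (ratr r)[%classic).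
  by rewrite -[X in measurable X]setTI; apply: measurable_tnth => //; exact: measurable_itv.
by apply/seteqP; split=> x /=; rewrite in_itv.
Qed.

(** The values index a finite measurable partition of R^d, the common refinement of the first N
    half-spaces, which gets finer as N grows. *)
Definition cell N (x : E) : {ffun 'I_N -> bool} := [ffun k : 'I_N => x \in sep_set k].

Lemma measurable_cell N (c : {ffun 'I_N -> bool}) : measurable [set x | cell N x = c].
Proof.
rewrite (_ : [set x | _] = \bigcap_(k in [set: 'I_N]) [set x | (x \in sep_set k) = c k]); last first.
  apply/seteqP; split=> x /=; first by move=> <- k _; rewrite /= ffunE.
  by move=> h; apply/ffunP => k; rewrite ffunE; exact: h.
apply: fin_bigcap_measurable => // k _; case: (c k).
  rewrite (_ : [set x | _] = sep_set k); first exact: measurable_sep_set.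
  by apply/seteqP; split=> x /=; [move/set_mem|move/mem_set].
rewrite (_ : [set x | _] = ~` sep_set k); first by apply: measurableC; exact: measurable_sep_set.
by apply/seteqP; split=> x /= => [/negbT|nx]; [rewrite notin_setE|apply/negbTE; rewrite notin_setE].
Qed.

Lemma cell_neq (x y : E) : x != y -> exists N0, forall N, (N0 <= N)%N -> cell N x != cell N y.
Proof.
move=> xy; have [i xyi] : exists i, tnth x i != tnth y i.
  apply: contrapT => /forallNP h; case/eqP: xy; apply: eq_from_tnth => i.
  by apply/eqP; have /negP := h i; rewrite negbK.
have [k hk] : exists k, (x \in sep_set k) != (y \in sep_set k).
  have key (u v : E) : tnth u i < tnth v i -> exists k, (u \in sep_set k) != (v \in sep_set k).
    move=> /rat_in_itvoo[r]; rewrite in_itv/= => /andP[ur rv].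
    exists (choice.pickle (i, r)); rewrite /sep_set choice.pickleK mem_set//= memNset//=.
    by apply/negP; rewrite -leNgt ltW.
  have [xy0|yx0|exy] := ltgtP (tnth x i) (tnth y i); first exact: key.
    by have [k hk] := key _ _ yx0; exists k; rewrite eq_sym.
  by rewrite exy eqxx in xyi.
exists k.+1 => N kN; apply: contraNneq hk => h.
by have := congr1 (fun f : {ffun 'I_N -> bool} => f (Ordinal kN)) h; rewrite !ffunE /= => ->.
Qed.

(** Each of the finitely many pairs of distinct points is separated from some level on; the maximum
    of these levels serves all pairs. *)
Lemma cell_inj n (t : n.-tuple E) : uniq t ->
  exists N0, forall N, (N0 <= N)%N -> injectiveb [ffun i => cell N (tnth t i)].
Proof.
move=> /tuple_uniqP ut.
have h (ij : 'I_n * 'I_n) : exists N0, ij.1 != ij.2 ->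
    forall N, (N0 <= N)%N -> cell N (tnth t ij.1) != cell N (tnth t ij.2).
  have [e|ne] := eqVneq ij.1 ij.2; first by exists 0%N.
  have [|N0 hN] := @cell_neq (tnth t ij.1) (tnth t ij.2).
    by apply: contraNneq ne => /ut ->.
  by exists N0.
have [f hf] := choice h; exists (\max_ij f ij)%N => N hN.
apply/injectiveP => i j; rewrite !ffunE => e; apply/eqP; apply: contraT => ij.
have := hf (i, j) ij N (leq_trans (leq_bigmax (F := f) (i, j)) hN).
by rewrite /= e eqxx.
Qed.

End separating_sets.

Section diagonals.
Context (R : realType) (d : nat).
Local Notation E := (d.-tuple R).
Local Open Scope ereal_scope.

Lemma measurable_point (x : E) : measurable [set x].
Proof.
rewrite (_ : [set x] = rect (fun i => [set tnth x i])).
  by apply: measurable_rect => i; exact: measurable_set1.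
by apply/seteqP; split=> y /= => [-> i//|h]; apply: eq_from_tnth => i; exact: h.
Qed.

Lemma measurable_not_uniq n : measurable [set t : n.-tuple E | ~~ uniq t].
Proof.
rewrite (_ : [set t | _] = \bigcup_(ij in [set ij : 'I_n * 'I_n | ij.1 != ij.2])
   \bigcap_(k in [set: 'I_d]) [set t : n.-tuple E | tnth (tnth t ij.1) k = tnth (tnth t ij.2) k]); last first.
  apply/seteqP; split=> t /=.
    move=> nu; apply: contrapT => h; case/negP: nu; apply/tuple_uniqP => i j tij.
    apply/eqP; apply: contraT => ij; exfalso; apply: h; exists (i, j) => // k _ /=.
    by rewrite tij.
  move=> [[i j] /= ij h]; apply/negP => /tuple_uniqP ut; case/eqP: ij; apply: ut.
  by apply: eq_from_tnth => k; exact: h.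
apply: fin_bigcup_measurable => // -[i j] _; apply: fin_bigcap_measurable => // k _.
rewrite (_ : [set t | _] = (fun t : n.-tuple E => (tnth (tnth t i) k - tnth (tnth t j) k)%R) @^-1` [set 0%R]).
  rewrite -[X in measurable X]setTI.
  have m l : measurable_fun setT (fun t : n.-tuple E => tnth (tnth t l) k).
    exact: measurableT_comp (measurable_tnth k) (measurable_tnth l).
  by apply: (measurable_funB (m i) (m j)) => //; exact: measurable_set1.
by apply/seteqP; split=> t /= => [->|/eqP]; [rewrite subrr|rewrite subr_eq0 => /eqP].
Qed.

(** With the first point y fixed, either two of the others coincide, which is null by induction, or
    one of them equals y, which is null because points are. *)
Lemma tuple_prod_not_uniq n (m : nat -> {sigma_finite_measure set E -> \bar R}) :
  (forall i x, m i [set x] = 0) -> tuple_prod n m [set t : n.-tuple E | ~~ uniq t] = 0.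
Proof.
elim: n m => [|n IH] m m0.
  rewrite (_ : [set t : 0.-tuple E | _] = set0) ?measure0//.
  by apply/seteqP; split=> t //=; rewrite (tuple0 t).
rewrite /= /tuple_prod_step /pushforward /product_measure1.
apply: integral0_eq => y _ /=.
have mS : forall i x, (m \o S) i [set x] = 0 by move=> i x; exact: m0.
pose B (i : nat) : set (n.-tuple E) := rect (fun j : 'I_n => if val j == i then [set y] else setT).
have mB i : measurable (B i).
  by apply: measurable_rect => j; case: ifP => // _; exact: measurable_point.
have B0 i : (i < n)%N -> tuple_prod n (m \o S) (B i) = 0.
  move=> ni.
  rewrite tuple_prod_rect; last by move=> j; case: ifP => // _; exact: measurable_point.
  by rewrite (bigD1 (Ordinal ni))//= eqxx (m0 i.+1) mul0e.
have mx : measurable (xsection (@tuple_cons _ E n @^-1` [set t : n.+1.-tuple E | ~~ uniq t]) y).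
  apply: measurable_xsection; rewrite -[X in measurable X]setTI.
  exact: (measurable_tuple_cons measurableT (@measurable_not_uniq n.+1)).
pose C i := if (i < n)%N then B i else set0.
have C0 i : (tuple_prod n (m \o S)).-negligible (C i).
  rewrite /C; case: ifP => ni; last exact: negligible_set0.
  by exists (B i); split; [exact: mB|exact: B0|].
apply/(negligibleP _ mx).
apply: (negligibleS (A := [set t : n.-tuple E | ~~ uniq t] `|` \bigcup_i C i)); last first.
  apply: negligibleU; last exact: negligible_bigcup.
  by apply/negligibleP; [exact: measurable_not_uniq|exact: IH].
move=> t; rewrite /xsection/= inE/= negb_and negbK => /orP[yt|]; last by left.
right; have /tnthP[i yi] := yt; exists i => //; rewrite /C ltn_ord => j.
by case: eqP => [/val_inj ->|].
Qed.

End diagonals.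

(** * Density of products of indicators over disjoint bounded sets *)

Section density_of_products.
Context (R : realType) (d : nat).
Local Notation E := (d.-tuple R).
Variables (n : nat) (m : nat -> {sigma_finite_measure set E -> \bar R}).
Hypothesis m_fin : forall i D, bounded_borel D -> (m i D < +oo)%E.
Hypothesis m_point : forall i x, m i [set x] = 0%E.
Local Notation pi := (tuple_prod n m).
Variable Z : (n.-tuple E -> R) -> Prop.
Hypothesis Zlin : forall c f g, f \in Lfun pi 2%:E -> g \in Lfun pi 2%:E -> Z f -> Z g ->
  Z (fun t => c * f t + g t).
Hypothesis Zlim : forall f, f \in Lfun pi 2%:E ->
  (forall e : R, 0 < e -> exists g, [/\ g \in Lfun pi 2%:E, Z g &
     (sqint pi (fun t => f t - g t)%R < e%:E)%E]) -> Z f.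
Hypothesis Zprod : forall D : 'I_n -> set E, (forall i, bounded_borel (D i)) ->
  (forall i j, i != j -> D i `&` D j = set0) -> Z (fun t => \prod_(i < n) \1_(D i) (tnth t i)).

Let ZL f := f \in Lfun pi 2%:E /\ Z f.

Lemma Lfun2_prod_indic (D : 'I_n -> set E) : (forall i, bounded_borel (D i)) ->
  (fun t => \prod_(i < n) \1_(D i) (tnth t i)) \in Lfun pi 2%:E.
Proof.
move=> bD; apply: (@Lfun2_prod _ _ _ n m (fun i => \1_(D i) : E -> R)) => i.
have mD := (bD i).1; apply/Lfun2P; split; first exact: measurable_indic.
rewrite (_ : sqint _ _ = m i (D i)); first exact: m_fin.
rewrite /sqint -[in RHS](setIT (D i)) -integral_indic//; apply: eq_integral => x _.
by rewrite indicE; case: (_ \in _); rewrite ?expr1n ?expr0n.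
Qed.

Let ZL_prod D : (forall i, bounded_borel (D i)) ->
  (forall i j, i != j -> D i `&` D j = set0) -> ZL (fun t => \prod_(i < n) \1_(D i) (tnth t i)).
Proof. by move=> bD dD; split; [exact: Lfun2_prod_indic|exact: Zprod]. Qed.

Let ZL_lin c f g : ZL f -> ZL g -> ZL (fun t => c * f t + g t).
Proof. by move=> [Lf Zf] [Lg Zg]; split; [exact: Lfun2_lin|exact: Zlin]. Qed.

Let ZL0 : ZL (fun=> 0).
Proof.
have b0 : forall i : 'I_n, bounded_borel (set0 : set E) by move=> _; split => //; exists 0.
have h := ZL_prod b0 (fun _ _ _ => setI0 _).
by have := ZL_lin (-1) h h; congr ZL; apply/funext => t; rewrite mulN1r addNr.
Qed.

Let ZL_limit (f_ : nat -> n.-tuple E -> R) (f g : n.-tuple E -> R) :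
  (forall j, ZL (f_ j)) -> measurable_fun setT f -> g \in Lfun pi 2%:E ->
  (forall j x, `|f_ j x| <= g x) -> (forall x, `|f x| <= g x) ->
  (\forall x \ae pi, (f_ ^~ x : nat -> R) @ \oo --> (f x : R)) -> ZL f.
Proof.
move=> Zf mf Lg hf_ hf fc; have Lf := Lfun2_le mf Lg hf; split=> //.
apply: Zlim => // e e0.
have [j hj] := sqint_dominated (fun j => Lfun2_measurable (Zf j).1) mf Lg hf_ hf fc e0.
by exists (f_ j); have [? ?] := Zf j; split.
Qed.

Let box_n (M : R) : set (n.-tuple E) := rect (fun=> box M).

Let mbox_n M : measurable (box_n M).
Proof. by apply: measurable_rect => i; exact: measurable_box. Qed.

Let indic_rect (A : 'I_n -> set E) (t : n.-tuple E) :
  \1_(rect A) t = \prod_(i < n) \1_(A i) (tnth t i) :> R.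
Proof.
rewrite indicE; have [|tA] := boolP (t \in rect A).
  rewrite inE => tA; rewrite big1// => i _; rewrite indicE mem_set//; exact: tA.
have [i nAi] : exists i, ~ A i (tnth t i).
  apply: contrapT => /forallNP h; move: tA; rewrite notin_setE; apply => i.
  exact: contrapT (h i).
by rewrite (bigD1 i)//= indicE memNset// mul0r.
Qed.

Let Lbox_n M : (\1_(box_n M) : n.-tuple E -> R) \in Lfun pi 2%:E.
Proof.
rewrite (_ : \1_(box_n M) = fun t => \prod_(i < n) \1_(box M) (tnth t i)); last first.
  by apply/funext => t; rewrite indic_rect.
exact: (@Lfun2_prod_indic (fun=> box M) (fun=> bounded_borel_box d M)).
Qed.

Let ZL_rect M (A : 'I_n -> set E) : (forall i, measurable (A i)) ->
  ZL (\1_(rect A `&` box_n M)).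
Proof.
move=> mA; pose B i := A i `&` box M.
have bB i : bounded_borel (B i).
  apply/bounded_borelP; split; last by exists M => x [].
  by apply: measurableI => //; exact: measurable_box.
have mB i : measurable (B i) by have [] := bB i.
have -> : rect A `&` box_n M = rect B by rewrite /box_n rectI.
have mR : measurable (rect B) by exact: measurable_rect.
(* Keeps the tuples whose points lie in pairwise different cells of level N: a finite sum over
   injective assignments of cells, equal at each point off the diagonals to the full indicator for
   large N. *)
pose u N (t : n.-tuple E) : R := \1_(rect B) t * (injectiveb [ffun i => cell N (tnth t i)])%:R.
have uE N : u N = fun t => \sum_(c : {ffun 'I_n -> {ffun 'I_N -> bool}} | injectiveb c)
    \prod_(i < n) \1_(B i `&` [set x | cell N x = c i]) (tnth t i).
  apply/funext => t; pose c0 := [ffun i => cell N (tnth t i)].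
  rewrite big_mkcond (bigD1 c0)//= [X in _ + X]big1 ?addr0; last first.
    move=> c cc0; case: ifP => // _.
    have [i ci] : exists i, c i != c0 i.
      apply: contrapT => /forallNP h; case/eqP: cc0; apply/ffunP => i.
      by apply/eqP; apply: contraT => ?; case: (h i).
    rewrite (bigD1 i)//= indicE memNset ?mul0r// => -[_ /= e].
    by case/eqP: ci; rewrite /c0 ffunE e.
  rewrite /u -/c0; case: ifP => _; last by rewrite mulr0.
  rewrite mulr1 indic_rect; apply: eq_bigr => i _; rewrite indicI/=.
  by rewrite [X in _ = _ * X]indicE mem_set ?mulr1//= /c0 ffunE.
have Zu N : ZL (u N).
  rewrite uE; elim: (index_enum _) => [|c r IH].
    by have := ZL0; congr ZL; apply/funext => t; rewrite big_nil.
  have [ic|nic] := boolP (injectiveb c); last first.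
    by move: IH; congr ZL; apply/funext => t; rewrite big_cons (negbTE nic).
  pose D i := B i `&` [set x | cell N x = c i].
  have ZD : ZL (fun t => \prod_(i < n) \1_(D i) (tnth t i)).
    apply: ZL_prod => [i|i j ij].
      have /bounded_borelP[mBi [K BK]] := bB i; apply/bounded_borelP; split.
        by apply: measurableI => //; exact: measurable_cell.
      by exists K => x [/BK].
    apply/seteqP; split=> x //= -[[_ /= e1] [_ /= e2]].
    by move/injectiveP: ic => /(_ i j); rewrite -e1 -e2 => /(_ erefl) /eqP; rewrite (negbTE ij).
  have := ZL_lin 1 ZD IH; congr ZL; apply/funext => t.
  by rewrite mul1r big_cons ic.
apply: (@ZL_limit u _ \1_(rect B)) => //.
- rewrite (_ : \1_(rect B) = fun t => \prod_(i < n) \1_(B i) (tnth t i)); last first.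
    by apply/funext => t; rewrite indic_rect.
  exact: (@Lfun2_prod_indic B bB).
- move=> N t; rewrite /u normrM ger0_norm// ler_piMr//.
  by rewrite ger0_norm// lern1 leq_b1.
- by move=> t; rewrite ger0_norm.
exists [set t : n.-tuple E | ~~ uniq t]; split.
- exact: measurable_not_uniq.
- exact: tuple_prod_not_uniq.
move=> t /= nc; apply/negP => /cell_inj[N0 hN]; apply: nc.
rewrite (_ : \1_(rect B) t = \1_(rect B) t * 1) ?mulr1//.
apply: cvg_near_cst; exists N0 => // N /hN h /=.
by rewrite /u h mulr1.
Qed.

Let ZL_bounded M f : bounded_on (box_n M) f -> ZL f.
Proof.
apply: (@bounded_measurable_ind _ _ _ [set rect A | A in [set A : 'I_n -> set E | forall i, measurable (A i)]]).
- exact: mbox_n.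
- move=> _ _ [A mA <-] [B mB <-]; exists (fun i => A i `&` B i); last by rewrite rectI.
  by move=> i; exact: measurableI.
- by apply: tuple_measurableE => //; rewrite sigma_algebra_id//; exact: sigma_algebra_measurable.
- have := @ZL_rect M (fun=> setT) (fun=> measurableT).
  by rewrite (_ : rect _ = setT) ?setTI//; apply/seteqP; split.
- by move=> _ [A mA <-]; exact: ZL_rect.
- by move=> c u v _ _; exact: ZL_lin.
move=> f_ u K mf_ hf_ [mu [K' hu]] uc hZ.
apply: (@ZL_limit f_ u (fun t => (`|K| + `|K'|) * \1_(box_n M) t)) => //.
- exact: (Lfun2Z _ (Lbox_n M)).
- move=> j t; apply: (le_trans (hf_ j t)); rewrite ler_wpM2r//.
  by apply: le_trans (ler_norm _) _; rewrite lerDl.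
- move=> t; apply: (le_trans (hu t)); rewrite ler_wpM2r//.
  by apply: le_trans (ler_norm _) _; rewrite lerDr.
exact: aeW.
Qed.

(** Truncation to |f| <= N inside a cube of half-side N gives bounded functions of bounded support,
    which converge to f under the majorant |f|. *)
Lemma products_dense f : f \in Lfun pi 2%:E -> Z f.
Proof.
move=> Lf; have mf := Lfun2_measurable Lf.
pose S (N : nat) : set (n.-tuple E) := [set t | `|f t| <= N%:R] `&` box_n N%:R.
have mS N : measurable (S N).
  apply: measurableI; last exact: mbox_n.
  rewrite (_ : [set t | _] = (fun t => `|f t|) @^-1` `]-oo, N%:R]%classic); last first.
    by apply/seteqP; split=> t /=; rewrite in_itv.
  rewrite -[X in measurable X]setTI; apply: measurableT_comp => //; exact: measurable_itv.
suff [] : ZL f by [].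
have Lnf : (fun t => `|f t|) \in Lfun pi 2%:E.
  move/Lfun2P: Lf => [_ foo]; apply/Lfun2P; split; first exact: measurableT_comp.
  by move: foo; congr (_ < _)%E; apply: eq_integral => t _; rewrite real_normK ?num_real.
apply: (@ZL_limit (fun N t => f t * \1_(S N) t) f (fun t => `|f t|)) => //.
- move=> N; apply: (@ZL_bounded N%:R); split.
    by apply: measurable_funM => //; exact: measurable_indic.
  exists N%:R => t; rewrite normrM; have [|tS] := boolP (t \in S N).
    move=> tS; move: (tS); rewrite inE => -[/= h1 h2].
    by rewrite !indicE tS (mem_set h2) normr1 !mulr1.
  by rewrite [X in _ * `|X|]indicE (negbTE tS) normr0 mulr0 mulr_ge0.
- move=> N t; rewrite normrM ler_piMr// ger0_norm// indicE lern1 leq_b1.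
apply: aeW => t; rewrite -{2}[f t]mulr1; apply: cvg_near_cst.
pose K := `|f t| + \sum_(i < n) \sum_(k < d) `|tnth (tnth t i) k|.
have K0 : 0 <= K by rewrite addr_ge0// sumr_ge0// => i _; rewrite sumr_ge0.
near=> N; rewrite indicE mem_set//.
have KN : K <= N%:R by near: N; exact: nbhs_infty_ger.
split=> /=; first by apply: le_trans KN; rewrite /K lerDl sumr_ge0// => i _; rewrite sumr_ge0.
move=> i k; apply: le_trans KN; rewrite /K (bigD1 i)//= (bigD1 k)//=.
rewrite addrCA -!addrA lerDl !addr_ge0// ?sumr_ge0// => j _; rewrite sumr_ge0//.
Unshelve. all: by end_near.
Qed.

End density_of_products.

(** * Two multiple integrals on the same G_alpha agree *)

Section uniqueness.
Context (R : realType) (d : nat).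
Hypothesis d_gt0 : (0 < d)%N.
Variable sigma : R.-pker (d.-tuple R) ~> R.
Hypothesis sigma_moments : moment_bound sigma.
Variables (q : nat -> d.-tuple R -> {poly R}) (a b : nat -> d.-tuple R -> R).
Hypothesis q_orthogonal : monic_orthogonal sigma q a b.
Variable rho : nat -> {sigma_finite_measure set (d.-tuple R) -> \bar R}.
Hypothesis rhoE : rho_spec sigma q rho.
Hypothesis a_bounded : forall (n : nat) (L : set (d.-tuple R)), (0 < n)%N ->
  bounded_borel L -> exists C : R, forall x, L x -> a n x <= C.
Local Notation E := (d.-tuple R).
Local Notation X := (d.-tuple R * R)%type.
Variables (mu : probability (DprimeType R d) R).
Variable I : (seq X -> R^o) -> Dprime R d -> R^o.

(** Positivity of d provides a coordinate, in which a point is Lebesgue null. *)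
Lemma leb_point (x : E) : leb R d [set x] = 0%E.
Proof.
rewrite (_ : [set x] = rect (fun i => [set tnth x i])); last first.
  by apply/seteqP; split=> y /= => [-> i//|h]; apply: eq_from_tnth => i; exact: h.
rewrite /leb tuple_prod_rect; last by move=> i; exact: measurable_set1.
by rewrite (bigD1 (Ordinal d_gt0))//= /leb1 lebesgue_measure_set1 mul0e.
Qed.

Lemma rho_point k (x : E) : rho k [set x] = 0%E.
Proof.
rewrite rhoE; last exact: measurable_point.
rewrite (_ : (fun y => _) = fun y => (qnorm sigma q k y)%:E); last first.
  by apply/funext => y; rewrite (qnormE sigma_moments).
apply: null_set_integral; [exact: measurable_point| |exact: leb_point].
apply: measurable_funTS; apply/measurable_EFinP.
exact: (measurable_qnorm sigma_moments q_orthogonal).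
Qed.

Variable al : multiindex.
Local Notation n := (deg al).
Local Notation pi := (rho_prod rho al).
Local Notation Gcomp := (Gcomp rho al).
Local Notation Gcomp_sqnorm := (Gcomp_sqnorm rho al).
Local Notation multiple_integral W := (multiple_integral q rho mu I al W).

Definition ext m (phi : m.-tuple E -> R) : seq E -> R^o :=
  fun s => if insub s is Some t then phi t else 0.

Lemma component_ext m (phi : m.-tuple E -> R) : component m (ext phi) = phi.
Proof. by apply/funext => t; rewrite /component /ext valK. Qed.

Lemma ext_lin m c (phi psi : m.-tuple E -> R) :
  ext (fun t => c * phi t + psi t) = c *: ext phi + ext psi.
Proof.
apply/funext => s; transitivity (c * ext phi s + ext psi s : R) => //.
by rewrite /ext; case: insubP => //; rewrite mulr0 addr0.
Qed.

Lemma block_sym_lin c (g h : seq E -> R^o) :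
  block_sym al (c *: g + h) = c *: block_sym al g + block_sym al h.
Proof.
apply/funext => s; transitivity (c * block_sym al g s + block_sym al h s : R) => //.
rewrite /block_sym [c * _]mulrCA -mulrDr; congr (_ * _).
by rewrite mulr_sumr -big_split.
Qed.

Local Notation bs phi := (block_sym al (ext phi)).

Lemma Gcomp_bs phi : phi \in Lfun pi 2%:E -> Gcomp (bs phi).
Proof. by move=> Lphi; apply: Gcomp_block_sym; rewrite component_ext. Qed.

Lemma Gcomp_sqnorm_bs phi : measurable_fun setT phi ->
  (Gcomp_sqnorm (bs phi) <= (fact_index al)%:R%:E * sqint pi phi)%E.
Proof.
move=> mphi; apply: lee_wpmul2l; first by rewrite lee_fin.
by rewrite component_block_sym component_ext; exact: sqint_bsym_le.
Qed.

Lemma multiple_integral_dist W : multiple_integral W -> exists2 C : R, 0 <= C &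
  forall g h, Gcomp g -> Gcomp h ->
    (sqint mu (fun w => W g w - W h w)%R <= C%:E * Gcomp_sqnorm (g - h)%R)%E.
Proof.
move=> [LW linW [C hC] _]; exists `|C| => // g h Gg Gh.
have Ggh : Gcomp (-1 *: h + g) by exact: (dom_lin (sqnormed_Gcomp rho al)).
have -> : g - h = -1 *: h + g by rewrite scaleN1r addrC.
apply: (@le_trans _ _ (sqint mu (W (-1 *: h + g)))).
  rewrite le_eqVlt; apply/orP; left; apply/eqP; apply: ae_eq_sqint.
  - by apply: measurable_funB; apply: Lfun2_measurable; exact: LW.
  - by apply: Lfun2_measurable; exact: LW.
  apply: (aeS (linW (-1) h g Gh Gg)) => w e _; rewrite (e Logic.I).
  by rewrite mulN1r addrC.
apply: (le_trans (hC _ Ggh)); apply: lee_wpmul2r; last by rewrite lee_fin ler_norm.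
exact: (sqn_ge0 (sqnormed_Gcomp rho al)).
Qed.

(** Compatibility with almost everywhere equality is not part of [multiple_integral]; it follows
    from linearity and the norm bound. *)
Lemma multiple_integral_ae W g h : multiple_integral W -> Gcomp g -> Gcomp h ->
  component n g = component n h %[ae pi] -> W g = W h %[ae mu].
Proof.
move=> mW Gg Gh gh; have [C C0 hC] := multiple_integral_dist mW.
have [LW _ _ _] := mW; apply: sqintB_eq0.
- by apply: Lfun2_measurable; exact: LW.
- by apply: Lfun2_measurable; exact: LW.
apply/eqP; rewrite eq_le sqint_ge0 andbT; apply: (le_trans (hC _ _ Gg Gh)).
rewrite (_ : Gcomp_sqnorm _ = 0%E) ?mule0//.
have mg := Lfun2_measurable Gg.1; have mh := Lfun2_measurable Gh.1.
rewrite /Gcomp_sqnorm (_ : sqint _ _ = 0%E) ?mule0//.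
rewrite (@ae_eq_sqint _ _ _ _ _ (fun=> 0)) //.
- by rewrite /sqint integral0_eq// => t _; rewrite expr0n.
- exact: (measurable_funB mg mh).
apply: filterS gh => t e _; apply/eqP; rewrite -[_ == _]/(g t - h t == 0) subr_eq0.
by apply/eqP; exact: e.
Qed.

Lemma component_prod_in_tuple (D : nat -> set E) m (t : m.-tuple E) :
  component m (fun s : seq E => \prod_(i < size s) \1_(D i) (tnth (in_tuple s) i) : R^o) t =
  \prod_(i < m) \1_(D i) (tnth t i) :> R.
Proof.
rewrite /component; have x0 : E := point.
transitivity (\prod_(i < size t) \1_(D i) (nth x0 t i) : R).
  by apply: eq_bigr => i _; rewrite (tnth_nth x0).
by rewrite size_tuple; apply: eq_bigr => i _; rewrite (tnth_nth x0).
Qed.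

(** Both integrals are precomposed with block symmetrization, so they can be compared on all of L^2
    by [products_dense]; the agreement is linear, closed, and given on products over disjoint
    sets. *)
Lemma multiple_integral_uniq W W' g : multiple_integral W -> multiple_integral W' ->
  Gcomp g -> W g = W' g %[ae mu].
Proof.
move=> mW mW' Gg.
pose Z (phi : n.-tuple E -> R) : Prop := W (bs phi) = W' (bs phi) %[ae mu].
have [LW linW _ sW] := mW; have [LW' linW' _ sW'] := mW'.
suff Zall phi : phi \in Lfun pi 2%:E -> Z phi.
  have Lg := Gg.1; have Gbs := Gcomp_bs Lg.
  have gbs : component n g = component n (bs (component n g)) %[ae pi].
    move: Gg.2; rewrite !component_block_sym component_ext.
    by apply: filterS => t e _; rewrite e.
  have h1 := multiple_integral_ae mW Gg Gbs gbs.
  have h2 := multiple_integral_ae mW' Gg Gbs gbs.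
  have h3 : \forall w \ae mu, W (bs (component n g)) w = W' (bs (component n g)) w.
    by apply: (aeS (Zall _ Lg)) => w; exact.
  apply: (aeS4 h1 h2 h3 h3) => w e1 e2 e3 _ _.
  by rewrite (e1 Logic.I) (e2 Logic.I) e3.
have bs_lin c (f h : n.-tuple E -> R) : bs (fun t => c * f t + h t) = c *: bs f + bs h.
  by rewrite ext_lin block_sym_lin.
apply: (@products_dense _ _ n (fun j => rho (block al j))).
- by move=> i D; exact: (rho_bounded_lty sigma_moments q_orthogonal rhoE a_bounded).
- by move=> i x; exact: rho_point.
- move=> c f h Lf Lh Zf Zh; rewrite /Z bs_lin.
  have k := linW c _ _ (Gcomp_bs Lf) (Gcomp_bs Lh).
  have k' := linW' c _ _ (Gcomp_bs Lf) (Gcomp_bs Lh).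
  apply: (aeS4 Zf Zh k k') => w e1 e2 e3 e4 _.
  by rewrite (e3 Logic.I) (e4 Logic.I) (e1 Logic.I) (e2 Logic.I).
- move=> f Lf hf; have [C C0 hC] := multiple_integral_dist mW.
  have [C' C'0 hC'] := multiple_integral_dist mW'.
  have G0 := Gcomp_bs Lf.
  (* Closedness of the agreement under L^2 limits is [mul_limit] with the constant factor 1. *)
  have u1 : W (bs f) = (fun w => W' (bs f) w * 1) %[ae mu].
    apply: (@mul_limit _ _ _ mu (W (bs f)) (W' (bs f)) (fun=> 1)) => //.
    - exact: LW.
    - exact: LW'.
    move=> e e0; pose K := (C + C') * (fact_index al)%:R.
    have [e' e'0 he'] := @small_mul R K%:E e (ltac:(by rewrite lee_fin mulr_ge0// addr_ge0)) (ltry _) e0.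
    have [h [Lh Zh fh]] := hf e' e'0; have Gh := Gcomp_bs Lh.
    exists (W (bs h)), (W' (bs h)).
    have mfh : measurable_fun setT (fun t => f t - h t).
      exact: (measurable_funB (Lfun2_measurable Lf) (Lfun2_measurable Lh)).
    have key (B : R) (V : (seq E -> R^o) -> Dprime R d -> R^o) : 0 <= B -> B <= C + C' ->
        (sqint mu (fun w => V (bs f) w - V (bs h) w)%R <= B%:E * Gcomp_sqnorm (bs f - bs h)%R)%E ->
        (sqint mu (fun w => V (bs f) w - V (bs h) w)%R < e%:E)%E.
      move=> B0 BC hB; apply: (le_lt_trans hB).
      have -> : bs f - bs h = bs (fun t => f t - h t).
        have -> : (fun t => f t - h t) = (fun t => -1 * h t + f t).
          by apply/funext => t; rewrite mulN1r addrC.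
        by rewrite bs_lin scaleN1r addrC.
      apply: (@le_lt_trans _ _ (sqint pi (fun t => f t - h t)%R * K%:E)%E); last first.
        by apply: he'; [exact: sqint_ge0|exact: fh].
      apply: (@le_trans _ _ (B%:E * ((fact_index al)%:R%:E * sqint pi (fun t => f t - h t)%R))%E).
        by apply: lee_wpmul2l; rewrite ?lee_fin//; exact: Gcomp_sqnorm_bs.
      rewrite muleA -EFinM muleC; apply: lee_wpmul2l; first exact: sqint_ge0.
      by rewrite lee_fin /K ler_wpM2r.
    split.
    - exact: LW.
    - exact: LW'.
    - by apply: (aeS Zh) => w k _; rewrite mulr1 (k Logic.I).
    - by apply: (key C W C0); [rewrite lerDl|exact: hC].
    - by apply: (key C' W' C'0); [rewrite lerDr|exact: hC'].
  by apply: (aeS u1) => w k _; rewrite (k Logic.I) mulr1.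
(* [products_dense] indexes the sets by positions, [multiple_integral] by natural numbers; the
   missing indices receive the empty set. *)
move=> D bD dD; pose D' i := if insub i is Some j then D j else set0 : set E.
have D'E (i : 'I_n) : D' i = D i by rewrite /D' valK.
pose s0 : seq E -> R^o := fun s => \prod_(i < size s) \1_(D' i) (tnth (in_tuple s) i).
pose f0 (t : n.-tuple E) : R := \prod_(i < n) \1_(D i) (tnth t i).
have c0 : component n s0 = f0.
  apply/funext => t; rewrite /s0 component_prod_in_tuple.
  by apply: eq_bigr => i _; rewrite D'E.
have Lf0 : f0 \in Lfun pi 2%:E.
  apply: (@Lfun2_prod_indic _ _ n (fun j => rho (block al j))) => // i B.
  exact: (rho_bounded_lty sigma_moments q_orthogonal rhoE a_bounded).
have Gs : Gcomp (block_sym al s0) by apply: Gcomp_block_sym; rewrite c0.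
have Gf := Gcomp_bs Lf0.
have sf : component n (bs f0) = component n (block_sym al s0) %[ae pi].
  by rewrite !component_block_sym component_ext c0; apply: aeW.
have h1 := multiple_integral_ae mW Gf Gs sf.
have h2 := multiple_integral_ae mW' Gf Gs sf.
have bD' i : (i < n)%N -> bounded_borel (D' i).
  by move=> ni; rewrite -[i]/(val (Ordinal ni)) D'E.
have dD' i j : (i < j < n)%N -> D' i `&` D' j = set0.
  move=> /andP[ij jn]; rewrite -[i]/(val (Ordinal (ltn_trans ij jn))) -[j]/(val (Ordinal jn)) !D'E.
  by apply: dD; rewrite -val_eqE /= neq_ltn ij.
have h3 := sW D' bD' dD'; have h4 := sW' D' bD' dD'.
apply: (aeS4 h1 h2 h3 h4) => w e1 e2 e3 e4 _.
by rewrite (e1 Logic.I) (e2 Logic.I) -[LHS]/(W (simple_vector al D') w) (e3 Logic.I) -(e4 Logic.I).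
Qed.

End uniqueness.

Section series.
Context (R : realType) (d : nat) (sigma : R.-pker (d.-tuple R) ~> R).
Local Notation X := (d.-tuple R * R)%type.
Local Notation fock := (fock sigma).
Variables (mu : probability (DprimeType R d) R).
Variable I : (seq X -> R^o) -> Dprime R d -> R^o.
Hypothesis I_unitary : fock_unitary sigma mu I.

Lemma I_sum (K : Type) (r : seq K) (F : K -> seq X -> R^o) (G : K -> Dprime R d -> R^o) :
  (forall k, fock (F k)) -> (forall k, G k = I (F k) %[ae mu]) ->
  \sum_(k <- r) G k = I (\sum_(k <- r) F k) %[ae mu].
Proof.
move=> fF GF; elim: r => [|k r IH].
  have f0 : fock 0 by exact: (dom0 (sqnormed_fock sigma)).
  rewrite !big_nil; have := I_lin I_unitary (-1) f0 f0; rewrite scaler0 addr0 => h.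
  by apply: (aeS h) => w e _; rewrite (e Logic.I) mulN1r addNr.
have fr : fock (\sum_(k <- r) F k) by exact: (dom_sum (sqnormed_fock sigma)).
have h := I_lin I_unitary 1 (fF k) fr; rewrite scale1r in h.
rewrite !big_cons; apply: (aeS4 h IH (GF k) h) => w e1 e2 e3 _ _.
rewrite (e1 Logic.I) mul1r -(e3 Logic.I) -(e2 Logic.I); by [].
Qed.

End series.

Theorem theorem5p1 (R : realType) (d : nat) (d_gt0 : (0 < d)%N)
  (sigma : R.-pker (d.-tuple R) ~> R)
  (sigma_moments : moment_bound sigma)
  (q : nat -> d.-tuple R -> {poly R}) (a b : nat -> d.-tuple R -> R)
  (q_orthogonal : monic_orthogonal sigma q a b)
  (rho : nat -> {sigma_finite_measure set (d.-tuple R) -> \bar R})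
  (rhoE : rho_spec sigma q rho)
  (mu : probability (DprimeType R d) R)
  (I : (seq (d.-tuple R * R) -> R^o) -> Dprime R d -> R^o)
  (I_unitary : fock_unitary sigma mu I)
  (a_bounded : forall (n : nat) (L : set (d.-tuple R)), (0 < n)%N ->
     bounded_borel L -> exists C : R, forall x, L x -> a n x <= C) :
  [/\ unitary_onto (Gspace rho) (Gsqnorm rho) mu (K_op sigma q I),
      forall al, exists W, multiple_integral q rho mu I al W
    & forall W : multiindex -> (seq (d.-tuple R) -> R^o) -> Dprime R d -> R^o,
        (forall al, multiple_integral q rho mu I al (W al)) ->
        forall f, Gspace rho f ->
          sums_to (sqint mu) (fun al => W al (f al) : Dprime R d -> R^o)
            (K_op sigma q I f)].
Proof.
have spec f := @Sym_op_spec _ _ _ sigma_moments _ _ _ q_orthogonal _ rhoE f.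
have mW al := multiple_integral_Wint sigma_moments q_orthogonal rhoE a_bounded I_unitary al.
split; first split.
- move=> f Gf; have [fF _ nF] := spec f Gf; split; first exact: (I_Lfun I_unitary fF).
  by rewrite /K_op (I_sqint I_unitary fF).
- move=> c f g Gf Gg; have Gfg : Gspace rho (c *: f + g) by exact: (dom_lin (sqnormed_Gspace rho)).
  have [fF _ _] := spec f Gf; have [fG _ _] := spec g Gg; have [fFG _ _] := spec _ Gfg.
  have h1 := Sym_op_lin sigma_moments q_orthogonal rhoE c Gf Gg.
  have fL := dom_lin (sqnormed_fock sigma) c fF fG.
  have h2 := I_null I_unitary fFG fL h1.
  apply: (aeS2 h2 (I_lin I_unitary c fF fG)) => w e1 e2 _.
  exact: (etrans (e1 Logic.I) (e2 Logic.I)).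
(* A preimage of g under [I] is Sym J h up to a null vector, and [I] identifies vectors that differ
   by a null vector. *)
- move=> g Lg; have [[_ _ onto] _ _] := I_unitary; have [F fF IF] := onto g Lg.
  have [_ [h Gh hF]] := Rng_fock sigma_moments q_orthogonal rhoE I_unitary fF.
  have [fH _ _] := spec h Gh; exists h; first exact: Gh.
  apply: (aeS2 (I_null I_unitary fF fH hF) IF) => w e1 e2 _.
  exact: (etrans (esym (e1 Logic.I)) (e2 Logic.I)).
- by move=> al; exists (Wint q I al); exact: mW.
(* By uniqueness each [W al] may be replaced by I Sym J_alpha, and the isometry [I] then carries the
   convergence over finite sets of multi-indices from Fock space to L^2(mu). *)
move=> W hW f Gf e e0; have [fF sF _] := spec f Gf; have [A0 hA0] := sF e e0.
exists A0 => A AA0; have := hA0 A AA0.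
have fS al : fock sigma (Sym_comp (J_op q f) al).
  by have [] := Sym_comp_fock sigma_moments q_orthogonal rhoE (Gf.1 al).
have WE al : W al (f al) = I (Sym_comp (J_op q f) al) %[ae mu].
  exact: (multiple_integral_uniq d_gt0 sigma_moments q_orthogonal rhoE a_bounded (hW al) (mW al) (Gf.1 al)).
have hS := I_sum I_unitary A fS WE.
have fSum : fock sigma (\sum_(al <- A) Sym_comp (J_op q f) al) by exact: (dom_sum (sqnormed_fock sigma)).
rewrite -(I_dist I_unitary fF fSum); congr (_ < _)%E; apply: ae_eq_sqint.
- apply: measurable_funB; apply: Lfun2_measurable; exact: (I_Lfun I_unitary).
- have mK : measurable_fun setT (K_op sigma q I f : DprimeType R d -> R).
    by apply: Lfun2_measurable; exact: (I_Lfun I_unitary fF).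
  have mS : measurable_fun setT (\sum_(al <- A) (W al (f al) : Dprime R d -> R^o) : DprimeType R d -> R).
    elim/big_ind : _ => [|u v mu_ mv|al _]; first exact: measurable_cst.
      exact: (measurable_funD mu_ mv).
    by have [LW _ _ _] := hW al; apply: Lfun2_measurable; apply: LW; exact: Gf.1.
  exact: (measurable_funB mK mS).
apply: (aeS hS) => w k _; rewrite -(k Logic.I); by [].
Qed.
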